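(* Let $X\in\mathcal{V}^{hom}$. Then $X$ is $C^0$-regularisable if and only if $X$ has exactly one characteristic direction, with critical value $r^*$ (i.e. $r(X)=\{r^*\}$), and $r^*<0$.
   Context: Class $\mathcal{V}^{hom}$: let $X=(P(x,y),Q(x,y))$ be a planar vector field with $P,Q$ real homogeneous polynomials of degree $n$. The characteristic directions of $X$ are the roots, in the real projective line, of the directional polynomial $xQ(x,y)-yP(x,y)$ (in the chart $\hat y=y/x$: roots of $p(\hat y)=Q(1,\hat y)-\hat yP(1,\hat y)$, possibly including $\hat y=\infty$). $X\in\mathcal{V}^{hom}$ if the origin is an isolated singular point of $X$ (no other zeros nearby) and all its characteristic directions have multiplicity one. Critical values: rotating if necessary so that no characteristic direction is at $\hat y=\infty$, the desingularised $x$-directional blow-up (via $(x,y)=(\hat x,\hat x\hat y)$, divided by $\hat x^{n-1}$) is $\hat X=(\hat xP(1,\hat y),\,Q(1,\hat y)-\hat yP(1,\hat y))$, with critical manifold $\hat x=0$. Its singular points on $\hat x=0$ are $(0,\hat y_i^* )$, $\hat y_i^*$ the characteristic directions. With $\lambda_{i,1}$ the eigenvalue of $\hat X$ at $(0,\hat y_i^* )$ for the direction along $\hat x=0$ and $\lambda_{i,2}$ the other eigenvalue, $r_i=\lambda_{i,1}/\lambda_{i,2}$, and $r(X)=\{r_1,\dots,r_d\}$ (one value for each characteristic direction). $C^0$-regularisability: let $\varphi$ be the flow of $X$ and $I$ the origin. For a compact smooth 2-dimensional submanifold with boundary $N$, $n=\partial N$, put $n^+=\{p\in n:\exists t>0,\varphi(p,(-t,0))\cap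 N=\emptyset\}$, $n^-=\{p\in n:\exists t>0,\varphi(p,(0,t))\cap N=\emptyset\}$, $\tau=\{p\in n: X\text{ tangent to }n\text{ at }p\}$, $a^+=\{p\in n^+:\varphi(p,t)\in N\ \forall t\ge0\}$, $a^-=\{p\in n^-:\varphi(p,t)\in N\ \forall t\le0\}$. $N$ is an isolating block for $I$ if $I$ is the maximal invariant set in $N$, $n^+\cap n^-=\tau$ and $\tau$ is a smooth codimension-one submanifold of $n$. Let $\pi:n^+\setminus a^+\to n^-\setminus a^-$ send $p$ to the exit point of its forward orbit from $N$. $X$ (its singular point $I$) is $C^k$-regularisable if for some isolating block $N$ for $I$ the map $\pi$ has a unique $C^k$ extension $\overline\pi:n^+\to n^-$.
   Formalization: C^0-regularisable also requires the unique continuous extension n^+ -> n^- to be onto n^-. Read literally, any source, e.g. (x,2y) with N the unit disc (n^+ empty), is vacuously regularisable, so the claim fails; for other fields the clause is automatic. *)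

(* Defs.v *)
From HB Require Import structures.
From mathcomp Require Import all_boot all_order all_algebra polyXY.
From mathcomp Require Import all_classical all_reals all_analysis.

Set Implicit Arguments.
Unset Strict Implicit.
Unset Printing Implicit Defensive.

Import Order.TTheory GRing.Theory Num.Theory.
Import numFieldNormedType.Exports.

Local Open Scope classical_set_scope.
Local Open Scope ring_scope.

Section PolynomialFields.
Variable R : realType.
Implicit Types (P Q : {poly {poly R}}) (p q : R * R).

(* The outer variable 'X is x and the inner variable 'Y is y. *)
Definition homogeneous (n : nat) P : Prop :=
  forall i j : nat, P`_i`_j != 0 -> (i + j = n)%N.

Definition vfield P Q : R * R -> R * R :=
  fun z => (P.[z.1, z.2], Q.[z.1, z.2]).

Definition isolated_singular_point P Q : Prop :=
  vfield P Q (0, 0) = (0, 0) /\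
  \forall z \near ((0, 0) : R * R), vfield P Q z = (0, 0) -> z = (0, 0).

Definition directional_poly P Q : {poly {poly R}} := 'X * Q - 'Y * P.

(* The real projective line is [option R]: [Some y] is the direction (1 : y),
   that is y-hat = y, and [None] is (0 : 1), that is y-hat = infinity, which is
   the point 0 of the chart x / y.                                            *)
Definition char_dirs P Q : set (option R) := [set l |
  if l is Some y then (directional_poly P Q).[1, y] = 0
  else (directional_poly P Q).[0, 1] = 0].

(* The multiplicity of a point is read in an affine chart around it:
   D(1, y-hat) in the first case, D(x-hat, 1) in the second.
   By convention, [mup _ 0 = 0].                                              *)
Definition dir_multiplicity P Q (l : option R) : nat :=
  if l is Some y then mup y (directional_poly P Q).[1%:P]
  else mup 0 (swapXY (directional_poly P Q)).[1%:P].

Definition Vhom (n : nat) P Q : Prop :=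
  [/\ homogeneous n P, homogeneous n Q, isolated_singular_point P Q &
      forall l, char_dirs P Q l -> dir_multiplicity P Q l = 1%N].

Definition subst2 P (A B : {poly {poly R}}) : {poly {poly R}} :=
  (map_poly (map_poly (polyC \o polyC)) P).[A, B].

(* The field in coordinates rotated by the angle with cosine c and sine s:
   rho^-1 o (P, Q) o rho, where rho (x, y) = (c x - s y, s x + c y).          *)
Definition rotate (c s : R) P Q : {poly {poly R}} * {poly {poly R}} :=
  let u := c%:P%:P * 'X - s%:P%:P * 'Y in
  let v := s%:P%:P * 'X + c%:P%:P * 'Y in
  (c%:P%:P * subst2 P u v + s%:P%:P * subst2 Q u v,
   c%:P%:P * subst2 Q u v - s%:P%:P * subst2 P u v).

Definition blowup P Q : {poly {poly R}} * {poly {poly R}} :=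
  ('X * P.[1%:P]%:P, Q.[1%:P]%:P - 'Y * P.[1%:P]%:P).

Definition jacobian2 (F : {poly {poly R}} * {poly {poly R}}) (a b : R) :
    'M[R]_2 :=
  \matrix_(i, j)
    (let f := if i == 0 then F.1 else F.2 in
     (if j == 0 then f^`() else map_poly (@deriv R) f).[a, b]).

(* r = l1 / l2, where l1 is the eigenvalue whose eigenvector spans x-hat = 0
   and l2 is the other eigenvalue, counted with multiplicity.                 *)
Definition critical_value_at P Q (y r : R) : Prop :=
  let J := jacobian2 (blowup P Q) 0 y in
  exists l1 l2 : R,
    [/\ J *m delta_mx 1 (0 : 'I_1) = l1 *: delta_mx 1 0,
        char_poly J = ('X - l1%:P) * ('X - l2%:P) & r = l1 / l2].

Definition critical_values P Q : set R := [set r | exists c s : R,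
  c ^+ 2 + s ^+ 2 = 1 /\
  let F := rotate c s P Q in
  ~ char_dirs F.1 F.2 None /\
  exists y, char_dirs F.1 F.2 (Some y) /\ critical_value_at F.1 F.2 y r].

End PolynomialFields.

Section SmoothDomains.
Variable R : realType.
Implicit Types (U V N : set (R * R)) (p q : R * R).

Fixpoint Ck_on (k : nat) U (f : R * R -> R) : Prop :=
  {in U, continuous f} /\
  if k is k'.+1 then
    [/\ forall p, U p -> derivable f p (1, 0) /\ derivable f p (0, 1),
        Ck_on k' U ('D_(1, 0) f) & Ck_on k' U ('D_(0, 1) f)]
  else True.

Definition smooth_on U (F : R * R -> R * R) : Prop :=
  forall k, Ck_on k U (fst \o F) /\ Ck_on k U (snd \o F).

(* V is any open subset of the plane; at an interior point of N it can be taken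
   inside the open upper half-plane.                                          *)
Definition chart_at N p (F : R * R -> R * R) : Prop :=
  exists (U V : set (R * R)) (G : R * R -> R * R),
    [/\ open U, open V & U p] /\
    [/\ smooth_on U F, smooth_on V G, F @` U `<=` V & G @` V `<=` U] /\
    [/\ {in U, cancel F G}, {in V, cancel G F} &
        forall q, U q -> (N q <-> 0 <= (F q).2)].

Definition compact_domain N : Prop :=
  compact N /\ forall p, N p -> exists F, chart_at N p F.

Definition bdry N : set (R * R) :=
  [set p | exists F, chart_at N p F /\ (F p).2 = 0].

End SmoothDomains.

Section Regularisation.
Variable R : realType.
Variable X : R * R -> R * R.
Implicit Types (N : set (R * R)) (p q : R * R) (t : R).

(* [flow p t q] means that phi (p, t) is defined and equal to q; solutions need
   not exist for all times.                                                   *)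
Definition flow p t q : Prop :=
  exists (a b : R) (g : R -> R * R),
    [/\ a < 0 < b, a < t < b, g 0 = p, g t = q &
        forall s, a < s < b -> is_derive s 1 g (X (g s))].

Definition flow_in N p t : Prop := exists q, flow p t q /\ N q.

Definition max_invariant N : set (R * R) := [set p | forall t, flow_in N p t].

Definition nplus N : set (R * R) := [set p | bdry N p /\
  exists2 t, 0 < t & forall s, - t < s < 0 -> ~ flow_in N p s].

Definition nminus N : set (R * R) := [set p | bdry N p /\
  exists2 t, 0 < t & forall s, 0 < s < t -> ~ flow_in N p s].

(* The boundary is {F_2 = 0} near p, so X p is tangent to it iff dF_2 (X p) = 0. *)
Definition tau N : set (R * R) := [set p | exists F,
  [/\ chart_at N p F, (F p).2 = 0 & 'D_(X p) (snd \o F) p = 0]].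

Definition aplus N : set (R * R) :=
  [set p | nplus N p /\ forall t, 0 <= t -> flow_in N p t].

Definition aminus N : set (R * R) :=
  [set p | nminus N p /\ forall t, t <= 0 -> flow_in N p t].

(* The boundary is a curve, so its submanifolds of codimension one are its
   subsets consisting of isolated points.                                     *)
Definition isolating_block N (I : set (R * R)) : Prop :=
  [/\ compact_domain N, max_invariant N = I,
      nplus N `&` nminus N = tau N & tau N `<=` isolated (tau N)].

Definition exit_point N p q : Prop := exists t,
  [/\ 0 <= t, flow p t q, (forall s, 0 <= s <= t -> flow_in N p s) &
      forall t', t < t' -> ~ (forall s, 0 <= s <= t' -> flow_in N p s)].

Definition C0_extension N (f : R * R -> R * R) : Prop :=
  [/\ {within nplus N, continuous f}, f @` nplus N `<=` nminus N &
      forall p, (nplus N `\` aplus N) p -> exit_point N p (f p)].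

(* The last clause, that the extension is onto n^-, makes the notion invariant
   under time reversal, in accordance with the extension being a homeomorphism
   from n^+ to n^-.  It only excludes the degenerate case of a source: for the
   field (x, 2y) and N the unit disc, n^+ is empty and n^- is the unit circle,
   so that the empty map would be the unique extension of pi.                 *)
Definition C0_regularisable (I : set (R * R)) : Prop :=
  exists N, isolating_block N I /\ exists f,
    [/\ C0_extension N f,
        forall g, C0_extension N g -> forall p, nplus N p -> g p = f p &
        nminus N `<=` f @` nplus N].

End Regularisation.

(* Main.v *)
Require Import Defs.
From HB Require Import structures.
From mathcomp Require Import all_boot all_order all_algebra polyXY.
From mathcomp Require Import all_classical all_reals all_analysis.
From mathcomp Require Import ring lra.

Import Order.TTheory GRing.Theory Num.Theory.
Import numFieldNormedType.Exports.

Local Open Scope classical_set_scope.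
Local Open Scope ring_scope.

Set Implicit Arguments.
Unset Strict Implicit.
Unset Printing Implicit Defensive.

(** Let [D u = u /\ X u] be the directional function. At a characteristic unit
    vector [e] one has [X e = alpha e], and if [kappa] is the derivative of D
    across [e], the critical value is [kappa / alpha].

    Necessity. Since the extension of [pi] is unique and onto, the points of [n^+]
    that never leave N, and those of [n^-] that never left it, have empty interior.
    If [alpha] and [kappa] had the same sign, a sector around [e] would be attracted
    to the origin in forward or backward time; hence [kappa / alpha < 0] at every
    characteristic direction. Without characteristic directions, there is a positive
    function G, homogeneous of degree one, with [X (ln G) = - c D / rho ^ 2], which has
    a constant sign, so that again a neighbourhood of the origin is trapped. Two
    distinct characteristic lines are impossible: they are invariant, and [pi] maps
    points on both sides of an incoming ray to points on both sides of the line, in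
    the same half-plane of the other line, so by continuity the limit of their exit
    points is on the incoming ray itself, although it has to stay in N backwards.

    Sufficiency. In coordinates [(x, y)] along and across the only characteristic
    vector, there is a positive G, homogeneous of degree one, such that [X G] is a
    positive multiple of a linear form [A x + c y]. In [N = {G <= 1}], the orbits are
    the curves on which [G exp (K (x / y))] is constant, for an explicit function K that
    increases and then decreases, and this first integral extends by 0 to the axis.
    The exit point of an orbit is determined by the value of the first integral and the
    side of the axis, a closed condition, so that [pi] extends continuously. *)

(** * Curves and flows in the plane *)

(** The relation [flow] is partial, as solutions of a polynomial field may blow up. A block is
    bounded, so the field is changed outside a ball into a globally Lipschitz one with a complete
    flow [phi]. Entering, leaving and staying only involve orbit pieces near or in the block, so all
    notions are rephrased for [phi], and backward statements are forward ones for [- X].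

    The obstacle in the necessity is the tangencies: uniqueness is exploited by sliding a value of
    the extension along the boundary, which works only at transversal exit points. At tangencies,
    their isolatedness is used instead.

    On a round disc, orbits could touch the circle from inside; hence the special G. Prescribing the
    derivative of [ln G] along the field means integrating a 1-form on the projective line, which is
    exact only after subtracting a multiple [c] of the angular form. With a characteristic
    direction, dividing by D creates a pole as well, which the term with [A] removes. What remains
    of [X G] vanishes on one line only, so that the curve G = 1 has two tangencies, and there orbits
    touch it from outside. *)

Section RealLine.
Variable R : realType.
Implicit Types (f g y : R -> R) (a b t x : R).

Lemma is_derive_fst (V W : normedModType R) (g : R -> V * W) x v :
  is_derive x 1 g v -> is_derive x 1 (fst \o g) v.1.
Proof.
move=> gv; apply: DeriveDef.
  apply/cvg_ex; exists v.1; case: gv => dg <-.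
  exact: (cvg_comp (G := nbhs ('D_1 g x)) _ _ dg (@cvg_fst _ _ _ _ _)).
case: gv => dg <-; apply/cvg_lim => //.
exact: (cvg_comp (G := nbhs ('D_1 g x)) _ _ dg (@cvg_fst _ _ _ _ _)).
Qed.

Lemma is_derive_snd (V W : normedModType R) (g : R -> V * W) x v :
  is_derive x 1 g v -> is_derive x 1 (snd \o g) v.2.
Proof.
move=> gv; apply: DeriveDef.
  apply/cvg_ex; exists v.2; case: gv => dg <-.
  exact: (cvg_comp (G := nbhs ('D_1 g x)) _ _ dg (@cvg_snd _ _ _ _ _)).
case: gv => dg <-; apply/cvg_lim => //.
exact: (cvg_comp (G := nbhs ('D_1 g x)) _ _ dg (@cvg_snd _ _ _ _ _)).
Qed.

Lemma is_derive_pair (V W : normedModType R) (f : R -> V) (g : R -> W) x v w :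
  is_derive x 1 f v -> is_derive x 1 g w ->
  is_derive x 1 (fun t => (f t, g t)) (v, w).
Proof.
move=> [df <-] [dg <-]; have h := cvg_pair df dg.
apply: DeriveDef; first by apply/cvg_ex; exists ('D_1 f x, 'D_1 g x); exact: (h _ _ _).
rewrite /derive; apply: cvg_lim; [exact: norm_hausdorff|exact: (h _ _ _)].
Qed.

Lemma is_derive_continuous (V : normedModType R) (f : R -> V) x v :
  is_derive x 1 f v -> {for x, continuous f}.
Proof.
by move=> [df _]; apply: differentiable_continuous; apply/derivable1_diffP.
Qed.

Lemma is_derive_within_continuous (f df : R -> R) a b :
  (forall x, a <= x <= b -> is_derive x 1 f (df x)) ->
  {within `[a, b], continuous f}.
Proof.
move=> h; apply/continuous_in_subspaceT => x; rewrite inE/= in_itv/= => xab.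
exact: is_derive_continuous (h x xab).
Qed.

Lemma ge0_is_derive_le (f df : R -> R) a b : a <= b ->
  (forall x, a <= x <= b -> is_derive x 1 f (df x)) ->
  (forall x, a <= x <= b -> 0 <= df x) -> f a <= f b.
Proof.
move=> ab h d0; rewrite -subr_ge0.
have [|c cab ->] := MVT_segment (df := df) ab _ (is_derive_within_continuous h).
  by move=> x; rewrite in_itv/= => /andP[ax xb]; apply: h; rewrite !ltW.
rewrite mulr_ge0 ?subr_ge0//; apply: d0.
by move: cab; rewrite in_itv.
Qed.

Lemma le0_is_derive_ge (f df : R -> R) a b : a <= b ->
  (forall x, a <= x <= b -> is_derive x 1 f (df x)) ->
  (forall x, a <= x <= b -> df x <= 0) -> f b <= f a.
Proof.
move=> ab h d0; rewrite -lerN2.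
apply: (@ge0_is_derive_le (fun x => - f x) (fun x => - df x)) => // x xab.
  by have hx := h _ xab; apply: is_deriveN.
by rewrite oppr_ge0 d0.
Qed.

Lemma is_derive_le_sub (f df : R -> R) a b m : a <= b ->
  (forall x, a <= x <= b -> is_derive x 1 f (df x)) ->
  (forall x, a <= x <= b -> m <= df x) -> m * (b - a) <= f b - f a.
Proof.
move=> ab h d0.
suff : f a - m * a <= f b - m * b by lra.
apply: (@ge0_is_derive_le (fun x => f x - m * x) (fun x => df x - m)) => // x xab.
  have hx := h _ xab.
  by apply: is_derive_eq; rewrite /GRing.scale/=; ring.
by rewrite subr_ge0 d0.
Qed.

Lemma gt0_is_derive_lt (f df : R -> R) a b : a < b ->
  (forall x, a <= x <= b -> is_derive x 1 f (df x)) ->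
  (forall x, a < x < b -> 0 < df x) -> f a < f b.
Proof.
move=> ab h d0; rewrite -subr_gt0.
have [|c cab ->] := MVT (df := df) ab _ (is_derive_within_continuous h).
  by move=> x; rewrite in_itv/= => /andP[ax xb]; apply: h; rewrite !ltW.
by rewrite mulr_gt0 ?subr_gt0//; apply: d0; move: cab; rewrite in_itv.
Qed.

Lemma is_derive0_eq (f : R -> R) a b : a <= b ->
  (forall x, a <= x <= b -> is_derive x 1 f 0) -> f a = f b.
Proof.
move=> ab h; apply/eqP; rewrite eq_le; apply/andP; split.
  exact: (@ge0_is_derive_le f (cst 0)).
exact: (@le0_is_derive_ge f (cst 0)).
Qed.

Lemma is_derive1_compV (V : normedModType R) (f : R -> V) (u : R -> R) x v c :
  is_derive (u x) 1 f v -> is_derive x 1 u c ->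
  is_derive x 1 (f \o u) (c *: v).
Proof.
move=> fv uc.
have /derivable1_diffP df : derivable f (u x) 1 by case: fv.
have /derivable1_diffP du : derivable u x 1 by case: uc.
have dc : differentiable (f \o u) x by apply: differentiable_comp.
apply: DeriveDef; first exact/derivable1_diffP.
rewrite deriveE// diff_comp//= -!deriveE//.
have [_ ->] := uc; rewrite deriveE// -[X in 'd f _ X](mulr1 c).
have -> : 'd f (u x) (c * 1) = c *: 'd f (u x) 1 by rewrite -linearZ.
by rewrite -deriveE//; case: fv => _ ->.
Qed.

Lemma is_derive_comp_opp (V : normedModType R) (f : R -> V) x v :
  is_derive (- x) 1 f v -> is_derive x 1 (fun t => f (- t)) (- v).
Proof.
by move=> fv; rewrite -scaleN1r; apply: (is_derive1_compV (u := -%R)).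
Qed.

Lemma is_derive_comp_shift (V : normedModType R) (f : R -> V) c x v :
  is_derive (c + x) 1 f v -> is_derive x 1 (fun t => f (c + t)) v.
Proof.
move=> fv; rewrite -[v]scale1r; apply: (is_derive1_compV (u := +%R c)) => //.
by apply: is_derive_eq; rewrite add0r.
Qed.

(** [y] and [C] may be negative: [sign_keep] uses this to bound a square from below. *)
Lemma gronwall (y dy : R -> R) C a b : a <= b ->
  (forall x, a <= x <= b -> is_derive x 1 y (dy x)) ->
  (forall x, a <= x <= b -> dy x <= C * y x) ->
  y b <= y a * expR (C * (b - a)).
Proof.
move=> ab h d.
suff : y b * expR (- C * (b - a)) <= y a * expR (- C * (a - a)).
  rewrite subrr mulr0 expR0 mulr1 mulNr expRN => le.
  by rewrite -ler_pdivrMr ?expR_gt0.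
apply: (@le0_is_derive_ge (fun x => y x * expR (- C * (x - a)))
  (fun x => (dy x - C * y x) * expR (- C * (x - a)))) => // x xab; last first.
  by rewrite mulr_le0_ge0 ?expR_ge0// subr_le0 d.
have hx := h _ xab.
have : is_derive x 1 (fun x => - C * (x - a)) (- C).
  by apply: is_derive_eq; rewrite /GRing.scale/=; ring.
move=> /(is_derive1_comp (is_derive_expR _)) he.
by apply: is_derive_eq; rewrite /= /GRing.scale/=; lra.
Qed.

End RealLine.

Lemma near_dist_lt (R : realType) (V : normedModType R) (x : V) (e : R) :
  0 < e -> \forall y \near x, `|y - x| < e.
Proof.
by move=> e0; apply/nbhs_normP; exists e => // y /=; rewrite /ball_/= distrC.
Qed.

(** * Antiderivatives of continuous functions *)

Section Antiderivative.
Variable R : realType.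
Implicit Types (f : R -> R) (a b t x : R).

Let mu := @lebesgue_measure R.
Let intf f a x := \int[mu]_(t in `[a, x]) f t.

Let is_derive_intf f a x : continuous f -> a < x ->
  is_derive x 1 (intf f a) (f x).
Proof.
move=> cf ax.
have xu : x < x + 1 by rewrite ltrDl.
have int : mu.-integrable `[a, x + 1] (EFin \o f).
  apply: continuous_compact_integrable; first exact: segment_compact.
  by apply: continuous_subspaceT => y; exact: cf.
have [df fE] := continuous_FTC1_closed xu int ax (cf x).
by rewrite derive1E in fE; split.
Qed.

(** The integral from [a] is a primitive only to the right of [a], so the base point moves with [x].
    Normalised to vanish at 0, the primitives for different base points agree. *)
Lemma antiderivative f : continuous f ->
  {F : R -> R | F 0 = 0 & forall x, is_derive x 1 F (f x)}.
Proof.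
move=> cf.
pose G a x := intf f a x - intf f a 0.
have dG a x : a < x -> is_derive x 1 (G a) (f x).
  move=> ax; have h := is_derive_intf cf ax.
  by apply: is_derive_eq; rewrite subr0.
have GG a b x : a < 0 -> b < 0 -> a < x -> b < x -> G a x = G b x.
  move=> a0 b0 ax bx.
  have dGG y : a < y -> b < y -> is_derive y 1 (fun z => G a z - G b z) 0.
    move=> ay b_y; have h := dG _ _ ay; have h' := dG _ _ b_y.
    by apply: is_derive_eq; rewrite subrr.
  apply/eqP; rewrite -subr_eq0; apply/eqP.
  transitivity (G a 0 - G b 0); last by rewrite /G !subrr.
  have [x0|x0] := leP x 0.
    apply: (@is_derive0_eq _ (fun z => G a z - G b z)) => // y /andP[xy _].
    by apply: dGG; apply: lt_le_trans xy.
  apply/esym; apply: (@is_derive0_eq _ (fun z => G a z - G b z)) (ltW x0) _ => y.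
  by case/andP=> y0 _; apply: dGG; apply: lt_le_trans y0.
exists (fun x => G (- `|x| - 1) x); first by rewrite /G subrr.
move=> x.
(* Near [x] the moving base point can be frozen at [- |x| - 2], which is below every point at
   distance less than 1 from [x]. *)
apply: near_eq_is_derive (dG (- `|x| - 2) x _); last first.
  by have := ler_norm (- x); rewrite normrN; lra.
apply: filterS (@near_dist_lt _ R^o x 1 ltr01) => y xy.
have := ler_norm (- y); have := ler_norm (-x); rewrite !normrN => hx hy.
have := normr_ge0 x; have := normr_ge0 y => y0 x0.
move: xy; rewrite ltr_norml => /andP[? ?].
apply: GG; lra.
Qed.

End Antiderivative.

Section PlaneNorm.
Variable R : realType.
Implicit Types (u v p : R * R).

Lemma plane_norm_le u (r : R) : (`|u| <= r) = (`|u.1| <= r) && (`|u.2| <= r).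
Proof. by rewrite prod_normE ge_max. Qed.

Lemma plane_norm_lt u (r : R) : (`|u| < r) = (`|u.1| < r) && (`|u.2| < r).
Proof. by rewrite prod_normE gt_max. Qed.

Lemma plane_norm_fst u : `|u.1| <= `|u|.
Proof. by have := lexx `|u|; rewrite {1}plane_norm_le => /andP[]. Qed.

Lemma plane_norm_snd u : `|u.2| <= `|u|.
Proof. by have := lexx `|u|; rewrite {1}plane_norm_le => /andP[]. Qed.

(** The norm of [R * R] is the sup norm, which is not differentiable. Comparing it with the
    Euclidean norm is the source of many factors 2 below. *)
Lemma plane_norm_sqr_le u : `|u| ^+ 2 <= u.1 ^+ 2 + u.2 ^+ 2.
Proof.
rewrite prod_normE; have h1 := sqr_ge0 u.1; have h2 := sqr_ge0 u.2.
by have [_|_] := leP `|u.1| `|u.2|; rewrite real_normK ?num_real//; lra.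
Qed.

Lemma plane_norm_sqr_ge u : u.1 ^+ 2 + u.2 ^+ 2 <= 2 * `|u| ^+ 2.
Proof.
rewrite -(real_normK (num_real u.1)) -(real_normK (num_real u.2)).
have h1 := plane_norm_fst u; have h2 := plane_norm_snd u.
have : `|u.1| ^+ 2 <= `|u| ^+ 2 by rewrite lerXn2r// nnegrE.
have : `|u.2| ^+ 2 <= `|u| ^+ 2 by rewrite lerXn2r// nnegrE.
by lra.
Qed.

End PlaneNorm.

Section Gronwall.
Variable R : realType.
Implicit Types (g h G H : R -> R * R).

(** Gronwall is applied to the squared Euclidean distance, with rate [4 L] since each of the two
    coordinates contributes [2 L]. Taking the root halves the rate, and the return to the sup norm
    costs the factor 2. *)
Lemma gronwall_plane g h G H (L a b : R) : 0 <= L -> a <= b ->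
  (forall x, a <= x <= b -> is_derive x 1 g (G x)) ->
  (forall x, a <= x <= b -> is_derive x 1 h (H x)) ->
  (forall x, a <= x <= b -> `|G x - H x| <= L * `|g x - h x|) ->
  `|g b - h b| <= 2 * expR (2 * L * (b - a)) * `|g a - h a|.
Proof.
move=> L0 ab dg dh GH.
pose y x := ((fst \o g) x - (fst \o h) x) ^+ 2 + ((snd \o g) x - (snd \o h) x) ^+ 2.
pose dy x := 2 * (((g x).1 - (h x).1) * ((G x).1 - (H x).1) +
                  ((g x).2 - (h x).2) * ((G x).2 - (H x).2)).
have : y b <= y a * expR (4 * L * (b - a)).
  apply: (@gronwall _ y dy) => // x xab.
    have [/is_derive_fst g1 /is_derive_snd g2] := (dg x xab, dg x xab).
    have [/is_derive_fst h1 /is_derive_snd h2] := (dh x xab, dh x xab).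
    by apply: is_derive_eq; rewrite /dy /GRing.scale/=; ring.
  have := GH x xab; have := plane_norm_sqr_le (g x - h x).
  rewrite -/(y x) /dy /y /=.
  set m := `|_ - _|; set k := `|_ - _| => my km.
  have m0 : 0 <= m by exact: normr_ge0.
  have a1 : `|(g x).1 - (h x).1| <= m by exact: (plane_norm_fst (g x - h x)).
  have a2 : `|(g x).2 - (h x).2| <= m by exact: (plane_norm_snd (g x - h x)).
  have b1 : `|(G x).1 - (H x).1| <= k by exact: (plane_norm_fst (G x - H x)).
  have b2 : `|(G x).2 - (H x).2| <= k by exact: (plane_norm_snd (G x - H x)).
  have c1 : ((g x).1 - (h x).1) * ((G x).1 - (H x).1) <= m * (L * m).
    by rewrite (le_trans (ler_norm _))// normrM ler_pM// (le_trans b1).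
  have c2 : ((g x).2 - (h x).2) * ((G x).2 - (H x).2) <= m * (L * m).
    by rewrite (le_trans (ler_norm _))// normrM ler_pM// (le_trans b2).
  rewrite (@le_trans _ _ (4 * L * m ^+ 2))//; first by rewrite expr2; lra.
  by rewrite ler_wpM2l// mulr_ge0.
move=> yy.
rewrite -(@ler_pXn2r _ 2) ?nnegrE ?mulr_ge0 ?expR_ge0//.
apply: (le_trans (plane_norm_sqr_le _)); apply: (le_trans yy).
have := plane_norm_sqr_ge (g a - h a); rewrite -/(y a) => ya.
have -> : expR (4 * L * (b - a)) = expR (2 * L * (b - a)) ^+ 2.
  by rewrite expr2 -expRD; congr expR; ring.
rewrite !exprMn mulrAC; apply: ler_wpM2r; first exact: sqr_ge0.
rewrite (le_trans ya)// ler_wpM2r ?sqr_ge0//; lra.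
Qed.

End Gronwall.

(** * Picard iteration and the global flow of a Lipschitz field *)

Section Picard.
Variable R : realType.
Implicit Types (g u : R -> R * R) (p : R * R).

Lemma antiderivative_plane g : continuous g ->
  {F : R -> R * R | F 0 = 0 & forall x : R, is_derive x 1 F (g x)}.
Proof.
move=> cg.
have [F1 F10 dF1] : {F : R -> R | F 0 = 0 & forall x : R, is_derive x 1 F (g x).1}.
  by apply: antiderivative => x; apply: (cvg_comp _ _ (cg x)); exact: cvg_fst.
have [F2 F20 dF2] : {F : R -> R | F 0 = 0 & forall x : R, is_derive x 1 F (g x).2}.
  by apply: antiderivative => x; apply: (cvg_comp _ _ (cg x)); exact: cvg_snd.
exists (fun t => (F1 t, F2 t)); first by rewrite F10 F20.
by move=> x; rewrite [g x]surjective_pairing; apply: is_derive_pair.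
Qed.

(** In the weight [exp (c |x|)], integration from 0 gains a factor [1 / c]. With [c = 2 L] the
    Picard operator contracts by 1/2 on the whole line, which gives global solutions at once. *)
Lemma exp_bound_antiderivative (f df : R -> R) (B c : R) : 0 < c ->
  f 0 = 0 -> (forall x : R, is_derive x 1 f (df x)) ->
  (forall x, `|df x| <= B * expR (c * `|x|)) ->
  forall t, `|f t| <= B / c * expR (c * `|t|).
Proof.
move=> c0 f0 dfx dfB.
have B0 : 0 <= B by have := dfB 0; rewrite normr0 mulr0 expR0 mulr1; apply: le_trans.
suff pos (h dh : R -> R) t : h 0 = 0 -> (forall x : R, is_derive x 1 h (dh x)) ->
    (forall x, `|dh x| <= B * expR (c * `|x|)) -> 0 <= t ->
    h t <= B / c * expR (c * t).
  have posN (h dh : R -> R) t : h 0 = 0 -> (forall x : R, is_derive x 1 h (dh x)) ->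
      (forall x, `|dh x| <= B * expR (c * `|x|)) -> 0 <= t ->
      `|h t| <= B / c * expR (c * t).
    move=> h0 dhx hB t0; rewrite ler_norml lerNl (pos _ _ _ h0 dhx hB t0) andbT.
    apply: (pos (fun x => - h x) (fun x => - dh x)) => // [|x].
      by rewrite h0 oppr0.
    by rewrite normrN.
  move=> t; have [t0|t0] := leP 0 t.
    by rewrite (ger0_norm t0); exact: (posN _ _ _ f0 dfx dfB).
  rewrite (ltr0_norm t0) -[in f t](opprK t).
  apply: (posN (fun x => f (- x)) (fun x => - df (- x))).
  - by rewrite oppr0.
  - by move=> x; apply: is_derive_comp_opp.
  - by move=> x; rewrite normrN (le_trans (dfB _))// normrN.
  - by rewrite oppr_ge0 ltW.
move=> h0 dhx hB t0; rewrite -subr_ge0.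
apply: (@le_trans _ _ (B / c * expR (c * 0) - h 0)).
  by rewrite h0 subr0 mulr_ge0 ?expR_ge0// divr_ge0// ltW.
apply: (@ge0_is_derive_le _ (fun x => B / c * expR (c * x) - h x)
  (fun x => B * expR (c * x) - dh x)) => // x /andP[x0 _].
  have hx := dhx x.
  have : is_derive x 1 (fun x => c * x) c.
    by apply: is_derive_eq; rewrite /GRing.scale/=; ring.
  move=> /(is_derive1_comp (is_derive_expR _)) he.
  by apply: is_derive_eq; rewrite /GRing.scale/=; field; rewrite gt_eqF.
have := hB x; rewrite (ger0_norm x0) subr_ge0; exact: le_trans (ler_norm _).
Qed.

Lemma exp_bound_antiderivative_plane (F dF : R -> R * R) (B c : R) : 0 < c ->
  F 0 = 0 -> (forall x : R, is_derive x 1 F (dF x)) ->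
  (forall x, `|dF x| <= B * expR (c * `|x|)) ->
  forall t, `|F t| <= B / c * expR (c * `|t|).
Proof.
move=> c0 F0 dFx dFB t; rewrite plane_norm_le; apply/andP; split.
  apply: (@exp_bound_antiderivative (fst \o F) (fst \o dF)) => //=; first by rewrite F0.
    by move=> x; apply: is_derive_fst.
  by move=> x; rewrite (le_trans (plane_norm_fst _)).
apply: (@exp_bound_antiderivative (snd \o F) (snd \o dF)) => //=; first by rewrite F0.
  by move=> x; apply: is_derive_snd.
by move=> x; rewrite (le_trans (plane_norm_snd _)).
Qed.

(** Nested intervals [[a k, b k]]: the limit is the supremum of the lower ends. The explicit rate is
    what makes the Picard iterates converge locally uniformly. *)
Lemma geometric_limit (x : nat -> R) (C : R) :
  (forall k, `|x k.+1 - x k| <= C / 2 ^+ k) ->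
  {l : R | forall k, `|l - x k| <= 2 * C / 2 ^+ k}.
Proof.
move=> dx.
pose a k := x k - 2 * C / 2 ^+ k; pose b k := x k + 2 * C / 2 ^+ k.
have C0 : 0 <= C by have := dx 0%N; rewrite expr0 divr1; apply: le_trans.
have p0 k : 0 <= C / 2 ^+ k by rewrite divr_ge0// exprn_ge0.
have hS k : C / 2 ^+ k = 2 * (C / 2 ^+ k.+1).
  by rewrite exprS; field; rewrite expf_eq0 pnatr_eq0 andbF.
have aS : {homo a : m n / (m <= n)%N >-> m <= n}.
  apply: homo_leq => // [?|k]; first exact: le_trans.
  have := dx k; rewrite ler_norml /a -!mulrA (hS k) => /andP[+ _]; lra.
have bS : {homo b : m n / (m <= n)%N >-> n <= m}.
  apply: homo_leq => // [? ? ? h1 h2|k]; first exact: le_trans h2 h1.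
  have := dx k; rewrite ler_norml /b -!mulrA (hS k) => /andP[_ +]; lra.
have ab j k : a j <= b k.
  apply: (@le_trans _ _ (a (maxn j k))); first by apply: aS; exact: leq_maxl.
  apply: (@le_trans _ _ (b (maxn j k))); last by apply: bS; exact: leq_maxr.
  by rewrite /a /b -!mulrA; have := p0 (maxn j k); lra.
exists (sup (range a)) => k; rewrite ler_distl; apply/andP; split.
  rewrite -/(a k); apply: ub_le_sup; last by exists k.
  by exists (b 0%N) => _ [j _ <-].
rewrite -/(b k); apply: ge_sup; first by exists (a 0%N), 0%N.
by move=> _ [j _ <-].
Qed.

Lemma geometric_small (C e : R) : 0 < e -> exists k, C / 2 ^+ k < e.
Proof.
move=> e0; have [k Ck] : exists k : nat, C / e < k%:R.
  by exists (Num.truncn (C / e)).+1; exact: truncnS_gt.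
exists k; rewrite ltr_pdivrMr ?exprn_gt0// mulrC -ltr_pdivrMr//.
apply: (lt_le_trans Ck); rewrite -natrX ler_nat.
by rewrite ltnW// ltn_expl.
Qed.

End Picard.

Section GlobalFlow.
Variable R : realType.
Variables (Y : R * R -> R * R) (L : R).
Hypotheses (L0 : 0 < L) (lipY : forall u v, `|Y u - Y v| <= L * `|u - v|).
Implicit Types (g u : R -> R * R) (p : R * R) (t : R).

Let contY g : continuous g -> continuous (Y \o g).
Proof.
move=> cg t; apply/cvgrPdist_lt => e e0.
have /cvgrPdist_lt/(_ (e / L)) := cg t; rewrite divr_gt0// => /(_ isT).
apply: filterS => s gs; apply: (le_lt_trans (lipY _ _)).
by rewrite mulrC -ltr_pdivlMr.
Qed.

Let A g (cg : continuous g) := s2val (antiderivative_plane (contY cg)).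

Let A0 g (cg : continuous g) : A cg 0 = 0.
Proof. exact: (s2valP (antiderivative_plane (contY cg))). Qed.

Let dA g (cg : continuous g) (x : R) : is_derive x 1 (A cg) (Y (g x)).
Proof. exact: (s2valP' (antiderivative_plane (contY cg))). Qed.

Let contA g (cg : continuous g) p : continuous (fun t => p + A cg t).
Proof.
by move=> x; apply: cvgD; [exact: cvg_cst|exact: is_derive_continuous (dA cg x)].
Qed.

Let step p (u : {g : R -> R * R | continuous g}) : {g : R -> R * R | continuous g} :=
  exist _ _ (@contA (sval u) (svalP u) p).

Let cont_cst p : continuous (fun _ : R => p).
Proof. by move=> x; exact: cvg_cst. Qed.

Let iterates p k := iter k (step p) (exist _ _ (@cont_cst p)).

Let iteratesS p k t :
  sval (iterates p k.+1) t = p + A (svalP (iterates p k)) t.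
Proof. by []. Qed.

Let AB (g h : R -> R * R) (cg : continuous g) (ch : continuous h) B :
  (forall t, `|g t - h t| <= B * expR (2 * L * `|t|)) ->
  forall t, `|A cg t - A ch t| <= B / 2 * expR (2 * L * `|t|).
Proof.
move=> gh t; have -> : B / 2 = (L * B) / (2 * L) by field; rewrite gt_eqF.
apply: (@exp_bound_antiderivative_plane _ (fun t => A cg t - A ch t)
  (fun t => Y (g t) - Y (h t))).
- by rewrite mulr_gt0.
- by rewrite !A0 subrr.
- by move=> x; have h1 := dA cg x; have h2 := dA ch x; apply: is_deriveB.
- by move=> x; rewrite (le_trans (lipY _ _))// -mulrA ler_wpM2l// ltW.
Qed.

Let iterates_dist p k t :
  `|sval (iterates p k.+1) t - sval (iterates p k) t| <=
  `|Y p| / (2 * L) / 2 ^+ k * expR (2 * L * `|t|).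
Proof.
elim: k t => [|k IH] t.
  rewrite expr0 divr1 /= addrAC subrr add0r.
  apply: (@exp_bound_antiderivative_plane _ _ (fun t => Y p)).
  - by rewrite mulr_gt0.
  - exact: A0.
  - by move=> x; exact: dA.
  - move=> x; rewrite ler_peMr// -[leLHS]expR0 ler_expR mulr_ge0// mulr_ge0//.
    exact: ltW.
rewrite (iteratesS p k.+1) (iteratesS p k) opprD addrACA subrr add0r.
have := AB (svalP (iterates p k.+1)) (svalP (iterates p k)) IH t.
by rewrite exprSr (invfM (2 ^+ k)) mulrA.
Qed.

Let picard p : {u : R -> R * R | u 0 = p & forall t : R, is_derive t 1 u (Y (u t))}.
Proof.
pose C := `|Y p| / (2 * L).
have C0 : 0 <= C by rewrite divr_ge0// mulr_ge0// ltW.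
pose x k t := sval (iterates p k) t.
have dx k t : `|x k.+1 t - x k t| <= C * expR (2 * L * `|t|) / 2 ^+ k.
  by have := iterates_dist p k t; rewrite -/C mulrAC.
have lim t : {l : R * R | forall k, `|l - x k t| <= 2 * (C * expR (2 * L * `|t|)) / 2 ^+ k}.
  have [l1 h1] : {l : R | forall k, `|l - (x k t).1| <= 2 * (C * expR (2 * L * `|t|)) / 2 ^+ k}.
    by apply: geometric_limit => k; apply: le_trans (dx k t); exact: (plane_norm_fst (_ - _)).
  have [l2 h2] : {l : R | forall k, `|l - (x k t).2| <= 2 * (C * expR (2 * L * `|t|)) / 2 ^+ k}.
    by apply: geometric_limit => k; apply: le_trans (dx k t); exact: (plane_norm_snd (_ - _)).
  by exists (l1, l2) => k; rewrite plane_norm_le h1 h2.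
pose u t := sval (lim t).
have ux t k : `|u t - x k t| <= 2 * C / 2 ^+ k * expR (2 * L * `|t|).
  by have := svalP (lim t) k; rewrite -/(u t) mulrA mulrAC.
(* The rate is uniform for times bounded by [|t| + 1], so the limit inherits the continuity of the
   iterates. *)
have cu : continuous u.
  move=> t; apply/cvgrPdist_lt => e e0.
  have [k hk] := geometric_small (2 * C * expR (2 * L * (`|t| + 1))) (divr_gt0 e0 (ltr0n R 3)).
  have /cvgrPdist_lt/(_ _ (divr_gt0 e0 (ltr0n R 3))) := svalP (iterates p k) t.
  apply: filterS2 (@near_dist_lt _ R^o t 1 ltr01) => s st xst.
  have small r : `|r| <= `|t| + 1 -> `|u r - x k r| < e / 3.
    move=> rt; apply: le_lt_trans (ux r k) _; apply: le_lt_trans hk.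
    rewrite mulrAC ler_wpM2r ?invr_ge0 ?exprn_ge0// ler_wpM2l//; first by rewrite mulr_ge0.
    by rewrite ler_expR ler_wpM2l// mulr_ge0// ltW.
  have sm1 := small t; have sm2 : `|u s - x k s| < e / 3.
    apply: small; have -> : s = t + (s - t) by ring.
    by rewrite (le_trans (ler_normD _ _))// lerD2l ltW.
  have -> : u t - u s = (u t - x k t) + (x k t - x k s) + (x k s - u s).
    by rewrite !addrA !subrK.
  rewrite (le_lt_trans (ler_normD _ _))// (distrC (x k s)).
  have := ler_normD (u t - x k t) (x k t - x k s).
  have {}sm1 : `|u t - x k t| < e / 3 by apply: sm1; rewrite lerDl.
  have {}xst : `|x k t - x k s| < e / 3 by exact: xst.
  lra.
(* [v] is the Picard image of [u]. Once [v = u] is known, the differentiability of [u] is that of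
   the integral [v]. *)
pose v t := p + A cu t.
have vE : v = u.
  apply/funext => t; apply/eqP; rewrite -subr_eq0 -normr_le0; apply/ler_addgt0Pl => e e0.
  have [k hk] := geometric_small (2 * C * expR (2 * L * `|t|)) e0.
  rewrite addr0.
  have -> : v t - u t = (v t - x k.+1 t) - (u t - x k.+1 t) by rewrite opprB addrA subrK.
  apply: (le_trans (ler_normB _ _)); apply: ltW; apply: le_lt_trans hk.
  have h1 := ux t k.+1.
  have := AB cu (svalP (iterates p k)) (fun t => ux t k) t.
  have -> : A cu t - A (svalP (iterates p k)) t = v t - x k.+1 t.
    by rewrite /v /x iteratesS opprD addrACA subrr add0r.
  move: h1; rewrite exprS (invfM 2 (2 ^+ k)); set E := expR _; set q := (2 ^+ k)^-1.
  lra.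
exists u; first by rewrite -vE /v A0 addr0.
move=> t; rewrite -{1}vE /v; have h := dA cu t.
by apply: is_derive_eq; rewrite add0r.
Qed.

Lemma global_flow : {phi : R * R -> R -> R * R | (forall p, phi p 0 = p) &
  forall p (t : R), is_derive t 1 (phi p) (Y (phi p t))}.
Proof.
exists (fun p => s2val (picard p)) => p; first exact: (s2valP (picard p)).
exact: (s2valP' (picard p)).
Qed.

End GlobalFlow.

(** * Flow boxes: a complete flow that follows the field on a ball *)

Section FlowBox.
Variable R : realType.
Implicit Types (X Y : R * R -> R * R) (g h : R -> R * R) (p q u v : R * R).
Implicit Types (phi : R * R -> R -> R * R) (t s L M : R).

Definition locally_lipschitz X := forall M, exists2 L, 0 < L &
  forall u v, `|u| <= M -> `|v| <= M -> `|X u - X v| <= L * `|u - v|.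

Definition is_flow Y L phi := [/\ 0 < L,
  forall u v, `|Y u - Y v| <= L * `|u - v|,
  forall p, phi p 0 = p &
  forall p t, is_derive t (1 : R) (phi p) (Y (phi p t))].

(* [Y] is a globally Lipschitz field that agrees with [X] on the ball of radius [M]:
   its flow [phi] is complete, and follows the orbits of [X] as long as they stay
   in this ball. *)
Definition flow_box X M Y L phi := [/\ locally_lipschitz X, is_flow Y L phi &
  forall u, `|u| <= M -> Y u = X u].

(** Time reversal: [rev phi] is the flow of [- Y], so every statement about entering and staying has
    a twin about leaving and having stayed. *)
Definition rev phi : R * R -> R -> R * R := fun p t => phi p (- t).

Lemma lipschitz_opp X L : (forall u v, `|X u - X v| <= L * `|u - v|) ->
  forall u v, `|- X u - - X v| <= L * `|u - v|.
Proof. by move=> lip u v; rewrite -opprD normrN. Qed.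

Lemma is_flow_rev Y L phi : is_flow Y L phi -> is_flow (fun u => - Y u) L (rev phi).
Proof.
case=> L0 lip phi0 dphi; split => //.
- exact: lipschitz_opp.
- by move=> p; rewrite /rev oppr0.
- by move=> p t; apply: is_derive_comp_opp; exact: dphi.
Qed.

Lemma flow_box_rev X M Y L phi : flow_box X M Y L phi ->
  flow_box (fun u => - X u) M (fun u => - Y u) L (rev phi).
Proof.
case=> lipX fl YX; split.
- move=> K; have [LK LK0 h] := lipX K; exists LK => // u v uK vK.
  by rewrite -opprD normrN h.
- exact: is_flow_rev.
- by move=> u uM; rewrite YX.
Qed.

Definition clamp M (x : R) := Num.max (- M) (Num.min x M).

Lemma clamp_id M (x : R) : `|x| <= M -> clamp M x = x.
Proof.
rewrite ler_norml /clamp => /andP[a b].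
by rewrite (min_idPl b) (max_idPr a).
Qed.

Lemma norm_clamp M (x : R) : 0 <= M -> `|clamp M x| <= M.
Proof.
move=> M0; rewrite /clamp; have [h|h] := leP (- M) (Num.min x M).
  rewrite ler_norml h/=; by rewrite ge_min lexx orbT.
by rewrite normrN ger0_norm.
Qed.

Lemma clamp_lip M (x y : R) : 0 <= M -> `|clamp M x - clamp M y| <= `|x - y|.
Proof.
move=> M0; rewrite ler_norml /clamp.
have := ler_norm (x - y); have := ler_norm (y - x); rewrite distrC.
set n := `|_ - _|; move: n => n.
have [a|a] := leP x M; have [b|b] := leP y M;
  [have [c|c] := leP (- M) x|have [c|c] := leP (- M) x|have [c|c] := leP (- M) M|
   have [c|c] := leP (- M) M];
  [have [d|d] := leP (- M) y|have [d|d] := leP (- M) y|have [d|d] := leP (- M) M|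
   have [d|d] := leP (- M) M|have [d|d] := leP (- M) y|have [d|d] := leP (- M) y
  |have [d|d] := leP (- M) M|have [d|d] := leP (- M) M]; move=> h1 h2; apply/andP; lra.
Qed.

(** Balls of the sup norm are squares, so clamping each coordinate to [[- M, M]] is a 1-Lipschitz
    retraction onto the ball. Composing [X] with it makes the local Lipschitz bound global. *)
Lemma exists_flow_box X M : 0 <= M -> locally_lipschitz X ->
  exists Y L phi, flow_box X M Y L phi.
Proof.
move=> M0 lipX; have [L L0 lip] := lipX M.
pose Y (u : R * R) := X (clamp M u.1, clamp M u.2).
have lipY u v : `|Y u - Y v| <= L * `|u - v|.
  apply: (le_trans (lip _ _ _ _)); rewrite ?plane_norm_le ?norm_clamp//=.
  rewrite ler_wpM2l ?(ltW L0)// plane_norm_le/=.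
  rewrite (le_trans (clamp_lip _ _ M0)) ?(plane_norm_fst (u - v))//=.
  by rewrite (le_trans (clamp_lip _ _ M0)) ?(plane_norm_snd (u - v)).
have [phi phi0 dphi] := global_flow L0 lipY.
exists Y, L, phi; split => // -[x y]; rewrite plane_norm_le => /andP[/= xM yM].
by rewrite /Y/= !clamp_id.
Qed.

Section IsFlow.
Variables (Y : R * R -> R * R) (L : R) (phi : R * R -> R -> R * R).
Hypothesis fl : is_flow Y L phi.

Lemma flow_start p : phi p 0 = p. Proof. by case: fl. Qed.

Lemma flow_derive p t : is_derive t (1 : R) (phi p) (Y (phi p t)).
Proof. by case: fl. Qed.

Lemma flow_cont p : continuous (phi p).
Proof. by move=> t; exact: is_derive_continuous (flow_derive p t). Qed.

Lemma flow_unique p g t : 0 <= t -> g 0 = p ->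
  (forall s, 0 <= s <= t -> is_derive s (1 : R) g (Y (g s))) -> g t = phi p t.
Proof.
move=> t0 g0 dg; have [L0 lip _ dphi] := fl.
apply/eqP; rewrite -subr_eq0 -normr_le0.
have := gronwall_plane (ltW L0) t0 dg (fun s _ => dphi p s)
  (fun s _ => lip (g s) (phi p s)).
by rewrite flow_start g0 subrr normr0 mulr0.
Qed.

Lemma flow_depend_pos p q t : 0 <= t ->
  `|phi p t - phi q t| <= 2 * expR (2 * L * t) * `|p - q|.
Proof.
move=> t0; have [L0 lip _ dphi] := fl.
have := gronwall_plane (ltW L0) t0 (fun s _ => dphi p s) (fun s _ => dphi q s)
  (fun s _ => lip (phi p s) (phi q s)).
by rewrite !flow_start subr0.
Qed.

End IsFlow.

Lemma flow_depend Y L phi p q t : is_flow Y L phi ->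
  `|phi p t - phi q t| <= 2 * expR (2 * L * `|t|) * `|p - q|.
Proof.
move=> fl; have [t0|t0] := leP 0 t; first by rewrite ger0_norm// (flow_depend_pos fl).
rewrite ltr0_norm// -[in phi p t](opprK t) -[in phi q t](opprK t).
by apply: (flow_depend_pos (is_flow_rev fl)); rewrite oppr_ge0 ltW.
Qed.

Lemma flow_add Y L phi p s t : is_flow Y L phi -> phi p (s + t) = phi (phi p s) t.
Proof.
move=> fl; have [t0|t0] := leP 0 t.
  apply: (flow_unique fl (g := fun r => phi p (s + r))) => //; first by rewrite addr0.
  by move=> r _; apply: is_derive_comp_shift; apply: flow_derive fl _ _.
have h : rev phi p (- s - t) = rev phi (phi p s) (- t).
  apply: (flow_unique (is_flow_rev fl) (g := fun r => rev phi p (- s + r))).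
  - by rewrite oppr_ge0 ltW.
  - by rewrite addr0 /rev opprK.
  - move=> r _; apply: (@is_derive_comp_shift _ _ (rev phi p)).
    exact: flow_derive (is_flow_rev fl) _ _.
by rewrite /rev opprK opprD !opprK in h.
Qed.

Lemma flowK Y L phi p t : is_flow Y L phi -> phi (phi p t) (- t) = p.
Proof. by move=> fl; rewrite -(flow_add _ _ _ fl) subrr (flow_start fl). Qed.

Lemma flow_near Y L phi p t (e : R) : is_flow Y L phi -> 0 < e ->
  exists2 d : R, 0 < d & forall q s, `|q - p| < d -> `|s| <= `|t| ->
    `|phi q s - phi p s| < e.
Proof.
move=> fl e0; have [L0 _ _ _] := fl; pose K := 2 * expR (2 * L * `|t|).
have K0 : 0 < K by rewrite mulr_gt0 ?expR_gt0.
exists (e / K); first by rewrite divr_gt0.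
move=> q s qp st; apply: (le_lt_trans (flow_depend _ _ _ fl)).
apply: (@le_lt_trans _ _ (K * `|q - p|)); last by rewrite mulrC -ltr_pdivlMr.
by rewrite ler_wpM2r// ler_wpM2l// ler_expR ler_wpM2l// mulr_ge0// ltW.
Qed.

Lemma flow_near_time Y L phi p t (e : R) : is_flow Y L phi -> 0 < e ->
  exists2 d : R, 0 < d & forall s, `|s - t| < d -> `|phi p s - phi p t| < e.
Proof.
move=> fl e0; have /cvgrPdist_lt/(_ e e0)/nbhs_normP[d /= d0 h] := @flow_cont _ _ _ fl p t.
by exists d => // s st; rewrite distrC; apply: h; rewrite /ball_/= distrC.
Qed.

End FlowBox.

(** * From the relation [flow] to the complete flow *)

Section FlowUniqueness.
Variable R : realType.
Implicit Types (X : R * R -> R * R) (g : R -> R * R) (p q : R * R).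
Implicit Types (N : set (R * R)) (t s : R).

Lemma flow_oppW X p t q : flow X p t q -> flow (fun u => - X u) p (- t) q.
Proof.
case=> a [b [g [/andP[a0 b0] /andP[aT tb] g0 gt dg]]].
exists (- b), (- a), (fun s => g (- s)); split.
- by rewrite oppr_lt0 b0 oppr_gt0.
- by rewrite !ltrN2 tb.
- by rewrite oppr0.
- by rewrite opprK.
- move=> s /andP[bs sa]; apply: is_derive_comp_opp; apply: dg.
  by rewrite ltrNr sa ltrNl.
Qed.

Lemma flow_opp X p t q : flow (fun u => - X u) p (- t) q <-> flow X p t q.
Proof.
split; last exact: flow_oppW.
move=> /flow_oppW; rewrite opprK.
by have -> : (fun u => - - X u) = X by apply/funext => u; rewrite opprK.
Qed.

Lemma curve_bounded g dg t : 0 <= t ->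
  (forall s, 0 <= s <= t -> is_derive s 1 g (dg s)) ->
  exists K, forall s, 0 <= s <= t -> `|g s| <= K.
Proof.
move=> t0 h.
have [|c _ hc] := @EVT_max R (fun s => `|g s|) 0 t t0.
  apply/continuous_in_subspaceT => x; rewrite inE/= in_itv/= => xt.
  by apply: cvg_norm; exact: is_derive_continuous (h x xt).
by exists `|g c| => s st; apply: hc; rewrite in_itv.
Qed.

(** Both curves are bounded on the compact time interval, so a single Lipschitz constant serves
    Gronwall's estimate. Negative times follow by reversal. *)
Lemma flow_uniq X p t q q' : locally_lipschitz X ->
  flow X p t q -> flow X p t q' -> q = q'.
Proof.
suff pos Z r z z' : locally_lipschitz Z -> 0 <= r ->
    flow Z p r z -> flow Z p r z' -> z = z'.
  move=> lipX; have [t0|t0] := leP 0 t; first exact: pos.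
  move=> /flow_oppW h /flow_oppW h'; apply: pos h h'; last by rewrite oppr_ge0 ltW.
  move=> K; have [LK LK0 hK] := lipX K; exists LK => // u v uK vK.
  by rewrite -opprD normrN hK.
move=> lipZ r0 [a [b [g [/andP[a0 b0] /andP[ar rb] g0 gr dg]]]].
move=> [c [d [h [/andP[c0 d0] /andP[cr rd] h0 hr dh]]]].
have dg' s : 0 <= s <= r -> is_derive s 1 g (Z (g s)).
  case/andP=> s0 sr; apply: dg.
  by rewrite (lt_le_trans a0)//= (le_lt_trans sr).
have dh' s : 0 <= s <= r -> is_derive s 1 h (Z (h s)).
  case/andP=> s0 sr; apply: dh.
  by rewrite (lt_le_trans c0)//= (le_lt_trans sr).
have [K1 gK] := curve_bounded r0 dg'; have [K2 hK] := curve_bounded r0 dh'.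
have [LK LK0 lip] := lipZ (Num.max K1 K2).
have := gronwall_plane (ltW LK0) r0 dg' dh' _.
rewrite g0 h0 gr hr subrr normr0 mulr0 => H.
apply/eqP; rewrite -subr_eq0 -normr_le0; apply: H => s sr.
by apply: lip; rewrite le_max ?gK ?hK ?orbT.
Qed.

(** The set [n^+] for a complete flow; [n^-] is obtained as [entry (rev phi) N]. *)
Definition entry (phi : R * R -> R -> R * R) N : set (R * R) := [set p | bdry N p /\
  exists2 t, 0 < t & forall s, - t < s < 0 -> ~ N (phi p s)].

Section Translation.
Variables (X Y : R * R -> R * R) (M L : R) (phi : R * R -> R -> R * R).
Hypothesis fb : flow_box X M Y L phi.

Let fl : is_flow Y L phi. Proof. by case: fb. Qed.

(** [flow] asks for a solution on an open interval around [[0, t]]. The strict bound leaves room: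
    the orbit is still in the ball a little before 0 and a little after [t]. *)
Lemma phi_flow_pos p t : 0 <= t -> (forall s, 0 <= s <= t -> `|phi p s| < M) ->
  flow X p t (phi p t).
Proof.
move=> t0 pM; have [_ _ YX] := fb.
have p0 : `|phi p 0| < M by apply: pM; rewrite lexx.
have pt : `|phi p t| < M by apply: pM; rewrite lexx t0.
have [|d0 d00 h0] := @flow_near_time _ _ _ _ p 0 (M - `|phi p 0|) fl.
  by rewrite subr_gt0.
have [|d1 d10 h1] := @flow_near_time _ _ _ _ p t (M - `|phi p t|) fl.
  by rewrite subr_gt0.
exists (- d0), (t + d1), (phi p); split => //.
- by rewrite oppr_lt0 d00/=; lra.
- by apply/andP; split; lra.
- exact: flow_start fl _.
move=> s /andP[s1 s2]; rewrite -YX; first exact: flow_derive fl _ _.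
have near (a b : R * R) : `|a - b| < M - `|b| -> `|a| <= M.
  by have := ler_normD (a - b) b; rewrite subrK; lra.
have [s0|s0] := ltP s 0.
  by apply: (near _ (phi p 0)); apply: h0; rewrite subr0 ltr0_norm//; lra.
have [ts|st] := ltP t s.
  by apply: (near _ (phi p t)); apply: h1; rewrite gtr0_norm ?subr_gt0//; lra.
by apply/ltW/pM; rewrite s0.
Qed.

Lemma phi_flow_near_pos p : `|p| < M ->
  exists2 e, 0 < e & forall s, 0 <= s < e -> flow X p s (phi p s).
Proof.
move=> pM; have [|d d0 h] := @flow_near_time _ _ _ _ p 0 (M - `|phi p 0|) fl.
  by rewrite (flow_start fl) subr_gt0.
exists d => // s /andP[s0 sd]; apply: phi_flow_pos => // r /andP[r0 rs].
have := h r; rewrite subr0 ger0_norm// => /(_ (le_lt_trans rs sd)).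
by have := ler_normD (phi p r - phi p 0) (phi p 0); rewrite subrK; lra.
Qed.

Lemma flow_phi_pos p t q : 0 <= t -> flow X p t q ->
  (forall s z, 0 <= s <= t -> flow X p s z -> `|z| <= M) -> q = phi p t.
Proof.
move=> t0 [a [b [g [/andP[a0 b0] /andP[aT tb] g0 gt dg]]]] hM.
have [_ _ YX] := fb.
rewrite -gt; apply: (flow_unique fl) => // s /andP[s0 st].
have asb : a < s < b by rewrite (lt_le_trans a0)//= (le_lt_trans st).
rewrite YX; first exact: dg.
apply: (hM s); first by rewrite s0.
by exists a, b, g; split => //; rewrite a0.
Qed.

(** The equivalence concerns whole initial pieces of orbits. It would fail at a single time, since
    [phi] may leave the ball, stop following [X], and come back. *)
Lemma flow_in_phi_pos N p t : (forall q, N q -> `|q| < M) -> 0 <= t ->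
  (forall s, 0 <= s <= t -> flow_in X N p s) <->
  (forall s, 0 <= s <= t -> N (phi p s)).
Proof.
move=> NM t0; have [lipX _ _] := fb; split=> h s /andP[s0 st].
  have inN r z : 0 <= r <= t -> flow X p r z -> N z.
    by move=> /h[z' [fz' Nz']] fz; rewrite (flow_uniq lipX fz fz').
  have [z [fz Nz]] := h s (introT andP (conj s0 st)).
  rewrite -(flow_phi_pos s0 fz)// => r w /andP[r0 rs] fw.
  by apply/ltW/NM; apply: inN fw; rewrite r0 (le_trans rs).
exists (phi p s); split; last by apply: h; rewrite s0.
apply: phi_flow_pos => // r /andP[r0 rs].
by apply/NM/h; rewrite r0 (le_trans rs).
Qed.

End Translation.

Section Translation2.
Variables (X Y : R * R -> R * R) (M L : R) (phi : R * R -> R -> R * R).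
Variable N : set (R * R).
Hypotheses (fb : flow_box X M Y L phi) (NM : forall q, N q -> `|q| < M).

Let fl : is_flow Y L phi. Proof. by case: fb. Qed.
Let lipX : locally_lipschitz X. Proof. by case: fb. Qed.

Lemma flow_in_opp p t : flow_in (fun u => - X u) N p (- t) <-> flow_in X N p t.
Proof. by split=> -[q [/flow_opp fq Nq]]; exists q. Qed.

Lemma flow_in_phi_neg p t : 0 <= t ->
  (forall s, - t <= s <= 0 -> flow_in X N p s) <->
  (forall s, - t <= s <= 0 -> N (phi p s)).
Proof.
move=> t0; have [h1 h2] := flow_in_phi_pos (flow_box_rev fb) p NM t0.
split=> h s /andP[ts s0].
  have := h1 _ (- s); rewrite /rev opprK; apply; last by rewrite oppr_ge0 s0 lerNl.
  move=> r /andP[r0 rt]; rewrite -(opprK r); apply/flow_in_opp/h.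
  by rewrite lerN2 rt oppr_le0.
have := h2 _ (- s); rewrite flow_in_opp; apply; last by rewrite oppr_ge0 s0 lerNl.
by move=> r /andP[r0 rt]; apply: h; rewrite lerN2 rt oppr_le0.
Qed.

Lemma flow_in_phi_near p : `|p| < M ->
  exists2 e, 0 < e & forall s, `|s| < e -> flow_in X N p s <-> N (phi p s).
Proof.
move=> pM; have [e1 e10 h1] := phi_flow_near_pos fb pM.
have [e2 e20 h2] := phi_flow_near_pos (flow_box_rev fb) pM.
exists (Num.min e1 e2); first by rewrite lt_min e10.
move=> s; rewrite lt_min => /andP[s1 s2].
have fs : flow X p s (phi p s).
  have [s0|s0] := leP 0 s; first by apply: h1; rewrite s0 -(ger0_norm s0).
  apply/flow_opp; have := h2 (- s); rewrite /rev opprK; apply.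
  by rewrite oppr_ge0 ltW//= -ltr0_norm.
split; last by exists (phi p s).
by move=> [q [fq Nq]]; rewrite (flow_uniq lipX fs fq).
Qed.

Let bdryM p : bdry N p -> `|p| < M.
Proof.
move=> [F [[U [V [G [[_ _ Up] [_ [_ _ UN]]]]]] Fp0]]; apply/NM.
by apply/(UN p Up); rewrite Fp0.
Qed.

Lemma nplusE : nplus X N = entry phi N.
Proof.
apply/seteqP; split=> p [bp [t t0 h]]; split=> //;
  have [e e0 he] := flow_in_phi_near (bdryM bp);
  exists (Num.min t e); rewrite ?lt_min ?t0//= => s /andP[];
  rewrite ltrNl lt_min => /andP[ts es] s0.
  by rewrite -he ?ltr0_norm//; apply: h; rewrite s0 ltrNl ts.
by rewrite he ?ltr0_norm//; apply: h; rewrite s0 ltrNl ts.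
Qed.

Lemma nminusE : nminus X N = entry (rev phi) N.
Proof.
apply/seteqP; split=> p [bp [t t0 h]]; split=> //;
  have [e e0 he] := flow_in_phi_near (bdryM bp);
  exists (Num.min t e); rewrite ?lt_min ?t0//= => s.
  rewrite ltrNl lt_min => /andP[/andP[ts es] s0].
  by rewrite /rev -he ?normrN ?ltr0_norm//; apply: h; rewrite oppr_gt0 s0.
rewrite lt_min => /andP[s0 /andP[st se]].
rewrite he ?gtr0_norm//; have := h (- s); rewrite /rev opprK; apply.
by rewrite oppr_lt0 s0 ltrN2 st.
Qed.

Lemma flow_in_phi_forward p :
  (forall t, 0 <= t -> flow_in X N p t) <-> (forall t, 0 <= t -> N (phi p t)).
Proof.
split=> h t t0.
  by apply: (flow_in_phi_pos fb p NM t0).1; rewrite ?t0 ?lexx// => s /andP[/h].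
by apply: (flow_in_phi_pos fb p NM t0).2; rewrite ?t0 ?lexx// => s /andP[/h].
Qed.

Lemma flow_in_phi_backward p :
  (forall t, t <= 0 -> flow_in X N p t) <-> (forall t, t <= 0 -> N (phi p t)).
Proof.
split=> h t t0; have t0' : 0 <= - t by rewrite oppr_ge0.
  apply: (flow_in_phi_neg p t0').1; rewrite ?opprK ?t0 ?lexx// => s /andP[_ /h].
  by [].
by apply: (flow_in_phi_neg p t0').2; rewrite ?opprK ?t0 ?lexx// => s /andP[_ /h].
Qed.

Lemma max_invariantE : max_invariant X N = [set p | forall t, N (phi p t)].
Proof.
apply/seteqP; split=> p /= h t.
  have [t0|t0] := leP 0 t.
    by apply: (flow_in_phi_forward p).1 t0 => s _; apply: h.
  by apply: (flow_in_phi_backward p).1 (ltW t0) => s _; apply: h.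
have [t0|t0] := leP 0 t.
  by apply: (flow_in_phi_forward p).2 t0 => s _; apply: h.
by apply: (flow_in_phi_backward p).2 (ltW t0) => s _; apply: h.
Qed.

Lemma aplusE : aplus X N = [set p | entry phi N p /\ forall t, 0 <= t -> N (phi p t)].
Proof.
apply/seteqP; split=> p [np h]; split; first by rewrite -nplusE.
- by case: (flow_in_phi_forward p) => + _; apply.
- by rewrite nplusE.
- by case: (flow_in_phi_forward p) => _; apply.
Qed.

Lemma exit_pointE p q : exit_point X N p q <-> exists t,
  [/\ 0 <= t, phi p t = q, (forall s, 0 <= s <= t -> N (phi p s)) &
    forall t', t < t' -> ~ (forall s, 0 <= s <= t' -> N (phi p s))].
Proof.
split=> -[t [t0 ptq h1 h2]]; exists t.
  have h := (flow_in_phi_pos fb p NM t0).1 h1.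
  split => // [|t' tt' h'].
    apply: esym; apply: (flow_uniq lipX ptq); apply: (phi_flow_pos fb) => // s st.
    exact/NM/h.
  apply: (h2 t' tt').
  by apply/(flow_in_phi_pos fb p NM (le_trans t0 (ltW tt'))).
have h := (flow_in_phi_pos fb p NM t0).2 h1.
split => // [|t' tt' h'].
  by rewrite -ptq; apply: (phi_flow_pos fb) => // s st; exact/NM/h1.
apply: (h2 t' tt').
by apply/(flow_in_phi_pos fb p NM (le_trans t0 (ltW tt'))).
Qed.

End Translation2.
End FlowUniqueness.

Lemma continuous_atP (R : realType) (V W : normedModType R) (f : V -> W) (p : V) :
  {for p, continuous f} <-> (forall e : R, 0 < e ->
    exists2 d : R, 0 < d & forall q, `|q - p| < d -> `|f q - f p| < e).
Proof.
split=> [cf e e0|h].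
  have /cvgrPdist_lt/(_ e e0)/nbhs_normP[d /= d0 hd] := cf.
  by exists d => // q qp; rewrite distrC; apply: hd; rewrite /ball_/= distrC.
apply/cvgrPdist_lt => e e0; have [d d0 hd] := h e e0.
apply/nbhs_normP; exists d => // q; rewrite /ball_/= distrC => qp.
by rewrite distrC hd.
Qed.

Lemma open_ballP (R : realType) (V : normedModType R) (U : set V) (p : V) : open U -> U p ->
  exists2 d : R, 0 < d & forall q, `|q - p| < d -> U q.
Proof.
move=> oU Up; have /nbhs_normP[d /= d0 hd] : nbhs p U by exact: open_nbhs_nbhs.
by exists d => // q qp; apply: hd; rewrite /ball_/= distrC.
Qed.

(** * Functions of class C^1 and their derivatives along curves *)

Section C1.
Variable R : realType.
Implicit Types (f : R * R -> R) (p q : R * R) (U : set (R * R)).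

Lemma is_derive_partial1 f p : derivable f p (1, 0) ->
  is_derive p.1 1 (fun s => f (s, p.2)) ('D_(1, 0) f p).
Proof.
move=> df; have E : (fun h : R => h^-1 *: ((fun s => f (s, p.2)) (h *: 1 + p.1) - f (p.1, p.2)))
    = (fun h : R => h^-1 *: (f (h *: (1, 0) + p) - f p)).
  apply/funext => h; have -> : h *: (1, 0) + p = (h *: 1 + p.1, p.2).
    by rewrite [LHS]surjective_pairing/= scaler0 add0r.
  by rewrite -surjective_pairing.
split; first by rewrite /derivable/= E.
by rewrite /derive/= E.
Qed.

Lemma is_derive_partial2 f p : derivable f p (0, 1) ->
  is_derive p.2 1 (fun s => f (p.1, s)) ('D_(0, 1) f p).
Proof.
move=> df; have E : (fun h : R => h^-1 *: ((fun s => f (p.1, s)) (h *: 1 + p.2) - f (p.1, p.2)))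
    = (fun h : R => h^-1 *: (f (h *: (0, 1) + p) - f p)).
  apply/funext => h; have -> : h *: (0, 1) + p = (p.1, h *: 1 + p.2).
    by rewrite [LHS]surjective_pairing/= scaler0 add0r.
  by rewrite -surjective_pairing.
split; first by rewrite /derivable/= E.
by rewrite /derive/= E.
Qed.

Lemma mean_value_between (f df : R -> R) (a b : R) : a != b ->
  (forall x, Num.min a b <= x <= Num.max a b -> is_derive x 1 f (df x)) ->
  exists c, Num.min a b <= c <= Num.max a b /\ (f a - f b) / (a - b) = df c.
Proof.
move=> ab h; wlog lt_ab : a b ab h / a < b.
  move=> H; have [lt|ge] := boolP (a < b); first exact: (H a b ab h lt).
  have ba : b < a by rewrite lt_neqAle eq_sym ab leNgt.
  have := H b a; rewrite eq_sym (minC b) (maxC b) => /(_ ab h ba)[c [cab E]].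
  by exists c; split => //; rewrite -E -(opprB b a) -(opprB (f b)) invrN mulrNN.
move: h; rewrite (min_idPl (ltW lt_ab)) (max_idPr (ltW lt_ab)) => h.
have [c|c cab E] := MVT_segment (df := df) (ltW lt_ab) _ (is_derive_within_continuous h).
  by rewrite in_itv/= => /andP[? ?]; apply: h; rewrite !ltW.
exists c; split; first by move: cab; rewrite in_itv.
by rewrite -(opprB b a) -(opprB (f b) (f a)) invrN mulrNN E mulfK// subr_eq0 gt_eqF.
Qed.

(** [Ck_on] only provides partial derivatives. Going from [p] to [q] first vertically and then
    horizontally, the mean value theorem turns them into slopes continuous at [p], which is what the
    chain rule requires. *)
Lemma C1_slope U f p : open U -> U p -> Ck_on 1 U f ->
  exists a b : R * R -> R, [/\ {for p, continuous a}, {for p, continuous b},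
    a p = 'D_(1, 0) f p, b p = 'D_(0, 1) f p &
    forall q, f q - f p = a q * (q.1 - p.1) + b q * (q.2 - p.2)].
Proof.
move=> oU Up [_ [dU [cx _] [cy _]]].
have [r r0 inU] := open_ballP oU Up.
have btw (x y z d : R) : `|x - y| < d -> Num.min x y <= z <= Num.max x y -> `|z - y| < d.
  by rewrite !ltr_norml; have [xy|xy] := leP x y => /andP[? ?] /andP[? ?]; apply/andP; split; lra.
pose a q := if q.1 == p.1 then 'D_(1, 0) f p else (f q - f (p.1, q.2)) / (q.1 - p.1).
pose b q := if q.2 == p.2 then 'D_(0, 1) f p else (f (p.1, q.2) - f p) / (q.2 - p.2).
exists a, b; split; rewrite /a /b ?eqxx//.
- apply/continuous_atP => e e0; rewrite eqxx.
  have [d1 d10 h1] := (continuous_atP _ _).1 (cx p (mem_set Up)) e e0.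
  exists (Num.min r d1) => [|q]; rewrite lt_min ?r0// => /andP[qr qd].
  case: eqP => [_|/eqP qp]; first by rewrite subrr normr0.
  move: qr qd; rewrite !plane_norm_lt/= => /andP[qr1 qr2] /andP[qd1 qd2].
  have [x xqp|c [cq]] := mean_value_between
    (f := fun s => f (s, q.2)) (df := fun s => 'D_(1, 0) f (s, q.2)) qp.
    apply: (@is_derive_partial1 f (x, q.2)).
    by apply: (dU _ _).1; apply: inU; rewrite plane_norm_lt/= qr2 (btw _ _ _ _ qr1 xqp).
  rewrite -surjective_pairing => ->.
  by apply: h1; rewrite plane_norm_lt/= qd2 (btw _ _ _ _ qd1 cq).
- apply/continuous_atP => e e0; rewrite eqxx.
  have [d1 d10 h1] := (continuous_atP _ _).1 (cy p (mem_set Up)) e e0.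
  exists (Num.min r d1) => [|q]; rewrite lt_min ?r0// => /andP[qr qd].
  case: eqP => [_|/eqP qp]; first by rewrite subrr normr0.
  move: qr qd; rewrite !plane_norm_lt/= => /andP[qr1 qr2] /andP[qd1 qd2].
  have [x xqp|c [cq]] := mean_value_between
    (f := fun s => f (p.1, s)) (df := fun s => 'D_(0, 1) f (p.1, s)) qp.
    apply: (@is_derive_partial2 f (p.1, x)).
    apply: (dU _ _).2; apply: inU.
    by rewrite plane_norm_lt/= subrr normr0 r0 (btw _ _ _ _ qr2 xqp).
  rewrite -surjective_pairing => ->.
  apply: h1; rewrite plane_norm_lt/= subrr normr0 d10.
  by rewrite (btw _ _ _ _ qd2 cq).
- move=> q; case: p {Up inU dU cx cy a b} => x y /=; case: q => x' y' /=.
  have [->|xx] := eqVneq x' x; have [->|yy] := eqVneq y' y;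
    rewrite ?subrr ?mulr0 ?addr0 ?add0r ?divfK ?subr_eq0//.
  by rewrite addrA subrK.
Qed.

Lemma is_derive_C1_curve U f (g : R -> R * R) t v : open U -> U (g t) ->
  Ck_on 1 U f -> is_derive t 1 g v ->
  is_derive t 1 (f \o g) (v.1 * 'D_(1, 0) f (g t) + v.2 * 'D_(0, 1) f (g t)).
Proof.
move=> oU Up c1 dg; have [a [b [ca cb <- <- h]]] := C1_slope oU Up c1.
have cg := is_derive_continuous dg.
have [[dg1 g1E] [dg2 g2E]] := (is_derive_fst dg, is_derive_snd dg).
have cg' : g (h *: 1 + t) @[h --> 0^'] --> g t.
  have ck : {for (0 : R), continuous (fun h : R => g (h *: 1 + t))}.
    apply/continuous_atP => e e0; have [d d0 hd] := (continuous_atP _ _).1 cg e e0.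
    exists d => // s; rewrite subr0 => sd; rewrite scale0r add0r.
    by apply: hd; rewrite addrK [_ *: _]mulr1.
  have {}ck : g (h *: 1 + t) @[h --> (0 : R)] --> g t.
    have -> : g t = (fun h : R => g (h *: 1 + t)) 0 by rewrite scale0r add0r.
    exact: ck.
  by apply: cvg_trans ck; apply: cvg_app; exact: nbhs_dnbhs.
have lim : h^-1 *: ((f \o g) (h *: 1 + t) - (f \o g) t) @[h --> 0^'] -->
    v.1 * a (g t) + v.2 * b (g t).
  have lim' : (h^-1 *: ((fst \o g) (h *: 1 + t) - (fst \o g) t)) * a (g (h *: 1 + t)) +
      (h^-1 *: ((snd \o g) (h *: 1 + t) - (snd \o g) t)) * b (g (h *: 1 + t)) @[h --> 0^'] -->
      v.1 * a (g t) + v.2 * b (g t).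
    apply: cvgD; apply: cvgM.
    - by rewrite -g1E; exact: dg1.
    - by apply: continuous_cvg; [exact: ca|exact: cg'].
    - by rewrite -g2E; exact: dg2.
    - by apply: continuous_cvg; [exact: cb|exact: cg'].
  apply: cvg_trans lim'; apply: near_eq_cvg; apply: nearW => s /=.
  by rewrite h /GRing.scale/=; ring.
split; first by apply/cvg_ex; eexists; exact: lim.
by apply: cvg_lim => //; exact: lim.
Qed.

Lemma derive_C1 U f p v : open U -> U p -> Ck_on 1 U f ->
  'D_v f p = v.1 * 'D_(1, 0) f p + v.2 * 'D_(0, 1) f p.
Proof.
move=> oU Up c1; pose l (s : R) := (s * v.1 + p.1, s * v.2 + p.2).
have lE s : l s = s *: v + p by [].
have l0 : l 0 = p by rewrite lE scale0r add0r.
have dl : is_derive (0 : R) 1 l v.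
  rewrite [v]surjective_pairing; apply: is_derive_pair;
    by apply: is_derive_eq; rewrite /GRing.scale/=; ring.
have Ul : U (l 0) by rewrite l0.
have [_] := is_derive_C1_curve oU Ul c1 dl.
have E : (fun h : R => h^-1 *: (f (l (h *: 1 + 0)) - f (l 0))) =
    (fun h : R => h^-1 *: (f (h *: v + p) - f p)).
  by apply/funext => h; rewrite /= !lE addr0 scale0r add0r [_ *: 1]mulr1.
by rewrite l0 => <-; rewrite /derive/= E.
Qed.

End C1.

(** * Isolating blocks *)

Section Domain.
Variable R : realType.
Implicit Types (F G : R * R -> R * R) (p q : R * R) (U V N : set (R * R)).

Lemma continuous_pair_at (V' : normedModType R) (F : V' -> R * R) (p : V') :
  {for p, continuous (fst \o F)} -> {for p, continuous (snd \o F)} ->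
  {for p, continuous F}.
Proof.
move=> /continuous_atP c1 /continuous_atP c2; apply/continuous_atP => e e0.
have [d1 d10 h1] := c1 e e0; have [d2 d20 h2] := c2 e e0.
exists (Num.min d1 d2); first by rewrite lt_min d10.
move=> q; rewrite lt_min => /andP[q1 q2].
by rewrite plane_norm_lt (h1 _ q1) (h2 _ q2).
Qed.

Lemma smooth_on_continuous U F p : smooth_on U F -> U p -> {for p, continuous F}.
Proof.
move=> sF Up; have [c1 c2] := sF 0%N.
by apply: continuous_pair_at; [apply: c1.1|apply: c2.1]; rewrite inE.
Qed.

Lemma bdry_in N p : bdry N p -> N p.
Proof.
by move=> [F [[U [V [G [[_ _ Up] [_ [_ _ UN]]]]]] Fp0]]; apply/UN => //; rewrite Fp0.
Qed.

(** In the chart, [F p] moved down by a small [d] stays in the open image [V]; its preimage is near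
    [p] and outside [N]. *)
Lemma bdry_adherent N p e : bdry N p -> 0 < e -> exists2 q, `|q - p| < e & ~ N q.
Proof.
move=> [F [[U [V [G [[oU oV Up] [[sF sG FU GV] [FG GF UN]]]]]] Fp0]] e0.
have VFp : V (F p) by apply: FU; exists p.
have GFp : G (F p) = p by apply: FG; rewrite inE.
have [d1 d10 h1] := open_ballP oV VFp.
have [d2 d20 h2] := (continuous_atP _ _).1 (smooth_on_continuous sG VFp) e e0.
pose d := Num.min d1 d2 / 2.
have d0 : 0 < d by rewrite divr_gt0// lt_min d10.
have [dd1 dd2] : d < d1 /\ d < d2.
  have : Num.min d1 d2 <= d1 /\ Num.min d1 d2 <= d2 by rewrite !ge_min !lexx orbT.
  by move: d0; rewrite /d; lra.
pose z := ((F p).1, (F p).2 - d).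
have zF : `|z - F p| <= d.
  by rewrite plane_norm_le/= subrr normr0 ltW//= addrC addKr normrN ger0_norm// ltW.
have Vz : V z by apply: h1; exact: le_lt_trans zF dd1.
exists (G z); first by rewrite -{1}GFp; apply: h2; exact: le_lt_trans zF dd2.
have UGz : U (G z) by apply: GV; exists z.
rewrite UN// GF ?inE//= Fp0 add0r oppr_ge0.
by apply/negP; rewrite -ltNge.
Qed.

Lemma interior_notbdry N p e : 0 < e -> (forall q, `|q - p| < e -> N q) -> ~ bdry N p.
Proof. by move=> e0 h /bdry_adherent /(_ e0)[q /h]. Qed.

(** Being a boundary point does not depend on the chart: where the second coordinate is positive,
    [N] is a neighbourhood, against [bdry_adherent]. *)
Lemma bdry_chart0 N q U F : open U -> smooth_on U F ->
  (forall q, U q -> N q <-> 0 <= (F q).2) -> U q -> bdry N q -> (F q).2 = 0.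
Proof.
move=> oU sF UN Uq bq; have Fq : 0 <= (F q).2 by apply: (UN _ Uq).1; exact: bdry_in.
apply/eqP; rewrite eq_le Fq andbT leNgt; apply/negP => Fq0.
have [d1 d10 h1] := open_ballP oU Uq.
have [d2 d20 h2] := (continuous_atP _ _).1 (smooth_on_continuous sF Uq) _ Fq0.
have d0 : 0 < Num.min d1 d2 by rewrite lt_min d10.
apply: (interior_notbdry d0 _ bq) => z; rewrite lt_min => /andP[z1 z2].
apply/UN; first exact: h1.
have := h2 _ z2; rewrite plane_norm_lt/= => /andP[_].
by rewrite ltr_norml => /andP[+ _]; lra.
Qed.

Lemma notbdry_interior N p : compact_domain N -> N p -> ~ bdry N p ->
  exists2 e, 0 < e & forall q, `|q - p| < e -> N q.
Proof.
move=> [_ ch] Np nb.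
have [F cF] := ch p Np.
have [U [V [G [[oU oV Up] [[sF sG FU GV] [FG GF UN]]]]]] := cF.
have Fp0 : 0 < (F p).2.
  rewrite lt_neqAle eq_sym ((UN _ Up).1 Np) andbT.
  by apply/eqP => Fp0; apply: nb; exists F.
have [d1 d10 h1] := open_ballP oU Up.
have [d2 d20 h2] := (continuous_atP _ _).1 (smooth_on_continuous sF Up) _ Fp0.
exists (Num.min d1 d2); first by rewrite lt_min d10.
move=> z; rewrite lt_min => /andP[z1 z2]; apply/UN; first exact: h1.
have := h2 _ z2; rewrite plane_norm_lt/= => /andP[_].
by rewrite ltr_norml => /andP[+ _]; lra.
Qed.

Lemma domain_closed N p : compact_domain N -> ~ N p ->
  exists2 e : R, 0 < e & forall q, `|q - p| < e -> ~ N q.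
Proof.
move=> [cN _] nNp.
have oN : open (~` N) by apply: closed_openC; apply: compact_closed => //; exact: norm_hausdorff.
exact: (open_ballP oN nNp).
Qed.

Lemma domain_bounded N : compact_domain N -> exists2 M : R, 0 < M & forall p, N p -> `|p| < M.
Proof.
move=> [/compact_bounded[M [_ hM]] _]; exists (Num.max 1 (M + 2)).
  by rewrite lt_max ltr01.
move=> p Np; rewrite lt_max; apply/orP; right.
apply: (@le_lt_trans _ _ (M + 1)); last by rewrite ltrD2l ltr1n.
by apply: (hM (M + 1) _ p Np); rewrite ltrDl.
Qed.

End Domain.

(** * Transversal crossing of the boundary *)

Section Transversality.
Variable R : realType.
Variables (X Y : R * R -> R * R) (M L : R) (phi : R * R -> R -> R * R).
Hypothesis fb : flow_box X M Y L phi.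
Implicit Types (F G : R * R -> R * R) (p q : R * R) (U V N : set (R * R)).

Let fl : is_flow Y L phi. Proof. by case: fb. Qed.

Lemma flow_near_joint p e : 0 < e -> exists2 r : R, 0 < r &
  forall q s, `|q - p| < r -> `|s| < r -> `|phi q s - p| < e.
Proof.
move=> e0; have e20 : 0 < e / 2 by rewrite divr_gt0.
have [d1 d10 h1] := flow_near p 1 fl e20.
have [d2 d20 h2] := flow_near_time p 0 fl e20.
exists (Num.min 1 (Num.min d1 d2)); first by rewrite !lt_min ltr01 d10.
move=> q s; rewrite !lt_min => /andP[_ /andP[q1 _]] /andP[s1 /andP[_ s2]].
have := h1 q s q1; rewrite normr1 => /(_ (ltW s1)) h.
have := h2 s; rewrite subr0 => /(_ s2); rewrite (flow_start fl) => h'.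
have := ler_normD (phi q s - phi p s) (phi p s - p); rewrite addrA subrK; lra.
Qed.

(** The derivative [w] of the second chart coordinate along the flow is continuous, hence positive
    near [p], so this coordinate increases along orbits there. The radius [r] serves all boundary
    points near [p], which matters when exit points are moved. *)
Lemma transversal_pos N p F : `|p| < M -> chart_at N p F ->
  0 < 'D_(X p) (snd \o F) p -> exists2 r : R, 0 < r &
  forall q, bdry N q -> `|q - p| < r ->
    (forall s, 0 < s < r -> N (phi q s)) /\ (forall s, - r < s < 0 -> ~ N (phi q s)).
Proof.
move=> pM [U [V [G [[oU oV Up] [[sF sG FU GV] [FG GF UN]]]]]] D0.
have [_ c1] := sF 1%N.
pose w u := (Y u).1 * 'D_(1, 0) (snd \o F) u + (Y u).2 * 'D_(0, 1) (snd \o F) u.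
have wp : 0 < w p.
  by have [_ _ YX] := fb; rewrite /w YX ?ltW// -(derive_C1 _ oU Up c1).
have cY : {for p, continuous Y}.
  have [L0 lip _ _] := fl; apply/continuous_atP => e e0.
  exists (e / L); first by rewrite divr_gt0.
  by move=> q qp; apply: (le_lt_trans (lip _ _)); rewrite mulrC -ltr_pdivlMr.
have cw : {for p, continuous w}.
  have [_ [_ [cx _] [cy _]]] := c1.
  apply: cvgD; apply: cvgM.
  - by apply: (cvg_comp _ _ cY); exact: cvg_fst.
  - by apply: cx; rewrite inE.
  - by apply: (cvg_comp _ _ cY); exact: cvg_snd.
  - by apply: cy; rewrite inE.
have [d1 d10 h1] := open_ballP oU Up.
have [d2 d20 h2] := (continuous_atP _ _).1 cw _ wp.
have [|r r0 hr] := @flow_near_joint p (Num.min d1 d2); first by rewrite lt_min d10.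
have good u : `|u - p| < Num.min d1 d2 -> U u /\ 0 < w u.
  rewrite lt_min => /andP[u1 u2]; split; first exact: h1.
  by have := h2 _ u2; rewrite ltr_norml => /andP[+ _]; lra.
have mono q s1 s2 : `|q - p| < r -> - r < s1 -> s1 < s2 -> s2 < r ->
    (F (phi q s1)).2 < (F (phi q s2)).2.
  move=> qp s1r ss s2r.
  have g s : s1 <= s <= s2 -> U (phi q s) /\ 0 < w (phi q s).
    case/andP=> a b; apply: good; apply: hr => //.
    by rewrite ltr_norml; apply/andP; split; lra.
  apply: (@gt0_is_derive_lt _ (snd \o F \o phi q) (w \o phi q)) => // s ss12.
    by apply: (is_derive_C1_curve oU (g s ss12).1 c1 (flow_derive fl q s)).
  by case/andP: ss12 => a b; apply: (g s _).2; rewrite !ltW.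
exists r => // q bq qr.
have Uphi s : `|s| < r -> U (phi q s).
  by move=> sr; apply: (good _ _).1; apply: hr.
have Uq : U q by rewrite -(flow_start fl q); apply: Uphi; rewrite normr0.
have Fq0 : (F q).2 = 0 by exact: (bdry_chart0 oU sF UN Uq bq).
split=> s /andP[sa sb].
  apply/UN; first by apply: Uphi; rewrite ger0_norm// ltW.
  by rewrite -Fq0 ltW// -{1}(flow_start fl q); apply: mono => //; rewrite oppr_lt0.
have Us : U (phi q s) by apply: Uphi; rewrite ltr0_norm// ltrNl.
rewrite (UN _ Us); apply/negP; rewrite -ltNge -Fq0 -[in X in _ < X](flow_start fl q).
exact: mono.
Qed.

End Transversality.

(** * Isolating blocks for a complete flow *)

Section Block.
Variable R : realType.
Implicit Types (X Y f g : R * R -> R * R) (phi : R * R -> R -> R * R).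
Implicit Types (p q w : R * R) (N : set (R * R)) (t s e d : R).

Definition block X Y M L phi N := [/\ flow_box X M Y L phi,
  forall q, N q -> `|q| < M, compact_domain N,
  entry phi N `&` entry (rev phi) N = tau X N & tau X N `<=` isolated (tau X N)].

Lemma tau_opp X N : tau (fun u => - X u) N = tau X N.
Proof.
have sub Z : tau Z N `<=` tau (fun u => - Z u) N.
  move=> p [F [cF Fp0 D0]]; exists F; split; [exact: cF|exact: Fp0|].
  move: D0; have [U [V [G [[oU _ Up] [[sF _ _ _] _]]]]] := cF.
  have [_ c1] := sF 1%N; rewrite (derive_C1 (Z p) oU Up c1) (derive_C1 (- Z p) oU Up c1)/= => D0.
  by rewrite !mulNr -opprD D0 oppr0.
apply/seteqP; split; last exact: sub.
move=> p /sub; have -> // : (fun u => - - X u) = X.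
by apply/funext => u; rewrite opprK.
Qed.

Lemma rev_rev phi : rev (rev phi) = phi.
Proof. by apply/funext => p; apply/funext => t; rewrite /rev opprK. Qed.

Lemma block_rev X Y M L phi N : block X Y M L phi N ->
  block (fun u => - X u) (fun u => - Y u) M L (rev phi) N.
Proof.
case=> fb NM cN eN iN.
split; [exact: flow_box_rev|exact: NM|exact: cN| |by rewrite tau_opp].
by rewrite tau_opp rev_rev setIC.
Qed.

Definition stays phi N p := forall t, 0 <= t -> N (phi p t).

Definition exits_at phi N p q := exists t, [/\ 0 <= t, phi p t = q,
  (forall s, 0 <= s <= t -> N (phi p s)) &
  forall t', t < t' -> ~ (forall s, 0 <= s <= t' -> N (phi p s))].

Lemma entryN phi N p e : entry phi N p -> 0 < e ->
  (forall s, - e < s < 0 -> N (phi p s)) -> False.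
Proof.
move=> [_ [t t0 h]] e0 h'.
pose m := Num.min t e / 2.
have : Num.min t e <= t /\ Num.min t e <= e by rewrite !ge_min !lexx orbT.
have : 0 < Num.min t e by rewrite lt_min t0.
move=> m0 [mt me].
by apply: (h (- m)); [|apply: h']; apply/andP; split; rewrite /m; lra.
Qed.

Section ForwardBlock.
Variables (X Y : R * R -> R * R) (M L : R) (phi : R * R -> R -> R * R).
Variable N : set (R * R).
Hypothesis B : block X Y M L phi N.

Let fl : is_flow Y L phi. Proof. by case: B => -[]. Qed.
Let cN : compact_domain N. Proof. by case: B. Qed.

Lemma bdry_transversal p : bdry N p -> tau X N p \/ exists2 r, 0 < r &
  (forall q, bdry N q -> `|q - p| < r ->
    (forall s, 0 < s < r -> N (phi q s)) /\ (forall s, - r < s < 0 -> ~ N (phi q s))) \/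
  (forall q, bdry N q -> `|q - p| < r ->
    (forall s, 0 < s < r -> ~ N (phi q s)) /\ (forall s, - r < s < 0 -> N (phi q s))).
Proof.
move=> bp; have [tp|ntp] := pselect (tau X N p); [by left|right].
have [fb NM _ _ _] := B.
have [F [cF Fp0]] := bp; have pM := NM _ (bdry_in bp).
have D0 : 'D_(X p) (snd \o F) p != 0.
  by apply/eqP => D0; apply: ntp; exists F.
have [D|D] := ltP 0 ('D_(X p) (snd \o F) p).
  by have [r r0 h] := transversal_pos fb pM cF D; exists r => //; left.
have [|r r0 h] := @transversal_pos _ _ _ _ _ _ (flow_box_rev fb) _ _ _ pM cF.
  move: (D) (D0); have [U [V [G [[oU _ Up] [[sF _ _ _] _]]]]] := cF.
  have [_ c1] := sF 1%N; rewrite (derive_C1 (X p) oU Up c1) (derive_C1 (- X p) oU Up c1)/= !mulNr.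
  by move=> D1 D2; rewrite -opprD oppr_gt0 lt_neqAle D2.
exists r => //; right => q bq qp; have [h1 h2] := h q bq qp; split=> s /andP[s1 s2].
  by have := h2 (- s); rewrite /rev opprK; apply; rewrite ltrN2 s2 oppr_lt0.
by have := h1 (- s); rewrite /rev opprK; apply; rewrite oppr_gt0 s2 ltrNl.
Qed.

Lemma tau_entry p : tau X N p <-> entry phi N p /\ entry (rev phi) N p.
Proof. by have [_ _ _ <- _] := B. Qed.

Lemma bdry_entry p : bdry N p -> entry phi N p \/ entry (rev phi) N p.
Proof.
move=> bp; have [/tau_entry[]|[r r0 [|] h]] := bdry_transversal bp; first by left.
  have [|_ h2] := h p bp; first by rewrite subrr normr0.
  by left; split=> //; exists r => // s sr; apply: h2.
have [|h1 _] := h p bp; first by rewrite subrr normr0.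
right; split=> //; exists r => // s /andP[s1 s2]; apply: h1 => //.
by rewrite oppr_gt0 s2 ltrNl.
Qed.

Lemma entry_transversal p : entry phi N p -> ~ entry (rev phi) N p ->
  exists2 r, 0 < r & forall q, bdry N q -> `|q - p| < r ->
    (forall s, 0 < s < r -> N (phi q s)) /\ (forall s, - r < s < 0 -> ~ N (phi q s)).
Proof.
move=> ep nep; have bp : bdry N p by case: ep.
have [/tau_entry[]//|[r r0 [h|h]]] := bdry_transversal bp; first by exists r.
have [|_ h2] := h p bp; first by rewrite subrr normr0.
by case: (entryN ep r0) => s; apply: h2.
Qed.

Lemma stays_exitN p : stays phi N p -> ~ entry (rev phi) N p.
Proof.
move=> sp ep; apply: (entryN ep ltr01) => s /andP[_ s0].
by apply: sp; rewrite oppr_ge0 ltW.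
Qed.

(** By [bdry_entry], the orbit through a boundary point is outside [N] just before or just after it,
    which cannot happen in the middle of an orbit piece lying in [N]. *)
Lemma inside_notbdry p t s : (forall r, 0 <= r <= t -> N (phi p r)) ->
  0 < s < t -> ~ bdry N (phi p s).
Proof.
move=> h /andP[s0 st] /bdry_entry[e|e].
  apply: (entryN e s0) => r /andP[r1 r2]; rewrite -(flow_add _ _ _ fl).
  by apply: h; apply/andP; split; lra.
apply: (@entryN _ _ _ (t - s) e); first by rewrite subr_gt0.
move=> r /andP[r1 r2]; rewrite /rev -(flow_add _ _ _ fl).
by apply: h; apply/andP; split; lra.
Qed.

(** The exit time is the supremum of the times up to which the orbit lies in [N]. It is attained
    because [N] is closed, and at an interior point or a transversal entry the orbit could be
    continued in [N]. *)
Lemma exit_exists p : N p -> ~ stays phi N p ->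
  exists t, [/\ 0 <= t, (forall s, 0 <= s <= t -> N (phi p s)) &
    entry (rev phi) N (phi p t)].
Proof.
move=> Np /existsNP[T /not_implyP[T0 nT]].
pose E := [set t | 0 <= t /\ forall s, 0 <= s <= t -> N (phi p s)].
have E0 : E 0.
  split=> // s s0; have -> : s = 0 by apply/eqP; rewrite eq_le andbC.
  by rewrite (flow_start fl).
have ubE : ubound E T.
  by move=> t [t0 h]; rewrite leNgt; apply/negP => Tt; apply: nT; apply: h; rewrite T0 ltW.
have supE : has_sup E by split; [exists 0|exists T].
pose t := sup E.
have t0 : 0 <= t by apply: ub_le_sup => //; exists T.
have below s : 0 <= s -> s < t -> N (phi p s).
  move=> s0 st; have [|u [u0 h] su] := @sup_adherent _ E (t - s) _ supE.
    by rewrite subr_gt0.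
  by apply: h; rewrite s0/= ltW//; move: su; rewrite -/t; lra.
have Nt : N (phi p t).
  apply: contrapT => /(domain_closed cN)[e e0 h].
  have [d d0 hd] := flow_near_time p t fl e0.
  have [tz|tn0] := eqVneq t 0.
    by apply: (h (phi p 0)); rewrite ?tz ?subrr ?normr0// (flow_start fl).
  have tp : 0 < t by rewrite lt_neqAle eq_sym tn0.
  have m0 : 0 < Num.min t d by rewrite lt_min tp.
  have [mt md] : Num.min t d <= t /\ Num.min t d <= d by rewrite !ge_min !lexx orbT.
  apply: (h (phi p (t - Num.min t d / 2))); last by apply: below; lra.
  by apply: hd; rewrite addrC addKr normrN ger0_norm; lra.
have Nt' s : 0 <= s <= t -> N (phi p s).
  by case/andP=> s0; rewrite le_eqVlt => /orP[/eqP->//|]; exact: below.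
have ext d : 0 < d -> ~ (forall s, 0 <= s < d -> N (phi (phi p t) s)).
  move=> d0 h; have : E (t + d / 2).
    split; first by lra.
    move=> s /andP[s0 st]; have [st'|ts] := leP s t; first by apply: Nt'; rewrite s0.
    have := h (s - t); rewrite -(flow_add _ _ _ fl) (addrC t) subrK; apply.
    by apply/andP; split; lra.
  move=> Etd; have := ub_le_sup (ex_intro _ T ubE) Etd; rewrite -/t; lra.
exists t; split => //; have [bt|nbt] := pselect (bdry N (phi p t)); last first.
  have [e e0 h] := notbdry_interior cN Nt nbt.
  have [d d0 hd] := flow_near_time (phi p t) 0 fl e0.
  exfalso; apply: (ext d d0) => s /andP[s0 sd]; apply: h.
  by have := hd s; rewrite subr0 (flow_start fl); apply; rewrite ger0_norm.
have [en|//] := bdry_entry bt.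
apply: contrapT => nex; have [r r0 h] := entry_transversal en nex.
have [|h1 _] := h _ bt; first by rewrite subrr normr0.
apply: (ext r r0) => s /andP[]; rewrite le_eqVlt => /orP[/eqP<- _|s0 sr].
  by rewrite (flow_start fl).
by apply: h1; rewrite ?s0.
Qed.

Lemma exit_exits_at p t : 0 <= t -> (forall s, 0 <= s <= t -> N (phi p s)) ->
  entry (rev phi) N (phi p t) -> exits_at phi N p (phi p t).
Proof.
move=> t0 h e; exists t; split => // t' tt' h'.
apply: (@entryN _ _ _ (t' - t) e); first by rewrite subr_gt0.
move=> s /andP[s1 s2]; rewrite /rev -(flow_add _ _ _ fl).
by apply: h'; apply/andP; split; lra.
Qed.

Lemma exits_at_uniq p q q' : exits_at phi N p q -> exits_at phi N p q' -> q = q'.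
Proof.
move=> [t [t0 <- h1 h2]] [u [u0 <- h3 h4]].
by have [tu|ut|->//] := ltgtP t u; [case: (h2 u)|case: (h4 t)].
Qed.

Lemma stays_closed p : ~ stays phi N p ->
  exists2 d, 0 < d & forall q, `|q - p| < d -> ~ stays phi N q.
Proof.
move=> /existsNP[T /not_implyP[T0 nT]].
have [e e0 h] := domain_closed cN nT.
have [d d0 hd] := flow_near p T fl e0.
by exists d => // q qp sq; apply: (h (phi q T)); [exact: hd|exact: sq].
Qed.

(** The boundary arc is the image of the horizontal axis under the inverse chart. It serves to slide
    exit points along the boundary. *)
Lemma chart_curve p F : chart_at N p F -> (F p).2 = 0 ->
  exists c : R -> R * R, exists2 d, 0 < d &
    [/\ c 0 = p, (forall x, `|x| < d -> {for x, continuous c}),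
      forall x, `|x| < d -> bdry N (c x) /\ F (c x) = ((F p).1 + x, 0) &
      forall q, bdry N q -> `|q - p| < d -> c ((F q).1 - (F p).1) = q].
Proof.
move=> [U [V [G [[oU oV Up] [[sF sG FU GV] [FG GF UN]]]]]] Fp0.
have VFp : V (F p) by apply: FU; exists p.
have [d1 d10 h1] := open_ballP oV VFp.
have [d2 d20 h2] := open_ballP oU Up.
pose c x := G ((F p).1 + x, 0).
have Vx x : `|x| < d1 -> V ((F p).1 + x, 0).
  by move=> xd; apply: h1; rewrite plane_norm_lt/= Fp0 subrr normr0 d10 addrC addKr xd.
exists c, (Num.min d1 d2); first by rewrite lt_min d10.
split.
- by rewrite /c addr0 -Fp0 -surjective_pairing FG// inE.
- move=> x; rewrite lt_min => /andP[xd _]; apply/continuous_atP => e e0.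
  have [d d0 hd] := (continuous_atP _ _).1 (smooth_on_continuous sG (Vx _ xd)) e e0.
  exists d => // y yx; apply: hd; rewrite plane_norm_lt/= subrr normr0 d0 andbT.
  by rewrite opprD addrACA subrr add0r.
- move=> x; rewrite lt_min => /andP[xd _].
  have Fc : F (c x) = ((F p).1 + x, 0) by rewrite /c GF// inE; exact: Vx.
  split => //; exists F; split; last by rewrite Fc.
  exists U, V, G; split => //; split => //.
  by apply: GV; exists ((F p).1 + x, 0) => //; exact: Vx.
- move=> q bq; rewrite lt_min => /andP[_ qd].
  have Uq : U q by exact: h2.
  rewrite /c addrC subrK -(bdry_chart0 oU sF UN Uq bq) -surjective_pairing FG//.
  by rewrite inE.
Qed.

(** A boundary point [c x] close to the tangency [w] is carried out of [N], as [w] is. Its orbit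
    cannot exit at [w]: just before [w] it would lie in [N], although [w] is an entry point. So it
    exits elsewhere. *)
Lemma exit_not_isolated w : entry phi N w -> entry (rev phi) N w ->
  exists2 w', entry (rev phi) N w' & w' != w.
Proof.
move=> enw exw.
have [bw [t t0 ht]] := exw; have [F [cF Fw0]] := bw.
have [c [d d0 [c0 cc cb _]]] := chart_curve cF Fw0.
have nN : ~ N (phi w (t / 2)).
  by have := ht (- (t / 2)); rewrite /rev opprK; apply; apply/andP; split; lra.
have [e e0 he] := domain_closed cN nN.
have [d1 d10 hd1] := flow_near w (t / 2) fl e0.
have cc0 : {for 0, continuous c} by apply: cc; rewrite normr0.
have [d2 d20 hd2] := (continuous_atP _ _).1 cc0 _ d10.
pose x := Num.min d d2 / 2.
have m0 : 0 < Num.min d d2 by rewrite lt_min d0.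
have [md md2] : Num.min d d2 <= d /\ Num.min d d2 <= d2 by rewrite !ge_min !lexx orbT.
have nx : `|x| = x by rewrite ger0_norm// /x; lra.
have xd : `|x| < d by rewrite nx /x; lra.
have xd2 : `|x - 0| < d2 by rewrite subr0 nx /x; lra.
have [bcx Fcx] := cb x xd.
have cxw : c x != w.
  apply/eqP => E; move: Fcx; rewrite E => /(congr1 fst)/=; rewrite /x; lra.
have nst : ~ stays phi N (c x).
  move=> st; apply: (he (phi (c x) (t / 2))); last by apply: st; lra.
  by apply: hd1 => //; rewrite -c0; apply: hd2.
have [u [u0 hu eu]] := exit_exists (bdry_in bcx) nst.
exists (phi (c x) u) => //; apply/eqP => E.
have [uz|un0] := eqVneq u 0.
  by move/eqP: cxw; apply; rewrite -E uz (flow_start fl).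
have up : 0 < u by rewrite lt_neqAle eq_sym un0.
apply: (entryN enw up) => s /andP[s1 s2]; rewrite -E -(flow_add _ _ _ fl).
by apply: hu; apply/andP; split; lra.
Qed.

End ForwardBlock.
End Block.

Lemma max0_lip (R : realType) (a b : R) :
  `|Num.max 0 a - Num.max 0 b| <= `|a - b|.
Proof.
have h1 := ler_norm (a - b); have h2 := ler_norm (b - a); rewrite distrC in h2.
rewrite ler_norml; move: h1 h2; set n := `|_|; move: n => n.
by have [x|x] := leP 0 a; have [y|y] := leP 0 b; move=> h1 h2; apply/andP; split; lra.
Qed.

(** * What a unique continuous extension implies *)

Section Regular.
Variable R : realType.
Implicit Types (X Y f g : R * R -> R * R) (phi : R * R -> R -> R * R).
Implicit Types (p q w : R * R) (N : set (R * R)) (t s e d : R).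

Definition continuous_in (A : set (R * R)) f := forall p, A p -> forall e, 0 < e ->
  exists2 d, 0 < d & forall q, A q -> `|q - p| < d -> `|f q - f p| < e.

Definition extension phi N f := [/\ continuous_in (entry phi N) f,
  forall p, entry phi N p -> entry (rev phi) N (f p) &
  forall p, entry phi N p -> ~ stays phi N p -> exits_at phi N p (f p)].

Section ForwardRegular.
Variables (X Y : R * R -> R * R) (M L : R) (phi : R * R -> R -> R * R).
Variable N : set (R * R).
Hypothesis B : block X Y M L phi N.
Variable f : R * R -> R * R.
Hypotheses (ext : extension phi N f)
  (uniq : forall g, extension phi N g -> forall p, entry phi N p -> g p = f p)
  (onto : forall w, entry (rev phi) N w -> exists2 p, entry phi N p & f p = w).

Let fl : is_flow Y L phi. Proof. by case: B => -[]. Qed.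
Let cN : compact_domain N. Proof. by case: B. Qed.

(* Orbits entering near [q] take longer and longer to leave [N]; hence so do the
   backward orbits of their exit points, which converge to [f q]. *)
Lemma limit_stays_back q : entry phi N q -> stays phi N q ->
  (forall d, 0 < d -> exists p, [/\ entry phi N p, ~ stays phi N p & `|p - q| < d]) ->
  stays (rev phi) N (f q).
Proof.
move=> eq sq lim T T0; apply: contrapT => nT; have [cf fx fe] := ext.
pose w := f q; have [bw [t0 t00 ht0]] := fx q eq.
have nS : ~ N (phi w (t0 / 2)).
  by have := ht0 (- (t0 / 2)); rewrite /rev opprK; apply; apply/andP; split; lra.
have [e1 e10 h1] := domain_closed cN nT.
have [e2 e20 h2] := domain_closed cN nS.
have [d1 d10 k1] := flow_near w (- T) fl e10.
have [d2 d20 k2] := flow_near w (t0 / 2) fl e20.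
have d3p : 0 < Num.min d1 d2 / 2 by rewrite divr_gt0// lt_min d10.
have m1 : Num.min d1 d2 <= d1 by rewrite ge_min lexx.
have m2 : Num.min d1 d2 <= d2 by rewrite ge_min lexx orbT.
have [r r0 kr] := cf q eq _ d3p.
have [r' r'0 kr'] := flow_near q T fl d3p.
have [|p [ep np]] := lim (Num.min r r'); first by rewrite lt_min r0.
rewrite lt_min => /andP[pr pr'].
have [t [tt0 ptf hN _]] := fe p ep np.
have fpw := kr p ep pr; rewrite -/w in fpw.
have tT : t < T.
  rewrite ltNge; apply/negP => Tt; apply: (h1 (phi (f p) (- T))).
    by apply: k1 => //; lra.
  rewrite -ptf -(flow_add _ _ _ fl); apply: hN; apply/andP; split; lra.
(* Since [t < T], the orbit of [q] shadows that of [p] up to time [t] and is then near [w]. Orbits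
   near [w] are outside [N] at time [t0 / 2], whereas [q] stays. *)
have qw : `|phi q t - w| < d2.
  have := kr' p t pr'; rewrite !ger0_norm// => /(_ (ltW tT)) h.
  have := ler_normD (phi q t - phi p t) (phi p t - w).
  by rewrite addrA subrK (distrC (phi q t) (phi p t)); rewrite -ptf in fpw; lra.
apply: (h2 (phi (phi q t) (t0 / 2))); first exact: k2.
by rewrite -(flow_add _ _ _ fl); apply: sq; lra.
Qed.

(** On a part [W] of [a^+] that is open and closed in [n^+], the extension can be given any constant
    value in [n^-] without losing continuity. *)
Let modify (W : set (R * R)) w : (forall p, W p -> stays phi N p) ->
  entry (rev phi) N w ->
  (forall p, entry phi N p -> exists2 d, 0 < d &
     forall q, entry phi N q -> `|q - p| < d -> W q <-> W p) ->
  extension phi N (fun p => if `[< W p >] then w else f p).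
Proof.
move=> Ws ew clop; have [cf fx fe] := ext; split.
- move=> p ep e e0; have [d1 d10 h1] := clop p ep; have [d2 d20 h2] := cf p ep e e0.
  exists (Num.min d1 d2); first by rewrite lt_min d10.
  move=> q eq; rewrite lt_min => /andP[q1 q2]; have [a b] := h1 q eq q1.
  case: asboolP => Wq; case: asboolP => Wp.
  + by rewrite subrr normr0.
  + by have := Wp (a Wq).
  + by have := Wq (b Wp).
  + exact: h2.
- by move=> p ep; case: asboolP => // _; exact: fx.
- by move=> p ep np; case: asboolP => [/Ws//|_]; exact: fe.
Qed.

(** If [f q] is no tangency, all boundary points near it are exit points. Sliding the values of [f]
    near [q] along the boundary gives a second extension that differs at [q], against uniqueness. *)
Let perturb q d0 : entry phi N q -> ~ entry phi N (f q) -> 0 < d0 ->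
  (forall p, entry phi N p -> `|p - q| < d0 -> stays phi N p) -> False.
Proof.
move=> eq nef d00 hs; have [cf fx fe] := ext; pose w := f q.
have exw := fx q eq; rewrite -/w in exw nef.
have nef' : ~ entry (rev (rev phi)) N w by rewrite rev_rev.
have [r1 r10 h1] := entry_transversal (block_rev B) exw nef'.
have nearex z : bdry N z -> `|z - w| < r1 -> entry (rev phi) N z.
  by move=> bz zw; split => //; exists r1 => //; exact: (h1 z bz zw).2.
have [bw _] := exw; have [F [cF Fw0]] := bw.
have [c [d1 d10 [c0 cc cb cK]]] := chart_curve cF Fw0.
have cc0 : {for 0, continuous c} by apply: cc; rewrite normr0.
have [d2 d20 hd2] := (continuous_atP _ _).1 cc0 _ r10.
have [d [dp dd1 dd2]] : exists d, [/\ 0 < d, d <= d1 & d <= d2].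
  by exists (Num.min d1 d2); rewrite lt_min d10 d20 !ge_min !lexx orbT.
have [U [V [G [[oU oV Uw] [[sF sG FU GV] [FG GF UN]]]]]] := cF.
have dp2 : 0 < d / 2 by rewrite divr_gt0.
have [d3 d30 h3] := (continuous_atP _ _).1 (smooth_on_continuous sF Uw) _ dp2.
have [d4 d40 h4] := open_ballP oU Uw.
have m0 : 0 < Num.min d1 (Num.min d3 d4) by rewrite !lt_min d10 d30.
have [d5 d50 h5] := cf q eq _ m0.
have [r [r0 rd0 rd rd5]] : exists r, [/\ 0 < r, r <= d0, r <= d & r <= d5].
  exists (Num.min d0 (Num.min d d5)).
  by rewrite !lt_min d00 dp d50 !ge_min !lexx !orbT.
have fnear p : entry phi N p -> `|p - q| < r ->
    [/\ U (f p), `|(F (f p)).1 - (F w).1| < d / 2, c ((F (f p)).1 - (F w).1) = f p &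
      stays phi N p].
  move=> ep pr; have p0 := lt_le_trans pr rd0; have p5 := lt_le_trans pr rd5.
  have := h5 p ep p5; rewrite !lt_min => /andP[q1 /andP[q3 q4]].
  split; [exact: h4| |by apply: cK => //; case: (fx p ep)|exact: hs].
  by have := h3 _ q3; rewrite plane_norm_lt => /andP[].
(* A 1-Lipschitz bump, equal to [r / 2] at [q] and zero from distance [r / 2] on: the amount by
   which the chart parameter of [f p] is shifted. *)
pose h p := Num.max 0 (r / 2 - `|p - q|).
have h_ge0 p : 0 <= h p by rewrite le_max lexx.
have h_le p : h p <= d / 2.
  rewrite ge_max (ltW dp2)/=; have := normr_ge0 (p - q); lra.
have hlip p p' : `|h p' - h p| <= `|p' - p|.
  apply: (le_trans (max0_lip _ _)).
  have -> : r / 2 - `|p' - q| - (r / 2 - `|p - q|) = `|p - q| - `|p' - q| by ring.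
  apply: (le_trans (ler_dist_dist _ _)).
  by rewrite opprB addrA subrK distrC.
pose x p := (F (f p)).1 - (F w).1 + h p.
have xd p : entry phi N p -> `|p - q| < r -> `|x p| < d.
  move=> ep pr; have [_ a _ _] := fnear p ep pr.
  have := ler_normD ((F (f p)).1 - (F w).1) (h p); rewrite -/(x p).
  by rewrite (ger0_norm (h_ge0 p)); have := h_le p; lra.
pose g p := if `|p - q| < r then c (x p) else f p.
have gf p : entry phi N p -> r / 2 <= `|p - q| -> g p = f p.
  move=> ep pr; rewrite /g; case: ifPn => // pr'.
  have [_ _ cE _] := fnear p ep pr'.
  rewrite /x; have -> : h p = 0 by apply/max_idPl; lra.
  by rewrite addr0.
have eg : extension phi N g.
  split.
  - move=> p ep e e0; have [pr|pr] := ltP `|p - q| r.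
      have [Uf _ _ _] := fnear p ep pr.
      have [|k1 k10 hk1] := (continuous_atP _ _).1 (cc (x p) _) e e0.
        by apply: lt_le_trans dd1; exact: xd.
      have k12 : 0 < k1 / 2 by rewrite divr_gt0.
      have [k2 k20 hk2] := (continuous_atP _ _).1 (smooth_on_continuous sF Uf) _ k12.
      have [k3 k30 hk3] := cf p ep _ k20.
      exists (Num.min k3 (Num.min (k1 / 2) (r - `|p - q|))).
        by rewrite !lt_min k30 k12 subr_gt0.
      move=> p' ep'; rewrite !lt_min => /andP[p3 /andP[p1 pr']].
      have pr2 : `|p' - q| < r.
        by have := ler_normD (p' - p) (p - q); rewrite addrA subrK; lra.
      rewrite /g pr pr2; apply: hk1.
      have := hk2 _ (hk3 p' ep' p3); rewrite plane_norm_lt => /andP[a _].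
      have b := hlip p p'.
      have -> : x p' - x p = ((F (f p')).1 - (F (f p)).1) + (h p' - h p).
        by rewrite /x; ring.
      apply: (le_lt_trans (ler_normD _ _)).
      have -> : k1 = k1 / 2 + k1 / 2 by field.
      by apply: ltrD => //; apply: le_lt_trans p1.
    have [k k0 hk] := cf p ep e e0.
    exists (Num.min k (r / 2)); first by rewrite lt_min k0 divr_gt0.
    move=> p' ep'; rewrite lt_min => /andP[pk pr'].
    have h' := ler_normD (p - p') (p' - q).
    rewrite addrA subrK (distrC p p') in h'.
    by rewrite !gf//; [exact: hk|lra|lra].
  - move=> p ep; rewrite /g; case: ifPn => [pr|_]; last exact: fx.
    have xpd := xd p ep pr; apply: nearex.
      by have [] := cb (x p) (lt_le_trans xpd dd1).
    by rewrite -c0; apply: hd2; rewrite subr0 (lt_le_trans xpd).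
  - move=> p ep np; rewrite /g; case: ifPn => [pr|_]; last exact: fe.
    by have [_ _ _] := fnear p ep pr.
have := uniq eg eq; rewrite /g subrr normr0 r0 => E.
have xq := xd q eq; rewrite subrr normr0 in xq.
have [_] := cb (x q) (lt_le_trans (xq r0) dd1).
rewrite E -/w => /(congr1 fst)/=; rewrite /x -/w /h !subrr normr0 subr0 add0r.
by rewrite max_r; lra.
Qed.

(* The extension is free on the interior of [a^+]: where its value is not a
   tangency it can be moved along the boundary, and the preimage of a tangency
   in [a^+] is open and closed, so its value there can be replaced. *)
Lemma not_stays_dense q d : entry phi N q -> 0 < d ->
  exists p, [/\ entry phi N p, ~ stays phi N p & `|p - q| < d].
Proof.
move=> eq d0; apply: contrapT => nex; have [cf fx fe] := ext.
have all_stay : forall p, entry phi N p -> `|p - q| < d -> stays phi N p.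
  by move=> p ep pq; apply: contrapT => np; apply: nex; exists p.
(* If points near [p0] did leave [N], then [f p0] would never have left [N] in the past by
   [limit_stays_back], which is impossible for an entry point. *)
have ints p0 : entry phi N p0 -> entry phi N (f p0) -> stays phi N p0 ->
    exists2 d, 0 < d & forall p, entry phi N p -> `|p - p0| < d -> stays phi N p.
  move=> ep0 efp sp0; apply: contrapT => nh.
  have : stays (rev phi) N (f p0).
    apply: limit_stays_back => // e e0; apply: contrapT => ne; apply: nh.
    by exists e => // p ep pe; apply: contrapT => np; apply: ne; exists p.
  by move=> /(stays_exitN) ; rewrite rev_rev.
have sq : stays phi N q by apply: all_stay => //; rewrite subrr normr0.
have efq : entry phi N (f q).
  by apply: contrapT => nef; exact: (perturb eq nef d0 all_stay).
pose w := f q; pose W := [set p | stays phi N p /\ f p = w].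
have tw : tau X N w by apply/(tau_entry B); split => //; exact: fx.
have [_ _ _ _ isoN] := B.
have [_ [Z nZ Zw]] := isoN w tw.
have [e0 e00 he0] : exists2 e, 0 < e & forall z, `|z - w| < e -> tau X N z -> z = w.
  have [e /= e0 he] := (nbhs_normP _ _).1 nZ.
  exists e => // z zw tz; have : (Z `&` tau X N) z.
    by split => //; apply: he; rewrite /ball_/= distrC.
  by rewrite Zw.
(* Open: near a point of [W] all entry points stay, so by [perturb] their values are tangencies
   close to [w], and isolatedness makes them equal to [w]. Closed: by continuity of [f], and by
   [stays_closed]. *)
have clop p : entry phi N p -> exists2 d, 0 < d &
     forall q, entry phi N q -> `|q - p| < d -> W q <-> W p.
  move=> ep; have [Wp|nWp] := pselect (W p).
    have [sp fp] := Wp.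
    have [|d1 d10 h1] := ints p ep _ sp; first by rewrite fp.
    have [d2 d20 h2] := cf p ep _ e00.
    exists (Num.min d1 d2); first by rewrite lt_min d10.
    move=> z ez; rewrite lt_min => /andP[z1 z2]; split => // _.
    have sz := h1 z ez z1; split => //; apply: he0; first by rewrite -fp; exact: h2.
    apply/(tau_entry B); split; last exact: fx.
    apply: contrapT => nef; apply: (perturb (d0 := d1 - `|z - p|) ez nef).
      by rewrite subr_gt0.
    move=> y ey yz; apply: h1 => //.
    by have := ler_normD (y - z) (z - p); rewrite addrA subrK; lra.
  have [sp|nsp] := pselect (stays phi N p).
    have fpw : f p != w by apply/eqP => E; apply: nWp.
    have n0 : 0 < `|f p - w| by rewrite normr_gt0 subr_eq0.
    have [d1 d10 h1] := cf p ep _ n0.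
    exists d1 => // z ez zp; split => // -[_ fz]; exfalso.
    by have := h1 z ez zp; rewrite fz distrC ltxx.
  have [d1 d10 h1] := stays_closed B nsp.
  by exists d1 => // z ez zp; split => // -[sz]; case: (h1 z zp).
have [w' ew' w'w] := exit_not_isolated B efq (fx q eq).
have Ws p : W p -> stays phi N p by case.
have := uniq (modify Ws ew' clop) eq; case: asboolP => [_ E|[]//].
by rewrite E eqxx in w'w.
Qed.

(** Surjectivity is used here: [w = f p], and some [q] near [p] does leave [N]. Its exit point [f q]
    is near [w], and its backward orbit leaves [N] just before [q]. *)
Lemma not_stays_back_dense w d : entry (rev phi) N w -> 0 < d ->
  exists v, [/\ entry (rev phi) N v, ~ stays (rev phi) N v & `|v - w| < d].
Proof.
move=> ew d0; have [cf fx fe] := ext; have [p ep fpw] := onto ew.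
have [d1 d10 h1] := cf p ep d d0.
have [q [eq nq qp]] := not_stays_dense ep d10.
exists (f q); split; [exact: fx| |by rewrite -fpw; exact: h1].
have [t [t0 <- hN _]] := fe q eq nq => sr.
have [_ [u u0 hu]] := eq.
apply: (hu (- u / 2)); first by apply/andP; split; lra.
have := sr (t + u / 2); rewrite /rev -(flow_add _ _ _ fl).
have -> : t - (t + u / 2) = - u / 2 by field.
by apply; lra.
Qed.

End ForwardRegular.

(** * Interior points of the stable set *)

Section StableSet.
Variables (X Y : R * R -> R * R) (M L : R) (phi : R * R -> R -> R * R).
Variable N : set (R * R).
Hypothesis B : block X Y M L phi N.
Hypothesis dense : forall q d, entry phi N q -> 0 < d ->
  exists p, [/\ entry phi N p, ~ stays phi N p & `|p - q| < d].

Let fl : is_flow Y L phi. Proof. by case: B => -[]. Qed.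
Let cN : compact_domain N. Proof. by case: B. Qed.

(** Otherwise the orbit of [p] has entered [N] at some point [q], transversally since [q] stays. All
    entry points near [q] then reach the ball around [p] without leaving [N], and stay for ever,
    against the density of those that do not. *)
Lemma nbhs_stays_back p e : 0 < e -> (forall q, `|q - p| < e -> stays phi N q) ->
  stays (rev phi) N p.
Proof.
move=> e0 hp; apply: contrapT => nb.
have sp : stays phi N p by apply: hp; rewrite subrr normr0.
have Np : N p by rewrite -(flow_start fl p); apply: sp.
have [t [t0 ht et]] := exit_exists (block_rev B) Np nb.
rewrite rev_rev in et; pose q := rev phi p t; rewrite -/q in et.
have qp : phi q t = p.
  by rewrite /q /rev -(flow_add _ _ _ fl) addrC subrr (flow_start fl).
have sq : stays phi N q.
  move=> s s0; rewrite /q /rev -(flow_add _ _ _ fl) addrC.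
  have [st|ts] := leP t s; first by apply: sp; rewrite subr_ge0.
  have := ht (t - s); rewrite /rev opprB; apply; apply/andP; split; lra.
have [r r0 hr] := entry_transversal B et (stays_exitN sq).
have inner s : 0 < s -> exists2 e, 0 < e & forall z, `|z - phi q s| < e -> N z.
  move=> s0; apply: notbdry_interior => //; first by apply: sq; exact: ltW.
  apply: (@inside_notbdry _ _ _ _ _ _ _ B _ (s + 1)).
    by move=> u /andP[u0 _]; apply: sq.
  by rewrite s0 ltrDl ltr01.
(* A tube in [N] around the orbit of [q] over [[r / 2, t]], of uniform radius by compactness. Times
   before [r / 2], when the orbit is too close to the boundary, are covered by transversality. *)
have [rho rho0 hrho] : exists2 rho, 0 < rho &
    forall s, r / 2 <= s <= t -> forall z, `|z - phi q s| < rho -> N z.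
  have cov := (compact_near_coveringP _).1 (@segment_compact R (r / 2) t).
  have := cov R (0 : R)^'+ (fun rho s => forall z, `|z - phi q s| < rho -> N z) _ _.
  move=> /(_ _)[s sI|rho0 [/= rho00 h]].
    have s0 : 0 < s by move: sI; rewrite /= in_itv/= => /andP[+ _]; lra.
    have [e1 e10 h1] := inner s s0.
    have e12 : 0 < e1 / 2 by rewrite divr_gt0.
    have [d d0 hd] := flow_near_time q s fl e12.
    exists ([set s' | `|s' - s| < d], [set i | i < e1 / 2]) => /=.
      by split; [exact: (@near_dist_lt _ R^o)|exact: nbhs_right_lt].
    move=> [s' i] [/= h2 h3] z zi; apply: h1.
    have := ler_normD (z - phi q s') (phi q s' - phi q s); rewrite addrA subrK.
    have := hd _ h2; lra.
  exists (rho0 / 2); first by rewrite divr_gt0.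
  move=> s srt z zs; apply: (h (rho0 / 2)) zs => //=.
  - by rewrite /ball_/= sub0r normrN ger0_norm; lra.
  - by rewrite divr_gt0.
have [d1 d10 h1] := flow_near q t fl rho0.
have [d2 d20 h2] := flow_near q t fl e0.
have [|p' [ep' np' ]] := @dense q (Num.min r (Num.min d1 d2)) et.
  by rewrite !lt_min r0 d10.
rewrite !lt_min => /andP[pr /andP[p1 p2]]; apply: np' => s s0.
have [hr1 _] := hr p' (ep'.1) pr.
have [st|ts] := leP s t; last first.
  have -> : s = t + (s - t) by ring.
  rewrite (flow_add _ _ _ fl); apply: hp; last by rewrite subr_ge0 ltW.
  by have := h2 p' t p2 (lexx _); rewrite qp.
have [rs|sr] := leP (r / 2) s.
  by apply: (hrho s); [rewrite rs|apply: h1 => //; rewrite !ger0_norm].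
have [->|sn0] := eqVneq s 0; first by rewrite (flow_start fl); apply: bdry_in; case: ep'.
by apply: hr1; apply/andP; split; [rewrite lt_neqAle eq_sym sn0|lra].
Qed.

End StableSet.
End Regular.

(** * Regularisability rephrased for a complete flow *)

Section RegularisableData.
Variable R : realType.
Implicit Types (X Y f g : R * R -> R * R) (phi : R * R -> R -> R * R).
Implicit Types (p q w : R * R) (N : set (R * R)).

Lemma continuous_inP (A : set (R * R)) f :
  {within A, continuous f} <-> continuous_in A f.
Proof.
split=> [/subspace_continuousP cf p Ap e e0|cf].
  have /cvgrPdist_lt/(_ e e0) := cf p Ap.
  move=> /nbhs_normP[d /= d0 h].
  by exists d => // q Aq qp; rewrite distrC; apply: h => //; rewrite /ball_/= distrC.
apply/subspace_continuousP => p Ap; apply/cvgrPdist_lt => e e0.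
have [d d0 h] := cf p Ap e e0; rewrite near_withinE.
apply: filterS (@near_dist_lt R (R * R)%type p d d0) => q qp Aq.
by rewrite distrC; exact: h.
Qed.

Section Translate.
Variables (X Y : R * R -> R * R) (M L : R) (phi : R * R -> R -> R * R).
Variable N : set (R * R).
Hypotheses (fb : flow_box X M Y L phi) (NM : forall q, N q -> `|q| < M).

Lemma C0_extensionE f : C0_extension X N f <-> extension phi N f.
Proof.
have aE p : aplus X N p <-> entry phi N p /\ stays phi N p by rewrite (aplusE fb NM).
rewrite /C0_extension /extension (nplusE fb NM) (nminusE fb NM); split.
  move=> [/continuous_inP cf sub ex]; split => //.
    by move=> p ep; apply: sub; exists p.
  move=> p ep np; apply/(exit_pointE fb NM)/ex; split => //.
  by move=> /aE[_].
move=> [cf sub ex]; split; first exact/continuous_inP.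
  by move=> _ [p ep <-]; exact: sub.
move=> p [ep na]; apply/(exit_pointE fb NM)/ex => // sp.
by apply: na; apply/aE.
Qed.

Lemma isolating_blockE (I : set (R * R)) : isolating_block X N I <->
  block X Y M L phi N /\ I = [set p | forall t, N (phi p t)].
Proof.
rewrite /isolating_block /block (nplusE fb NM) (nminusE fb NM) (max_invariantE fb NM).
by split=> [[cN <- -> iN]|[[_ _ cN -> iN] ->]].
Qed.

Lemma regularisableE f :
  [/\ C0_extension X N f,
      forall g, C0_extension X N g -> forall p, nplus X N p -> g p = f p &
      nminus X N `<=` f @` nplus X N] <->
  [/\ extension phi N f,
     (forall g, extension phi N g -> forall p, entry phi N p -> g p = f p) &
     forall w, entry (rev phi) N w -> exists2 p, entry phi N p & f p = w].
Proof.
rewrite (nplusE fb NM) (nminusE fb NM).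
by split=> -[/C0_extensionE ex un on]; split => // g /C0_extensionE; exact: un.
Qed.

End Translate.

Lemma regularisable_data X I : locally_lipschitz X -> C0_regularisable X I ->
  exists N Y M L phi f, [/\ block X Y M L phi N,
    I = [set p | forall t, N (phi p t)], extension phi N f,
    (forall g, extension phi N g -> forall p, entry phi N p -> g p = f p) &
    forall w, entry (rev phi) N w -> exists2 p, entry phi N p & f p = w].
Proof.
move=> lipX [N [ib [f reg]]]; have [cN _ _ _] := ib.
have [M M0 NM] := domain_bounded cN.
have [Y [L [phi fb]]] := exists_flow_box (ltW M0) lipX.
have [B IE] := (isolating_blockE fb NM I).1 ib.
have [ex un on] := (regularisableE fb NM f).1 reg.
by exists N, Y, M, L, phi, f; split.
Qed.

End RegularisableData.

(** * Homogeneous polynomial fields *)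

Section BivariatePolynomials.
Variable R : realType.
Implicit Types (P Q : {poly {poly R}}) (p q : {poly R}) (u v : R * R) (x y : R).

Lemma horner2_MXaddC P p x y : (P * 'X + p%:P).[x, y] = P.[x, y] * x + p.[y].
Proof. by rewrite hornerMXaddC hornerD hornerM hornerC. Qed.

Definition partialY P : {poly {poly R}} := map_poly (@deriv R) P.

Lemma partialY_MXaddC P p : partialY (P * 'X + p%:P) = partialY P * 'X + p^`()%:P.
Proof.
apply/polyP => i; rewrite /partialY !(coefD, coefMX, coefC, coef_map)/=.
by case: i => [|i] /=; rewrite derivD ?deriv0 ?addr0 ?add0r.
Qed.

Lemma is_derive_horner2 P (f g : R -> R) df dg x :
  is_derive x 1 f df -> is_derive x 1 g dg ->
  is_derive x 1 (fun s => P.[f s, g s])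
    (P^`().[f x, g x] * df + (partialY P).[f x, g x] * dg).
Proof.
move=> hf hg; elim/poly_ind: P => [|P p IH].
  rewrite /partialY map_poly0 deriv0.
  have -> : (fun s => (0 : {poly {poly R}}).[f s, g s]) = cst 0.
    by apply/funext => s; rewrite !horner0.
  by rewrite !horner0 !mul0r addr0; exact: is_derive_cst.
have -> : (fun s => (P * 'X + p%:P).[f s, g s]) =
    (fun s => P.[f s, g s] * f s + p.[g s]).
  by apply/funext => s; rewrite horner2_MXaddC.
have hp : is_derive x 1 (fun s => p.[g s]) (p^`().[g x] * dg).
  exact: (is_derive1_comp (f := horner p) (g := g) (is_derive_poly _ _) hg).
apply: is_derive_eq; rewrite /GRing.scale/=.
rewrite derivMXaddC partialY_MXaddC horner2_MXaddC.
by rewrite !(hornerD, hornerM, hornerX, hornerC); ring.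
Qed.

Lemma homogeneousE n P (a x y : R) : homogeneous n P ->
  P.[a * x, a * y] = a ^+ n * P.[x, y].
Proof.
move=> hP; rewrite !(horner_coef P) !horner_sum mulr_sumr.
apply: eq_bigr => i _; rewrite !hornerM -!polyC_exp !hornerC exprMn.
rewrite !(horner_coef P`_i) !mulr_suml mulr_sumr; apply: eq_bigr => j _.
have [->|nz] := eqVneq (P`_i`_j) 0; first by rewrite !mul0r mulr0.
by rewrite -(hP _ _ nz) exprMn exprD; ring.
Qed.

Lemma subst2E P A B x y : (subst2 P A B).[x, y] = P.[A.[x, y], B.[x, y]].
Proof.
rewrite /subst2; elim/poly_ind: P => [|P p IH].
  by rewrite rmorph0 !horner0.
rewrite horner2_MXaddC -IH rmorphD rmorphM /= map_polyX map_polyC/=.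
rewrite hornerMXaddC hornerD hornerM hornerC !hornerD !hornerM; congr (_ + _).
elim/poly_ind: p => [|p a IHp]; first by rewrite rmorph0 !horner0.
rewrite hornerMXaddC -IHp rmorphD rmorphM /= map_polyX map_polyC/=.
by rewrite hornerMXaddC !hornerD !hornerM !hornerC.
Qed.

Lemma rotateE (c s : R) P Q x y :
  let F := rotate c s P Q in let u := c * x - s * y in let v := s * x + c * y in
  F.1.[x, y] = c * P.[u, v] + s * Q.[u, v] /\
  F.2.[x, y] = c * Q.[u, v] - s * P.[u, v].
Proof.
rewrite /rotate/=.
by rewrite !(hornerD, hornerN, hornerM, hornerC, subst2E, hornerX).
Qed.

Definition dirD P Q u := u.1 * Q.[u.1, u.2] - u.2 * P.[u.1, u.2].

Lemma directional_polyE P Q x y : (directional_poly P Q).[x, y] = dirD P Q (x, y).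
Proof. by rewrite /directional_poly !(hornerD, hornerN, hornerM, hornerC, hornerX). Qed.

(** Bound and Lipschitz constant are carried together, since the Lipschitz constant of a product
    involves both. *)
Definition locally_bounded_lip (f : R * R -> R) := forall M, exists L, forall u v,
  `|u| <= M -> `|v| <= M -> `|f u| <= L /\ `|f u - f v| <= L * `|u - v|.

Lemma blip_cst (a : R) : locally_bounded_lip (fun=> a).
Proof.
by move=> M; exists `|a| => u v _ _; split => //; rewrite subrr normr0 mulr_ge0.
Qed.

Lemma blip_fst : locally_bounded_lip fst.
Proof.
move=> M; exists (Num.max M 1) => u v uM vM; rewrite le_max.
rewrite (le_trans (plane_norm_fst u) uM); split => //.
apply: (le_trans (plane_norm_fst (u - v))).
by rewrite ler_peMl// le_max lexx orbT.
Qed.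

Lemma blip_snd : locally_bounded_lip snd.
Proof.
move=> M; exists (Num.max M 1) => u v uM vM; rewrite le_max.
rewrite (le_trans (plane_norm_snd u) uM); split => //.
apply: (le_trans (plane_norm_snd (u - v))).
by rewrite ler_peMl// le_max lexx orbT.
Qed.

Lemma blipD f g : locally_bounded_lip f -> locally_bounded_lip g ->
  locally_bounded_lip (fun u => f u + g u).
Proof.
move=> hf hg M; have [L hL] := hf M; have [K hK] := hg M; exists (L + K) => u v uM vM.
have [a b] := hL u v uM vM; have [c d] := hK u v uM vM; split.
  by rewrite (le_trans (ler_normD _ _))// lerD.
by rewrite opprD addrACA (le_trans (ler_normD _ _))// mulrDl lerD.
Qed.

Lemma blipM f g : locally_bounded_lip f -> locally_bounded_lip g ->
  locally_bounded_lip (fun u => f u * g u).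
Proof.
move=> hf hg M; have [L hL] := hf M; have [K hK] := hg M.
exists (Num.max (L * K) (2 * L * K)) => u v uM vM.
have [a b] := hL u v uM vM; have [c d] := hK u v uM vM.
have [c' _] := hK v v vM vM.
have L0 : 0 <= L by exact: le_trans a.
have K0 : 0 <= K by exact: le_trans c.
split; first by rewrite le_max normrM ler_pM.
have -> : f u * g u - f v * g v = f u * (g u - g v) + (f u - f v) * g v by ring.
apply: (le_trans (ler_normD _ _)); rewrite !normrM.
apply: (@le_trans _ _ (2 * L * K * `|u - v|)); last by rewrite ler_wpM2r// le_max lexx orbT.
have -> : 2 * L * K * `|u - v| = L * (K * `|u - v|) + L * `|u - v| * K by ring.
by rewrite lerD// ler_pM.
Qed.

Lemma blip_poly p : locally_bounded_lip (fun u => p.[u.2]).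
Proof.
elim/poly_ind: p => [|p a IH].
  have -> : (fun u : R * R => (0 : {poly R}).[u.2]) = fun=> 0.
    by apply/funext => u; rewrite horner0.
  exact: blip_cst.
have -> : (fun u : R * R => (p * 'X + a%:P).[u.2]) = fun u => p.[u.2] * u.2 + a.
  by apply/funext => u; rewrite hornerMXaddC.
by apply: blipD (blipM IH blip_snd) (blip_cst _).
Qed.

Lemma blip_horner2 P : locally_bounded_lip (fun u => P.[u.1, u.2]).
Proof.
elim/poly_ind: P => [|P p IH].
  have -> : (fun u : R * R => (0 : {poly {poly R}}).[u.1, u.2]) = fun=> 0.
    by apply/funext => u; rewrite !horner0.
  exact: blip_cst.
have -> : (fun u : R * R => (P * 'X + p%:P).[u.1, u.2]) =
    fun u => P.[u.1, u.2] * u.1 + p.[u.2].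
  by apply/funext => u; rewrite horner2_MXaddC.
by apply: blipD (blipM IH blip_fst) (blip_poly _).
Qed.

Lemma vfield_lipschitz P Q : locally_lipschitz (vfield P Q).
Proof.
move=> M; have [L hL] := blip_horner2 P M; have [K hK] := blip_horner2 Q M.
exists (Num.max 1 (Num.max L K)) => [|u v uM vM]; first by rewrite lt_max ltr01.
rewrite plane_norm_le/=; apply/andP; split.
  have [_ h] := hL u v uM vM; apply: (le_trans h).
  by rewrite ler_wpM2r// !le_max lexx !orbT.
have [_ h] := hK u v uM vM; apply: (le_trans h).
by rewrite ler_wpM2r// !le_max lexx !orbT.
Qed.

Lemma mup1_deriv p x : mup x p = 1%N -> p^`().[x] != 0.
Proof.
move=> m1; have p0 : p != 0.
  (* The exponent is sought up to the size of the polynomial, so the zero polynomial gets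
     multiplicity 0, not 1. *)
  apply/eqP => p0; move: m1; rewrite p0 /mup; set o := (X in nat_of_ord X).
  by have := ltn_ord o; rewrite {2}size_poly0; case: (nat_of_ord o) => [|[]].
have /dvdpP[q pE] : 'X - x%:P %| p by rewrite XsubC_dvd// m1.
rewrite pE derivM derivXsubC !hornerE/= subrr mulr0 add0r.
apply/eqP => qx; have /factor_theorem[r qE] : root q x by apply/rootP.
have : (2 <= mup x p)%N by rewrite mup_geq// pE qE -mulrA -expr2 dvdp_mulIr.
by rewrite m1.
Qed.

End BivariatePolynomials.

(** * Characteristic vectors and their two eigenvalues *)

Section CharacteristicDirections.
Variable R : realType.
Variables (n : nat) (P Q : {poly {poly R}}).
Hypothesis V : Vhom n P Q.
Implicit Types (u v e : R * R) (x y c s a b : R).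

Let D := dirD P Q.
Let X := vfield P Q.

Let homP : homogeneous n P. Proof. by case: V. Qed.
Let homQ : homogeneous n Q. Proof. by case: V. Qed.

Lemma vfieldZ a u : X (a * u.1, a * u.2) = (a ^+ n * (X u).1, a ^+ n * (X u).2).
Proof. by rewrite /X /vfield/= !(homogeneousE _ _ _ homP) !(homogeneousE _ _ _ homQ). Qed.

Lemma dirDZ a u : D (a * u.1, a * u.2) = a ^+ n.+1 * D u.
Proof.
rewrite /D /dirD/= (homogeneousE _ _ _ homP) (homogeneousE _ _ _ homQ) exprS; ring.
Qed.

Lemma is_derive_dirD e v : is_derive (0 : R) 1 (fun s => D (e.1 + s * v.1, e.2 + s * v.2))
  ((directional_poly P Q)^`().[e.1, e.2] * v.1 +
   (partialY (directional_poly P Q)).[e.1, e.2] * v.2).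
Proof.
have -> : (fun s => D (e.1 + s * v.1, e.2 + s * v.2)) =
    (fun s => (directional_poly P Q).[e.1 + s * v.1, e.2 + s * v.2]).
  by apply/funext => s; rewrite directional_polyE.
have h1 : is_derive (0 : R) 1 (fun s => e.1 + s * v.1) v.1.
  by apply: is_derive_eq; rewrite /GRing.scale/=; ring.
have h2 : is_derive (0 : R) 1 (fun s => e.2 + s * v.2) v.2.
  by apply: is_derive_eq; rewrite /GRing.scale/=; ring.
by have := is_derive_horner2 (directional_poly P Q) h1 h2; rewrite !mul0r !addr0.
Qed.

(* The derivative of D at [e] in the direction orthogonal to [e]. *)
Definition kappa e := e.1 * (partialY (directional_poly P Q)).[e.1, e.2] -
  e.2 * (directional_poly P Q)^`().[e.1, e.2].

Definition alpha e := e.1 * (X e).1 + e.2 * (X e).2.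

Definition char_vector e := e.1 ^+ 2 + e.2 ^+ 2 = 1 /\ D e = 0.

Lemma derive_uniq (f : R -> R) x a b : is_derive x 1 f a -> is_derive x 1 f b -> a = b.
Proof. by move=> [_ <-] [_ <-]. Qed.

(** Euler's relation: D vanishes on the whole ray through [e], so its gradient there is orthogonal
    to [e] and is determined by [kappa e]. *)
Lemma dirD_grad e : char_vector e ->
  (directional_poly P Q)^`().[e.1, e.2] = - kappa e * e.2 /\
  (partialY (directional_poly P Q)).[e.1, e.2] = kappa e * e.1.
Proof.
move=> [e1 De]; have h := is_derive_dirD e e.
have euler : (directional_poly P Q)^`().[e.1, e.2] * e.1 +
    (partialY (directional_poly P Q)).[e.1, e.2] * e.2 = 0.
  apply: (derive_uniq h).
  have -> : (fun s => D (e.1 + s * e.1, e.2 + s * e.2)) = fun=> 0.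
    apply/funext => s; have -> : (e.1 + s * e.1, e.2 + s * e.2) = ((1 + s) * e.1, (1 + s) * e.2).
      by congr (_, _); ring.
    by rewrite dirDZ De mulr0.
  exact: is_derive_cst.
rewrite /kappa; move: euler e1.
set gx := _^`().[_, _]; set gy := (partialY _).[_, _] => E e1.
split.
  rewrite -[LHS]mul1r -e1.
  have -> : (e.1 ^+ 2 + e.2 ^+ 2) * gx = (gx * e.1 + gy * e.2) * e.1 - (e.1 * gy - e.2 * gx) * e.2 by ring.
  by rewrite E; ring.
rewrite -[LHS]mul1r -e1.
have -> : (e.1 ^+ 2 + e.2 ^+ 2) * gy = (gx * e.1 + gy * e.2) * e.2 + (e.1 * gy - e.2 * gx) * e.1 by ring.
by rewrite E; ring.
Qed.

Lemma is_derive_dirD_char e a v : char_vector e -> a != 0 ->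
  is_derive (0 : R) 1 (fun s => D (a * e.1 + s * v.1, a * e.2 + s * v.2))
    (a ^+ n * kappa e * (e.1 * v.2 - e.2 * v.1)).
Proof.
move=> ce a0; have [gx gy] := dirD_grad ce.
have -> : (fun s => D (a * e.1 + s * v.1, a * e.2 + s * v.2)) =
    (fun s => a ^+ n.+1 * D (e.1 + s * (v.1 / a), e.2 + s * (v.2 / a))).
  apply/funext => s; rewrite -(dirDZ a (_, _))/=; congr (D (_, _)); field; exact: a0.
have h := is_derive_dirD e (v.1 / a, v.2 / a).
by apply: is_derive_eq; rewrite /= gx gy /GRing.scale/= exprS; field.
Qed.

Lemma char_dirsE u : u != 0 -> D u = 0 ->
  char_dirs P Q (if u.1 == 0 then None else Some (u.2 / u.1)).
Proof.
move=> u0 Du; case: ifPn => [/eqP u1|u1]; rewrite /char_dirs/= directional_polyE -/(D _).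
  have u2 : u.2 != 0.
    by apply: contraNneq u0 => u2; rewrite [u]surjective_pairing u1 u2.
  have := dirDZ u.2^-1 u; rewrite u1 mulr0 mulVf// Du mulr0 => -> //.
by have := dirDZ u.1^-1 u; rewrite mulVf// mulrC Du mulr0 => ->.
Qed.

(** In the affine chart around [e], the derivative of the directional polynomial at its root is a
    nonzero multiple of [kappa e], and the root is simple. *)
Lemma kappa_neq0 e : char_vector e -> kappa e != 0.
Proof.
move=> ce; have [e1 De] := ce; have [_ _ _ mult] := V.
have e0 : e != 0.
  apply/eqP => e0; move: e1; rewrite e0/= expr0n/= addr0 => /eqP.
  by rewrite eq_sym oner_eq0.
have := mult _ (char_dirsE e0 De); case: ifPn => [/eqP e10|e10] /= /mup1_deriv.
  apply: contraNneq => k0.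
  have e20 : e.2 != 0.
    by apply: contraNneq e0 => e20; rewrite [e]surjective_pairing e10 e20.
  have /is_derive_dirD_char/(_ (invr_neq0 e20)) h := ce.
  have := h (1, 0); rewrite k0 mulr0 mul0r e10 !mulr0 mulVf//=.
  move=> /derive_uniq H; apply/eqP/esym; apply: H.
  have -> : (fun s => D (0 + s * 1, 1 + s * 0)) = horner (swapXY (directional_poly P Q)).[1%:P].
    by apply/funext => s; rewrite horner2_swapXY directional_polyE; congr (D (_, _)); ring.
  exact: is_derive_poly.
apply: contraNneq => k0.
have /is_derive_dirD_char/(_ (invr_neq0 e10)) h := ce.
have := h (0, 1); rewrite k0 mulr0 mul0r mulVf//= => h'.
have := is_derive_poly ((directional_poly P Q).[1%:P]) (e.2 / e.1).
have -> : horner ((directional_poly P Q).[1%:P]) =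
   fun z => D (1 + (- (e.2 / e.1) + z) * 0, e.1^-1 * e.2 + (- (e.2 / e.1) + z) * 1).
  by apply/funext => z; rewrite directional_polyE; congr (D (_, _)); ring.
move=> /derive_uniq H; apply/eqP; apply: H.
apply: (@is_derive_comp_shift _ _ (fun z => D (1 + z * 0, e.1^-1 * e.2 + z * 1))).
by rewrite addNr.
Qed.

Lemma vfield_char e : char_vector e -> X e = (alpha e * e.1, alpha e * e.2).
Proof.
move=> [e1 De]; move: De; rewrite /alpha /D /dirD /X /vfield/=.
set p := P.[_, _]; set q := Q.[_, _] => De.
congr (_, _).
  rewrite -[LHS]mul1r -e1; have -> : (e.1 ^+ 2 + e.2 ^+ 2) * p =
    (e.1 * p + e.2 * q) * e.1 - (e.1 * q - e.2 * p) * e.2 by ring.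
  by rewrite De; ring.
rewrite -[LHS]mul1r -e1; have -> : (e.1 ^+ 2 + e.2 ^+ 2) * q =
  (e.1 * p + e.2 * q) * e.2 + (e.1 * q - e.2 * p) * e.1 by ring.
by rewrite De; ring.
Qed.

(** If [alpha e] were zero, X would vanish on the whole ray through [e], and the origin would not be
    isolated. *)
Lemma alpha_neq0 e : char_vector e -> alpha e != 0.
Proof.
move=> ce; apply/eqP => a0; have [_ _ [_ iso] _] := V.
have Xe := vfield_char ce; rewrite a0 !mul0r in Xe.
have [e1 _] := ce.
have /nbhs_normP[d /= d0 h] := iso.
have en : `|e| <= 1.
  rewrite -(@ler_pXn2r _ 2) ?nnegrE// expr1n -e1; exact: plane_norm_sqr_le.
have hd0 : 0 < d / 2 by rewrite divr_gt0.
have := h (d / 2 * e.1, d / 2 * e.2); rewrite -/X vfieldZ Xe !mulr0 => /(_ _ erefl).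
have ball : ball_ Num.Def.normr (0, 0) d (d / 2 * e.1, d / 2 * e.2).
  rewrite /ball_/= plane_norm_lt/= !sub0r !normrN !(normrM (d / 2)) (ger0_norm (ltW hd0)).
  have := plane_norm_fst e; have := plane_norm_snd e => h1 h2.
  have l1 : d / 2 * `|e.1| <= d / 2 * 1 by rewrite ler_wpM2l ?(ltW hd0)// (le_trans h2).
  have l2 : d / 2 * `|e.2| <= d / 2 * 1 by rewrite ler_wpM2l ?(ltW hd0)// (le_trans h1).
  by apply/andP; split; lra.
move=> /(_ ball)[].
move=> /eqP + /eqP; rewrite !(mulf_eq0 (d / 2)) !(gt_eqF hd0)/= => /eqP e10 /eqP e20.
by move: e1; rewrite e10 e20 expr0n/= addr0 => /eqP; rewrite eq_sym oner_eq0.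
Qed.

Lemma char_vectorN e : char_vector e -> char_vector (- e.1, - e.2).
Proof.
move=> [e1 De]; split; first by rewrite /= !sqrrN.
by rewrite -(mulN1r e.1) -(mulN1r e.2) dirDZ De mulr0.
Qed.

(** [alpha] and [kappa] change by the same sign, so their quotient belongs to the line and not to
    the vector. For even [n] both signs flip, which the sufficiency uses to choose [alpha > 0]. *)
Lemma alphaN e : char_vector e -> alpha (- e.1, - e.2) = (-1) ^+ n.+1 * alpha e.
Proof.
move=> ce; rewrite /alpha -(mulN1r e.1) -(mulN1r e.2) vfieldZ/= exprS; ring.
Qed.

Lemma kappaN e : char_vector e -> kappa (- e.1, - e.2) = (-1) ^+ n.+1 * kappa e.
Proof.
move=> ce; have ce' := char_vectorN ce; have [e1 _] := ce.
have nz : (-1 : R) != 0 by rewrite oppr_eq0 oner_eq0.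
have h1 := is_derive_dirD_char (- e.2, e.1) ce nz.
have := is_derive_dirD_char (- e.2, e.1) ce' (oner_neq0 _).
have -> : (fun s => D (1 * (- e.1, - e.2).1 + s * (- e.2, e.1).1,
                       1 * (- e.1, - e.2).2 + s * (- e.2, e.1).2)) =
    (fun s => D (-1 * e.1 + s * (- e.2, e.1).1, -1 * e.2 + s * (- e.2, e.1).2)).
  by apply/funext => z; congr (D (_, _)); rewrite /=; ring.
move=> /(derive_uniq h1)/=.
have -> : e.1 * e.1 - e.2 * - e.2 = e.1 ^+ 2 + e.2 ^+ 2 by ring.
have -> : - e.1 * e.1 - - e.2 * - e.2 = - (e.1 ^+ 2 + e.2 ^+ 2) by ring.
by rewrite e1 expr1n exprS; lra.
Qed.

Lemma char_dirs_vector l : char_dirs P Q l ->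
  exists2 e, char_vector e & (if e.1 == 0 then None else Some (e.2 / e.1)) = l.
Proof.
case: l => [y|]; rewrite /char_dirs/= directional_polyE -/(D _) => Dl; last first.
  by exists (0, 1); rewrite ?eqxx// /char_vector/= expr0n expr1n add0r.
have y0 : 0 < 1 + y ^+ 2 by rewrite ltr_wpDr ?sqr_ge0.
have r0 : 0 < Num.sqrt (1 + y ^+ 2) by rewrite sqrtr_gt0.
set r := Num.sqrt _ in r0; have r2 : r ^+ 2 = 1 + y ^+ 2 by rewrite sqr_sqrtr// ltW.
exists (r^-1 * 1, r^-1 * y) => /=; last first.
  by rewrite mulr1 invr_eq0 gt_eqF// invrK mulrAC mulVf ?mul1r// gt_eqF.
split; last by have := dirDZ r^-1 (1, y); rewrite Dl mulr0.
rewrite /= mulr1 exprMn -[X in X + _]mulr1 exprVn -mulrDr -r2 mulVf//.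
by rewrite expf_neq0// gt_eqF.
Qed.

Lemma char_vector_neq0 e : char_vector e -> e != 0.
Proof.
move=> [e1 _]; apply/eqP => e0; move: e1; rewrite e0/= expr0n/= addr0 => /eqP.
by rewrite eq_sym oner_eq0.
Qed.

Lemma char_dirs_parallel l e u : char_dirs P Q = [set l] -> char_vector e ->
  u != 0 -> D u = 0 -> exists2 a, a != 0 & u = (a * e.1, a * e.2).
Proof.
move=> lE ce u0 Du; have e0 := char_vector_neq0 ce.
have := char_dirsE e0 ce.2; have := char_dirsE u0 Du; rewrite lE /= => <-.
have [u1|u1] := eqVneq u.1 0; have [e1|e1] := eqVneq e.1 0 => //.
  have u2 : u.2 != 0.
    by apply: contraNneq u0 => u2; rewrite [u]surjective_pairing u1 u2.
  have e2 : e.2 != 0.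
    by apply: contraNneq e0 => e2; rewrite [e]surjective_pairing e1 e2.
  exists (u.2 / e.2); first by rewrite mulf_neq0// invr_neq0.
  by rewrite [LHS]surjective_pairing u1 e1 mulr0 divfK.
move=> [E]; exists (u.1 / e.1); first by rewrite mulf_neq0// invr_neq0.
rewrite [LHS]surjective_pairing divfK//; congr (_, _).
have -> : u.2 = u.1 * (u.2 / u.1) by rewrite mulrC divfK.
by rewrite -E; field.
Qed.

End CharacteristicDirections.

(** * Critical values as quotients of eigenvalues *)

Section CriticalValues.
Variable R : realType.
Implicit Types (P Q : {poly {poly R}}) (e : R * R) (y r : R).

(** On [x-hat = 0] the Jacobian of the blow-up is triangular with the two eigenvalues on the
    diagonal: [P (1, y)] transversally, and the derivative of the directional polynomial along the
    critical manifold. *)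
Lemma critical_value_atE P Q y r : critical_value_at P Q y r <->
  r = (Q.[1%:P] - 'X * P.[1%:P])^`().[y] / P.[1, y].
Proof.
set q := Q.[1%:P] - 'X * P.[1%:P].
have F1 : 'X * P.[1%:P]%:P = P.[1%:P]%:P * 'X + 0%:P by rewrite addr0 mulrC.
have F2 : Q.[1%:P]%:P - 'Y * P.[1%:P]%:P = q%:P by rewrite /q polyCB polyCM.
pose J := jacobian2 (blowup P Q) 0 y.
have J00 : J 0 0 = P.[1, y].
  by rewrite mxE/= F1 derivMXaddC derivC mul0r addr0 hornerC.
have J01 : J 0 1 = 0.
  rewrite mxE/= F1 -/(partialY _) partialY_MXaddC deriv0.
  by rewrite horner2_MXaddC mulr0 horner0 addr0.
have J10 : J 1 0 = 0 by rewrite mxE/= F2 derivC !horner0.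
have J11 : J 1 1 = q^`().[y] by rewrite mxE/= F2 map_polyC/= hornerC.
rewrite /critical_value_at -/J /=; move: J J00 J01 J10 J11 => {F1 F2} J J00 J01 J10 J11.
have cJ : char_poly J = ('X - (P.[1, y])%:P) * ('X - (q^`().[y])%:P).
  rewrite char_poly_trig; first by rewrite big_ord_recl big_ord1 J00 -J11; congr (_ * ('X - (J _ _)%:P)); apply: val_inj.
  apply/is_trig_mxP => i j; case: i => -[|[|//]] hi; case: j => -[|[|//]] hj //= _.
  by rewrite -J01; congr (J _ _); apply: val_inj.
have JE : J *m delta_mx 1 (0 : 'I_1) = q^`().[y] *: delta_mx 1 0.
  apply/colP => i; rewrite !mxE big_ord_recl big_ord1 !mxE/= mulr0 add0r mulr1.
  case: i => -[|[|//]] hi /=; rewrite ?mulr0 ?mulr1.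
    by rewrite -J01; congr (J _ _); apply: val_inj.
  by rewrite -J11; congr (J _ _); apply: val_inj.
split=> [[l1 [l2 [J1 cJ' ->]]]|->]; last by exists q^`().[y], P.[1, y]; split => //; rewrite cJ mulrC.
have l1E : l1 = q^`().[y].
  move: J1; rewrite JE => /colP/(_ 1); rewrite !mxE/= !mulr1.
  by [].
move: cJ'; rewrite cJ l1E mulrC => /mulfI; rewrite polyXsubC_eq0 => /(_ isT) E.
have : ('X - (P.[1, y])%:P).[l2] = 0 by rewrite E !hornerE subrr.
by rewrite !hornerE => /eqP; rewrite subr_eq0 => /eqP ->.
Qed.

(** The rotation takes the chart point [(1, y)] to a multiple [u = a e] of [e]. Both eigenvalues are
    then those at [e] times [a ^ n / a], so the quotient depends neither on the rotation nor on the
    vector. *)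
Lemma critical_valuesE n P Q l e : Vhom n P Q -> char_dirs P Q = [set l] ->
  char_vector P Q e -> critical_values P Q = [set kappa P Q e / alpha P Q e].
Proof.
move=> V lE ce; pose D := dirD P Q; pose X := vfield P Q.
have [homP homQ _ _] := V.
have val c s y : c ^+ 2 + s ^+ 2 = 1 -> char_dirs (rotate c s P Q).1 (rotate c s P Q).2 (Some y) ->
    let F := rotate c s P Q in
    (F.2.[1%:P] - 'X * F.1.[1%:P])^`().[y] / F.1.[1, y] = kappa P Q e / alpha P Q e.
  move=> cs; move: (rotateE c s P Q); move: (rotate c s P Q) => F FE.
  rewrite /char_dirs/= directional_polyE.
  have DF z : F.2.[1, z] - z * F.1.[1, z] = D (c - s * z, s + c * z).
    have /= [-> ->] := FE 1 z; rewrite !mulr1 /D /dirD/=; ring.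
  rewrite /dirD/= mul1r DF => Du.
  pose u := (c - s * y, s + c * y); rewrite -/u in Du.
  have u0 : u != 0.
    apply/eqP => -[u1 u2].
    have : c * (c - s * y) + s * (s + c * y) = 0 by rewrite u1 u2 !mulr0 addr0.
    by apply/eqP; rewrite (_ : _ + _ = 1) ?oner_eq0// -cs; ring.
  have [a a0 uE] := char_dirs_parallel V lE ce u0 Du.
  have [u1 u2] : a * e.1 = c - s * y /\ a * e.2 = s + c * y by move: uE => [-> ->].
  have k : c * (a * e.1) + s * (a * e.2) = 1 by rewrite u1 u2 -cs; ring.
  have F1 : F.1.[1, y] = a ^+ n * alpha P Q e / a.
    have /= [-> _] := FE 1 y; rewrite !mulr1.
    have := vfieldZ V a e; rewrite /vfield/= u1 u2 => -[-> ->].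
    have := vfield_char ce; rewrite /vfield/= => -[-> ->].
    have -> : c * (a ^+ n * (alpha P Q e * e.1)) + s * (a ^+ n * (alpha P Q e * e.2)) =
        (c * (a * e.1) + s * (a * e.2)) * (a ^+ n * alpha P Q e / a) by field.
    by rewrite k mul1r.
  have dF : (F.2.[1%:P] - 'X * F.1.[1%:P])^`().[y] = a ^+ n * kappa P Q e / a.
    apply: (derive_uniq (is_derive_poly _ y)).
    have -> : horner (F.2.[1%:P] - 'X * F.1.[1%:P]) = fun z =>
       D (a * e.1 + (- y + z) * (- s), a * e.2 + (- y + z) * c).
      apply/funext => z; rewrite !hornerE DF u1 u2; congr (D (_, _)); ring.
    apply: (@is_derive_comp_shift _ _ (fun z => D (a * e.1 + z * (- s), a * e.2 + z * c))).
    rewrite addNr; have := is_derive_dirD_char V (- s, c) ce a0.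
    rewrite (_ : _ * (e.1 * _ - _) = a ^+ n * kappa P Q e / a)//=.
    have -> : e.1 * c - e.2 * - s = (c * (a * e.1) + s * (a * e.2)) / a by field.
    by rewrite k mul1r.
  rewrite /= dF F1; field.
  by rewrite a0 expf_neq0// (alpha_neq0 V ce).
apply/seteqP; split=> r.
  by move=> [c [s [cs [_ [y [cy /critical_value_atE ->]]]]]]; exact: val.
(* Rotating by [e] itself puts the direction at [y-hat = 0]; infinity then stands for the vector
   orthogonal to [e], which is not characteristic. *)
move=> ->; exists e.1, e.2; have [e1 De] := ce; split => //.
have cd0 : char_dirs (rotate e.1 e.2 P Q).1 (rotate e.1 e.2 P Q).2 (Some 0).
  rewrite /char_dirs/= directional_polyE /dirD/= mul0r subr0 mul1r.
  have [_ ->] := rotateE e.1 e.2 P Q 1 0; rewrite !mulr1 !mulr0 subr0 addr0.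
  by move: De; rewrite /dirD.
split; last by exists 0; split => //; apply/critical_value_atE; rewrite -(val e.1 e.2 0).
rewrite /char_dirs/= directional_polyE /dirD/= mul0r sub0r mul1r => /eqP.
have [-> _] := rotateE e.1 e.2 P Q 0 1; rewrite !mulr1 !mulr0 !add0r => De'.
have Du : D (- e.2, e.1) = 0.
  by rewrite /D /dirD/=; move: De'; rewrite oppr_eq0 => /eqP; lra.
have u0 : (- e.2, e.1) != 0.
  apply/eqP => -[/eqP]; rewrite oppr_eq0 => /eqP e2 e1'.
  by move: e1; rewrite e2 e1' expr0n/= addr0 => /eqP; rewrite eq_sym oner_eq0.
have [a a0 [E1 E2]] := char_dirs_parallel V lE ce u0 Du.
have : a * (e.1 ^+ 2 + e.2 ^+ 2) = 0.
  have -> : a * (e.1 ^+ 2 + e.2 ^+ 2) = (a * e.1) * e.1 + (a * e.2) * e.2 by ring.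
  by rewrite -E1 -E2; ring.
by rewrite e1 mulr1; exact/eqP.
Qed.

End CriticalValues.

(** * Necessity *)

Section OneVariable.
Variable R : realType.
Implicit Types (f y : R -> R) (T s t : R).

Lemma ge0_right_end f T : 0 < T -> {for T, continuous f} ->
  (forall s, 0 <= s < T -> 0 <= f s) -> 0 <= f T.
Proof.
move=> T0 /continuous_atP cf h; rewrite leNgt; apply/negP => fT.
have [|d d0 hd] := cf (- f T); first by rewrite oppr_gt0.
have m0 : 0 < Num.min T d by rewrite lt_min T0.
have [mT md] : Num.min T d <= T /\ Num.min T d <= d by rewrite !ge_min !lexx orbT.
have := hd (T - Num.min T d / 2); rewrite addrC addKr normrN gtr0_norm ?divr_gt0//.
have := h (T - Num.min T d / 2) => h1 h2.
have := h2 ltac:(lra); rewrite ltr_norml => /andP[_].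
have := h1 ltac:(apply/andP; split; lra); lra.
Qed.

(** With [|y'| <= C |y|], the square of [y] neither grows nor decays faster than exponentially, so
    zero can be neither left nor reached. The invariance of characteristic lines rests on this. *)
Lemma sign_keep y dy (C : R) T : 0 <= T ->
  (forall s, 0 <= s <= T -> is_derive s 1 y (dy s)) ->
  (forall s, 0 <= s <= T -> `|dy s| <= C * `|y s|) ->
  (y 0 = 0 -> y T = 0) /\ (0 < y 0 -> 0 < y T).
Proof.
move=> T0 dyE dyC.
have dz t s : t <= T -> 0 <= s <= t -> is_derive s 1 (fun r => y r * y r) (2 * (y s * dy s)).
  move=> tT /andP[s0 st]; have h := dyE s; have {}h : is_derive s 1 y (dy s).
    by apply: h; rewrite s0 (le_trans st).
  by apply: is_derive_eq; rewrite /GRing.scale/=; ring.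
have bnd s : 0 <= s <= T -> `|2 * (y s * dy s)| <= 2 * C * (y s * y s).
  move=> sT; have -> : y s * y s = `|y s| * `|y s| by rewrite -normrM ger0_norm// -expr2 sqr_ge0.
  rewrite normrM normrM (ger0_norm (_ : 0 <= 2))// -mulrA ler_wpM2l//.
  have := dyC s sT; have := normr_ge0 (y s); nra.
split=> [y0|y0].
  have := @gronwall R (fun r => y r * y r) (fun s => 2 * (y s * dy s)) (2 * C) 0 T T0 (dz T ^~ (lexx T)).
  rewrite y0 mul0r mul0r => h.
  have : y T * y T <= 0.
    by apply: h => s sT; exact: le_trans (ler_norm _) (bnd s sT).
  by rewrite -expr2 real_exprn_even_le0 ?num_real//= => /eqP.
have pos t : 0 <= t <= T -> y t != 0.
  move=> /andP[t0 tT].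
  (* For the opposite of the square, Gronwall's inequality is a lower bound on the square. *)
  have := @gronwall R (fun s => - (y s * y s)) (fun s => - (2 * (y s * dy s))) (- (2 * C)) 0 t t0.
  move=> /(_ _ _)h; apply/eqP => yt.
  have : - (y t * y t) <= - (y 0 * y 0) * expR (- (2 * C) * (t - 0)).
    apply: h => s st; first by apply: is_deriveN; exact: (dz t).
    have /andP[s0 st'] := st; rewrite mulrN mulNr opprK.
    have := bnd s; rewrite s0 (le_trans st' tT) => /(_ isT).
    by rewrite ler_norml => /andP[+ _]; lra.
  rewrite yt mulr0 oppr0; apply/negP; rewrite -ltNge mulNr oppr_lt0.
  by rewrite !mulr_gt0// expR_gt0.
rewrite ltNge; apply/negP => yT.
have cy : {within `[0, T], continuous y} := is_derive_within_continuous dyE.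
have [|c cT yc] := @IVT R y 0 T 0 T0 cy.
  by rewrite ge_min le_max (ltW y0) yT/= orbT.
by move: (pos c); rewrite yc eqxx; move: cT; rewrite in_itv/= => -> /(_ isT).
Qed.

Lemma negative_slope f (k : R) (x : R) : is_derive x 1 f k -> f x = 0 -> k < 0 ->
  exists2 d, 0 < d & (forall s, x < s < x + d -> f s < 0) /\
                     (forall s, x - d < s < x -> 0 < f s).
Proof.
move=> [df fE] fx k0.
have := df; rewrite /derivable -/(derive f x 1) fE => dlim.
have lim : h^-1 *: ((f \o shift x) (h *: 1) - f x) @[h --> 0^'] --> k.
  by rewrite -fE; exact: df.
have /cvgrPdist_lt/(_ (- k)) := lim; rewrite oppr_gt0 => /(_ k0).
rewrite /dnbhs near_withinE => /nbhs_normP[d /= d0 hd].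
exists d => //.
have slope s : s != x -> `|s - x| < d -> (s - x)^-1 * f s < 0.
  move=> sx sd; have := hd (s - x).
  rewrite /ball_/= sub0r normrN => /(_ sd); rewrite subr_eq0 => /(_ sx).
  rewrite fx subr0 [_ *: 1]mulr1 subrK.
  have -> : (s - x)^-1 *: f s = (s - x)^-1 * f s by [].
  by rewrite ltr_norml => /andP[+ _]; lra.
split=> s /andP[s1 s2].
  have := slope s; rewrite gt_eqF// gtr0_norm ?subr_gt0// => /(_ isT).
  move=> /(_ ltac:(lra)); rewrite pmulr_rlt0// invr_gt0 subr_gt0//.
have := slope s; rewrite lt_eqF// ltr0_norm ?subr_lt0// => /(_ isT).
by move=> /(_ ltac:(lra)); rewrite nmulr_rlt0// invr_lt0 subr_lt0.
Qed.

(** Let [s] be the supremum of the times up to which [f <= 0]. It is less than 1, since [f > 0] just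
    before the falling zero at 1. But whether [f s] is negative or a falling zero, [f <= 0]
    continues beyond [s]. *)
Lemma no_two_falling_zeros f : continuous f -> f 0 = 0 -> f 1 = 0 ->
  (forall s, 0 <= s <= 1 -> f s = 0 -> exists2 k, k < 0 & is_derive s 1 f k) -> False.
Proof.
move=> cf f0 f1 fall.
have [k1 k10 df1] := fall 1 ltac:(rewrite ler01 lexx//) f1.
have [d1 d10 [_ h1]] := negative_slope df1 f1 k10.
pose E := [set s | 0 <= s <= 1 /\ forall r, 0 <= r <= s -> f r <= 0].
have E0 : E 0.
  split; first by rewrite lexx ler01.
  move=> r /andP[a b]; have -> : r = 0 by lra.
  by rewrite f0.
have supE : has_sup E by split; [exists 0|exists 1 => s [/andP[_ ->]]].
pose s := sup E.
have s0 : 0 <= s by apply: ub_le_sup => //; exists 1 => ? [/andP[_ ->]].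
have below r : 0 <= r -> r < s -> f r <= 0.
  move=> r0 rs; have [|u [u01 hu] su] := @sup_adherent _ E (s - r) _ supE.
    by rewrite subr_gt0.
  by apply: hu; rewrite r0/=; move: su; rewrite -/s; lra.
have s1 : s < 1.
  rewrite ltNge; apply/negP => s1.
  have m0 : 0 < Num.min 1 d1 by rewrite lt_min ltr01.
  have [m1 md] : Num.min 1 d1 <= 1 /\ Num.min 1 d1 <= d1 by rewrite !ge_min !lexx orbT.
  have := h1 (1 - Num.min 1 d1 / 2) ltac:(apply/andP; split; lra).
  have := below (1 - Num.min 1 d1 / 2) ltac:(lra) ltac:(lra).
  lra.
have fs : f s <= 0.
  have [->|sn0] := eqVneq s 0; first by rewrite f0.
  rewrite -oppr_ge0; apply: (@ge0_right_end (fun r => - f r)).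
  - by rewrite lt_neqAle eq_sym sn0.
  - by apply: cvgN; exact: cf.
  - by move=> r /andP[r0 rs]; rewrite oppr_ge0 below.
have ext d : 0 < d -> ~ (forall r, s < r < s + d -> f r <= 0).
  move=> d0 h.
  have m0 : 0 < Num.min d (1 - s) by rewrite lt_min d0 subr_gt0.
  have [md m1] : Num.min d (1 - s) <= d /\ Num.min d (1 - s) <= 1 - s.
    by rewrite !ge_min !lexx orbT.
  have : E (s + Num.min d (1 - s) / 2).
    split; first by apply/andP; split; lra.
    move=> r /andP[r0 rs]; have [rs'|sr] := ltP r s; first exact: below.
    have [->//|rns] := eqVneq r s.
    by apply: h; rewrite lt_neqAle eq_sym rns sr/=; lra.
  move=> Es; have : s + Num.min d (1 - s) / 2 <= s.
    by apply: ub_le_sup => //; exists 1 => ? [/andP[_ ->]].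
  lra.
have [fs0|fsn] := eqVneq (f s) 0.
  have [k k0 dk] := fall s ltac:(apply/andP; split; lra) fs0.
  have [d d0 [h _]] := negative_slope dk fs0 k0.
  by apply: (ext d d0) => r /h/ltW.
have fsneg : f s < 0 by rewrite lt_neqAle fsn.
have [|d d0 hd] := (continuous_atP _ _).1 (cf s) (- f s); first by rewrite oppr_gt0.
apply: (ext d d0) => r /andP[r1 r2].
have := hd r; rewrite gtr0_norm ?subr_gt0// => /(_ ltac:(lra)).
by rewrite ltr_norml => /andP[_]; lra.
Qed.

End OneVariable.

(** * Boundary crossings and trapping regions *)

Section BlockCrossing.
Variable R : realType.
Implicit Types (N O : set (R * R)) (a b p : R * R) (s t : R).

Lemma segment_bdry N a b : compact_domain N -> N a -> ~ N b ->
  exists2 t, 0 <= t <= 1 & bdry N (a.1 + t * (b.1 - a.1), a.2 + t * (b.2 - a.2)).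
Proof.
move=> cN Na nNb; pose g t := (a.1 + t * (b.1 - a.1), a.2 + t * (b.2 - a.2)).
have K0 : 0 < `|b - a| + 1 by rewrite ltr_wpDl.
have gg t s : `|g t - g s| <= `|t - s| * (`|b - a| + 1).
  rewrite plane_norm_le/=; apply/andP; split.
    have -> : a.1 + t * (b.1 - a.1) - (a.1 + s * (b.1 - a.1)) = (t - s) * (b - a).1.
      by rewrite /=; ring.
    by rewrite normrM ler_wpM2l// (le_trans (plane_norm_fst _))// lerDl.
  have -> : a.2 + t * (b.2 - a.2) - (a.2 + s * (b.2 - a.2)) = (t - s) * (b - a).2.
    by rewrite /=; ring.
  by rewrite normrM ler_wpM2l// (le_trans (plane_norm_snd _))// lerDl.
have cg t e : 0 < e -> exists2 d, 0 < d & forall s, `|s - t| < d -> `|g s - g t| < e.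
  move=> e0; exists (e / (`|b - a| + 1)); first by rewrite divr_gt0.
  by move=> s st; apply: (le_lt_trans (gg _ _)); rewrite -ltr_pdivlMr.
have g0 : g 0 = a by rewrite /g !mul0r !addr0 -surjective_pairing.
have g1 : g 1 = b by rewrite /g !mul1r !(addrC a.1, addrC a.2) !subrK -surjective_pairing.
pose E := [set t | 0 <= t <= 1 /\ forall r, 0 <= r <= t -> N (g r)].
have E0 : E 0.
  split; first by rewrite lexx ler01.
  move=> r /andP[x y]; have -> : r = 0 by lra.
  by rewrite g0.
have supE : has_sup E by split; [exists 0|exists 1 => s [/andP[_ ->]]].
pose s := sup E.
have s0 : 0 <= s by apply: ub_le_sup => //; exists 1 => ? [/andP[_ ->]].
have s1 : s <= 1 by apply: ge_sup; [exists 0|move=> ? [/andP[_ ->]]].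
have below r : 0 <= r -> r < s -> N (g r).
  move=> r0 rs; have [|u [u01 hu] su] := @sup_adherent _ E (s - r) _ supE.
    by rewrite subr_gt0.
  by apply: hu; rewrite r0/=; move: su; rewrite -/s; lra.
have Ns : N (g s).
  have [->|sn0] := eqVneq s 0; first by rewrite g0.
  have sp : 0 < s by rewrite lt_neqAle eq_sym sn0.
  apply: contrapT => /(domain_closed cN)[e e0 h].
  have [d d0 hd] := cg s e e0.
  have m0 : 0 < Num.min s d by rewrite lt_min sp.
  have [ms md] : Num.min s d <= s /\ Num.min s d <= d by rewrite !ge_min !lexx orbT.
  apply: (h (g (s - Num.min s d / 2))); last by apply: below; lra.
  by apply: hd; rewrite addrC addKr normrN gtr0_norm; lra.
exists s; first by rewrite s0.
apply: contrapT => nb.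
have sl1 : s < 1.
  by rewrite lt_neqAle s1 andbT; apply/eqP => sE; apply: nNb; rewrite -g1 -sE.
have [e e0 h] := notbdry_interior cN Ns nb.
have [d d0 hd] := cg s e e0.
have m0 : 0 < Num.min d (1 - s) by rewrite lt_min d0 subr_gt0.
have [md m1] : Num.min d (1 - s) <= d /\ Num.min d (1 - s) <= 1 - s.
  by rewrite !ge_min !lexx orbT.
have : E (s + Num.min d (1 - s) / 2).
  split; first by apply/andP; split; lra.
  move=> r /andP[r0 rs]; have [rs'|sr] := ltP r s; first exact: below.
  by apply: h; apply: hd; rewrite ger0_norm ?subr_ge0//; lra.
move=> Es; have : s + Num.min d (1 - s) / 2 <= s.
  by apply: ub_le_sup => //; exists 1 => ? [/andP[_ ->]].
lra.
Qed.

(** A continuity argument: the times up to which the orbit is in [O] form an interval, open because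
    [O] is and closed by the hypothesis on the end point. *)
Lemma flow_trap (Y : R * R -> R * R) L phi O p : is_flow Y L phi ->
  (forall u, O u -> exists2 e : R, 0 < e & forall v, `|v - u| < e -> O v) -> O p ->
  (forall t, 0 < t -> (forall s, 0 <= s < t -> O (phi p s)) -> O (phi p t)) ->
  forall t, 0 <= t -> O (phi p t).
Proof.
move=> fl oO Op step t t0; apply: contrapT => nO.
pose E := [set t | 0 <= t /\ forall s, 0 <= s <= t -> O (phi p s)].
have E0 : E 0.
  split=> // r /andP[x y]; have -> : r = 0 by lra.
  by rewrite (flow_start fl).
have ubE : ubound E t.
  by move=> u [u0 hu]; rewrite leNgt; apply/negP => tu; apply: nO; apply: hu; rewrite t0 ltW.
have supE : has_sup E by split; [exists 0|exists t].
pose s := sup E.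
have s0 : 0 <= s by apply: ub_le_sup => //; exists t.
have below r : 0 <= r -> r < s -> O (phi p r).
  move=> r0 rs; have [|u [u01 hu] su] := @sup_adherent _ E (s - r) _ supE.
    by rewrite subr_gt0.
  by apply: hu; rewrite r0/=; move: su; rewrite -/s; lra.
have Os : O (phi p s).
  have [->|sn0] := eqVneq s 0; first by rewrite (flow_start fl).
  apply: step; first by rewrite lt_neqAle eq_sym sn0.
  by move=> r /andP[r0 rs]; apply: below.
have [e e0 h] := oO _ Os; have [d d0 hd] := flow_near_time p s fl e0.
have : E (s + d / 2).
  split; first by lra.
  move=> r /andP[r0 rs]; have [rs'|sr] := ltP r s; first exact: below.
  by apply: h; apply: hd; rewrite ger0_norm ?subr_ge0//; lra.
move=> Es; have : s + d / 2 <= s by apply: ub_le_sup => //; exists t.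
lra.
Qed.

End BlockCrossing.

(** * Coordinates along and across a unit vector *)

Section PlaneFrame.
Variable R : realType.
Implicit Types (e u v : R * R).

Definition dot e u := e.1 * u.1 + e.2 * u.2.
Definition wedge e u := e.1 * u.2 - e.2 * u.1.

Lemma dotB e u v : dot e (u - v) = dot e u - dot e v.
Proof. by rewrite /dot/=; ring. Qed.

Lemma wedgeB e u v : wedge e (u - v) = wedge e u - wedge e v.
Proof. by rewrite /wedge/=; ring. Qed.

Lemma dotZ e a u : dot e (a * u.1, a * u.2) = a * dot e u.
Proof. by rewrite /dot/=; ring. Qed.

Lemma wedgeZr e a u : wedge e (a * u.1, a * u.2) = a * wedge e u.
Proof. by rewrite /wedge/=; ring. Qed.

Lemma wedgeZl e a u : wedge (a * e.1, a * e.2) u = a * wedge e u.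
Proof. by rewrite /wedge/=; ring. Qed.

Lemma unit_le1 e : e.1 ^+ 2 + e.2 ^+ 2 = 1 -> `|e.1| <= 1 /\ `|e.2| <= 1.
Proof.
move=> e1; have : `|e| <= 1.
  rewrite -(@ler_pXn2r _ 2) ?nnegrE// expr1n -e1; exact: plane_norm_sqr_le.
by rewrite plane_norm_le => /andP[].
Qed.

Lemma dot_le e u : e.1 ^+ 2 + e.2 ^+ 2 = 1 -> `|dot e u| <= 2 * `|u|.
Proof.
move=> /unit_le1[h1 h2]; rewrite (le_trans (ler_normD _ _))// !normrM.
have k1 := plane_norm_fst u; have k2 := plane_norm_snd u.
have : `|e.1| * `|u.1| <= 1 * `|u| by apply: ler_pM.
have : `|e.2| * `|u.2| <= 1 * `|u| by apply: ler_pM.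
by lra.
Qed.

Lemma wedge_le e u : e.1 ^+ 2 + e.2 ^+ 2 = 1 -> `|wedge e u| <= 2 * `|u|.
Proof.
move=> /unit_le1[h1 h2]; rewrite (le_trans (ler_normB _ _))// !normrM.
have k1 := plane_norm_fst u; have k2 := plane_norm_snd u.
have : `|e.1| * `|u.2| <= 1 * `|u| by apply: ler_pM.
have : `|e.2| * `|u.1| <= 1 * `|u| by apply: ler_pM.
by lra.
Qed.

Lemma frameE e u : e.1 ^+ 2 + e.2 ^+ 2 = 1 ->
  u = (dot e u * e.1 - wedge e u * e.2, dot e u * e.2 + wedge e u * e.1).
Proof.
move=> e1; rewrite [LHS]surjective_pairing; congr (_, _).
  by rewrite -[LHS]mul1r -e1 /dot /wedge; ring.
by rewrite -[LHS]mul1r -e1 /dot /wedge; ring.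
Qed.

Lemma wedge_frame e u v : e.1 ^+ 2 + e.2 ^+ 2 = 1 ->
  wedge u v = dot e u * wedge e v - wedge e u * dot e v.
Proof. by move=> e1; rewrite -[LHS]mul1r -e1 /wedge /dot; ring. Qed.

Lemma norm_frame e u : e.1 ^+ 2 + e.2 ^+ 2 = 1 ->
  `|u| <= `|dot e u| + `|wedge e u|.
Proof.
move=> e1; have [h1 h2] := unit_le1 e1.
have d0 := normr_ge0 (dot e u); have w0 := normr_ge0 (wedge e u).
rewrite [in `|u|](frameE u e1) plane_norm_le/=; apply/andP; split.
  by rewrite (le_trans (ler_normB _ _))// !normrM lerD// ler_piMr.
by rewrite (le_trans (ler_normD _ _))// !normrM lerD// ler_piMr.
Qed.

Lemma is_derive_dot e (g : R -> R * R) (t : R) v :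
  is_derive t 1 g v -> is_derive t 1 (fun s => dot e (g s)) (dot e v).
Proof.
move=> dg; have h1 := is_derive_fst dg; have h2 := is_derive_snd dg.
have -> : (fun s => dot e (g s)) = (fun s => e.1 * (fst \o g) s + e.2 * (snd \o g) s) by [].
by apply: is_derive_eq; rewrite /dot /GRing.scale/=; ring.
Qed.

Lemma is_derive_wedge e (g : R -> R * R) (t : R) v :
  is_derive t 1 g v -> is_derive t 1 (fun s => wedge e (g s)) (wedge e v).
Proof.
move=> dg; have h1 := is_derive_fst dg; have h2 := is_derive_snd dg.
have -> : (fun s => wedge e (g s)) = (fun s => e.1 * (snd \o g) s - e.2 * (fst \o g) s) by [].
by apply: is_derive_eq; rewrite /wedge /GRing.scale/=; ring.
Qed.

End PlaneFrame.

(** * Attracting sectors *)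

Section Node.
Variable R : realType.
Variables (n : nat) (Z Y : R * R -> R * R) (M L : R) (phi : R * R -> R -> R * R).
Hypothesis fb : flow_box Z M Y L phi.
Hypothesis M0 : 0 < M.
Hypothesis homZ : forall a u, Z (a * u.1, a * u.2) = (a ^+ n * (Z u).1, a ^+ n * (Z u).2).
Hypothesis Z0 : Z (0, 0) = (0, 0).
Implicit Types (e p q u v : R * R) (s t : R).

Let fl : is_flow Y L phi. Proof. by case: fb. Qed.

Lemma flow_zero t : phi (0, 0) t = (0, 0).
Proof.
have [_ _ YZ] := fb.
have Y0 : Y (0, 0) = 0 by rewrite YZ ?Z0// plane_norm_le/= normr0 ltW.
have [t0|t0] := leP 0 t.
  apply/esym; apply: (flow_unique fl (g := fun _ : R => (0, 0) : R * R)) => // s _.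
  by rewrite Y0; exact: is_derive_cst.
have : (0, 0) = rev phi (0, 0) (- t).
  apply: (flow_unique (is_flow_rev fl) (g := fun _ : R => (0, 0) : R * R)) => //.
    by rewrite oppr_ge0 ltW.
  by move=> s _; rewrite Y0 oppr0; exact: is_derive_cst.
by rewrite /rev opprK.
Qed.

Lemma flow_neq0 p t : p != (0, 0) -> phi p t != (0, 0).
Proof.
by apply: contra_neq => pt; rewrite -(flowK p t fl) pt flow_zero.
Qed.

(* In the sector |wedge e u| <= d * dot e u, orbits approach the ray through [e]
   and the distance to the origin decreases. *)
Lemma node_stays (N : set (R * R)) e d r : e.1 ^+ 2 + e.2 ^+ 2 = 1 ->
  0 < d -> 0 < r -> r <= M -> (forall u, `|u| < r -> N u) ->
  (forall t, `|t| <= d -> let u := (e.1 - t * e.2, e.2 + t * e.1) in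
     dot e (Z u) <= 0 /\ t * wedge u (Z u) <= 0) ->
  exists p, p != (0, 0) /\ exists2 rho, 0 < rho &
    forall q, `|q - p| < rho -> stays phi N q.
Proof.
move=> e1 d0 r0 rM rN sec; have [_ _ YZ] := fb.
(* With [c <= 1] the norm in the sector is at most [2 * dot e u], so the bound [r / 2] on [dot e u]
   keeps the sector in the ball of radius [r]. *)
pose c := Num.min d 1; have c0 : 0 < c by rewrite lt_min d0 ltr01.
have cd : c <= d by rewrite ge_min lexx.
have c1 : c <= 1 by rewrite ge_min lexx orbT.
move: c c0 cd c1 => c c0 cd c1.
pose O := [set u | [/\ 0 < dot e u, dot e u < r / 2 & `|wedge e u| < c * dot e u]].
pose Ob := [set u | [/\ 0 < dot e u, dot e u <= r / 2 & `|wedge e u| <= c * dot e u]].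
have OO u : O u -> Ob u by case=> a b h; split => //; rewrite ltW.
have Onorm u : O u -> `|u| < r.
  move=> [a b h]; apply: (le_lt_trans (norm_frame _ e1)).
  rewrite (gtr0_norm a); apply: (@lt_le_trans _ _ (dot e u + c * dot e u)); first by rewrite ltrD2l.
  have : c * dot e u <= 1 * dot e u by rewrite ler_wpM2r// ltW.
  lra.
have Obnorm u : Ob u -> `|u| <= M.
  move=> [a b h]; apply: (le_trans (norm_frame _ e1)).
  rewrite (gtr0_norm a); apply: (@le_trans _ _ (dot e u + c * dot e u)); first by rewrite lerD2l.
  have : c * dot e u <= 1 * dot e u by rewrite ler_wpM2r// ltW.
  lra.
have secO u : Ob u -> dot e (Z u) <= 0 /\ wedge e u * wedge u (Z u) <= 0.
  move=> [a b h]; pose t := wedge e u / dot e u.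
  have td : `|t| <= d.
    rewrite normrM normfV (gtr0_norm a) ler_pdivrMr//.
    by rewrite (le_trans h)// ler_wpM2r// ltW.
  pose w := (e.1 - t * e.2, e.2 + t * e.1).
  have uw : u = (dot e u * w.1, dot e u * w.2).
    rewrite {1}(frameE u e1) /w /t/=; congr (_, _); field; exact: lt0r_neq0.
  have [h1 h2] := sec t td; rewrite -/w in h1 h2.
  have Zu : Z u = (dot e u ^+ n * (Z w).1, dot e u ^+ n * (Z w).2) by rewrite -homZ -uw.
  have xn : 0 <= dot e u ^+ n by rewrite exprn_ge0// ltW.
  split.
    by rewrite Zu dotZ mulr_ge0_le0.
  have wu v : wedge u v = dot e u * wedge w v by rewrite {1}uw wedgeZl.
  have -> : wedge e u * wedge u (Z u) =
      (dot e u ^+ n * dot e u ^+ 2) * (t * wedge w (Z w)).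
    rewrite wu Zu wedgeZr (_ : wedge e u = t * dot e u); first by ring.
    by rewrite /t divfK// lt0r_neq0.
  by rewrite mulr_ge0_le0// mulr_ge0// sqr_ge0.
have oO u : O u -> exists2 e0 : R, 0 < e0 & forall v, `|v - u| < e0 -> O v.
  move=> [a b h].
  pose m := Num.min (dot e u) (Num.min (r / 2 - dot e u) (c * dot e u - `|wedge e u|)).
  have m0 : 0 < m by rewrite !lt_min a !subr_gt0 b h.
  have [m1 m2 m3] : [/\ m <= dot e u, m <= r / 2 - dot e u & m <= c * dot e u - `|wedge e u|].
    by rewrite !ge_min !lexx !orbT.
  exists (m / 4); first by rewrite divr_gt0.
  move=> v vu.
  have dv : `|dot e v - dot e u| < m / 2.
    by rewrite -dotB; apply: (le_lt_trans (dot_le _ e1)); lra.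
  have wv : `|wedge e v - wedge e u| < m / 2.
    by rewrite -wedgeB; apply: (le_lt_trans (wedge_le _ e1)); lra.
  have := ler_normD (wedge e v - wedge e u) (wedge e u); rewrite subrK => wv'.
  move: dv; rewrite ltr_norml => /andP[dv1 dv2].
  have cm : c * (dot e u - m / 2) <= c * dot e v by rewrite ler_wpM2l ?(ltW c0)//; lra.
  have cm' : c * (m / 2) <= 1 * (m / 2) by rewrite ler_wpM2r// divr_ge0// ltW.
  by split; lra.
pose p := (r / 4 * e.1, r / 4 * e.2).
have dp : dot e p = r / 4.
  have -> : dot e p = r / 4 * (e.1 ^+ 2 + e.2 ^+ 2) by rewrite /dot/=; ring.
  by rewrite e1 mulr1.
have Op : O p.
  have wp : wedge e p = 0 by rewrite /wedge/=; ring.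
  by split; rewrite ?wp dp ?normr0 ?mulr_gt0//; lra.
exists p; split.
  apply/eqP => p0; have : dot e p = 0 by rewrite p0 /dot/= !mulr0 addr0.
  by rewrite dp; lra.
have [rho rho0 hrho] := oO p Op; exists rho => // q /hrho Oq t t0.
apply: rN; apply: Onorm; apply: (flow_trap fl oO Oq) t0 => {}t t0 hO.
have q0 : q != (0, 0).
  by apply: contraPneq Oq => ->; case; rewrite /dot/= !mulr0 addr0 ltxx.
have cdot s : {for s, continuous (fun s => dot e (phi q s))}.
  exact: is_derive_continuous (is_derive_dot e (flow_derive fl q s)).
have cwedge s : {for s, continuous (fun s => wedge e (phi q s))}.
  exact: is_derive_continuous (is_derive_wedge e (flow_derive fl q s)).
have Obt : Ob (phi q t).
  have h1 : 0 <= dot e (phi q t).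
    by apply: (ge0_right_end t0 (cdot t)) => s /hO[/ltW].
  have h2 : 0 <= r / 2 - dot e (phi q t).
    apply: (@ge0_right_end _ (fun s => r / 2 - dot e (phi q s)) t t0).
      by apply: cvgB; [exact: cvg_cst|exact: cdot].
    by move=> s /hO[_ /ltW]; rewrite subr_ge0.
  have h3 : 0 <= c * dot e (phi q t) - `|wedge e (phi q t)|.
    apply: (@ge0_right_end _ (fun s => c * dot e (phi q s) - `|wedge e (phi q s)|) t t0).
      apply: cvgB; last by apply: cvg_norm; exact: cwedge.
      by apply: cvgM; [exact: cvg_cst|exact: cdot].
    by move=> s /hO[_ _ /ltW]; rewrite subr_ge0.
  split; [|lra|lra].
  (* The tip of the sector is excluded because an orbit does not reach the singular point in finite
     time. *)
  rewrite lt_neqAle h1 andbT eq_sym; apply/eqP => dt.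
  have wt : wedge e (phi q t) = 0.
    by apply/eqP; rewrite -normr_le0; rewrite dt mulr0 in h3; lra.
  have := flow_neq0 t q0; rewrite (frameE (phi q t) e1) dt wt !mul0r subr0 addr0.
  by rewrite eqxx.
have Obs s : 0 <= s <= t -> Ob (phi q s).
  case/andP=> s0; rewrite le_eqVlt => /orP[/eqP->//|st].
  by apply: OO; apply: hO; rewrite s0.
have dd s : 0 <= s <= t -> is_derive s 1 (fun s => dot e (phi q s)) (dot e (Z (phi q s))).
  move=> /Obs/Obnorm h; rewrite -YZ//; exact: is_derive_dot (flow_derive fl q s).
have dw s : 0 <= s <= t -> is_derive s 1 (fun s => wedge e (phi q s)) (wedge e (Z (phi q s))).
  move=> /Obs/Obnorm h; rewrite -YZ//; exact: is_derive_wedge (flow_derive fl q s).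
have [dq wq] : dot e q < r / 2 /\ `|wedge e q| < c * dot e q by case: Oq.
have dq0 : 0 < dot e q by case: Oq.
have dt : dot e (phi q t) <= dot e q.
  rewrite -[in X in _ <= X](flow_start fl q).
  apply: (le0_is_derive_ge (ltW t0) dd) => s /Obs/secO[].
  by [].
have dt0 : 0 < dot e (phi q t) by case: Obt.
(* The squared slope: the numerator of its derivative is [wedge e u * wedge u (Z u)] up to a
   positive factor, so it decreases and the sides of the sector are not reached. *)
pose qt s := (wedge e (phi q s) * (dot e (phi q s))^-1) ^+ 2.
have qq : qt t <= qt 0.
  apply: (@le0_is_derive_ge _ qt (fun s => 2 * (wedge e (phi q s) * wedge (phi q s) (Z (phi q s))) /
      dot e (phi q s) ^+ 3) 0 t (ltW t0)) => s st.
    have ds := dd s st; have ws := dw s st.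
    have [ps _ _] := Obs s st; have pn : dot e (phi q s) != 0 by rewrite gt_eqF.
    have dV : is_derive s 1 (fun r => (dot e (phi q r))^-1)
        (- dot e (phi q s) ^- 2 *: dot e (Z (phi q s))).
      exact: (@is_deriveV _ (fun r => dot e (phi q r))).
    apply: is_derive_eq; rewrite /GRing.scale/=.
    by rewrite (wedge_frame (phi q s) _ e1); field.
  have [_ h] := secO _ (Obs s st); have [ps _ _] := Obs s st.
  rewrite -mulrA mulr_ge0_le0// mulr_le0_ge0// invr_ge0 exprn_ge0// ltW//.
have qt0 : qt 0 < c ^+ 2.
  rewrite /qt (flow_start fl) -[X in X < _]real_normK ?num_real//.
  rewrite ltrXn2r// normrM normfV (gtr0_norm dq0) ltr_pdivrMr//.
have qtt : `|wedge e (phi q t)| < c * dot e (phi q t).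
  have := le_lt_trans qq qt0; rewrite /qt -[X in X < _]real_normK ?num_real//.
  rewrite ltr_pXn2r// ?nnegrE ?(ltW c0)// normrM normfV (gtr0_norm dt0).
  by rewrite ltr_pdivrMr.
by split => //; lra.
Qed.

End Node.

(** * Invariant rays *)

Section Ray.
Variable R : realType.
Variables (n : nat) (Z Y : R * R -> R * R) (M L : R) (phi : R * R -> R -> R * R).
Hypothesis fb : flow_box Z M Y L phi.
Hypothesis homZ : forall a u, Z (a * u.1, a * u.2) = (a ^+ n * (Z u).1, a ^+ n * (Z u).2).
Hypothesis Z0 : Z (0, 0) = (0, 0).
Variables (e : R * R) (a : R).
Hypotheses (e1 : e.1 ^+ 2 + e.2 ^+ 2 = 1) (Ze : Z e = (a * e.1, a * e.2)).
Implicit Types (p q u v : R * R) (s t T : R).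

Let fl : is_flow Y L phi. Proof. by case: fb. Qed.

Lemma ray_field x : Z (x * e.1, x * e.2) = (a * x ^+ n * e.1, a * x ^+ n * e.2).
Proof. by rewrite homZ Ze/=; congr (_, _); ring. Qed.

(** The field is compared with its value at the projection [v] of [u] on the line, where its
    transversal component vanishes. In the sup norm the projection may have norm [2 * M], whence the
    larger ball. *)
Lemma wedge_field_bound : exists C, forall u, `|u| <= M ->
  `|wedge e (Z u)| <= C * `|wedge e u|.
Proof.
have [lipZ _ _] := fb; have [K K0 hK] := lipZ (2 * M); exists (2 * K) => u uM.
pose v := (dot e u * e.1, dot e u * e.2).
have wv : wedge e (Z v) = 0 by rewrite ray_field /wedge/=; ring.
have [h1 h2] := unit_le1 e1.
have du := dot_le u e1.
have uvM : `|v| <= 2 * M.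
  by rewrite plane_norm_le/= !normrM; apply/andP; split;
    rewrite (le_trans (ler_piMr _ _))//; lra.
have uM2 : `|u| <= 2 * M by have := normr_ge0 u; lra.
have uv : `|u - v| <= `|wedge e u|.
  rewrite {1}(frameE u e1) plane_norm_le/= addrAC subrr add0r normrN.
  by rewrite addrAC subrr add0r !normrM; apply/andP; split; rewrite ler_piMr.
rewrite -[wedge e (Z u)]subr0 -wv -wedgeB.
apply: (le_trans (wedge_le _ e1)); rewrite -mulrA ler_wpM2l//.
by apply: (le_trans (hK _ _ uM2 uvM)); rewrite ler_wpM2l// ltW.
Qed.

Lemma wedge_keep p T : 0 <= T -> (forall s, 0 <= s <= T -> `|phi p s| <= M) ->
  (wedge e p = 0 -> wedge e (phi p T) = 0) /\
  (0 < wedge e p -> 0 < wedge e (phi p T)).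
Proof.
move=> T0 pM; have [C hC] := wedge_field_bound; have [_ _ YZ] := fb.
have := @sign_keep _ (fun s => wedge e (phi p s)) (fun s => wedge e (Z (phi p s))) C T T0.
rewrite (flow_start fl); apply=> s sT; last by apply: hC; exact: pM.
by rewrite -YZ; [exact: is_derive_wedge (flow_derive fl p s)|exact: pM].
Qed.

Lemma ray_keep p T : 0 <= T -> (forall s, 0 <= s <= T -> `|phi p s| <= M) ->
  wedge e p = 0 -> 0 < dot e p ->
  [/\ wedge e (phi p T) = 0, 0 < dot e (phi p T) &
      is_derive T 1 (fun s => dot e (phi p s)) (a * dot e (phi p T) ^+ n)].
Proof.
move=> T0 pM wp dp; have [lipZ _ YZ] := fb; have [K K0 hK] := lipZ M.
have w0 s : 0 <= s <= T -> wedge e (phi p s) = 0.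
  move=> /andP[s0 sT]; apply: (wedge_keep s0 _).1 => // r /andP[r0 rs].
  by apply: pM; rewrite r0 (le_trans rs).
have M0 : 0 <= M by apply: le_trans (pM 0 _); rewrite ?lexx.
have phiE s : 0 <= s <= T -> phi p s = (dot e (phi p s) * e.1, dot e (phi p s) * e.2).
  by move=> /w0 w; rewrite {1}(frameE (phi p s) e1) w !mul0r subr0 addr0.
have TT : 0 <= T <= T by rewrite T0 lexx.
have dd s : 0 <= s <= T -> is_derive s 1 (fun s => dot e (phi p s)) (dot e (Z (phi p s))).
  by move=> sT; rewrite -YZ; [exact: is_derive_dot (flow_derive fl p s)|exact: pM].
split; first exact: w0.
  have := @sign_keep _ (fun s => dot e (phi p s)) (fun s => dot e (Z (phi p s))) (2 * K) T T0 dd.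
  rewrite (flow_start fl) => h; apply: (h _).2 => // s sT.
  have pd : `|phi p s| <= `|dot e (phi p s)|.
    by rewrite (le_trans (norm_frame _ e1))// w0// normr0 addr0.
  have O0 : `|(0, 0) : R * R| <= M by rewrite plane_norm_le/= normr0 M0.
  have := hK (phi p s) (0, 0) (pM s sT) O0; rewrite Z0.
  have -> : Z (phi p s) - (0, 0) = Z (phi p s).
    by rewrite [RHS]surjective_pairing [LHS]surjective_pairing/= !subr0.
  have -> : phi p s - (0, 0) = phi p s.
    by rewrite [RHS]surjective_pairing [LHS]surjective_pairing/= !subr0.
  move=> zK; apply: (le_trans (dot_le _ e1)); rewrite -mulrA ler_wpM2l//.
  by apply: (le_trans zK); rewrite ler_wpM2l// ltW.
have -> // : a * dot e (phi p T) ^+ n = dot e (Z (phi p T)).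
  have -> : Z (phi p T) = (a * dot e (phi p T) ^+ n * e.1, a * dot e (phi p T) ^+ n * e.2).
    by rewrite [in LHS](phiE T TT) ray_field.
  rewrite dotZ /dot -!expr2 e1 mulr1//.
exact: dd.
Qed.

(** Moving outwards along the ray, the speed stays at least [c = a * dot e w ^ n]. After time
    [(2 * M + 1) / c], [dot e] exceeds its bound [2 * M] on the ball. *)
Lemma ray_escape w : 0 < a -> wedge e w = 0 -> 0 < dot e w ->
  ~ (forall t, 0 <= t -> `|phi w t| <= M).
Proof.
move=> an ww dw sw.
have keep s : 0 <= s -> [/\ wedge e (phi w s) = 0, 0 < dot e (phi w s) &
    is_derive s 1 (fun s => dot e (phi w s)) (a * dot e (phi w s) ^+ n)].
  move=> s0; apply: (ray_keep s0) => // u /andP[u0 _].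
  exact: sw.
have mono s : 0 <= s -> dot e w <= dot e (phi w s).
  move=> s0.
  have := @ge0_is_derive_le _ (fun s => dot e (phi w s))
    (fun s => a * dot e (phi w s) ^+ n) 0 s s0.
  rewrite (flow_start fl).
  apply=> u /andP[u0 _]; have [_ d0 du] := keep u u0; first exact: du.
  by rewrite mulr_ge0 ?(ltW an)// exprn_ge0// ltW.
pose c := a * dot e w ^+ n.
have c0 : 0 < c by rewrite mulr_gt0// exprn_gt0.
have M0 : 0 <= M by apply: le_trans (sw 0 (lexx 0)).
pose T := (2 * M + 1) / c.
have T0 : 0 <= T by apply: divr_ge0; [lra|exact: ltW].
have h : c * (T - 0) <= dot e (phi w T) - dot e (phi w 0).
  have := @is_derive_le_sub _ (fun s => dot e (phi w s))
    (fun s => a * dot e (phi w s) ^+ n) 0 T c T0.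
  apply=> s /andP[s0 _]; first by have [_ _ ds] := keep s s0; exact: ds.
  rewrite /c ler_wpM2l ?(ltW an)//.
  by rewrite lerXn2r// ?nnegrE ?(ltW dw)// ?mono// (le_trans (ltW dw))// mono.
rewrite subr0 in h.
have cT : c * T = 2 * M + 1 by rewrite /T mulrC divfK// gt_eqF.
have := dot_le (phi w T) e1; have := sw T T0.
have := ler_norm (dot e (phi w T)).
rewrite (flow_start fl) in h; lra.
Qed.

End Ray.

Lemma segment_near (R : realType) (a b o q : R * R) (t x h m : R) : 0 <= t <= 1 ->
  `|a - q| < x -> `|b - q| < x -> `|o| <= h -> x + h <= m ->
  `|((a + o).1 + t * ((b + o).1 - (a + o).1),
     (a + o).2 + t * ((b + o).2 - (a + o).2)) - q| < m.
Proof.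
move=> /andP[t0 t1]; rewrite !plane_norm_lt !plane_norm_le/=.
move=> /andP[a1 a2] /andP[b1 b2] /andP[c1 c2] xh.
have aux (a' b' c' y : R) : `|a' - c'| < x -> `|b' - c'| < x ->
    `|y| <= h -> `|a' + y + t * (b' + y - (a' + y)) - c'| < m.
  move=> /ltr_normlP[k1 k2] /ltr_normlP[k3 k4] /ler_normlP[k5 k6].
  have -> : a' + y + t * (b' + y - (a' + y)) - c' = (1 - t) * (a' - c') + t * (b' - c') + y.
    by ring.
  have [t10|t10] := ltP 0 (1 - t).
    have u1 : (1 - t) * (a' - c') < (1 - t) * x by rewrite ltr_pM2l.
    have u2 : (1 - t) * - (a' - c') < (1 - t) * x by rewrite ltr_pM2l.
    have u3 : t * (b' - c') <= t * x by apply: ler_wpM2l; lra.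
    have u4 : t * - (b' - c') <= t * x by apply: ler_wpM2l; lra.
    rewrite ltr_norml; apply/andP; split; lra.
  have -> : t = 1 by lra.
  rewrite ltr_norml; apply/andP; split; lra.
by apply/andP; split; apply: aux.
Qed.

(** * Characteristic directions of a regularisable field *)

Section ForwardCases.
Variable R : realType.
Variables (n : nat) (P Q : {poly {poly R}}).
Hypothesis V : Vhom n P Q.
Implicit Types (e p q u v w : R * R) (s t d : R).

Let X := vfield P Q.

(** First-order analysis at [e]: [wedge u (X u)] is D, which vanishes at [e] with transversal slope
    [kappa], and [dot e (X u)] is close to [alpha]. *)
Lemma char_vector_sector e : char_vector P Q e -> exists2 d, 0 < d &
  forall t, `|t| <= d -> let u := (e.1 - t * e.2, e.2 + t * e.1) in
    0 <= alpha P Q e * dot e (X u) /\ 0 <= kappa P Q e * (t * wedge u (X u)).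
Proof.
move=> ce; have [e1 De] := ce.
have a0 := alpha_neq0 V ce; have k0 := kappa_neq0 V ce.
pose f (s : R) := dirD P Q (e.1 - s * e.2, e.2 + s * e.1).
have df : is_derive (0 : R) 1 f (kappa P Q e).
  have := is_derive_dirD_char V (- e.2, e.1) ce (oner_neq0 _).
  rewrite /= expr1n mul1r.
  have -> : e.1 * e.1 - e.2 * - e.2 = e.1 ^+ 2 + e.2 ^+ 2 by ring.
  rewrite e1 mulr1.
  have -> // : (fun s => dirD P Q (1 * e.1 + s * - e.2, 1 * e.2 + s * e.1)) = f.
  by apply/funext => s; rewrite /f; congr (dirD P Q (_, _)); ring.
have f0 : f 0 = 0 by rewrite /f !mul0r subr0 addr0 -surjective_pairing.
have [d1 d10 h1] : exists2 d, 0 < d & forall s, `|s| < d -> 0 <= kappa P Q e * (s * f s).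
  have [k|k] := ltP (kappa P Q e) 0.
    have [d d0 [h1 h2]] := negative_slope df f0 k; exists d => // s.
    rewrite ltr_norml => /andP[sa sb].
    have [->|sn] := eqVneq s 0; first by rewrite mul0r mulr0.
    rewrite nmulr_rge0//; have [s0|s0] := ltP 0 s.
      by rewrite pmulr_rle0// ltW// h1// s0 add0r.
    have sneg : s < 0 by rewrite lt_neqAle sn.
    by rewrite nmulr_rle0// ltW// h2// sub0r sa.
  have kp : 0 < kappa P Q e by rewrite lt_neqAle eq_sym k0 k.
  have dg : is_derive (0 : R) 1 (fun s => - f s) (- kappa P Q e) by apply: is_deriveN.
  have g0 : - f 0 = 0 by rewrite f0 oppr0.
  have [|d d0 [h1 h2]] := negative_slope dg g0; first by rewrite oppr_lt0.
  exists d => // s; rewrite ltr_norml => /andP[sa sb].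
  have [->|sn] := eqVneq s 0; first by rewrite mul0r mulr0.
  rewrite pmulr_rge0//; have [s0|s0] := ltP 0 s.
    by rewrite pmulr_rge0// ltW// -oppr_lt0 h1// s0 add0r.
  have sneg : s < 0 by rewrite lt_neqAle sn.
  by rewrite nmulr_rge0// ltW// -oppr_gt0 h2// sub0r sa.
pose g (s : R) := dot e (X (e.1 - s * e.2, e.2 + s * e.1)).
have g0 : g 0 = alpha P Q e by rewrite /g !mul0r subr0 addr0 -surjective_pairing.
have cg : {for (0 : R), continuous g}.
  have l1 : is_derive (0 : R) 1 (fun s => e.1 - s * e.2) (- e.2).
    by apply: is_derive_eq; rewrite /GRing.scale/=; ring.
  have l2 : is_derive (0 : R) 1 (fun s => e.2 + s * e.1) e.1.
    by apply: is_derive_eq; rewrite /GRing.scale/=; ring.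
  have c1 := is_derive_continuous (is_derive_horner2 P l1 l2).
  have c2 := is_derive_continuous (is_derive_horner2 Q l1 l2).
  by apply: cvgD; apply: cvgM; [exact: cvg_cst|exact: c1|exact: cvg_cst|exact: c2].
have [|d2 d20 h2] := (continuous_atP _ _).1 cg `|alpha P Q e|; first by rewrite normr_gt0.
have m0 : 0 < Num.min d1 d2 by rewrite lt_min d10.
have [m1 m2] : Num.min d1 d2 <= d1 /\ Num.min d1 d2 <= d2 by rewrite !ge_min !lexx orbT.
exists (Num.min d1 d2 / 2); first by rewrite divr_gt0.
move=> t td; split; last by apply: h1; lra.
have := h2 t; rewrite subr0 g0 => /(_ ltac:(lra)) h.
have -> : dot e (X (e.1 - t * e.2, e.2 + t * e.1)) = g t by [].
move: h; have [a|a] := ltP 0 (alpha P Q e).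
  by rewrite (gtr0_norm a) ltr_norml => /andP[h _]; rewrite pmulr_rge0//; lra.
have an : alpha P Q e < 0 by rewrite lt_neqAle a0.
by rewrite (ltr0_norm an) ltr_norml => /andP[_ h]; rewrite nmulr_rge0//; lra.
Qed.

Section Data.
Variables (N : set (R * R)) (Y : R * R -> R * R) (M L : R).
Variables (phi : R * R -> R -> R * R) (f : R * R -> R * R).
Hypotheses (B : block X Y M L phi N)
  (Hmax : [set (0, 0)] = [set p | forall t, N (phi p t)])
  (ext : extension phi N f)
  (uniq : forall g, extension phi N g -> forall p, entry phi N p -> g p = f p)
  (onto : forall w, entry (rev phi) N w -> exists2 p, entry phi N p & f p = w).

Let fb : flow_box X M Y L phi. Proof. by case: B. Qed.
Let fl : is_flow Y L phi. Proof. by case: fb. Qed.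
Let NM : forall q, N q -> `|q| < M. Proof. by case: B. Qed.
Let cN : compact_domain N. Proof. by case: B. Qed.

Lemma max_invariant0 p : (forall t, N (phi p t)) -> p = (0, 0).
Proof. by move=> h; have : [set p | forall t, N (phi p t)] p by []; rewrite -Hmax. Qed.

Lemma block_origin : exists2 r, 0 < r & r <= M /\ forall u, `|u| < r -> N u.
Proof.
have N0 t : N (phi (0, 0) t).
  by have : [set (0, 0)] ((0, 0) : R * R) by []; rewrite Hmax; apply.
have N00 : N (0, 0) by rewrite -(flow_start fl (0, 0)).
have M0 : 0 < M by exact: le_lt_trans (NM N00).
have nb : ~ bdry N (0, 0).
  move=> /(bdry_entry B)[|] en; apply: (entryN en ltr01) => s _; exact: N0.
have [r r0 hr] := notbdry_interior cN N00 nb.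
exists (Num.min r M); first by rewrite lt_min r0.
split; first by rewrite ge_min lexx orbT.
move=> u; rewrite lt_min => /andP[ur _]; apply: hr.
by rewrite (_ : u - (0, 0) = u)// [u]surjective_pairing; congr (_, _); rewrite /= subr0.
Qed.

Lemma stays_both p : stays phi N p -> stays (rev phi) N p -> p = (0, 0).
Proof.
move=> s1 s2; apply: max_invariant0 => t; have [t0|t0] := leP 0 t; first exact: s1.
by have := s2 (- t); rewrite /rev opprK oppr_ge0 => /(_ (ltW t0)).
Qed.

(** By [nbhs_stays_back] the centre of such a ball also stays in the past, so it belongs to the
    maximal invariant set. *)
Lemma no_stable_ball p r : 0 < r -> (forall q, `|q - p| < r -> stays phi N q) ->
  p = (0, 0).
Proof.
move=> r0 h; have sp : stays phi N p by apply: h; rewrite subrr normr0.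
apply: stays_both => //.
exact: (nbhs_stays_back B (not_stays_dense B ext uniq) r0 h).
Qed.

Lemma no_unstable_ball p r : 0 < r ->
  (forall q, `|q - p| < r -> stays (rev phi) N q) -> p = (0, 0).
Proof.
move=> r0 h; have sp : stays (rev phi) N p by apply: h; rewrite subrr normr0.
apply: stays_both => //.
rewrite -[phi in stays phi](rev_rev phi).
apply: (nbhs_stays_back (block_rev B) _ r0 h) => q d.
by move=> eq d0; have [w [? ? ?]] := not_stays_back_dense B ext uniq onto eq d0; exists w.
Qed.

Lemma saddle e : char_vector P Q e -> alpha P Q e * kappa P Q e < 0.
Proof.
move=> ce; have [e1 _] := ce; have [r r0 [rM rN]] := block_origin.
have M0 : 0 < M by exact: lt_le_trans rM.
have a0 := alpha_neq0 V ce; have k0 := kappa_neq0 V ce.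
rewrite ltNge; apply/negP => ak.
have [d d0 sec] := char_vector_sector ce.
have homX a u : X (a * u.1, a * u.2) = (a ^+ n * (X u).1, a ^+ n * (X u).2) by exact: vfieldZ V a u.
have X0 : X (0, 0) = (0, 0) by case: V => _ _ [].
have [a|a] := ltP (alpha P Q e) 0.
  have k : kappa P Q e < 0.
    by rewrite lt_neqAle k0 leNgt; apply/negP => k; move: ak; rewrite nmulr_rge0// leNgt k.
  have [|p [pn [rho rho0 h]]] := node_stays fb M0 homX X0 e1 d0 r0 rM rN.
    by move=> t td; have := sec t td; rewrite /= nmulr_rge0// nmulr_rge0//.
  by move/eqP: pn; apply; exact: (no_stable_ball rho0 h).
have ap : 0 < alpha P Q e by rewrite lt_neqAle eq_sym a0 a.
have k : 0 < kappa P Q e by rewrite lt_neqAle eq_sym k0 -(pmulr_rge0 _ ap).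
have homX' b u : - X (b * u.1, b * u.2) = (b ^+ n * (- X u).1, b ^+ n * (- X u).2).
  by rewrite homX/= !mulrN.
have X0' : - X (0, 0) = (0, 0) by rewrite X0 [LHS]surjective_pairing/= oppr0.
have [|p [pn [rho rho0 h]]] := node_stays (flow_box_rev fb) M0 homX' X0' e1 d0 r0 rM rN.
  move=> t td; have := sec t td; rewrite /= pmulr_rge0// pmulr_rge0// => -[h1 h2].
  have -> u v : dot u (- v) = - dot u v by rewrite /dot/=; ring.
  have -> u v : wedge u (- v) = - wedge u v by rewrite /wedge/=; ring.
  by rewrite mulrN !oppr_le0.
by move/eqP: pn; apply; exact: (no_unstable_ball rho0 h).
Qed.

Let homX a u : X (a * u.1, a * u.2) = (a ^+ n * (X u).1, a ^+ n * (X u).2).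
Proof. exact: vfieldZ V a u. Qed.

Let X0 : X (0, 0) = (0, 0). Proof. by case: V => _ _ []. Qed.

Let homNX a u : - X (a * u.1, a * u.2) = (a ^+ n * (- X u).1, a ^+ n * (- X u).2).
Proof. by rewrite homX/= !mulrN. Qed.

Let NX0 : - X (0, 0) = (0, 0).
Proof. by rewrite X0 [LHS]surjective_pairing/= oppr0. Qed.

Let NXe e : char_vector P Q e -> - X e = (- alpha P Q e * e.1, - alpha P Q e * e.2).
Proof. by move=> ce; rewrite /X (vfield_char ce)/= !mulNr. Qed.

(* A point of [a^+] on the ray through [e]: follow the ray away from the origin. *)
Lemma incoming_entry e : char_vector P Q e -> alpha P Q e < 0 ->
  exists q, [/\ entry phi N q, stays phi N q, wedge e q = 0 & 0 < dot e q].
Proof.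
move=> ce a0; have [e1 _] := ce; have [r r0 [rM rN]] := block_origin.
pose p := (r / 2 * e.1, r / 2 * e.2).
have [h1 h2] := unit_le1 e1.
have wp : wedge e p = 0 by rewrite /wedge/=; ring.
have dp : dot e p = r / 2.
  have -> : dot e p = r / 2 * (e.1 ^+ 2 + e.2 ^+ 2) by rewrite /dot/=; ring.
  by rewrite e1 mulr1.
have dp0 : 0 < dot e p by rewrite dp divr_gt0.
have Np : N p.
  by apply: rN; apply: (le_lt_trans (norm_frame p e1)); rewrite wp normr0 addr0 dp gtr0_norm; lra.
have sp : stays phi N p.
  apply: contrapT => nsp; have [t [t0 ht [bt _]]] := exit_exists B Np nsp.
  have box s : 0 <= s <= t -> `|phi p s| <= M by move=> /ht/NM/ltW.
  have keep s : 0 <= s <= t -> [/\ wedge e (phi p s) = 0, 0 < dot e (phi p s) &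
      is_derive s 1 (fun s => dot e (phi p s)) (alpha P Q e * dot e (phi p s) ^+ n)].
    move=> /andP[s0 st]; apply: (ray_keep fb homX X0 e1 (vfield_char ce) s0) => // u /andP[u0 us].
    by apply: box; rewrite u0 (le_trans us).
  have dt : dot e (phi p t) <= r / 2.
    rewrite -dp.
    have := @le0_is_derive_ge _ (fun s => dot e (phi p s))
      (fun s => alpha P Q e * dot e (phi p s) ^+ n) 0 t t0.
    rewrite (flow_start fl); apply=> s st; first by have [] := keep s st.
    have [_ ds _] := keep s st; rewrite nmulr_rle0// exprn_ge0// ltW//.
  have [wt dt0 _] := keep t (introT andP (conj t0 (lexx t))).
  have pt : `|phi p t| < r.
    apply: (le_lt_trans (norm_frame _ e1)); rewrite wt normr0 addr0 gtr0_norm//; lra.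
  apply: (@interior_notbdry _ N (phi p t) (r - `|phi p t|)) bt; first by rewrite subr_gt0.
  move=> z zp; apply: rN.
  by have := ler_normD (z - phi p t) (phi p t); rewrite subrK; lra.
have nbp : ~ stays (rev phi) N p.
  move=> bp; have := stays_both sp bp => p0; move: dp0.
  by rewrite p0 /dot/= !mulr0 addr0 ltxx.
have [t [t0 ht et]] := exit_exists (block_rev B) Np nbp.
rewrite rev_rev in et; exists (rev phi p t).
have box s : 0 <= s <= t -> `|rev phi p s| <= M by move=> /ht/NM/ltW.
have [wt dt _] := ray_keep (flow_box_rev fb) homNX NX0 e1 (NXe ce) t0 box wp dp0.
split => // s s0; rewrite /rev -(flow_add _ _ _ fl) addrC.
have [st|ts] := leP t s; first by apply: sp; rewrite subr_ge0.
have := ht (t - s); rewrite /rev opprB; apply; apply/andP; split; lra.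
Qed.

Lemma incoming_not_back e w : char_vector P Q e -> alpha P Q e < 0 ->
  wedge e w = 0 -> 0 < dot e w -> ~ stays (rev phi) N w.
Proof.
move=> ce a0 ww dw sw; have [e1 _] := ce.
have an : 0 < - alpha P Q e by rewrite oppr_gt0.
apply: (ray_escape (flow_box_rev fb) homNX NX0 e1 (NXe ce) an ww dw) => t /sw.
by move/NM/ltW.
Qed.

Lemma exit_side e p w : char_vector P Q e -> exits_at phi N p w ->
  0 < wedge e p -> 0 < wedge e w.
Proof.
move=> ce [t [t0 <- ht _]]; have [e1 _] := ce.
apply: (wedge_keep fb homX e1 (vfield_char ce) t0 _).2 => s /ht.
by move/NM/ltW.
Qed.

Lemma exit_side_opp e p w : char_vector P Q e -> exits_at phi N p w ->
  wedge e p < 0 -> wedge e w < 0.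
Proof.
have opp u : wedge (- e.1, - e.2) u = - wedge e u by rewrite /wedge/=; ring.
move=> ce pw; rewrite -oppr_gt0 -opp => /(exit_side (char_vectorN V ce) pw).
by rewrite opp oppr_gt0.
Qed.

(** Two points of the orbit of [q], just inside and just outside [N], are shifted across the ray to
    the side given by [sg]. The segment between them crosses the boundary on that side, and density
    provides nearby an entry point whose orbit leaves [N]. *)
Lemma entry_beside e q sg d : char_vector P Q e -> entry phi N q -> stays phi N q ->
  wedge e q = 0 -> sg ^+ 2 = 1 -> 0 < d ->
  exists p, [/\ entry phi N p, ~ stays phi N p, `|p - q| < d & 0 < sg * wedge e p].
Proof.
move=> ce eq sq wq sg1 d0; have [e1 _] := ce.
have [r r0 hr] := entry_transversal B eq (stays_exitN sq).
have bq : bdry N q by case: eq.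
have qM : 0 < M - `|q| by rewrite subr_gt0 (NM (bdry_in bq)).
have [|h1 h2] := hr q bq; first by rewrite subrr normr0.
have [m [m0 mr md]] : exists m, [/\ 0 < m, m <= r & m <= d].
  by exists (Num.min r d); rewrite lt_min r0 !ge_min !lexx orbT.
have [x [x0 xm xM]] : exists x, [/\ 0 < x, x <= m / 4 & x <= M - `|q|].
  by exists (Num.min (m / 4) (M - `|q|)); rewrite lt_min divr_gt0// qM !ge_min !lexx orbT.
have [d1 d10 k1] := flow_near_time q 0 fl x0.
have [s [s0 sd sm]] : exists s, [/\ 0 < s, s < d1 & s < m].
  exists (Num.min d1 m / 2).
  have : [/\ 0 < Num.min d1 m, Num.min d1 m <= d1 & Num.min d1 m <= m].
    by rewrite lt_min d10 m0 !ge_min !lexx orbT.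
  by move: (Num.min d1 m) => y [? ? ?]; split; lra.
have near (u : R) : `|u| < d1 -> `|phi q u - q| < x.
  by move=> ud; have := k1 u; rewrite subr0 (flow_start fl); apply.
have NA : N (phi q s) by apply: h1; rewrite s0; lra.
have nA : ~ bdry N (phi q s).
  apply: (@inside_notbdry _ _ _ _ _ _ _ B q (s + 1)); last by rewrite s0; lra.
  by move=> u /andP[u0 _]; apply: sq.
have nNB : ~ N (phi q (- s)) by apply: h2; rewrite oppr_lt0 s0 ltrN2; lra.
have [rA rA0 hA] := notbdry_interior cN NA nA.
have [rB rB0 hB] := domain_closed cN nNB.
have [h [h0 hm hA' hB']] : exists h, [/\ 0 < h, h <= m / 8, h < rA & h < rB].
  exists (Num.min (m / 4) (Num.min rA rB) / 2).
  have : [/\ 0 < Num.min (m / 4) (Num.min rA rB), Num.min (m / 4) (Num.min rA rB) <= m / 4,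
     Num.min (m / 4) (Num.min rA rB) <= rA & Num.min (m / 4) (Num.min rA rB) <= rB].
    by rewrite !lt_min divr_gt0// rA0 rB0 !ge_min !lexx !orbT.
  by move: (Num.min _ (Num.min _ _)) => y [? ? ? ?]; split; lra.
have sgn : `|sg| = 1.
  by apply/eqP; rewrite -(@eqrXn2 _ 2)// expr1n real_normK ?num_real// sg1.
have [k2 k3] := unit_le1 e1.
(* The shift, orthogonal to [e]: it changes [wedge e] by exactly [sg * h]. *)
pose o : R * R := (- (sg * h * e.2), sg * h * e.1).
have oh : `|o| <= h.
  by rewrite plane_norm_le/= normrN !normrM sgn mul1r (gtr0_norm h0) !ler_piMr// ltW.
have wo : wedge e o = sg * h.
  have -> : wedge e o = sg * h * (e.1 ^+ 2 + e.2 ^+ 2) by rewrite /wedge/=; ring.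
  by rewrite e1 mulr1.
have Na : N (phi q s + o).
  by apply: hA; rewrite addrC addKr; exact: le_lt_trans oh hA'.
have Nb : ~ N (phi q (- s) + o).
  by apply: hB; rewrite addrC addKr; exact: le_lt_trans oh hB'.
have [t /andP[t0 t1]] := segment_bdry cN Na Nb.
set z := (_, _) => bz.
have wA : wedge e (phi q s) = 0.
  apply: (wedge_keep fb homX e1 (vfield_char ce) (ltW s0) _).1 => // u /andP[u0 _].
  exact/ltW/NM/sq.
have wB : wedge e (phi q (- s)) = 0.
  apply: (wedge_keep (flow_box_rev fb) homNX e1 (NXe ce) (ltW s0) _).1 => // u /andP[u0 us].
  have {}us : `|- u| < d1 by rewrite normrN ger0_norm// (le_lt_trans us).
  have := near _ us; have := ler_normD (phi q (- u) - q) q; rewrite subrK /rev; lra.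
have wz : wedge e z = sg * h.
  have -> : wedge e z = (1 - t) * (wedge e (phi q s) + wedge e o) +
     t * (wedge e (phi q (- s)) + wedge e o) by rewrite /z /wedge/=; ring.
  rewrite wA wB wo; ring.
have zq : `|z - q| < m / 2.
  have a1 : `|phi q s - q| < x by apply: near; rewrite gtr0_norm.
  have b1 : `|phi q (- s) - q| < x by apply: near; rewrite normrN gtr0_norm.
  apply: (segment_near _ a1 b1 oh); [by rewrite t0|lra].
have ez : entry phi N z.
  split => //; exists r => //; apply: (hr z bz _).2; lra.
have mh : 0 < Num.min (h / 2) (m / 2) by rewrite lt_min !divr_gt0.
have [p [ep np]] := not_stays_dense B ext uniq ez mh; rewrite lt_min => /andP[p1 p2].
exists p; split => //.
  by have := ler_normD (p - z) (z - q); rewrite addrA subrK; lra.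
have := wedge_le (p - z) e1; rewrite wedgeB wz => w1.
have -> : sg * wedge e p = sg * (wedge e p - sg * h) + sg ^+ 2 * h by ring.
rewrite sg1 mul1r -ltrBlDr sub0r.
have : `|sg * (wedge e p - sg * h)| < h by rewrite normrM sgn mul1r; lra.
by rewrite ltr_norml => /andP[].
Qed.

(* Both sides of the incoming ray carry entry points whose orbits leave N; these
   orbits do not cross the two invariant lines, so f q is on the same ray. *)
Lemma two_lines e e' : char_vector P Q e -> char_vector P Q e' ->
  alpha P Q e < 0 -> wedge e e' != 0 -> False.
Proof.
move=> ce ce' a0 we; have [cf fx fe] := ext; have [e1 _] := ce; have [e1' _] := ce'.
have [q [eq sq wq dq]] := incoming_entry ce a0.
have bq : bdry N q by case: eq.
have qE : q = (dot e q * e.1, dot e q * e.2).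
  by rewrite {1}(frameE q e1) wq !mul0r subr0 addr0.
have sfq : stays (rev phi) N (f q).
  apply: (limit_stays_back B ext eq sq) => d d0.
  have [p [? ? ? _]] := entry_beside ce eq sq wq (expr1n _ 2) d0; by exists p.
(* Entry points on either side of the ray have their exit points on the same side, so the limit
   [f q] can lie on neither. *)
have wf : wedge e (f q) = 0.
  apply/eqP/negPn/negP => c0.
  have c1 : 0 < `|wedge e (f q)| / 2 by rewrite divr_gt0// normr_gt0.
  have [d d0 hd] := cf q eq _ c1.
  have m1 : (-1 : R) ^+ 2 = 1 by rewrite sqrrN expr1n.
  have close p : `|f p - f q| < `|wedge e (f q)| / 2 ->
      `|wedge e (f p) - wedge e (f q)| < `|wedge e (f q)|.
    by move=> h; have := wedge_le (f p - f q) e1; rewrite wedgeB; lra.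
  have [c|c] := ltP 0 (wedge e (f q)).
    have [p [ep np pq]] := entry_beside ce eq sq wq m1 d0.
    rewrite mulN1r oppr_gt0 => /(exit_side_opp ce (fe p ep np)) h.
    by have := close p (hd p ep pq); rewrite (gtr0_norm c) ltr_norml => /andP[]; lra.
  have {}c : wedge e (f q) < 0 by rewrite lt_neqAle c0.
  have [p [ep np pq]] := entry_beside ce eq sq wq (expr1n _ 2) d0.
  rewrite mul1r => /(exit_side ce (fe p ep np)) h.
  by have := close p (hd p ep pq); rewrite (ltr0_norm c) ltr_norml => /andP[]; lra.
have fE : f q = (dot e (f q) * e.1, dot e (f q) * e.2).
  by rewrite {1}(frameE (f q) e1) wf !mul0r subr0 addr0.
have we' : wedge e' e != 0.
  have -> : wedge e' e = - wedge e e' by rewrite /wedge; ring.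
  by rewrite oppr_eq0.
have wqE : wedge e' q = dot e q * wedge e' e by rewrite {1}qE wedgeZr.
have wfE : wedge e' (f q) = dot e (f q) * wedge e' e by rewrite {1}fE wedgeZr.
(* Entry points near [q] are strictly on one side of the second line, and their orbits do not cross
   it. *)
have same : 0 <= wedge e' q * wedge e' (f q).
  rewrite leNgt; apply/negP => neg.
  have q0 : wedge e' q != 0 by apply: contraTneq neg => ->; rewrite mul0r ltxx.
  have f0 : wedge e' (f q) != 0 by apply: contraTneq neg => ->; rewrite mulr0 ltxx.
  have c1 : 0 < `|wedge e' (f q)| / 2 by rewrite divr_gt0// normr_gt0.
  have c2 : 0 < `|wedge e' q| / 2 by rewrite divr_gt0// normr_gt0.
  have [d d0 hd] := cf q eq _ c1.
  have m0 : 0 < Num.min d (`|wedge e' q| / 2) by rewrite lt_min d0.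
  have [p [ep np]] := not_stays_dense B ext uniq eq m0.
  rewrite lt_min => /andP[/(hd p ep) p1 p2].
  have w1 := wedge_le (f p - f q) e1'; rewrite wedgeB in w1.
  have w2 := wedge_le (p - q) e1'; rewrite wedgeB in w2.
  have := exit_side ce' (fe p ep np); have := exit_side_opp ce' (fe p ep np).
  have [c|c] := ltP 0 (wedge e' q).
    have c' : wedge e' (f q) < 0 by rewrite -(pmulr_rlt0 _ c).
    rewrite (gtr0_norm c) in p2; rewrite (ltr0_norm c') in p1.
    move=> _ h; have {h} h : 0 < wedge e' (f p).
      by apply: h; move: w2; rewrite ler_norml => /andP[]; lra.
    by move: w1; rewrite ler_norml => /andP[]; lra.
  have {}c : wedge e' q < 0 by rewrite lt_neqAle q0.
  have c' : 0 < wedge e' (f q) by rewrite -(nmulr_rlt0 _ c).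
  rewrite (ltr0_norm c) in p2; rewrite (gtr0_norm c') in p1.
  move=> h _; have {h} h : wedge e' (f p) < 0.
    by apply: h; move: w2; rewrite ler_norml => /andP[]; lra.
  by move: w1; rewrite ler_norml => /andP[]; lra.
(* The value 0 would place the boundary point [f q] at the origin, which is interior to [N]. *)
have df : 0 < dot e (f q).
  have : 0 <= dot e (f q).
    move: same; rewrite wqE wfE.
    have -> : dot e q * wedge e' e * (dot e (f q) * wedge e' e) =
      dot e q * wedge e' e ^+ 2 * dot e (f q) by ring.
    by rewrite pmulr_rge0// mulr_gt0// exprn_even_gt0.
  rewrite le_eqVlt => /orP[/eqP d0|//].
  have [/(bdry_in) _ _] := fx q eq.
  have bf : bdry N (f q) by case: (fx q eq).
  have [rr rr0 [_ hrr]] := block_origin.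
  exfalso; apply: (interior_notbdry rr0 _ bf) => u.
  rewrite fE -d0 !mul0r (_ : u - (0, 0) = u); first exact: hrr.
  by rewrite [u]surjective_pairing; congr (_, _); rewrite /= subr0.
exact: incoming_not_back ce a0 wf df sfq.
Qed.

End Data.
End ForwardCases.

(* If [alpha > 0] at all characteristic vectors, they are all saddles with
   [kappa < 0], which cannot happen at consecutive zeros of D. *)
Lemma char_vectors_parallel (R : realType) (n : nat) (P Q : {poly {poly R}}) :
  Vhom n P Q ->
  (forall e, char_vector P Q e -> alpha P Q e * kappa P Q e < 0) ->
  (forall e e', char_vector P Q e -> char_vector P Q e' -> alpha P Q e < 0 ->
     wedge e e' != 0 -> False) ->
  forall e e' : R * R, char_vector P Q e -> char_vector P Q e' ->
  wedge e e' = 0.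
Proof.
move=> V saddle two_lines e e'.
suff pos e1 e2 : char_vector P Q e1 -> char_vector P Q e2 -> ~ 0 < wedge e1 e2.
  move=> ce ce'; apply/eqP/negPn/negP => w0.
  have [w|w] := ltP 0 (wedge e e'); first exact: pos ce ce' w.
  apply: (pos _ _ ce (char_vectorN V ce')).
  have -> : wedge e (- e'.1, - e'.2) = - wedge e e' by rewrite /wedge/=; ring.
  by rewrite oppr_gt0 lt_neqAle w0.
move=> {e e'}; move: e1 e2 => e e' ce ce' w.
have [|pos] := pselect (exists2 e2, char_vector P Q e2 & alpha P Q e2 < 0).
  move=> [e2 c2 a2]; have [u2 _] := c2.
  have [w2|w2] := eqVneq (wedge e2 e) 0; last exact: two_lines c2 ce a2 w2.
  have [w3|w3] := eqVneq (wedge e2 e') 0; last exact: two_lines c2 ce' a2 w3.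
  by move: w; rewrite (wedge_frame _ _ u2) w2 w3 mulr0 mul0r subr0 ltxx.
have kn e2 : char_vector P Q e2 -> kappa P Q e2 < 0.
  move=> c2; have := saddle _ c2; rewrite pmulr_rlt0//.
  rewrite lt_neqAle eq_sym (alpha_neq0 V c2) leNgt/=; apply/negP => a2.
  by apply: pos; exists e2.
(* D is followed along the segment from [e] to [e']. As [wedge u v = wedge e e' > 0] at each of its
   points [u], the segment avoids the origin and crosses every ray in the same sense, so [kappa < 0]
   means that D falls at each zero. *)
pose v := (e'.1 - e.1, e'.2 - e.2).
pose m (s : R) := dirD P Q (e.1 + s * v.1, e.2 + s * v.2).
have [_ D1] := ce; have [_ D2] := ce'.
apply: (@no_two_falling_zeros _ m).
- move=> s; have -> : m = fun s => (directional_poly P Q).[e.1 + s * v.1, e.2 + s * v.2].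
    by apply/funext => t; rewrite directional_polyE.
  apply: is_derive_continuous; apply: is_derive_horner2.
- by rewrite /m !mul0r !addr0 -surjective_pairing.
- by rewrite /m !mul1r /= !subrKC -surjective_pairing.
move=> s s01 ms.
pose u := (e.1 + s * v.1, e.2 + s * v.2).
have wu : wedge u v = wedge e e' by rewrite /wedge /u /v /=; ring.
have u2 : 0 < u.1 ^+ 2 + u.2 ^+ 2.
  rewrite lt_neqAle eq_sym addr_ge0 ?sqr_ge0// andbT paddr_eq0 ?sqr_ge0//.
  apply/negP => /andP[]; rewrite !sqrf_eq0 => /eqP a /eqP b.
  by move: w; rewrite -wu /wedge a b !mul0r subr0 ltxx.
pose l := Num.sqrt (u.1 ^+ 2 + u.2 ^+ 2).
have l0 : 0 < l by rewrite sqrtr_gt0.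
have lE : l ^+ 2 = u.1 ^+ 2 + u.2 ^+ 2 by rewrite sqr_sqrtr// ltW.
pose e2 := (l^-1 * u.1, l^-1 * u.2).
have c2 : char_vector P Q e2.
  have Du : dirD P Q u = 0 by [].
  split; last by rewrite (dirDZ V l^-1 u) Du mulr0.
  by rewrite [e2.1]/= [e2.2]/= !exprMn -mulrDr -lE -exprMn mulVf ?expr1n// gt_eqF.
have uE : u = (l * e2.1, l * e2.2).
  by rewrite /= !mulrA divff ?gt_eqF// !mul1r.
exists (l ^+ n * kappa P Q e2 * (e2.1 * v.2 - e2.2 * v.1)).
  have -> : e2.1 * v.2 - e2.2 * v.1 = l^-1 * wedge u v by rewrite /wedge /=; ring.
  rewrite wu nmulr_rlt0 ?mulr_gt0 ?invr_gt0// pmulr_rlt0 ?exprn_gt0//; exact: kn.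
have := is_derive_dirD_char V v c2 (lt0r_neq0 l0).
rewrite -[X in is_derive X](addNr s) => /is_derive_comp_shift.
rewrite (_ : (fun _ => _) = m)//; apply/funext => t.
have [uE1 uE2] : u.1 = l * e2.1 /\ u.2 = l * e2.2 by split; rewrite {1}uE.
rewrite -uE1 -uE2 /m /u /=; congr (dirD P Q (_, _)); ring.
Qed.

(** * Potentials homogeneous of degree one *)

Section NormDerivatives.
Variable R : realType.
Implicit Types (x a b : R) (f g : R -> R).

Lemma is_derive_norm x : x != 0 -> is_derive x 1 (fun y : R => `|y|) (Num.sg x).
Proof.
move=> x0; apply: (@near_eq_is_derive _ _ _ (fun y => Num.sg x * y)).
  have h : 0 < `|x| by rewrite normr_gt0.
  have nb := @near_dist_lt R R^o x `|x| h.
  near=> y.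
  have : `|y - x| < `|x| by near: y; exact: nb.
  have [xp|xn] := ltP 0 x.
    rewrite (gtr0_norm xp) (gtr0_sg xp) ltr_norml mul1r => /andP[h1 _].
    by rewrite gtr0_norm//; lra.
  have {}xn : x < 0 by rewrite lt_neqAle x0.
  rewrite (ltr0_norm xn) (ltr0_sg xn) ltr_norml mulN1r => /andP[_ h1].
  by rewrite ltr0_norm//; lra.
by apply: is_derive_eq; rewrite /GRing.scale/=; ring.
Unshelve. all: by end_near. Qed.

Lemma is_derive_ln_norm x : x != 0 -> is_derive x 1 (fun y : R => ln `|y|) x^-1.
Proof.
move=> x0; have h : 0 < `|x| by rewrite normr_gt0.
have := is_derive1_comp (is_derive1_ln h) (is_derive_norm x0).
have -> // : `|x|^-1 * Num.sg x = x^-1.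
have [xp|xn] := ltP 0 x; first by rewrite gtr0_norm// gtr0_sg// mulr1.
by rewrite ltr0_norm ?ltr0_sg ?lt_neqAle ?x0//= mulrN1 invrN opprK.
Qed.

Lemma is_derive_inv x : x != 0 -> is_derive x 1 (fun y : R => y^-1) (- x ^- 2).
Proof.
move=> x0; have := is_deriveV x0 (is_derive_id x (1 : R)).
by rewrite /GRing.scale/= mulr1.
Qed.

Lemma nonvanishing_same_sign f a b : continuous f -> (forall x, f x != 0) ->
  0 < f a * f b.
Proof.
move=> cf f0; wlog ab : a b / a <= b.
  by move=> w; have [/w//|/ltW/w] := leP a b; rewrite mulrC.
rewrite lt_neqAle eq_sym mulf_neq0//= leNgt; apply/negP => neg.
have [||c _ fc] := @IVT _ f a b 0 ab.
- exact: continuous_subspaceT.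
- have [fa|fa] := ltP 0 (f a).
    have fb : f b < 0 by rewrite -(pmulr_rlt0 _ fa).
    by rewrite ge_min le_max (ltW fa) (ltW fb) orbT.
  have {}fa : f a < 0 by rewrite lt_neqAle fa f0.
  have fb : 0 < f b by rewrite -(nmulr_rlt0 _ fa).
  by rewrite ge_min le_max (ltW fa) (ltW fb) orbT.
by have := f0 c; rewrite fc eqxx.
Qed.

End NormDerivatives.

Section LogPotential.
Variable R : realType.
Variables (l' m' : R -> R).
Hypotheses (cl : continuous l') (cm : continuous m').
Hypothesis glue : forall t : R, t != 0 -> m' t = t^-1 - l' t^-1 / t ^+ 2.

(* [l' dx] and [m' dt] are the two expressions of a 1-form on the projective line,
   up to [d ln |t|]; subtracting a multiple of the angular form makes it exact. *)
Lemma log_potential : exists (c : R) (l m : R -> R),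
  [/\ forall x : R, is_derive x 1 l (l' x + c / (1 + x ^+ 2)),
      forall t : R, is_derive t 1 m (m' t - c / (1 + t ^+ 2)) &
      forall x y : R, x != 0 -> y != 0 -> ln `|y| + l (x / y) = ln `|x| + m (y / x)].
Proof.
have [l l0 dl] := antiderivative cl; have [m m0 dm] := antiderivative cm.
pose K t := m t - ln `|t| - l t^-1; pose A t := atan t + atan t^-1 : R.
have dK (t : R) : t != 0 -> is_derive t 1 K 0.
  move=> t0; have h1 := is_derive1_comp (dl t^-1) (is_derive_inv t0).
  have h2 := is_derive_ln_norm t0; have h3 := dm t.
  by apply: is_derive_eq; rewrite glue//; field.
have dA (t : R) : t != 0 -> is_derive t 1 A 0.
  move=> t0; have h1 := is_derive1_comp (is_derive1_atan t^-1) (is_derive_inv t0).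
  have h3 := is_derive1_atan t.
  apply: is_derive_eq; have : 1 + t ^+ 2 != 0 by rewrite gt_eqF// ltr_pwDl// sqr_ge0.
  have -> : 1 + t^-1 ^+ 2 = (1 + t ^+ 2) / t ^+ 2 by field.
  by move=> p; field; rewrite p t0.
have const (f : R -> R) (t : R) : (forall x : R, x != 0 -> is_derive x 1 f 0) -> t != 0 ->
    f t = if 0 < t then f 1 else f (- 1).
  move=> df t0; have [tp|tn] := ltP 0 t.
    have [t1|t1] := leP t 1.
      by apply: (is_derive0_eq t1) => x /andP[x1 _]; apply: df; rewrite gt_eqF// (lt_le_trans tp).
    by apply/esym/(is_derive0_eq (ltW t1)) => x /andP[x1 _]; apply: df; rewrite gt_eqF// (lt_le_trans ltr01).
  have {}tn : t < 0 by rewrite lt_neqAle t0.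
  have [t1|t1] := leP t (-1).
    by apply: (is_derive0_eq t1) => x /andP[_ x1]; apply: df; rewrite lt_eqF//; lra.
  by apply/esym/(is_derive0_eq (ltW t1)) => x /andP[_ x1]; apply: df; rewrite lt_eqF//; lra.
have a1 : 0 < atan (1 : R).
  have <- : atan (0 : R) = 0 by have := @atanN R 0; rewrite oppr0; lra.
  apply: (@gt0_is_derive_lt _ atan (fun x => (1 + x ^+ 2)^-1)) => // x _.
  by rewrite invr_gt0 ltr_pwDl// sqr_ge0.
have A1 : A 1 = 2 * atan 1 by rewrite /A invr1; ring.
have AN1 : A (-1) = - (2 * atan 1) by rewrite /A invrN1 atanN; ring.
(* [K] and [A] are constant on each half-line. The jump of [A] across 0 is [4 * atan 1], so [c]
   cancels the jump of [K], and [k] is the common value of [K - c A]. *)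
pose c := (K 1 - K (-1)) / (4 * atan 1); pose k := (K 1 + K (-1)) / 2.
exists c, (fun x => l x + c * atan x + k), (fun t => m t - c * atan t); split.
- move=> x; have h1 := dl x; have h2 := is_derive1_atan x.
  by apply: is_derive_eq; rewrite /GRing.scale/=; ring.
- move=> x; have h1 := dm x; have h2 := is_derive1_atan x.
  by apply: is_derive_eq; rewrite /GRing.scale/=; ring.
move=> x y x0 y0; have t0 : y / x != 0 by rewrite mulf_neq0// invr_neq0.
have hK := const K _ dK t0; have hA := const A _ dA t0.
have : K (y / x) - c * A (y / x) = k.
  by rewrite hK hA; case: ifP => _; rewrite ?A1 ?AN1 /c /k; field; exact: lt0r_neq0.
rewrite /K /A invf_div normrM normfV lnM ?posrE ?invr_gt0 ?normr_gt0//.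
by rewrite lnV ?posrE ?normr_gt0//; lra.
Qed.

End LogPotential.

Section Potential.
Variable R : realType.
Variables (l l' m m' : R -> R).
Hypotheses (dl : forall x : R, is_derive x 1 l (l' x)) (dm : forall x : R, is_derive x 1 m (m' x)).
Hypothesis glue : forall x y : R, x != 0 -> y != 0 ->
  ln `|y| + l (x / y) = ln `|x| + m (y / x).
Implicit Types (u v : R * R) (a t : R).

(** One expression for each affine chart of the projective line of directions; [glue] says that they
    agree where both make sense. *)
Definition potential u : R :=
  if u.2 == 0 then `|u.1| * expR (m 0) else `|u.2| * expR (l (u.1 / u.2)).

Lemma potential2 u : u.2 != 0 -> potential u = `|u.2| * expR (l (u.1 / u.2)).
Proof. by rewrite /potential => /negPf ->. Qed.

Lemma potential1 u : u.1 != 0 -> potential u = `|u.1| * expR (m (u.2 / u.1)).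
Proof.
move=> u1; rewrite /potential; have [->|u2] := eqVneq u.2 0; first by rewrite mul0r.
have p1 : 0 < `|u.1| by rewrite normr_gt0.
have p2 : 0 < `|u.2| by rewrite normr_gt0.
by rewrite -{1}(lnK p2) -{1}(lnK p1) -!expRD glue.
Qed.

Lemma potential0 : potential (0, 0) = 0.
Proof. by rewrite /potential eqxx normr0 mul0r. Qed.

Lemma plane_neq0 u : (u != (0, 0)) = (u.1 != 0) || (u.2 != 0).
Proof. by rewrite -negb_and. Qed.

Lemma potential_gt0 u : u != (0, 0) -> 0 < potential u.
Proof.
rewrite plane_neq0 /potential; have [_|u2 _] := eqVneq u.2 0.
  by rewrite orbF => u1; rewrite mulr_gt0 ?normr_gt0// expR_gt0.
by rewrite mulr_gt0 ?normr_gt0// expR_gt0.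
Qed.

Lemma potentialZ a u : potential (a * u.1, a * u.2) = `|a| * potential u.
Proof.
have [->|a0] := eqVneq a 0; first by rewrite !mul0r potential0 normr0 mul0r.
rewrite /potential/= mulf_eq0 (negPf a0)/=; case: eqVneq => u2.
  by rewrite normrM mulrA.
have -> : a * u.1 / (a * u.2) = u.1 / u.2 by field; rewrite ?a0 ?u2.
by rewrite normrM mulrA.
Qed.

(** In one of the two charts the slope is at most 1 in absolute value, and there the exponent is
    bounded by compactness. *)
Lemma potential_bounds : exists2 k, 0 < k &
  forall u, k * `|u| <= potential u /\ k * potential u <= `|u|.
Proof.
have bd (f f' : R -> R) : (forall x : R, is_derive x (1 : R) f (f' x)) ->
    exists2 K, 0 <= K & forall x : R, `|x| <= 1 -> `|f x| <= K.
  move=> df; have cf : continuous (fun x => `|f x|).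
    by move=> x; apply: cvg_norm; exact: is_derive_continuous (df x).
  have [|c _ hc] := @EVT_max _ (fun x => `|f x|) (-1) 1 ltac:(lra).
    exact: continuous_subspaceT.
  by exists `|f c| => // x x1; apply: hc; rewrite in_itv/= -ler_norml.
have [K1 K10 hl] := bd _ _ dl; have [K2 K20 hm] := bd _ _ dm.
have eb (K y : R) : `|y| <= K -> expR (- (K1 + K2)) <= expR (- K) ->
    expR (- (K1 + K2)) <= expR y /\ expR (- (K1 + K2)) * expR y <= 1.
  move=> /ler_normlP[y1 y2]; rewrite !ler_expR => yK.
  by rewrite -expRD -expR0 !ler_expR; split; lra.
exists (expR (- (K1 + K2))); first exact: expR_gt0.
have main (x y : R) : expR (- (K1 + K2)) <= expR y /\ expR (- (K1 + K2)) * expR y <= 1 ->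
    expR (- (K1 + K2)) * `|x| <= `|x| * expR y /\
    expR (- (K1 + K2)) * (`|x| * expR y) <= `|x|.
  move=> [h1 h2]; split; first by rewrite mulrC ler_wpM2l.
  by rewrite mulrCA -[leRHS]mulr1 ler_wpM2l.
move=> u; have [h|h] := leP `|u.1| `|u.2|.
  have uE : `|u| = `|u.2|.
    by apply/eqP; rewrite eq_le plane_norm_snd plane_norm_le h lexx.
  rewrite uE; have [u2|u2] := eqVneq u.2 0.
    have u1 : u.1 = 0 by apply/eqP; rewrite -normr_le0 (le_trans h)// u2 normr0.
    by rewrite (surjective_pairing u) u1 u2 potential0 normr0 !mulr0 lexx.
  rewrite potential2//; apply: main; apply: (eb K1).
    by apply: hl; rewrite normrM normfV ler_pdivrMr ?normr_gt0// mul1r.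
  by rewrite ler_expR; lra.
have u1 : u.1 != 0 by rewrite -normr_gt0; apply: le_lt_trans h.
have uE : `|u| = `|u.1|.
  by apply/eqP; rewrite eq_le plane_norm_fst plane_norm_le lexx ltW.
rewrite uE potential1//; apply: main; apply: (eb K2).
  by apply: hm; rewrite normrM normfV ler_pdivrMr ?normr_gt0// mul1r ltW.
by rewrite ler_expR; lra.
Qed.

Lemma is_derive_norm_exp (f g : R -> R) (h h' : R -> R) t df dg :
  (forall x : R, is_derive x 1 h (h' x)) -> f t != 0 ->
  is_derive t 1 f df -> is_derive t 1 g dg ->
  is_derive t 1 (fun s => `|f s| * expR (h (g s / f s)))
    (`|f t| * expR (h (g t / f t)) *
     (df / f t + h' (g t / f t) * (dg * f t - g t * df) / f t ^+ 2)).
Proof.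
move=> dh f0 Df Dg.
have h1 := is_derive1_comp (is_derive_norm f0) Df.
pose q s := g s / f s.
have h2 : is_derive t 1 q ((dg * f t - g t * df) / f t ^+ 2).
  have hi := is_derive1_comp (is_derive_inv f0) Df.
  by apply: is_derive_eq; rewrite /GRing.scale/=; field.
have h3 := is_derive1_comp (dh (q t)) h2.
have h4 := is_derive1_comp (is_derive_expR _) h3.
have -> : (fun s => `|f s| * expR (h (g s / f s))) =
  ((fun y => `|y|) \o f) * (expR \o (h \o q)) by [].
apply: is_derive_eq; rewrite /GRing.scale/= /q.
have -> : Num.sg (f t) = `|f t| / f t by rewrite normrEsg mulrK ?unitfE.
by move: (expR _) (h' _) `|_| => E H S; field.
Qed.

Lemma is_derive_potential2 (g : R -> R * R) t v : (g t).2 != 0 ->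
  is_derive t 1 g v -> is_derive t 1 (potential \o g) (potential (g t) *
    (v.2 / (g t).2 + l' ((g t).1 / (g t).2) * (v.1 * (g t).2 - (g t).1 * v.2) / (g t).2 ^+ 2)).
Proof.
move=> g2 dg; have c := is_derive_continuous (is_derive_snd dg).
have := is_derive_norm_exp dl g2 (is_derive_snd dg) (is_derive_fst dg).
rewrite potential2//; apply: near_eq_is_derive.
have nb := cvgr_neq0 _ c g2.
by near=> s; rewrite /= potential2//; near: s; exact: nb.
Unshelve. all: by end_near. Qed.

Lemma is_derive_potential1 (g : R -> R * R) t v : (g t).1 != 0 ->
  is_derive t 1 g v -> is_derive t 1 (potential \o g) (potential (g t) *
    (v.1 / (g t).1 + m' ((g t).2 / (g t).1) * (v.2 * (g t).1 - (g t).2 * v.1) / (g t).1 ^+ 2)).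
Proof.
move=> g1 dg; have c := is_derive_continuous (is_derive_fst dg).
have := is_derive_norm_exp dm g1 (is_derive_fst dg) (is_derive_snd dg).
rewrite potential1//; apply: near_eq_is_derive.
have nb := cvgr_neq0 _ c g1.
by near=> s; rewrite /= potential1//; near: s; exact: nb.
Unshelve. all: by end_near. Qed.

End Potential.

Section PotentialTrap.
Variable R : realType.
Variables (n : nat) (Z Y : R * R -> R * R) (M L : R) (phi : R * R -> R -> R * R).
Hypothesis fb : flow_box Z M Y L phi.
Hypothesis Z0 : Z (0, 0) = (0, 0).
Variables (G : R * R -> R) (W : R * R -> R * R -> R) (k : R).
Hypothesis dG : forall g (t : R) v, is_derive t 1 g v -> g t != (0, 0) ->
  is_derive t 1 (G \o g) (W (g t) v).
Hypothesis k0 : 0 < k.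
Hypothesis Gk : forall u, k * `|u| <= G u.
Hypothesis W0 : forall u, u != (0, 0) -> W u (Z u) <= 0.
Implicit Types (p u : R * R) (s t : R).

Let fl : is_flow Y L phi. Proof. by case: fb. Qed.

(** [G] is a Lyapunov function: it does not increase along the orbit, and [G u < k * r] forces
    [|u| < r]. *)
Lemma potential_trap N r p : 0 < r -> r <= M -> (forall u, `|u| < r -> N u) ->
  p != (0, 0) -> G p < k * r -> stays phi N p.
Proof.
move=> r0 rM rN pn Gp; have M0 : 0 < M by exact: lt_le_trans rM.
have [_ _ YZ] := fb.
have small u : G u < k * r -> `|u| < r.
  by move=> Gu; rewrite -(ltr_pM2l k0) (le_lt_trans (Gk u)).
suff h t : 0 <= t -> `|phi p t| < r by move=> t t0; apply/rN/h.
apply: (@flow_trap _ Y L phi (fun u => `|u| < r)) => //.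
- move=> u ur; exists (r - `|u|); first by rewrite subr_gt0.
  by move=> v vu; have := ler_normD (v - u) u; rewrite subrK; lra.
- exact: small.
move=> {}t t0 ht; apply: small.
have tr : `|phi p t| <= r.
  rewrite -subr_ge0; apply: (@ge0_right_end _ (fun s => r - `|phi p s|) t t0).
    by apply: cvgB; [exact: cvg_cst|apply: cvg_norm; exact: (flow_cont fl)].
  by move=> s st; rewrite subr_ge0 ltW// ht.
apply: le_lt_trans Gp; rewrite -[X in _ <= G X](flow_start fl p).
apply: (@le0_is_derive_ge _ (G \o phi p) (fun s => W (phi p s) (Y (phi p s))) 0 t (ltW t0)).
  move=> s _; apply: dG; first exact: (flow_derive fl).
  exact: (flow_neq0 fb M0 Z0).
move=> s /andP[s0 st]; have [st'|ts] := ltP s t.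
  rewrite YZ ?W0//; first exact: (flow_neq0 fb M0 Z0).
  by rewrite (le_trans _ rM)// ltW// ht// s0 st'.
have -> : s = t by apply/eqP; rewrite eq_le st.
rewrite YZ ?W0//; first exact: (flow_neq0 fb M0 Z0).
exact: le_trans rM.
Qed.

End PotentialTrap.

(** * Fields without characteristic direction *)

Section NoDirection.
Variable R : realType.
Variables (n : nat) (P Q : {poly {poly R}}).
Hypothesis V : Vhom n P Q.
Hypothesis D0 : forall u, u != (0, 0) -> dirD P Q u != 0.
Implicit Types (p q u v w : R * R) (s t d : R).

Let X := vfield P Q.
Let D := dirD P Q.

Lemma continuous_horner2 (F : {poly {poly R}}) (f g : R -> R) df dg t :
  is_derive t 1 f df -> is_derive t 1 g dg ->
  {for t, continuous (fun s => F.[f s, g s])}.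
Proof. by move=> df' dg'; apply: is_derive_continuous (is_derive_horner2 F df' dg'). Qed.

Lemma dirD_continuous1 : continuous (fun t => D (1, t)).
Proof.
move=> t; rewrite (_ : (fun t => D (1, t)) = fun t => (directional_poly P Q).[1, t]).
  exact: continuous_horner2 (is_derive_cst _ _ _) (is_derive_id _ _).
by apply/funext => s; rewrite directional_polyE.
Qed.

Lemma dirD_continuous2 : continuous (fun t => D (t, 1)).
Proof.
move=> t; rewrite (_ : (fun t => D (t, 1)) = fun t => (directional_poly P Q).[t, 1]).
  exact: continuous_horner2 (is_derive_id _ _) (is_derive_cst _ _ _).
by apply/funext => s; rewrite directional_polyE.
Qed.

(** D has constant sign on each of the lines [x = 1] and [y = 1], which meet at [(1, 1)]. Hence D
    has equal signs at [(1, -1)] and [(-1, 1)], its degree [n + 1] is even, and homogeneity covers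
    the rest of the plane. *)
Lemma dirD_same_sign : exists2 sg, sg != 0 & forall u, u != (0, 0) -> 0 < sg * D u.
Proof.
have c1 := dirD_continuous1; have c2 := dirD_continuous2.
have n1 t : D (1, t) != 0 by apply: D0; rewrite plane_neq0/= oner_eq0.
have n2 t : D (t, 1) != 0 by apply: D0; rewrite plane_neq0/= oner_eq0 orbT.
have s1 a b := nonvanishing_same_sign a b c1 n1.
have s2 a b := nonvanishing_same_sign a b c2 n2.
have DZ a u : D (a * u.1, a * u.2) = a ^+ n.+1 * D u by exact: dirDZ V a u.
have ev : 0 < (-1) ^+ n.+1 :> R.
  have := DZ (-1) (1, -1); rewrite /= !mulN1r opprK => e.
  have := s1 1 (-1); have := s2 1 (-1); rewrite /= e => h1 h2.
  have h3 : 0 < (-1) ^+ n.+1 * (D (1, 1) * D (1, -1)) by rewrite mulrCA.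
  by rewrite -(pmulr_lgt0 _ h2).
have evx (x : R) : x != 0 -> 0 < x ^+ n.+1.
  move=> x0; have [xp|xn] := ltP 0 x; first exact: exprn_gt0.
  have {}xn : x < 0 by rewrite lt_neqAle x0 xn.
  by rewrite -[x]opprK -mulN1r exprMn mulr_gt0// exprn_gt0// oppr_gt0.
exists (D (1, 1)); first exact: n1.
move=> u; rewrite plane_neq0; have [u1|u1] := eqVneq u.1 0; last first.
  move=> _; have -> : u = (u.1 * 1, u.1 * (u.2 / u.1)).
    by rewrite mulr1 mulrC divfK// -surjective_pairing.
  by rewrite (DZ _ (1, _)) mulrCA mulr_gt0// evx.
rewrite /= => u2; have -> : u = (u.2 * 0, u.2 * 1).
  by rewrite mulr1 mulr0 -u1 -surjective_pairing.
by rewrite (DZ _ (0, 1)) mulrCA mulr_gt0// evx.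
Qed.

(* Logarithm of a positive function of degree 1 whose derivative along X is
   [- c D / rho^2]. *)
Lemma spiral_potential : exists (G : R * R -> R) (W : R * R -> R * R -> R) (c k : R),
  [/\ forall g (t : R) v, is_derive t 1 g v -> g t != (0, 0) ->
        is_derive t 1 (G \o g) (W (g t) v),
      0 < k, forall u, k * `|u| <= G u /\ k * G u <= `|u| &
      forall u, u != (0, 0) -> exists2 b, 0 < b &
        forall a, W u (a * (X u).1, a * (X u).2) = - (a * c * b * D u)].
Proof.
(* With these two, [ln |y| + l (x / y)] and [ln |x| + m (y / x)] would be constant along orbits.
   Only the correction by [c] in [log_potential] contributes to the derivative. *)
pose l' x := Q.[x, 1] / D (x, 1); pose m' t := - (P.[1, t] / D (1, t)).
have n1 t : D (1, t) != 0 by apply: D0; rewrite plane_neq0/= oner_eq0.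
have n2 t : D (t, 1) != 0 by apply: D0; rewrite plane_neq0/= oner_eq0 orbT.
have cl : continuous l'.
  move=> x; apply: cvgM; first exact: continuous_horner2 (is_derive_id _ _) (is_derive_cst _ _ _).
  by apply: cvgV; [exact: n2|exact: dirD_continuous2].
have cm : continuous m'.
  move=> t; apply: cvgN.
  apply: cvgM; first exact: continuous_horner2 (is_derive_cst _ _ _) (is_derive_id _ _).
  by apply: cvgV; [exact: n1|exact: dirD_continuous1].
have [homP homQ _ _] := V.
have DZ a u : D (a * u.1, a * u.2) = a ^+ n.+1 * D u by exact: dirDZ V a u.
have scale2 (x y : R) : y != 0 -> [/\ Q.[x, y] = y ^+ n * Q.[x / y, 1],
    P.[x, y] = y ^+ n * P.[x / y, 1] & D (x, y) = y ^+ n.+1 * D (x / y, 1)].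
  move=> y0; have xE : x = y * (x / y) by rewrite mulrC divfK.
  by split; rewrite -?(homogeneousE _ _ _ homQ) -?(homogeneousE _ _ _ homP) -?(DZ _ (_, _)) /= -xE mulr1.
have scale1 (x y : R) : x != 0 -> [/\ Q.[x, y] = x ^+ n * Q.[1, y / x],
    P.[x, y] = x ^+ n * P.[1, y / x] & D (x, y) = x ^+ n.+1 * D (1, y / x)].
  move=> x0; have yE : y = x * (y / x) by rewrite mulrC divfK.
  by split; rewrite -?(homogeneousE _ _ _ homQ) -?(homogeneousE _ _ _ homP) -?(DZ _ (_, _)) /= -yE mulr1.
have glue (t : R) : t != 0 -> m' t = t^-1 - l' t^-1 / t ^+ 2.
  move=> t0; rewrite /m' /l'; have [-> _ ->] := scale1 t^-1 1 (invr_neq0 t0).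
  rewrite div1r invrK; have := n1 t; rewrite /D /dirD/= mul1r => d0.
  by rewrite !exprVn (exprS _ n); field; rewrite ?d0 ?t0 ?expf_neq0.
have [c [l [m [dl dm lm]]]] := log_potential cl cm glue.
have [k k0 hk] := potential_bounds dl dm lm.
pose G := potential l m.
pose W (u v : R * R) := if u.2 == 0 then
    G u * (v.1 / u.1 + (m' (u.2 / u.1) - c / (1 + (u.2 / u.1) ^+ 2)) * (v.2 * u.1 - u.2 * v.1) / u.1 ^+ 2)
  else G u * (v.2 / u.2 + (l' (u.1 / u.2) + c / (1 + (u.1 / u.2) ^+ 2)) * (v.1 * u.2 - u.1 * v.2) / u.2 ^+ 2).
exists G, W, c, k; split => //.
- move=> g t v dg; rewrite plane_neq0 /W; case: (eqVneq (g t).2 0) => [u2|u2 _].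
    by rewrite /= orbF => u1; exact: (is_derive_potential1 dm lm).
  exact: (is_derive_potential2 m dl).
move=> u u0; have Gu : 0 < G u by exact: potential_gt0.
have r0 : 0 < u.1 ^+ 2 + u.2 ^+ 2.
  rewrite lt_neqAle eq_sym addr_ge0 ?sqr_ge0// andbT paddr_eq0 ?sqr_ge0//.
  by rewrite !sqrf_eq0 negb_and -plane_neq0.
exists (G u / (u.1 ^+ 2 + u.2 ^+ 2)); first by rewrite divr_gt0.
have DE : D u = D (u.1, u.2) by rewrite -surjective_pairing.
move=> a; rewrite /W; case: (eqVneq u.2 0) => u2.
  have u1 : u.1 != 0 by move: u0; rewrite plane_neq0 u2 eqxx orbF.
  have [Qe Pe De] := scale1 u.1 u.2 u1; have := n1 (u.2 / u.1).
  rewrite DE De /X /vfield/= Qe Pe /m'.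
  move: (G u) => g; rewrite /D /dirD/= mul1r.
  rewrite u2 !mul0r subr0 expr0n/= !addr0 => d0.
  by rewrite (exprS _ n); field; rewrite d0 u1.
have [Qe Pe De] := scale2 u.1 u.2 u2; have := n2 (u.1 / u.2).
rewrite DE De /X /vfield/= Qe Pe /l'.
have h2 : 1 + (u.1 / u.2) ^+ 2 = (u.1 ^+ 2 + u.2 ^+ 2) / u.2 ^+ 2 by field.
rewrite h2 /D /dirD/= mul1r; move: (G u) (lt0r_neq0 r0) => g r1 d0.
have u1E : u.1 = u.1 / u.2 * u.2 by rewrite divfK.
rewrite (exprS _ n); move: (u.1 / u.2) u1E r1 d0 => x -> r1 d0.
by field; rewrite d0 u2 r1.
Qed.

End NoDirection.

(** * Conclusion of the necessity *)

Section Forward.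
Variable R : realType.
Variables (n : nat) (P Q : {poly {poly R}}).
Hypothesis V : Vhom n P Q.
Implicit Types (u v e p q : R * R).

Let X := vfield P Q.

Lemma char_vector_exists : C0_regularisable X [set (0, 0)] -> exists e, char_vector P Q e.
Proof.
move=> /(regularisable_data (vfield_lipschitz P Q))[N [Y [M [L [phi [f]]]]]].
move=> [B Hmax ext uniq onto].
have [[u u0 Du]|D0] := pselect (exists2 u, u != (0, 0) & dirD P Q u = 0).
  have r0 : 0 < u.1 ^+ 2 + u.2 ^+ 2.
    rewrite lt_neqAle eq_sym addr_ge0 ?sqr_ge0// andbT paddr_eq0 ?sqr_ge0//.
    by rewrite negb_and !sqrf_eq0 -plane_neq0.
  pose l := Num.sqrt (u.1 ^+ 2 + u.2 ^+ 2).
  have l0 : 0 < l by rewrite sqrtr_gt0.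
  exists (l^-1 * u.1, l^-1 * u.2); split; last by rewrite (dirDZ V l^-1 u) Du mulr0.
  by rewrite /= !exprMn -mulrDr -(sqr_sqrtr (ltW r0)) -exprMn mulVf ?expr1n// gt_eqF.
have {}D0 u : u != (0, 0) -> dirD P Q u != 0.
  by move=> u0; apply/eqP => Du; apply: D0; exists u.
exfalso; have [G [W [c [k [dG k0 Gk WX]]]]] := spiral_potential V D0.
have [sg sg0 hsg] := dirD_same_sign V D0.
have [fb _ _ _ _] := B; have [r r0 [rM rN]] := block_origin B Hmax.
(* The ball of radius [h] around [(h, 0)] misses the origin, and its points have norm below [2 * h],
   hence [G < 2 * h / k = k * r / 2]. *)
pose h := k * k * r / 4; have h0 : 0 < h by rewrite divr_gt0// !mulr_gt0.
pose p : R * R := (h, 0).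
have pn : p != (0, 0) by rewrite plane_neq0/= gt_eqF.
have ball q : `|q - p| < h -> q != (0, 0) /\ G q < k * r.
  rewrite plane_norm_lt /= subr0 => /andP[q1 q2]; split.
    rewrite plane_neq0; apply/orP; left; apply/eqP => q0.
    by move: q1; rewrite q0 sub0r normrN gtr0_norm// ltxx.
  have qn : `|q| < 2 * h.
    by rewrite plane_norm_lt; move: q1 q2; rewrite !ltr_norml; lra.
  have [_ Gq] := Gk q; rewrite -(ltr_pM2l k0) (le_lt_trans Gq)// (lt_trans qn)//.
  by rewrite mulrA; move: h0; rewrite /h; lra.
have X0 : X (0, 0) = (0, 0) by case: V => _ _ [].
have X0' : - X (0, 0) = (0, 0) by rewrite X0 [LHS]surjective_pairing/= oppr0.
have cD u : u != (0, 0) -> exists2 a, 0 < a & c * dirD P Q u = c * sg * a.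
  move=> /hsg su; exists (sg * dirD P Q u / sg ^+ 2); last by field.
  by rewrite divr_gt0// exprn_even_gt0.
(* The sign of [c D] decides whether G decreases in forward or in backward time; for [c = 0] it is
   constant, and the forward case applies. *)
have [csg|csg] := leP 0 (c * sg).
  apply: (negP pn); apply/eqP; apply: (no_stable_ball B Hmax ext uniq h0) => q /ball[qn Gq].
  apply: (potential_trap fb X0 dG k0 _ _ r0 rM rN qn Gq); first by move=> u; have [] := Gk u.
  move=> u u0; have [b b0 WE] := WX u u0; have [a a0 ca] := cD u u0.
  have := WE 1; rewrite !mul1r -surjective_pairing => ->.
  by rewrite mulrAC ca oppr_le0; apply: mulr_ge0 (ltW b0); apply: mulr_ge0 (ltW a0).
apply: (negP pn); apply/eqP; apply: (no_unstable_ball B Hmax ext uniq onto h0) => q /ball[qn Gq].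
apply: (potential_trap (flow_box_rev fb) X0' dG k0 _ _ r0 rM rN qn Gq); first by move=> u; have [] := Gk u.
move=> u u0; have [b b0 WE] := WX u u0; have [a a0 ca] := cD u u0.
have := WE (-1); rewrite !mulN1r !mulNr opprK => {}WE.
apply: (@le_trans _ _ (c * b * dirD P Q u)); first by rewrite -WE.
have ab : 0 < a * b by apply: mulr_gt0.
have := ltW ab; rewrite -(nmulr_rle0 _ csg).
by rewrite [c * b * _]mulrAC ca mulrA.
Qed.

Lemma char_dirs_set1 e : char_vector P Q e ->
  (forall e', char_vector P Q e' -> wedge e e' = 0) ->
  char_dirs P Q = [set (if e.1 == 0 then None else Some (e.2 / e.1))].
Proof.
move=> ce par; have [e1 De] := ce; apply/seteqP; split; last first.
  by move=> _ ->; apply: (char_dirsE V) De; exact: char_vector_neq0 ce.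
move=> l hl; have [e' ce' <-] := char_dirs_vector V hl.
have eE : e' = (dot e e' * e.1, dot e e' * e.2).
  by rewrite {1}(frameE e' e1) (par _ ce') !mul0r subr0 addr0.
have d0 : dot e e' != 0.
  apply/eqP => d0; have [e1' _] := ce'; move: e1'.
  by rewrite eE d0 /= !mul0r expr0n/= addr0 => /eqP; rewrite eq_sym oner_eq0.
rewrite /= eE /= mulf_eq0 (negPf d0)/=; case: (eqVneq e.1 0) => // e10.
by congr Some; field; rewrite ?d0 ?e10.
Qed.

Lemma regularisable_saddle : C0_regularisable X [set (0, 0)] -> exists r : R,
  [/\ exists l : option R, char_dirs P Q = [set l], critical_values P Q = [set r] & r < 0].
Proof.
move=> reg; have [e ce] := char_vector_exists reg.
have [N [Y [M [L [phi [f [B Hmax ext uniq onto]]]]]]] :=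
  regularisable_data (vfield_lipschitz P Q) reg.
have sd := saddle V B Hmax ext uniq onto.
have par e' : char_vector P Q e' -> wedge e e' = 0.
  apply: (char_vectors_parallel V sd) => //.
  exact: (two_lines V B Hmax ext uniq).
have cE := char_dirs_set1 ce par.
exists (kappa P Q e / alpha P Q e); split; first by eexists; exact: cE.
  exact: critical_valuesE V cE ce.
have a0 := alpha_neq0 V ce.
have -> : kappa P Q e / alpha P Q e = alpha P Q e * kappa P Q e / alpha P Q e ^+ 2 by field.
by rewrite pmulr_llt0 ?sd// invr_gt0 exprn_even_gt0.
Qed.

End Forward.

(** * Sufficiency *)

Section SmoothFunctions.
Variable R : realType.
Implicit Types (U : set (R * R)) (f g : R * R -> R) (p v : R * R) (h : R -> R).

Lemma is_derive_lineE f p v (df : R) :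
  is_derive p v f df <-> is_derive (0 : R) 1 (fun s : R => f (s *: v + p)) df.
Proof.
have E : (fun h : R => h^-1 *: (((fun s : R => f (s *: v + p)) \o shift 0) (h *: 1) -
      (fun s : R => f (s *: v + p)) 0)) =
    (fun h : R => h^-1 *: ((f \o shift p) (h *: v) - f p)).
  by apply/funext => h; rewrite /= addr0 scale0r add0r /GRing.scale/= mulr1.
split=> -[d <-]; split; rewrite /derivable /derive.
- by rewrite E.
- by rewrite E.
- by rewrite -E.
- by rewrite -E.
Qed.

Lemma is_derive_comp_plane h f p v (dh df : R) :
  is_derive (f p) 1 h dh -> is_derive p v f df -> is_derive p v (h \o f) (dh * df).
Proof.
move=> Dh /is_derive_lineE Df; apply/is_derive_lineE.
have := @is_derive1_comp R h (fun s => f (s *: v + p)) 0 dh df.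
by rewrite scale0r add0r; apply.
Qed.

Lemma near_derive_eq U f g p v (df : R) : open U -> U p -> (forall q, U q -> f q = g q) ->
  is_derive p v f df -> is_derive p v g df.
Proof.
move=> oU Up fg; apply: near_eq_is_derive.
have : nbhs p U by exact: open_nbhs_nbhs.
by apply: filterS => q /fg.
Qed.

Lemma Ck_on_continuous k U f p : Ck_on k U f -> U p -> {for p, continuous f}.
Proof. by case: k => [|k] [cf _] Up; apply: cf; rewrite inE. Qed.

Lemma continuous_congr U f g p : open U -> U p -> (forall q, U q -> f q = g q) ->
  {for p, continuous f} -> {for p, continuous g}.
Proof.
move=> oU Up fg; have Un : nbhs p U by exact: open_nbhs_nbhs.
rewrite /prop_for /continuous_at -(fg _ Up); apply: cvg_trans.
by apply: near_eq_cvg; apply: filterS Un => q /fg.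
Qed.

Lemma Ck_on_congr k U f g : open U -> (forall q, U q -> f q = g q) ->
  Ck_on k U f -> Ck_on k U g.
Proof.
move=> oU; elim: k f g => [|k IH] f g fg /=.
  move=> [cf _]; split => // p; rewrite inE => Up.
  by apply: (continuous_congr oU Up fg); apply: cf; rewrite inE.
move=> [cf [df f1 f2]]; split.
  move=> p; rewrite inE => Up.
  by apply: (continuous_congr oU Up fg); apply: cf; rewrite inE.
have D v q : U q -> derivable f q v -> is_derive q v g ('D_v f q).
  by move=> Uq /derivableP; apply: (near_derive_eq oU Uq fg).
split.
- by move=> q Uq; have [/(D _ _ Uq)[? _] /(D _ _ Uq)[? _]] := df q Uq.
- by apply: IH f1 => q Uq; have [/(D _ _ Uq) h _] := df q Uq; rewrite derive_val.
- by apply: IH f2 => q Uq; have [_ /(D _ _ Uq) h] := df q Uq; rewrite derive_val.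
Qed.

Lemma Ck_on_intro k U f f1 f2 : open U -> {in U, continuous f} ->
  (forall p, U p -> is_derive p (1, 0) f (f1 p)) ->
  (forall p, U p -> is_derive p (0, 1) f (f2 p)) ->
  Ck_on k U f1 -> Ck_on k U f2 -> Ck_on k.+1 U f.
Proof.
move=> oU cf d1 d2 c1 c2; split => //; split.
- by move=> p Up; have [? _] := d1 p Up; have [? _] := d2 p Up.
- by apply: Ck_on_congr c1 => // p /d1 h; rewrite derive_val.
- by apply: Ck_on_congr c2 => // p /d2 h; rewrite derive_val.
Qed.

Lemma Ck_on_le k U f : Ck_on k.+1 U f -> Ck_on k U f.
Proof.
elim: k f => [|k IH] f; first by case.
move=> [cf [df f1 f2]]; split; first exact: cf.
by split; [exact: df|exact: IH f1|exact: IH f2].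
Qed.

Lemma Ck_on_derive k U f p : Ck_on k.+1 U f -> U p ->
  is_derive p (1, 0) f ('D_(1, 0) f p) /\ is_derive p (0, 1) f ('D_(0, 1) f p).
Proof. by case=> _ [df _ _] /df[d1 d2]; split; apply/derivableP. Qed.

Lemma Ck_on_cst k U (a : R) : open U -> Ck_on k U (fun=> a).
Proof.
move=> oU; elim: k a => [|k IH] a.
  by split => // p _; exact: cvg_cst.
apply: (@Ck_on_intro k U _ (fun=> 0) (fun=> 0)); first exact: oU.
- by move=> p _; exact: cvg_cst.
- exact: IH.
- exact: IH.
Qed.

Lemma Ck_on_fst k U : open U -> Ck_on k U fst.
Proof.
move=> oU; have cf p : {for p, continuous (@fst R R)} by exact: cvg_fst.
case: k => [|k]; first by split => // p _; exact: cf.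
apply: (@Ck_on_intro k U _ (fun=> 1) (fun=> 0)); first exact: oU.
- by move=> p _; exact: cf.
- move=> p _; apply/is_derive_lineE; rewrite (_ : (fun _ => _) = (fun s : R => s + p.1)).
    by apply: is_derive_eq; rewrite addr0.
  by apply/funext => s; rewrite /= /GRing.scale/= mulr1.
- move=> p _; apply/is_derive_lineE; rewrite (_ : (fun _ => _) = (fun=> p.1)).
    exact: is_derive_cst.
  by apply/funext => s; rewrite /= /GRing.scale/= mulr0 add0r.
- exact: Ck_on_cst.
- exact: Ck_on_cst.
Qed.

Lemma Ck_on_snd k U : open U -> Ck_on k U snd.
Proof.
move=> oU; have cf p : {for p, continuous (@snd R R)} by exact: cvg_snd.
case: k => [|k]; first by split => // p _; exact: cf.
apply: (@Ck_on_intro k U _ (fun=> 0) (fun=> 1)); first exact: oU.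
- by move=> p _; exact: cf.
- move=> p _; apply/is_derive_lineE; rewrite (_ : (fun _ => _) = (fun=> p.2)).
    exact: is_derive_cst.
  by apply/funext => s; rewrite /= /GRing.scale/= mulr0 add0r.
- move=> p _; apply/is_derive_lineE; rewrite (_ : (fun _ => _) = (fun s : R => s + p.2)).
    by apply: is_derive_eq; rewrite addr0.
  by apply/funext => s; rewrite /= /GRing.scale/= mulr1.
- exact: Ck_on_cst.
- exact: Ck_on_cst.
Qed.

Lemma Ck_onD k U f g : open U -> Ck_on k U f -> Ck_on k U g ->
  Ck_on k U (fun u => f u + g u).
Proof.
move=> oU; elim: k f g => [|k IH] f g cf cg.
  split => // p; rewrite inE => Up.
  by apply: cvgD; [exact: Ck_on_continuous cf Up|exact: Ck_on_continuous cg Up].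
apply: (@Ck_on_intro k U _ (fun u => 'D_(1, 0) f u + 'D_(1, 0) g u)
   (fun u => 'D_(0, 1) f u + 'D_(0, 1) g u)) => //.
- move=> p; rewrite inE => Up.
  by apply: cvgD; [exact: Ck_on_continuous cf Up|exact: Ck_on_continuous cg Up].
- move=> p Up; have [f1 _] := Ck_on_derive cf Up; have [g1 _] := Ck_on_derive cg Up.
  exact: is_deriveD.
- move=> p Up; have [_ f1] := Ck_on_derive cf Up; have [_ g1] := Ck_on_derive cg Up.
  exact: is_deriveD.
- by case: cf cg => _ [_ ? _] [_ [_ ? _]]; apply: IH.
- by case: cf cg => _ [_ _ ?] [_ [_ _ ?]]; apply: IH.
Qed.

Lemma Ck_onM k U f g : open U -> Ck_on k U f -> Ck_on k U g ->
  Ck_on k U (fun u => f u * g u).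
Proof.
move=> oU; elim: k f g => [|k IH] f g cf cg.
  split => // p; rewrite inE => Up.
  by apply: cvgM; [exact: Ck_on_continuous cf Up|exact: Ck_on_continuous cg Up].
apply: (@Ck_on_intro k U _ (fun u => f u * 'D_(1, 0) g u + g u * 'D_(1, 0) f u)
   (fun u => f u * 'D_(0, 1) g u + g u * 'D_(0, 1) f u)) => //.
- move=> p; rewrite inE => Up.
  by apply: cvgM; [exact: Ck_on_continuous cf Up|exact: Ck_on_continuous cg Up].
- move=> p Up; have [f1 _] := Ck_on_derive cf Up; have [g1 _] := Ck_on_derive cg Up.
  exact: is_deriveM.
- move=> p Up; have [_ f1] := Ck_on_derive cf Up; have [_ g1] := Ck_on_derive cg Up.
  exact: is_deriveM.
- have cf' := Ck_on_le cf; have cg' := Ck_on_le cg.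
  by case: cf cg => _ [_ ? _] [_ [_ ? _]]; apply: Ck_onD => //; apply: IH.
- have cf' := Ck_on_le cf; have cg' := Ck_on_le cg.
  by case: cf cg => _ [_ _ ?] [_ [_ _ ?]]; apply: Ck_onD => //; apply: IH.
Qed.

Implicit Types (I : set R) (x : R).

(** The function comes with the sequence of all its derivatives on [I], so that composition with a
    plane function is treated by induction on the order, for all members of the sequence at once. *)
Definition smooth_line I h := exists h_ : nat -> R -> R, h_ 0%N = h /\
  forall i x, I x -> is_derive x 1 (h_ i) (h_ i.+1 x).

Lemma smooth_line_derive I h h' : (forall x, I x -> is_derive x 1 h (h' x)) ->
  smooth_line I h' -> smooth_line I h.
Proof.
move=> dh [h_ [h0 hd]]; exists (fun i => if i is i'.+1 then h_ i' else h); split => //.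
by move=> [|i] x Ix; [rewrite h0; exact: dh|exact: hd].
Qed.

Lemma smooth_lineD I h h1 : smooth_line I h -> smooth_line I h1 ->
  smooth_line I (fun x => h x + h1 x).
Proof.
move=> [h_ [<- hd]] [g_ [<- gd]]; exists (fun i x => h_ i x + g_ i x); split; first by [].
by move=> i x Ix; have := hd i x Ix; have := gd i x Ix => ? ?; exact: is_deriveD.
Qed.

Lemma is_derive_horner (a : {poly R}) (x : R) : is_derive x 1 (fun y => a.[y]) a^`().[x].
Proof. exact: is_derive_poly. Qed.

(** The successive derivatives come from iterating the unsimplified quotient rule [F] on pairs of
    numerator and denominator; the denominators are powers of [b]. *)
Lemma smooth_line_fraction (I : set R) (a b : {poly R}) : (forall x, I x -> b.[x] != 0) ->
  smooth_line I (fun x => a.[x] / b.[x]).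
Proof.
move=> b0.
pose F (ab : {poly R} * {poly R}) := (ab.1^`() * ab.2 - ab.1 * ab.2^`(), ab.2 ^+ 2).
exists (fun i x => let ab := iter i F (a, b) in ab.1.[x] / ab.2.[x]); split => // i x Ix.
have {b0} : (iter i F (a, b)).2.[x] != 0.
  by elim: i => [|i IH] /=; [exact: b0|rewrite horner_exp expf_neq0].
rewrite [iter i.+1 _ _]/=; move: (iter i F _) => [a' b'] /= b0.
have d1 := is_derive_horner a' x.
have d2 := is_deriveV b0 (is_derive_horner b' x).
apply: (is_derive_eq (is_deriveM d1 d2)).
rewrite /GRing.scale/= hornerD hornerN !hornerM; field; exact: b0.
Qed.

Lemma Ck_on_comp k U I h f : open U -> smooth_line I h -> Ck_on k U f ->
  (forall u, U u -> I (f u)) -> Ck_on k U (h \o f).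
Proof.
move=> oU [h_ [<- hd]] + UI; move: (0%N) => i.
have cont (j : nat) g : (forall p, U p -> {for p, continuous g}) ->
    (forall u, U u -> I (g u)) -> {in U, continuous (h_ j \o g)}.
  move=> cg gI p; rewrite inE => Up; apply: continuous_comp; first exact: cg.
  exact: is_derive_continuous (hd j _ (gI _ Up)).
elim: k i => [|k IH] i cf.
  by split => //; apply: cont => // p; exact: Ck_on_continuous cf.
apply: (@Ck_on_intro k U _ (fun u => (h_ i.+1 \o f) u * 'D_(1, 0) f u)
   (fun u => (h_ i.+1 \o f) u * 'D_(0, 1) f u)) => //.
- by apply: cont => // p; exact: Ck_on_continuous cf.
- move=> p Up; have [f1 _] := Ck_on_derive cf Up.
  by apply: is_derive_comp_plane => //; apply: hd; exact: UI.
- move=> p Up; have [_ f1] := Ck_on_derive cf Up.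
  by apply: is_derive_comp_plane => //; apply: hd; exact: UI.
- by apply: Ck_onM => //; [apply: IH; exact: Ck_on_le|case: cf => _ []].
- by apply: Ck_onM => //; [apply: IH; exact: Ck_on_le|case: cf => _ []].
Qed.

Lemma smooth_line_exp I : smooth_line I expR.
Proof. by exists (fun=> expR); split => // i x _; exact: is_derive_expR. Qed.

Lemma smooth_line_inv I : (forall x : R, I x -> x != 0) -> smooth_line I (fun x => x^-1).
Proof.
move=> I0; have := @smooth_line_fraction I 1 'X; rewrite (_ : (fun x => _ / _) = fun x => x^-1).
  by apply=> x Ix; rewrite hornerX I0.
by apply/funext => x; rewrite hornerX hornerC div1r.
Qed.

Lemma smooth_line_ln I : (forall x : R, I x -> 0 < x) -> smooth_line I (@ln R).
Proof.
move=> I0; apply: smooth_line_derive (smooth_line_inv _) => x /I0; last exact: lt0r_neq0.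
exact: is_derive1_ln.
Qed.

End SmoothFunctions.

(** * The potential adapted to a single saddle direction *)

Section SaddleForm.
Variable R : realType.
Variables (n : nat) (P Q : {poly {poly R}}).
Hypothesis V : Vhom n P Q.
Variable e : R * R.
Hypotheses (ce : char_vector P Q e) (a0 : 0 < alpha P Q e) (k0 : kappa P Q e < 0).
Hypothesis single : forall u, u != (0, 0) -> dirD P Q u = 0 -> wedge e u = 0.
Implicit Types (u v : R * R) (x y t : R).

Let X := vfield P Q.
Let e1 : e.1 ^+ 2 + e.2 ^+ 2 = 1. Proof. by case: ce. Qed.

(** In coordinates along and across [e], [radial] and [angular] are the components of the field and
    [torque] is D. The axis [y = 0] is the characteristic line. *)
Definition radial x y : R := (rotate e.1 e.2 P Q).1.[x, y].
Definition angular x y : R := (rotate e.1 e.2 P Q).2.[x, y].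
Definition torque x y : R := x * angular x y - y * radial x y.

Lemma radialE u : dot e (X u) = radial (dot e u) (wedge e u).
Proof.
rewrite /radial; have [-> _] := rotateE e.1 e.2 P Q (dot e u) (wedge e u).
have [f1 f2] : e.1 * dot e u - e.2 * wedge e u = u.1 /\ e.2 * dot e u + e.1 * wedge e u = u.2.
  by rewrite {3 6}(frameE u e1)/=; split; ring.
by rewrite f1 f2.
Qed.

Lemma angularE u : wedge e (X u) = angular (dot e u) (wedge e u).
Proof.
rewrite /angular; have [_ ->] := rotateE e.1 e.2 P Q (dot e u) (wedge e u).
have [f1 f2] : e.1 * dot e u - e.2 * wedge e u = u.1 /\ e.2 * dot e u + e.1 * wedge e u = u.2.
  by rewrite {3 6}(frameE u e1)/=; split; ring.
by rewrite f1 f2.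
Qed.

Lemma frame_surj x y : exists u, [/\ dot e u = x, wedge e u = y &
  forall a, dot e (a * u.1, a * u.2) = a * x /\ wedge e (a * u.1, a * u.2) = a * y].
Proof.
exists (x * e.1 - y * e.2, x * e.2 + y * e.1); rewrite /dot /wedge /=.
have h : e.2 ^+ 2 = 1 - e.1 ^+ 2 by move: e1; lra.
split; first by transitivity (x * (e.1 ^+ 2 + e.2 ^+ 2)); [ring|rewrite e1 mulr1].
  by transitivity (y * (e.1 ^+ 2 + e.2 ^+ 2)); [ring|rewrite e1 mulr1].
move=> a; split; first by transitivity (a * x * (e.1 ^+ 2 + e.2 ^+ 2)); [ring|rewrite e1 mulr1].
by transitivity (a * y * (e.1 ^+ 2 + e.2 ^+ 2)); [ring|rewrite e1 mulr1].
Qed.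

Lemma torqueE u : torque (dot e u) (wedge e u) = dirD P Q u.
Proof. by rewrite /torque -radialE -angularE -(wedge_frame _ _ e1). Qed.

Lemma radialZ a x y : radial (a * x) (a * y) = a ^+ n * radial x y.
Proof.
have [u [<- <- h]] := frame_surj x y; have [<- <-] := h a.
by rewrite -!radialE /X (vfieldZ V) dotZ.
Qed.

Lemma angularZ a x y : angular (a * x) (a * y) = a ^+ n * angular x y.
Proof.
have [u [<- <- h]] := frame_surj x y; have [<- <-] := h a.
by rewrite -!angularE /X (vfieldZ V) wedgeZr.
Qed.

Lemma torqueZ a x y : torque (a * x) (a * y) = a ^+ n.+1 * torque x y.
Proof. by rewrite /torque radialZ angularZ exprS; ring. Qed.

Lemma torque_neq0 x y : y != 0 -> torque x y != 0.
Proof.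
have [u [<- <- _]] := frame_surj x y; rewrite torqueE => w; apply/eqP => Du.
have u0 : u != (0, 0).
  by apply/eqP => u0; move: w; rewrite u0 /wedge/= !mulr0 subr0 eqxx.
by move: w; rewrite (single u0 Du) eqxx.
Qed.

Lemma radial_axis x : radial x 0 = alpha P Q e * x ^+ n.
Proof.
have := radialZ x 1 0; rewrite mulr1 mulr0 mulrC => ->; congr (_ * _).
have := radialE e.
have -> : dot e e = 1 by rewrite /dot -e1; ring.
have -> : wedge e e = 0 by rewrite /wedge; ring.
by move=> <-; rewrite /X (vfield_char ce) dotZ /dot -!expr2 e1 mulr1.
Qed.

Lemma angular_axis x : angular x 0 = 0.
Proof.
have := angularZ x 1 0; rewrite mulr1 mulr0 => ->.
have := angularE e.
have -> : dot e e = 1 by rewrite /dot -e1; ring.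
have -> : wedge e e = 0 by rewrite /wedge; ring.
by move=> <-; rewrite /X (vfield_char ce) wedgeZr /wedge; ring.
Qed.

Let p1 := (rotate e.1 e.2 P Q).1.[1%:P].
Let q1 := (rotate e.1 e.2 P Q).2.[1%:P].
Let p2 := (swapXY (rotate e.1 e.2 P Q).1).[1%:P].
Let q2 := (swapXY (rotate e.1 e.2 P Q).2).[1%:P].

Let p2E x : p2.[x] = radial x 1. Proof. exact: horner2_swapXY. Qed.
Let q2E x : q2.[x] = angular x 1. Proof. exact: horner2_swapXY. Qed.

(** D vanishes on the axis, so a factor [t] splits off. The quotient [S] has no zero, at 0 because
    the direction is simple and elsewhere because it is the only one; it keeps the sign of its value
    [kappa] at 0. *)
Let slopes : exists2 S : {poly R}, S.[0] = kappa P Q e & forall t, [/\ q1.[t] = t * (S.[t] + p1.[t]),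
  torque 1 t = t * S.[t] & 0 < kappa P Q e * S.[t]].
Proof.
have : root q1 0 by rewrite /root -[q1.[0]]/(angular 1 0) angular_axis.
move=> /factor_theorem[S' SE]; rewrite subr0 in SE.
pose S := S' - p1.
have Sq t : q1.[t] = t * (S.[t] + p1.[t]).
  by rewrite SE /S hornerM hornerX hornerD hornerN subrK mulrC.
have ST t : torque 1 t = t * S.[t].
  by rewrite /torque -[angular 1 t]/q1.[t] -[radial 1 t]/p1.[t] Sq; ring.
have S0 : S.[0] = kappa P Q e.
  have h := is_derive_dirD_char V (- e.2, e.1) ce (oner_neq0 R).
  rewrite /= expr1n mul1r in h.
  have kk : e.1 * e.1 - e.2 * - e.2 = e.1 ^+ 2 + e.2 ^+ 2 by ring.
  rewrite kk e1 mulr1 in h; apply: derive_uniq h.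
  have -> : (fun s => dirD P Q (1 * e.1 + s * - e.2, 1 * e.2 + s * e.1)) =
      (fun s => s * S.[s]).
    apply/funext => s; rewrite -torqueE -ST /dot /wedge/=; congr torque.
      by transitivity (e.1 ^+ 2 + e.2 ^+ 2); [ring|].
    by transitivity (s * (e.1 ^+ 2 + e.2 ^+ 2)); [ring|rewrite e1 mulr1].
  have h1 := is_derive_horner S 0; have h2 := is_derive_id (0 : R) (1 : R).
  apply: (is_derive_eq (is_deriveM h2 h1)).
  by rewrite /GRing.scale/= mul0r add0r mulr1.
have Sn t : S.[t] != 0.
  have [->|t0] := eqVneq t 0; first by rewrite S0 (kappa_neq0 V ce).
  by have := torque_neq0 1 t0; rewrite ST mulf_eq0 negb_or => /andP[].
exists S => // t; split => //.
have cS : continuous (fun t => S.[t]).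
  by move=> x; exact: is_derive_continuous (is_derive_horner S x).
by have := nonvanishing_same_sign 0 t cS Sn; rewrite S0.
Qed.

(** The sign found on the line [x = 1] is carried over to the line [y = 1] through their common
    point [(1, 1)]. *)
Let torque2 x : 0 < kappa P Q e * torque x 1.
Proof.
have [S _ hS] := slopes; have [_ T1 S1] := hS 1.
have cT : continuous (fun x => torque x 1).
  have -> : (fun x => torque x 1) = fun x => ('X * q2 - p2).[x].
    by apply/funext => y; rewrite hornerD hornerN hornerM hornerX p2E q2E /torque mul1r.
  by move=> y; exact: is_derive_continuous (is_derive_horner _ y).
have Tn y : torque y 1 != 0 by apply: torque_neq0; exact: oner_neq0.
have := mulr_gt0 S1 (nonvanishing_same_sign 1 x cT Tn); rewrite T1 mul1r.
have -> : kappa P Q e * S.[1] * (S.[1] * torque x 1) =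
  S.[1] ^+ 2 * (kappa P Q e * torque x 1) by ring.
rewrite pmulr_rgt0// exprn_even_gt0//=.
by apply: contraTneq S1 => ->; rewrite mulr0 ltxx.
Qed.

(** D changes sign across the axis: it has the sign of [- kappa] at [(1, -1)] and that of [kappa] at
    the opposite point. So its degree [n + 1] is odd. *)
Lemma degree_even : ~~ odd n.
Proof.
have [S _ hS] := slopes; have [_ T1 S1] := hS (-1).
have := torqueZ (-1) (-1) 1; rewrite mulrNN mulr1 mulr1 T1 mulN1r exprS mulN1r mulNr.
move/oppr_inj => E; have := torque2 (-1).
rewrite -signr_odd in E; case: odd E => //=; rewrite expr1 mulN1r => E.
by move: S1; rewrite E mulrN; lra.
Qed.

Lemma torque_sign x y : y != 0 -> torque x y / y < 0.
Proof.
move=> y0; have -> : torque x y = y ^+ n.+1 * torque (x / y) 1.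
  by rewrite -torqueZ mulr1 mulrC divfK.
have -> : y ^+ n.+1 * torque (x / y) 1 / y = y ^+ n * torque (x / y) 1.
  by rewrite exprS; field.
rewrite pmulr_rlt0; first by have := torque2 (x / y); rewrite nmulr_rgt0.
by rewrite exprn_even_gt0 ?y0 ?orbT//; exact: degree_even.
Qed.

(* The multiple [A] of [x / (1 + x ^ 2)] makes the radial derivative of the potential
   vanish on the axis direction to first order, so that its quotient by the torque
   stays smooth at the characteristic direction. *)
Lemma saddle_potential : exists (A c : R) (l l' m m' : R -> R),
  [/\ 0 < A, smooth_line setT l' /\ smooth_line setT m',
      (forall x, is_derive x 1 l (l' x)) /\ (forall x, is_derive x 1 m (m' x)),
      forall x y, x != 0 -> y != 0 -> ln `|y| + l (x / y) = ln `|x| + m (y / x) &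
      forall x y, y != 0 -> angular x y / y +
        l' (x / y) * (radial x y * y - x * angular x y) / y ^+ 2 =
        - (torque x y / y) / (x ^+ 2 + y ^+ 2) * (A * x + c * y)].
Proof.
have [S S0 hS] := slopes; pose A := - (alpha P Q e / kappa P Q e).
have A0 : 0 < A by rewrite /A oppr_gt0 pmulr_rlt0// invr_lt0.
(* In the chart around the axis the naive choice [- p1 / (t S)] has a pole at 0 with residue
   [- alpha / kappa]; the value of [A] makes the corrected numerator divisible by [t]. *)
have : root (- p1 * (1 + 'X ^+ 2) - A%:P * S) 0.
  rewrite /root !(hornerE, horner_exp) expr0n/= addr0 mulr1 S0.
  have -> : p1.[0] = alpha P Q e by rewrite -[LHS]/(radial 1 0) radial_axis expr1n mulr1.
  have -> : A * kappa P Q e = - alpha P Q e by rewrite /A mulNr divfK ?lt_eqF.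
  by rewrite subrr.
move=> /factor_theorem[N1]; rewrite subr0 => N1E.
have N1t t : t * N1.[t] = - p1.[t] * (1 + t ^+ 2) - A * S.[t].
  by have := congr1 (fun z : {poly R} => z.[t]) N1E; rewrite !hornerE => ->; rewrite mulrC.
have s0 t : 1 + t ^+ 2 != 0 :> R by rewrite gt_eqF// ltr_pwDl// sqr_ge0.
have Sn t : S.[t] != 0 
  by have [_ _] := hS t; apply: contraTneq => ->; rewrite mulr0 ltxx.
pose t2 := 'X * q2 - p2.
have t2E x : t2.[x] = torque x 1 by rewrite hornerD hornerN hornerM hornerX p2E q2E /torque mul1r.
have t2n x : t2.[x] != 0 
  by rewrite t2E; have := torque2 x; apply: contraTneq => ->; rewrite mulr0 ltxx.
pose o2 : {poly R} := 1 + 'X ^+ 2.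
have o2E x : o2.[x] = 1 + x ^+ 2 by rewrite /o2 !hornerE.
(* The first term alone would make the potential constant along orbits; the second is the correction
   by [A]. [M] is the same 1-form in the other chart, after the pole has been cancelled. *)
pose L x := q2.[x] / t2.[x] + (A%:P * 'X).[x] / o2.[x].
pose M t := N1.[t] / (S * o2).[t].
have sL : smooth_line setT L.
  by apply: smooth_lineD; apply: smooth_line_fraction => x _; [exact: t2n|rewrite o2E].
have sM : smooth_line setT M.
  by apply: smooth_line_fraction => x _; rewrite hornerM mulf_neq0// o2E.
have cont (h : R -> R) : smooth_line setT h -> continuous h.
  by move=> [h_ [<- hd]] x; exact: is_derive_continuous (hd 0%N x I).
have glue t : t != 0 -> M t = t^-1 - L t^-1 / t ^+ 2.
  move=> t0; rewrite /M /L hornerM !o2E t2E q2E hornerM hornerC hornerX.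
  have -> : torque t^-1 1 = t^-1 ^+ n.+1 * (t * S.[t]).
    by have [_ <- _] := hS t; rewrite -torqueZ mulr1 mulVf.
  have -> : angular t^-1 1 = t^-1 ^+ n * (t * (S.[t] + p1.[t])).
    by have [<- _ _] := hS t; rewrite -[q1.[t]]/(angular 1 t) -angularZ mulr1 mulVf.
  have -> : N1.[t] = (- p1.[t] * (1 + t ^+ 2) - A * S.[t]) / t by rewrite -N1t mulrAC divff// mul1r.
  have -> : 1 + t^-1 ^+ 2 = (1 + t ^+ 2) / t ^+ 2 by field.
  move: (s0 t) (Sn t) => o1 Sn1; rewrite !exprVn (exprS _ n).
  by field; rewrite ?t0 ?Sn1 ?o1 ?expf_neq0.
have [c [l [m [dl dm lm]]]] := log_potential (cont _ sL) (cont _ sM) glue.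
exists A, c, l, (fun x => L x + c / (1 + x ^+ 2)), m, (fun x => M x - c / (1 + x ^+ 2)).
have so a : smooth_line setT (fun x => a / (1 + x ^+ 2)).
  have -> : (fun x => a / (1 + x ^+ 2)) = fun x => (a%:P).[x] / o2.[x].
    by apply/funext => x; rewrite o2E hornerC.
  by apply: smooth_line_fraction => x _; rewrite o2E.
split => //.
  split; first exact: smooth_lineD.
  have -> : (fun x => M x - c / (1 + x ^+ 2)) = fun x => M x + (- c) / (1 + x ^+ 2).
    by apply/funext => x; rewrite mulNr.
  exact: smooth_lineD.
move=> x y y0.
have xE : x = y * (x / y) by rewrite mulrC divfK.
have TE : torque x y = y ^+ n.+1 * torque (x / y) 1 by rewrite -torqueZ mulr1 -xE.
have aE : angular x y = y ^+ n * angular (x / y) 1 by rewrite -angularZ mulr1 -xE.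
have -> : radial x y * y - x * angular x y = - torque x y by rewrite /torque; ring.
rewrite TE aE /L o2E t2E q2E hornerM hornerC hornerX (exprS _ n).
have := t2n (x / y); rewrite t2E; have := s0 (x / y).
have -> : x ^+ 2 + y ^+ 2 = y ^+ 2 * (1 + (x / y) ^+ 2) by field.
have -> : A * x + c * y = y * (A * (x / y) + c) by field.
move: (x / y) => z o1 T1; field.
by rewrite ?y0 ?T1 ?o1.
Qed.

End SaddleForm.

(** * Charts along level curves of a potential *)

Section LevelChart.
Variable R : realType.
Implicit Types (U N : set (R * R)) (p q u v : R * R) (s t : R).

(** A translation taking [p] to [(0, d)]: the ball of radius [d] goes into the open upper
    half-plane. *)
Lemma interior_chart N p d : 0 < d -> (forall q, `|q - p| < d -> N q) ->
  exists F, chart_at N p F.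
Proof.
move=> d0 pN; pose F q := (q.1 + - p.1, q.2 + (d - p.2)) : R * R.
pose H q := (q.1 + p.1, q.2 + (p.2 - d)) : R * R.
have HF : cancel F H by move=> q; rewrite [RHS]surjective_pairing /F /H /=; congr (_, _); ring.
have FH : cancel H F by move=> q; rewrite [RHS]surjective_pairing /F /H /=; congr (_, _); ring.
have E q : F q - (0, d) = q - p.
  by rewrite [LHS]surjective_pairing [RHS]surjective_pairing /F /=; congr (_, _); ring.
pose U := [set q | `|q - p| < d]; pose W := [set v : R * R | `|v - (0, d)| < d].
have oB (a : R * R) : open [set q | `|q - a| < d].
  have -> : [set q | `|q - a| < d] = ball a d.
    by apply/seteqP; split => q; rewrite -ball_normE /ball_/= distrC.
  exact: ball_open.
exists F, U, W, H; split; first by split; [exact: oB|exact: oB|rewrite /U/= subrr normr0].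
have lin V (a : R) : open V -> forall k, Ck_on k V (fun q => q.1 + a) /\ Ck_on k V (fun q => q.2 + a).
  by move=> oV k; split; apply: Ck_onD => //;
    [exact: Ck_on_fst|exact: Ck_on_cst|exact: Ck_on_snd|exact: Ck_on_cst].
split.
  split.
  - move=> k; split; first by have [h _] := lin U (- p.1) (oB p) k.
    by have [_ h] := lin U (d - p.2) (oB p) k.
  - move=> k; split; first by have [h _] := lin W p.1 (oB (0, d)) k.
    by have [_ h] := lin W (p.2 - d) (oB (0, d)) k.
  - by move=> _ [q Uq <-]; rewrite /W /= E.
  - by move=> _ [v Wv <-]; rewrite /U /= -E FH.
split.
- by move=> q _; exact: HF.
- by move=> q _; exact: FH.
move=> q Uq; split => [_|_]; last exact: pN.
move: Uq; rewrite /U/= plane_norm_lt /= => /andP[_]; rewrite ltr_norml => /andP[+ _]; lra.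
Qed.

Variables (a b : R * R -> R) (a1 a2 b1 b2 c1 c2 d1 d2 : R).
Hypotheses (aE : forall u, a u = a1 * u.1 + a2 * u.2) (bE : forall u, b u = b1 * u.1 + b2 * u.2).
Let J v : R * R := (c1 * v.1 + c2 * v.2, d1 * v.1 + d2 * v.2).
Hypotheses (abJ : forall u, J (a u, b u) = u) (aJ : forall v, a (J v) = v.1)
  (bJ : forall v, b (J v) = v.2).
Variables (L L' : R -> R) (sg : R).
Hypotheses (dL : forall x : R, is_derive x 1 L (L' x)) (sL : smooth_line setT L').
Hypothesis sg2 : sg * sg = 1.

Let U := [set u | 0 < sg * b u].
(** The slope and minus the logarithm of the potential, on the half-plane where [b] has sign [sg].
    The inverse is explicit: the second coordinate gives [b], and the slope then gives [a]. *)
Let F u : R * R := (a u / b u, - ln (sg * b u) - L (a u / b u)).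
Let H v : R * R := let y := sg * expR (- v.2 - L v.1) in J (v.1 * y, y).

Let CkL k V f : open V -> Ck_on k V f -> Ck_on k V (L \o f).
Proof.
move=> oV cf; apply: (Ck_on_comp oV _ cf (fun _ _ => I)).
by apply: smooth_line_derive sL => x _.
Qed.

Let Cklin k V (x y : R) : open V -> Ck_on k V (fun u => x * u.1 + y * u.2).
Proof.
move=> oV; apply: Ck_onD => //; apply: Ck_onM => //; try exact: Ck_on_cst.
  exact: Ck_on_fst.
exact: Ck_on_snd.
Qed.

Let bS u : U u -> b u != 0.
Proof. by move=> Uu; apply: contraTneq Uu => b0; rewrite /U /= b0 mulr0 ltxx. Qed.

Let Ckb k V : open V -> Ck_on k V b.
Proof. by move=> oV; rewrite (_ : b = fun u => b1 * u.1 + b2 * u.2); [exact: Cklin|exact/funext]. Qed.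

Let oU : open U.
Proof.
have cb : continuous (fun u => sg * b u).
  move=> u; apply: cvgM; first exact: cvg_cst.
  exact: (Ck_on_continuous (Ckb 0 openT)).
have -> : U = (fun u => sg * b u) @^-1` [set x | 0 < x] by [].
by apply: open_comp => [u _|]; [exact: cb|exact: open_gt].
Qed.

Let smoothF : smooth_on U F.
Proof.
move=> k.
have ca : Ck_on k U a by rewrite (_ : a = fun u => a1 * u.1 + a2 * u.2); [exact: Cklin|exact/funext].
have cb := Ckb k oU.
have cab : Ck_on k U (fun u => a u / b u).
  apply: Ck_onM => //.
  by apply: (Ck_on_comp oU (@smooth_line_inv _ [set x | x != 0] _) cb) => // u; exact: bS.
split; first exact: cab.
have E : snd \o F = fun u => -1 * (@ln R \o (fun u => sg * b u)) u + -1 * (L \o (fun u => a u / b u)) u.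
  by apply/funext => u; rewrite /F /= !mulN1r.
rewrite E; apply: Ck_onD => //; apply: Ck_onM => //; try exact: Ck_on_cst.
  apply: (Ck_on_comp oU (@smooth_line_ln _ [set x | 0 < x] _)) => //.
  by apply: Ck_onM => //; exact: Ck_on_cst.
exact: CkL.
Qed.

Let smoothH : smooth_on setT H.
Proof.
move=> k; have oT := @openT (R * R)%type.
pose y v := sg * (expR \o (fun v : R * R => -1 * v.2 + -1 * (L \o fst) v)) v.
have cy : Ck_on k setT y.
  apply: Ck_onM => //; first exact: Ck_on_cst.
  apply: (Ck_on_comp oT (smooth_line_exp setT)) => //.
  apply: Ck_onD => //; apply: Ck_onM => //; try exact: Ck_on_cst.
    exact: Ck_on_snd.
  by apply: CkL => //; exact: Ck_on_fst.
have cxy : Ck_on k setT (fun v => v.1 * y v) by apply: Ck_onM => //; exact: Ck_on_fst.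
have HE v : H v = (c1 * (v.1 * y v) + c2 * y v, d1 * (v.1 * y v) + d2 * y v).
  by rewrite /H /J /y /= !mulN1r.
have lin (x z : R) : Ck_on k setT (fun v => x * (v.1 * y v) + z * y v).
  by apply: Ck_onD => //; apply: Ck_onM => //; exact: Ck_on_cst.
split.
  by rewrite (_ : fst \o H = fun v => c1 * (v.1 * y v) + c2 * y v)//; apply/funext => v; rewrite -[LHS]/(H v).1 HE.
by rewrite (_ : snd \o H = fun v => d1 * (v.1 * y v) + d2 * y v)//; apply/funext => v; rewrite -[LHS]/(H v).2 HE.
Qed.

Lemma level_chart N p : 0 < sg * b p ->
  (forall u, 0 < sg * b u -> N u <-> sg * b u * expR (L (a u / b u)) <= 1) ->
  chart_at N p F.
Proof.
move=> Up NE.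
have sgn0 : sg != 0.
  by apply/eqP => s0; move: sg2; rewrite s0 mul0r => /eqP; rewrite eq_sym oner_eq0.
have HU v : sg * b (H v) = expR (- v.2 - L v.1).
  by rewrite /H bJ /= mulrA sg2 mul1r.
exists U, setT, H; split; first by split; [exact: oU|exact: openT|].
split.
  split => //.
  by move=> _ [v _ <-]; rewrite /U/= HU expR_gt0.
split.
- move=> u; rewrite inE => Uu; have b0 := bS Uu.
  have E : - (F u).2 - L (F u).1 = ln (sg * b u) by rewrite /F/=; ring.
  have sb : sg * (sg * b u) = b u by rewrite mulrA sg2 mul1r.
  by rewrite /H E lnK// sb /F/= divfK.
- move=> v _; have E0 := expR_gt0 (- v.2 - L v.1).
  rewrite /F HU expRK /H aJ bJ /= mulfK; last by rewrite mulf_neq0// gt_eqF.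
  by rewrite opprD !opprK addrK -surjective_pairing.
move=> u Uu; rewrite NE//=.
have -> : sg * b u * expR (L (a u / b u)) = expR (ln (sg * b u) + L (a u / b u)).
  by rewrite expRD lnK.
rewrite -[X in _ <= X](expR0 R) ler_expR; split; lra.
Qed.

End LevelChart.

Lemma derive_uniq_plane (R : realType) (g : R -> R * R) (t : R) (v w : R * R) :
  is_derive t 1 g v -> is_derive t 1 g w -> v = w.
Proof. by move=> [_ <-] [_ <-]. Qed.

Lemma is_derive_line (R : realType) (z y : R * R) (t : R) :
  is_derive t 1 (fun s : R => s *: z + y) z.
Proof.
have h1 : is_derive t 1 (fun s : R => s * z.1 + y.1) z.1.
  by apply: is_derive_eq; rewrite /GRing.scale/=; ring.
have h2 : is_derive t 1 (fun s : R => s * z.2 + y.2) z.2.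
  by apply: is_derive_eq; rewrite /GRing.scale/=; ring.
have := is_derive_pair h1 h2; rewrite -surjective_pairing.
by congr is_derive; apply/funext => s; rewrite [RHS]surjective_pairing.
Qed.

(** * The sublevel set of the potential as a compact domain *)

Section HomogeneousDomain.
Variable R : realType.
Variables (e : R * R) (l l' m m' : R -> R).
Hypothesis e1 : e.1 ^+ 2 + e.2 ^+ 2 = 1.
Hypotheses (sl : smooth_line setT l') (sm : smooth_line setT m').
Hypotheses (dl : forall x : R, is_derive x 1 l (l' x)) (dm : forall x : R, is_derive x 1 m (m' x)).
Hypothesis lm : forall x y : R, x != 0 -> y != 0 -> ln `|y| + l (x / y) = ln `|x| + m (y / x).
Implicit Types (p q u v w : R * R) (x y s t : R).

Definition level u : R := potential l m (dot e u, wedge e u).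

Definition dlevel u v : R := level u *
  (if wedge e u == 0
   then dot e v / dot e u + m' (wedge e u / dot e u) *
     (wedge e v * dot e u - wedge e u * dot e v) / dot e u ^+ 2
   else wedge e v / wedge e u + l' (dot e u / wedge e u) *
     (dot e v * wedge e u - dot e u * wedge e v) / wedge e u ^+ 2).

Definition sublevel : set (R * R) := [set u | level u <= 1].

Lemma frame_neq0 u : u != (0, 0) -> (dot e u, wedge e u) != (0, 0).
Proof.
apply: contra => /eqP[d w]; apply/eqP.
by rewrite (frameE u e1) d w !mul0r subr0 addr0.
Qed.

Lemma level0 : level (0, 0) = 0.
Proof. by rewrite /level /dot /wedge/= !mulr0 subr0 addr0 potential0. Qed.

Lemma level_gt0 u : u != (0, 0) -> 0 < level u.
Proof. by move=> /frame_neq0; exact: potential_gt0. Qed.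

Lemma levelZ a u : level (a * u.1, a * u.2) = `|a| * level u.
Proof. by rewrite /level dotZ wedgeZr -(potentialZ _ _ a (_, _)). Qed.

Lemma level_bounds : exists2 k, 0 < k & forall u, k * `|u| <= level u /\ k * level u <= `|u|.
Proof.
have [k k0 hk] := potential_bounds dl dm lm; exists (k / 2); first by rewrite divr_gt0.
move=> u; have [h1 h2] := hk (dot e u, wedge e u).
have n1 : `|(dot e u, wedge e u)| <= 2 * `|u|.
  by rewrite plane_norm_le/= dot_le// wedge_le.
have n2 : `|u| <= 2 * `|(dot e u, wedge e u)|.
  have := norm_frame u e1.
  by have := plane_norm_fst (dot e u, wedge e u); have := plane_norm_snd (dot e u, wedge e u) => /=; lra.
rewrite /level; split; first by apply: le_trans h1; rewrite mulrAC -mulrA ler_pM2l//; lra.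
by rewrite mulrAC; lra.
Qed.

Lemma is_derive_level (g : R -> R * R) t v : g t != (0, 0) -> is_derive t 1 g v ->
  is_derive t 1 (level \o g) (dlevel (g t) v).
Proof.
move=> g0 dg.
have d1 := is_derive_pair (is_derive_dot e dg) (is_derive_wedge e dg).
have -> : level \o g = potential l m \o (fun s => (dot e (g s), wedge e (g s))) by [].
have := frame_neq0 g0; rewrite plane_neq0 /dlevel/=.
case: (eqVneq (wedge e (g t)) 0) => [w|w _].
  rewrite orbF => x0.
  have h := @is_derive_potential1 _ l m m' dm lm
    (fun s => (dot e (g s), wedge e (g s))) t _ x0 d1.
  by rewrite /= in h; apply: h.
have h := @is_derive_potential2 _ l l' m dl (fun s => (dot e (g s), wedge e (g s))) t _ w d1.
by rewrite /= in h; apply: h.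
Qed.

Lemma dlevelZ a u v : dlevel u (a * v.1, a * v.2) = a * dlevel u v.
Proof. by rewrite /dlevel dotZ wedgeZr; case: ifP => _; ring. Qed.

(** [level_chart] is applied with the roles of the two coordinates exchanged when [p] is on the
    axis. Knowing the second coordinate explicitly reduces derivatives in the chart to those of
    [level]. *)
Lemma level_ln_chart p : p != (0, 0) -> exists F U,
  [/\ chart_at sublevel p F, open U, U p &
      forall u, U u -> u != (0, 0) /\ (F u).2 = - ln (level u)].
Proof.
move=> /frame_neq0; rewrite plane_neq0 /= => pn.
have sgP (x : R) : x != 0 -> exists2 sg : R, sg * sg = 1 & 0 < sg * x.
  move=> x0; have [xp|xn] := ltP 0 x; first by exists 1; rewrite !mul1r.
  by exists (-1); rewrite ?mulN1r ?oppr_gt0 ?opprK// lt_neqAle x0.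
have lnE (s x : R) : 0 < s -> ln (s * expR x) = ln s + x.
  by move=> s0; rewrite lnM ?expRK// posrE// expR_gt0.
have dE u : dot e u = e.1 * u.1 + e.2 * u.2 by [].
have wE u : wedge e u = - e.2 * u.1 + e.1 * u.2 by rewrite /wedge; ring.
have nrm sg x : sg * sg = 1 -> 0 < sg * x -> `|x| = sg * x.
  move=> s1 sx; rewrite -[RHS]gtr0_norm// normrM.
  by rewrite -[LHS]mul1r; congr (_ * _); apply/eqP; rewrite -(@eqrXn2 _ 2)// expr1n real_normK ?num_real// expr2 s1.
have op (b : R * R -> R) sg : (forall g : R * R, {for g, continuous b}) -> open [set u | 0 < sg * b u].
  move=> cb; have -> : [set u | 0 < sg * b u] = (fun u => sg * b u) @^-1` [set x | 0 < x] by [].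
  apply: open_comp => [u _|]; last exact: open_gt.
  by apply: cvgM; [exact: cvg_cst|exact: cb].
have lin (x y : R) g : {for g, continuous (fun u : R * R => x * u.1 + y * u.2)}.
  by apply: cvgD; apply: cvgM; try exact: cvg_cst; [exact: cvg_fst|exact: cvg_snd].
have [w0|w0] := eqVneq (wedge e p) 0.
  have d0 : dot e p != 0 by move: pn; rewrite w0 eqxx orbF.
  have [sg s1 sp] := sgP _ d0.
  have lE u : 0 < sg * dot e u -> level u = sg * dot e u * expR (m (wedge e u / dot e u)).
    move=> su; have u0 : dot e u != 0 by apply: contraTneq su => ->; rewrite mulr0 ltxx.
    by rewrite /level (potential1 lm)//= (nrm sg).
  eexists; exists [set u | 0 < sg * dot e u]; split.
  - apply: (@level_chart _ (wedge e) (dot e) (- e.2) e.1 e.1 e.2 (- e.2) e.1 e.1 e.2 wE dE _ _ _ m m' sg dm sm s1 _ p sp).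
    + by move=> u; rewrite /= [RHS](frameE u e1); congr (_, _); ring.
    + by move=> v; rewrite /wedge /=; transitivity (v.1 * (e.1 ^+ 2 + e.2 ^+ 2)); [ring|rewrite e1 mulr1].
    + by move=> v; rewrite /dot /=; transitivity (v.2 * (e.1 ^+ 2 + e.2 ^+ 2)); [ring|rewrite e1 mulr1].
    + by move=> u su; rewrite /sublevel/= lE.
  - by apply: op => g; exact: lin.
  - exact: sp.
  move=> u su; split.
    by apply: contraTneq su => ->; rewrite /dot/= !mulr0 addr0 mulr0 ltxx.
  by rewrite lE//= lnE//= opprD.
have [sg s1 sp] := sgP _ w0.
have lE u : 0 < sg * wedge e u -> level u = sg * wedge e u * expR (l (dot e u / wedge e u)).
  move=> su; have u0 : wedge e u != 0 by apply: contraTneq su => ->; rewrite mulr0 ltxx.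
  by rewrite /level potential2//= (nrm sg).
eexists; exists [set u | 0 < sg * wedge e u]; split.
- apply: (@level_chart _ (dot e) (wedge e) e.1 e.2 (- e.2) e.1 e.1 (- e.2) e.2 e.1 dE wE _ _ _ l l' sg dl sl s1 _ p sp).
  + by move=> u; rewrite /= [RHS](frameE u e1); congr (_, _); ring.
  + by move=> v; rewrite /dot /=; transitivity (v.1 * (e.1 ^+ 2 + e.2 ^+ 2)); [ring|rewrite e1 mulr1].
  + by move=> v; rewrite /wedge /=; transitivity (v.2 * (e.1 ^+ 2 + e.2 ^+ 2)); [ring|rewrite e1 mulr1].
  + by move=> u su; rewrite /sublevel/= lE.
- apply: op => g; rewrite (_ : wedge e = fun u => - e.2 * u.1 + e.1 * u.2); first exact: lin.
  by apply/funext => u; rewrite wE.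
- exact: sp.
move=> u su; split.
  by apply: contraTneq su => ->; rewrite /wedge/= !mulr0 subr0 mulr0 ltxx.
by rewrite lE//= lnE//= opprD.
Qed.

Lemma level_continuous : continuous level.
Proof.
move=> p; have [->|p0] := eqVneq p (0, 0).
  have [k k0 hk] := level_bounds; apply/continuous_atP => d d0.
  exists (k * d); first by rewrite mulr_gt0.
  move=> q; rewrite (_ : q - (0, 0) = q); last first.
    by rewrite [LHS]surjective_pairing [RHS]surjective_pairing/= !subr0.
  have [h1 h2] := hk q => qd; rewrite level0 subr0 ger0_norm.
    by rewrite -(ltr_pM2l k0) (le_lt_trans h2).
  by apply: le_trans h1; rewrite mulr_ge0// ltW.
have [F [U [ch oU Up FU]]] := level_ln_chart p0.
have [U' [V' [H [[oU' _ U'p] [[sF _ _ _] _]]]]] := ch.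
have cF : {for p, continuous (fun u => expR (- (F u).2))}.
  apply: continuous_comp; last exact: continuous_expR.
  by apply: cvgN; apply: (cvg_comp _ _ (smooth_on_continuous sF U'p)); exact: cvg_snd.
apply: (continuous_congr oU Up _ cF) => q /FU[q0 ->].
by rewrite opprK lnK// posrE level_gt0.
Qed.

Lemma sublevel_bounded : exists2 M, 0 < M & forall q, sublevel q -> `|q| < M.
Proof.
have [k k0 hk] := level_bounds; exists (k^-1 + 1); first by rewrite addr_gt0 ?invr_gt0.
move=> q Nq; have [h _] := hk q.
suff : `|q| <= k^-1 by lra.
by rewrite -(ler_pM2l k0) mulfV ?gt_eqF// (le_trans h).
Qed.

Lemma compact_sublevel_closed (A : set (R * R)) : closed A -> A `<=` sublevel -> compact A.
Proof.
move=> cA AN; have [M M0 hM] := sublevel_bounded.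
apply: (@subclosed_compact _ A (`[- M, M]%classic `*` `[- M, M]%classic)) => //.
  by apply: compact_setX; exact: segment_compact.
move=> q /AN/hM/ltW; rewrite plane_norm_le !ler_norml => /andP[h1 h2].
by split; rewrite /= in_itv.
Qed.

Lemma sublevel_domain : compact_domain sublevel.
Proof.
split.
  apply: compact_sublevel_closed => //.
  have -> : sublevel = level @^-1` [set x | x <= 1] by [].
  by apply: closed_comp => [u _|]; [exact: level_continuous|exact: closed_le].
move=> p _; have [->|p0] := eqVneq p (0, 0); last first.
  by have [F [U [ch _ _ _]]] := level_ln_chart p0; exists F.
have [k k0 hk] := level_bounds; apply: (interior_chart k0) => q.
rewrite (_ : q - (0, 0) = q); last first.
  by rewrite [LHS]surjective_pairing [RHS]surjective_pairing/= !subr0.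
by move=> qk; have [_ h] := hk q; rewrite /sublevel/= -(ler_pM2l k0) mulr1 (le_trans h)// ltW.
Qed.

Lemma bdry_sublevel p : bdry sublevel p <-> level p = 1.
Proof.
split => [bp|p1].
  apply/eqP; rewrite eq_le (bdry_in bp : level p <= 1) leNgt; apply/negP => lt1.
  have [|d d0 hd] := (continuous_atP level p).1 (@level_continuous p) (1 - level p).
    by rewrite subr_gt0.
  apply: (interior_notbdry d0 _ bp) => q /hd; rewrite ltr_norml /sublevel/= => /andP[]; lra.
have p0 : p != (0, 0) by apply: contra_eq_neq p1 => ->; rewrite level0 eq_sym oner_eq0.
have [F [U [ch oU Up FU]]] := level_ln_chart p0; exists F; split => //.
by have [_ ->] := FU p Up; rewrite p1 ln1 oppr0.
Qed.

Lemma derive_chart_level p v (F : R * R -> R * R) U : open U -> U p ->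
  (forall u, U u -> u != (0, 0) /\ (F u).2 = - ln (level u)) ->
  'D_v (snd \o F) p = - (dlevel p v / level p).
Proof.
move=> oU Up FU; have [p0 _] := FU p Up; have lp := level_gt0 p0.
suff h : is_derive p v (snd \o F) (- (dlevel p v / level p)) by rewrite derive_val.
apply: (near_derive_eq oU Up) (_ : is_derive p v (fun u => - ln (level u)) _).
  by move=> q /FU[_ h]; rewrite -h.
apply/is_derive_lineE.
have g0 : 0 *: v + p = p by rewrite scale0r add0r.
have dg := is_derive_line v p 0.
have := @is_derive_level (fun s : R => s *: v + p) 0 v; rewrite g0 => /(_ p0 dg) dlv.
have lp' : 0 < (level \o (fun s : R => s *: v + p)) 0 by rewrite /= g0.
have dln := is_derive1_comp (is_derive1_ln lp') dlv.
by apply: (is_derive_eq (is_deriveN dln)); rewrite /= g0 mulrC.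
Qed.

(* The boundary curve is [s |-> H (x + s, 0)] in any chart, where [H] inverts F;
   if [dF_2 v = 0], then v is tangent to it, so the derivative of the level along v vanishes. *)
Lemma tangent_dlevel p v (F : R * R -> R * R) : chart_at sublevel p F -> (F p).2 = 0 ->
  'D_v (snd \o F) p = 0 -> dlevel p v = 0.
Proof.
move=> ch Fp0 dF; have bp : bdry sublevel p by exists F.
have p1 := (bdry_sublevel p).1 bp.
have p0 : p != (0, 0) by apply: contra_eq_neq p1 => ->; rewrite level0 eq_sym oner_eq0.
have [U [V [H [[oU oV Up] [[sF sH FUV HVU] [FK HK FN]]]]]] := ch.
have VF : V (F p) by apply: FUV; exists p.
have HF : H (F p) = p by apply: FK; rewrite inE.
pose b := 'D_v (fst \o F) p.
have line (z y : R * R) := is_derive_line z y (0 : R).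
have pairE (k : R -> R * R) : (fun t => ((fst \o k) t, (snd \o k) t)) = k.
  by apply/funext => t /=; rewrite -surjective_pairing.
have dF1 : is_derive (0 : R) 1 (F \o (fun s : R => s *: v + p)) (b, 0).
  have [c1 c2] := sF 1%N.
  have U0 : U ((fun s : R => s *: v + p) 0) by rewrite scale0r add0r.
  have h1 := is_derive_C1_curve oU U0 c1 (line v p).
  have h2 := is_derive_C1_curve oU U0 c2 (line v p).
  rewrite -(derive_C1 v oU U0 c1) scale0r add0r -/b in h1.
  rewrite -(derive_C1 v oU U0 c2) scale0r add0r dF in h2.
  by have := is_derive_pair h1 h2; rewrite pairE.
have [c1 c2] := sH 1%N.
pose w := ('D_(1, 0) (fst \o H) (F p), 'D_(1, 0) (snd \o H) (F p)).
have dH (g : R -> R * R) (x : R) : g 0 = F p -> is_derive (0 : R) 1 g (x, 0) ->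
    is_derive (0 : R) 1 (H \o g) (x * w.1, x * w.2).
  move=> g0 dg; have Vg : V (g 0) by rewrite g0.
  have h1 := is_derive_C1_curve oV Vg c1 dg.
  have h2 := is_derive_C1_curve oV Vg c2 dg.
  by have := is_derive_pair h1 h2; rewrite pairE g0 /= !mul0r !addr0.
have near0 (W : set (R * R)) (z y : R * R) : open W -> W y -> \forall s \near (0 : R), W (s *: z + y).
  move=> oW Wy; have := is_derive_continuous (line z y).
  have Wn : nbhs ((fun s : R => s *: z + y) 0) W.
    by rewrite scale0r add0r; exact: open_nbhs_nbhs.
  by move=> /(_ W Wn).
have vE : v = (b * w.1, b * w.2).
  have F0 : (F \o (fun s : R => s *: v + p)) 0 = F p by rewrite /= scale0r add0r.
  apply: (derive_uniq_plane (line v p)).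
  apply: near_eq_is_derive (dH _ _ F0 dF1); apply: filterS (near0 U v p oU Up) => s Us.
  by rewrite /= FK// inE.
have dw : dlevel p w = 0.
  have F0 : (fun s : R => s *: (1, 0) + F p) 0 = F p by rewrite scale0r add0r.
  have := dH _ _ F0 (line (1, 0) (F p)); rewrite !mul1r -surjective_pairing => dg.
  have g0 : (H \o (fun s : R => s *: (1, 0) + F p)) 0 = p by rewrite /= F0.
  have := @is_derive_level _ 0 w _ dg; rewrite g0 => /(_ p0) dlg.
  apply: (derive_uniq dlg).
  apply: (@near_eq_is_derive _ _ _ (fun _ : R => 1 : R)).
  apply: filterS (near0 V (1, 0) (F p) oV VF) => s Vs; apply/esym/bdry_sublevel.
  exists F; split; last by rewrite /= HK ?inE//= /GRing.scale/= Fp0 mulr0 addr0.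
  exists U, V, H; split; first by split => //; apply: HVU; exists (s *: (1, 0) + F p).
  by split.
by rewrite vE dlevelZ dw mulr0.
Qed.

End HomogeneousDomain.

(** * Entries, exits and tangencies on the level curve *)

Section LevelCrossing.
Variable R : realType.
Variables (e : R * R) (l l' m m' : R -> R).
Hypothesis e1 : e.1 ^+ 2 + e.2 ^+ 2 = 1.
Hypotheses (sl : smooth_line setT l') (sm : smooth_line setT m').
Hypotheses (dl : forall x : R, is_derive x 1 l (l' x)) (dm : forall x : R, is_derive x 1 m (m' x)).
Hypothesis lm : forall x y : R, x != 0 -> y != 0 -> ln `|y| + l (x / y) = ln `|x| + m (y / x).
Implicit Types (p q u v w : R * R) (x y s t : R).

Let G := level e l m.
Let dG := dlevel e l l' m m'.
Let N := sublevel e l m.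

Definition tilt (A c : R) u := A * dot e u + c * wedge e u.

Lemma tiltN A c u : tilt (- A) (- c) u = - tilt A c u.
Proof. by rewrite /tilt; ring. Qed.

Lemma is_derive_tilt A c (g : R -> R * R) t v :
  is_derive t 1 g v -> is_derive t 1 (fun s => tilt A c (g s)) (tilt A c v).
Proof.
move=> dg; have h1 := is_derive_dot e dg; have h2 := is_derive_wedge e dg.
by apply: is_derive_eq; rewrite /GRing.scale/= /tilt; ring.
Qed.

Lemma plane_opp u : - u = (-1 * u.1, -1 * u.2).
Proof. by rewrite !mulN1r. Qed.

Section Field.
Variables (Z Y : R * R -> R * R) (M L : R) (phi : R * R -> R -> R * R) (A c : R).
Hypotheses (fb : flow_box Z M Y L phi) (NM : forall q, N q -> `|q| < M).
Hypothesis dGZ : forall u, u != (0, 0) -> exists2 om, 0 < om & dG u (Z u) = om * tilt A c u.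
Hypothesis tiltZ : forall u, u != (0, 0) -> tilt A c u = 0 -> 0 < tilt A c (Z u).

Let fl : is_flow Y L phi. Proof. by case: fb. Qed.

Let p0 p : G p = 1 -> p != (0, 0).
Proof. by apply: contra_eq_neq => ->; rewrite /G level0 eq_sym oner_eq0. Qed.

Let Np p : G p = 1 -> N p. Proof. by rewrite /N/sublevel/= -/(G p) => ->. Qed.

Lemma level_enter p : G p = 1 -> tilt A c p < 0 -> exists2 r, 0 < r &
  (forall s, 0 < s < r -> N (phi p s)) /\ (forall s, - r < s < 0 -> ~ N (phi p s)).
Proof.
move=> p1 pt; have [F [U [ch oU Up FU]]] := level_ln_chart e1 sl sm dl dm lm (p0 p1).
have dF := derive_chart_level e1 dl dm lm (Z p) oU Up FU.
have [om om0 E] := dGZ (p0 p1).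
have [|r r0 hr] := transversal_pos fb (NM (Np p1)) ch.
  by rewrite dF -/(dG p (Z p)) E -/(G p) p1 divr1 oppr_gt0 pmulr_rlt0.
exists r => //; apply: hr; last by rewrite subrr normr0.
exact/(bdry_sublevel e1 sl sm dl dm lm).
Qed.

(** At a tangency [tilt] vanishes and increases along the orbit. Just after it [tilt], and with it
    the derivative of the level, is positive, so the orbit is outside. *)
Lemma level_graze p : G p = 1 -> tilt A c p = 0 -> exists2 r, 0 < r &
  forall s, 0 < s < r -> ~ N (phi p s).
Proof.
move=> p1 pt; have pn := p0 p1; have [_ _ YZ] := fb.
have pM := NM (Np p1); have Mp : 0 < M - `|p| by rewrite subr_gt0.
have [d1 d10 h1] := flow_near_time p 0 fl Mp.
have box s : `|s| < d1 -> `|phi p s| <= M.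
  move=> sd; have := h1 s; rewrite subr0 (flow_start fl) => /(_ sd).
  by have := ler_normD (phi p s - p) p; rewrite subrK; lra.
have gp : 0 < G p / 2 by rewrite p1 divr_gt0.
have := @level_continuous _ _ _ _ _ _ e1 sl sm dl dm lm p => /continuous_atP.
move=> /(_ _ gp)[d2 d20 h2]; have [d3 d30 h3] := flow_near_time p 0 fl d20.
have nz s : `|s| < d3 -> phi p s != (0, 0).
  move=> sd; have := h3 s; rewrite subr0 (flow_start fl) => /(_ sd)/h2.
  rewrite -/(G _) -/(G p) p1 => h; apply: contraTneq h => ->.
  by rewrite /G level0 sub0r normrN normr1 -leNgt; lra.
have dt s : `|s| < d1 -> is_derive s 1 (fun t => tilt A c (phi p t)) (tilt A c (Z (phi p s))).
  by move=> sd; rewrite -YZ; [exact: is_derive_tilt (flow_derive fl p s)|exact: box].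
have t0 : tilt A c (phi p 0) = 0 by rewrite (flow_start fl).
have n0 : `|0 : R| < d1 by rewrite normr0.
have dt0 : is_derive (0 : R) 1 (fun t => - tilt A c (phi p t)) (- tilt A c (Z p)).
  by have := is_deriveN (dt 0 n0); rewrite (flow_start fl).
have [||d4 d40 [h4 _]] := negative_slope dt0; first by rewrite t0 oppr0.
  by rewrite oppr_lt0 tiltZ.
have [r [r0 [r1 r3 r4]]] : exists r, 0 < r /\ [/\ r <= d1, r <= d3 & r <= d4].
  by exists (Num.min d1 (Num.min d3 d4)); rewrite !lt_min d10 d30 d40 !ge_min !lexx !orbT.
exists r => // s /andP[s0 sr].
have rs x : 0 <= x <= s -> `|x| < r by move=> /andP[x0 xs]; rewrite ger0_norm//; lra.
suff : 1 < G (phi p s) by rewrite /N/sublevel/= leNgt => ->.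
rewrite -p1 -[X in G X < _](flow_start fl p).
apply: (@gt0_is_derive_lt _ (G \o phi p) (fun x => dG (phi p x) (Z (phi p x))) 0 s s0).
  move=> x xs; have xr := rs x xs; rewrite -YZ; last by apply: box; exact: lt_le_trans r1.
  apply: (is_derive_level e1 dl dm lm) (flow_derive fl p x).
  by apply: nz; exact: lt_le_trans r3.
move=> x /andP[x0 xs]; have xr : `|x| < r by apply: rs; lra.
have [|om om0 ->] := dGZ (u := phi p x); first by apply: nz; exact: lt_le_trans r3.
rewrite mulr_gt0// -oppr_lt0 h4// x0 add0r; lra.
Qed.

End Field.

Section Block.
Variables (Z Y : R * R -> R * R) (M L : R) (phi : R * R -> R -> R * R) (A c : R).
Hypotheses (fb : flow_box Z M Y L phi) (NM : forall q, N q -> `|q| < M).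
Hypothesis dGZ : forall u, u != (0, 0) -> exists2 om, 0 < om & dG u (Z u) = om * tilt A c u.
Hypothesis tiltZ : forall u, u != (0, 0) -> tilt A c u = 0 -> 0 < tilt A c (Z u).

Lemma dlevel_rev u : u != (0, 0) ->
  exists2 om, 0 < om & dG u (- Z u) = om * tilt (- A) (- c) u.
Proof.
move=> /dGZ[om om0 E]; exists om => //.
by rewrite plane_opp /dG dlevelZ -/(dG _ _) E tiltN; ring.
Qed.

Lemma tilt_rev u : u != (0, 0) -> tilt (- A) (- c) u = 0 -> 0 < tilt (- A) (- c) (- Z u).
Proof.
move=> un; rewrite tiltN => /eqP; rewrite oppr_eq0 => /eqP /(tiltZ un).
by rewrite plane_opp /tilt dotZ wedgeZr; lra.
Qed.

(** The sign of [tilt] is that of the derivative of the level. The tangencies are included because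
    orbits graze the block from outside, as [level_graze] for the reversed flow shows. *)
Lemma entry_level p : entry phi N p <-> G p = 1 /\ tilt A c p <= 0.
Proof.
have bE := bdry_sublevel e1 sl sm dl dm lm.
split=> [en|[p1 pt]].
  have p1 : G p = 1 by apply/bE; case: en.
  split=> //; rewrite leNgt; apply/negP => pt.
  have [|r r0 [h _]] := level_enter (flow_box_rev fb) NM dlevel_rev p1.
    by rewrite tiltN oppr_lt0.
  apply: (entryN en r0) => s /andP[s0 s1].
  by have := h (- s); rewrite /rev opprK; apply; apply/andP; split; lra.
split; first exact/bE.
have [pt0|pt0] := eqVneq (tilt A c p) 0; last first.
  have [|r r0 [_ h]] := level_enter fb NM dGZ p1; first by rewrite lt_neqAle pt0.
  by exists r.
have [|r r0 h] := level_graze (flow_box_rev fb) NM dlevel_rev tilt_rev p1.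
  by rewrite tiltN pt0 oppr0.
exists r => // s /andP[s0 s1]; have := h (- s); rewrite /rev opprK; apply.
by apply/andP; split; lra.
Qed.

Lemma tau_level p : tau Z N p <-> G p = 1 /\ tilt A c p = 0.
Proof.
have bE := bdry_sublevel e1 sl sm dl dm lm.
split=> [[F [ch F0 dF]]|[p1 pt]].
  have p1 : G p = 1 by apply/bE; exists F.
  have pn : p != (0, 0).
    by apply: contra_eq_neq p1 => ->; rewrite /G level0 eq_sym oner_eq0.
  split=> //; have := tangent_dlevel e1 sl sm dl dm lm ch F0 dF.
  have [om om0 E] := dGZ pn; rewrite [LHS]E => /eqP.
  by rewrite mulf_eq0 gt_eqF//= => /eqP.
have pn : p != (0, 0).
  by apply: contra_eq_neq p1 => ->; rewrite /G level0 eq_sym oner_eq0.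
have [F [U [ch oU Up FU]]] := level_ln_chart e1 sl sm dl dm lm pn.
exists F; split=> //; first by have [_ ->] := FU p Up; rewrite -/(G p) p1 ln1 oppr0.
rewrite (derive_chart_level e1 dl dm lm (Z p) oU Up FU).
by have [om _ E] := dGZ pn; rewrite -/(dG p (Z p)) E pt mulr0 mul0r oppr0.
Qed.

End Block.

(** The tangencies lie on the line [tilt = 0], where by homogeneity the level is 1 at only two
    antipodal points. Their distance is [2 * |p|], so they are isolated. *)
Lemma saddle_block Z Y M L phi A c : A != 0 ->
  flow_box Z M Y L phi -> (forall q, N q -> `|q| < M) ->
  (forall u, u != (0, 0) -> exists2 om, 0 < om & dG u (Z u) = om * tilt A c u) ->
  (forall u, u != (0, 0) -> tilt A c u = 0 -> 0 < tilt A c (Z u)) ->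
  [/\ block Z Y M L phi N, forall p, entry phi N p <-> G p = 1 /\ tilt A c p <= 0 &
     forall p, entry (rev phi) N p <-> G p = 1 /\ 0 <= tilt A c p].
Proof.
move=> A0 fb NM dGZ tiltZ.
have en := entry_level fb NM dGZ tiltZ.
have ex p : entry (rev phi) N p <-> G p = 1 /\ 0 <= tilt A c p.
  have := entry_level (flow_box_rev fb) NM (dlevel_rev dGZ) (tilt_rev tiltZ) p.
  by rewrite tiltN oppr_le0.
have ta := tau_level dGZ.
split=> //; split=> //.
- exact: sublevel_domain e1 sl sm dl dm lm.
- apply/seteqP; split=> p.
    move=> [/en[p1 h1] /ex[_ h2]]; apply/ta; split=> //.
    by apply/eqP; rewrite eq_le h1.
  by move=> /ta[p1 pt]; split; [apply/en|apply/ex]; rewrite pt lexx.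
move=> p tp; have [p1 pt] := (ta p).1 tp.
have pn : p != (0, 0).
  by apply: contra_eq_neq p1 => ->; rewrite /G level0 eq_sym oner_eq0.
have np : 0 < `|p| by rewrite normr_gt0.
split; first by rewrite inE.
exists [set q | `|q - p| < `|p|].
  exact: (@near_dist_lt R (R * R)%type p _ np).
apply/seteqP; split=> q; last by move=> ->; split=> //=; rewrite subrr normr0.
move=> [/= qp /ta[q1 qt]].
have w0 : wedge e p != 0.
  apply: contra_eq_neq pt => w0; rewrite /tilt w0 mulr0 addr0 mulf_neq0//.
  apply: contra pn => /eqP d0; apply/eqP.
  by rewrite (frameE p e1) d0 w0 !mul0r subr0 addr0.
have dE u : tilt A c u = 0 -> dot e u = - (c / A) * wedge e u.
  move=> ut; apply: (mulfI A0).
  have -> : A * (- (c / A) * wedge e u) = - (c * wedge e u) by field.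
  by move: ut; rewrite /tilt; lra.
pose b := wedge e q / wedge e p.
have qE : q = (b * p.1, b * p.2).
  have wE : wedge e q = b * wedge e p by rewrite divfK.
  have dqE : dot e q = b * dot e p by rewrite (dE _ qt) (dE _ pt) wE; ring.
  by rewrite (frameE q e1) wE dqE [in RHS](frameE p e1)/=; congr (_, _); ring.
have b1 : `|b| = 1.
  by have := levelZ e l m b p; rewrite -/(G _) -/(G p) -qE q1 p1 mulr1.
have [b0|b0] := leP 0 b.
  by move: b1; rewrite ger0_norm// => b1; rewrite qE b1 !mul1r -surjective_pairing.
move: b1; rewrite ltr0_norm// => b1; have {}b1 : b = -1 by rewrite -[b]opprK b1.
move: qp; have -> : q - p = (-2) *: p.
  rewrite qE b1 [LHS]surjective_pairing [RHS]surjective_pairing /= /GRing.scale/=.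
  by congr (_, _); ring.
rewrite normrZ normrN normr_nat => h; exfalso; move: h np.
by move: `|p| => y; lra.
Qed.

End LevelCrossing.

(** * The factor that completes the potential to a first integral *)

Section FirstIntegralFactor.
Variable R : realType.
Variables A c : R.
Hypothesis A0 : 0 < A.
Implicit Types (x y : R).

(** The function K of the overview. Along orbits, the derivative of [ln G] with respect to the slope
    [x = dot / wedge] is [(A x + c) / (1 + x ^ 2)]; this is a primitive of its opposite. *)
Definition conserve x : R := - c * atan x - A / 2 * ln (1 + x ^+ 2).

Let sq x : 0 < 1 + x ^+ 2. Proof. by rewrite ltr_pwDl// sqr_ge0. Qed.

Lemma is_derive_conserve x : is_derive x 1 conserve (- (A * x + c) / (1 + x ^+ 2)).
Proof.
have d1 := is_derive1_atan x.
pose q y : R := 1 + y ^+ 2.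
have d2 : is_derive x 1 q (2 * x) by apply: is_derive_eq; rewrite /GRing.scale/=; ring.
have d3 := is_derive1_comp (is_derive1_ln (sq x : 0 < q x)) d2.
have -> : conserve = fun y => - c * atan y - A / 2 * (@ln R \o q) y by [].
by apply: is_derive_eq; rewrite /GRing.scale/= /q; field; rewrite gt_eqF.
Qed.

(** The logarithm outweighs the bounded arctangent. This is why the first integral extends by 0 to
    the axis, where the slope becomes infinite. *)
Lemma conserve_small (d : R) : 0 < d ->
  exists2 T, 0 < T & forall x, T <= `|x| -> expR (conserve x) < d.
Proof.
move=> d0; pose B := 2 / A * (`|c| * pi - ln d + 1).
exists (expR B + 1); first by rewrite addr_gt0// expR_gt0.
move=> x xT; have eB := expR_gt0 B.
have h1 : B < ln (1 + x ^+ 2).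
  rewrite -[X in X < _]expRK ltr_ln ?posrE//.
  have : (expR B + 1) ^+ 2 <= `|x| ^+ 2 by rewrite lerXn2r// nnegrE; lra.
  by rewrite real_normK ?num_real//; nra.
have h2 : - c * atan x <= `|c| * pi.
  have := ler_norm (- c * atan x); rewrite normrM normrN => /le_trans; apply.
  rewrite ler_wpM2l// ler_norml; have := atan_ltpi2 x; have := atan_gtNpi2 x.
  by have := pi_gt0 R; lra.
have h3 : A / 2 * B < A / 2 * ln (1 + x ^+ 2) by rewrite ltr_pM2l ?divr_gt0.
have h4 : A / 2 * B = `|c| * pi - ln d + 1 by rewrite /B; field; rewrite gt_eqF.
rewrite -[X in _ < X](lnK d0) ltr_expR /conserve; lra.
Qed.

(** [conserve] has its maximum where [A x + c = 0] and is strictly monotone on either side of it;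
    the sign of [s] selects the side. *)
Lemma conserve_inj (s x y : R) : s != 0 -> 0 <= s * (A * x + c) -> 0 <= s * (A * y + c) ->
  conserve x = conserve y -> x = y.
Proof.
move=> s0; wlog : x y / x <= y.
  by move=> w hx hy xy; have [h|/ltW h] := leP x y; [exact: w|apply/esym/w].
rewrite le_eqVlt => /orP[/eqP //|xy] hx hy E; exfalso.
have [sp|sn] := ltP 0 s.
  have : - conserve x < - conserve y.
    apply: (@gt0_is_derive_lt _ (fun z => - conserve z) (fun z => - (- (A * z + c) / (1 + z ^+ 2))) x y xy).
      by move=> z _; apply: is_deriveN; exact: is_derive_conserve.
    move=> z /andP[xz _]; rewrite mulNr opprK; apply: divr_gt0 (sq z).
    have : 0 <= A * x + c by rewrite -(pmulr_rge0 _ sp).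
    have : A * x < A * z by rewrite ltr_pM2l.
    by lra.
  by rewrite E ltxx.
have {}sn : s < 0 by rewrite lt_neqAle s0 sn.
have : conserve x < conserve y.
  apply: (@gt0_is_derive_lt _ conserve (fun z => - (A * z + c) / (1 + z ^+ 2)) x y xy).
    by move=> z _; exact: is_derive_conserve.
  move=> z /andP[_ zy]; apply: divr_gt0 (sq z); rewrite oppr_gt0.
  have : A * y + c <= 0 by rewrite -(nmulr_rge0 _ sn).
  have : A * z < A * y by rewrite ltr_pM2l.
  by lra.
by rewrite E ltxx.
Qed.

End FirstIntegralFactor.

(** * Orbits near a saddle direction *)

Section SaddleOrbits.
Variable R : realType.
Variables (n : nat) (P Q : {poly {poly R}}).
Hypothesis V : Vhom n P Q.
Variable e : R * R.
Hypotheses (ce : char_vector P Q e) (a0 : 0 < alpha P Q e) (k0 : kappa P Q e < 0).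
Hypothesis single : forall u, u != (0, 0) -> dirD P Q u = 0 -> wedge e u = 0.
Variables (A c : R) (l l' m m' : R -> R).
Hypotheses (A0 : 0 < A) (sl : smooth_line setT l') (sm : smooth_line setT m').
Hypotheses (dl : forall x : R, is_derive x 1 l (l' x)) (dm : forall x : R, is_derive x 1 m (m' x)).
Hypothesis lm : forall x y : R, x != 0 -> y != 0 -> ln `|y| + l (x / y) = ln `|x| + m (y / x).
Hypothesis along : forall x y : R, y != 0 -> angular P Q e x y / y +
  l' (x / y) * (radial P Q e x y * y - x * angular P Q e x y) / y ^+ 2 =
  - (torque P Q e x y / y) / (x ^+ 2 + y ^+ 2) * (A * x + c * y).
Implicit Types (p q u v w : R * R) (x y s t : R).

Let X := vfield P Q.
Let G := level e l m.
Let dG := dlevel e l l' m m'.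
Let N := sublevel e l m.
Let tl := tilt e A c.
Let e1 : e.1 ^+ 2 + e.2 ^+ 2 = 1. Proof. by case: ce. Qed.
Let even : ~~ odd n. Proof. exact: (degree_even V ce single). Qed.
Let tq u := torque P Q e (dot e u) (wedge e u).

Let tq_sign u : wedge e u != 0 -> tq u / wedge e u < 0.
Proof. exact: (torque_sign V ce k0 single). Qed.

Let sum_sqr_gt0 x y : y != 0 -> 0 < x ^+ 2 + y ^+ 2.
Proof. by move=> y0; rewrite ltr_wpDl ?sqr_ge0// exprn_even_gt0. Qed.

Lemma dlevel_off_axis u : wedge e u != 0 -> dG u (X u) =
  G u * (- (tq u / wedge e u) / (dot e u ^+ 2 + wedge e u ^+ 2) * tl u).
Proof.
move=> y0; rewrite /dG /dlevel (negPf y0) -/(G u) (radialE ce) (angularE ce).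
by congr (_ * _); rewrite along.
Qed.

Lemma dlevel_saddle u : u != (0, 0) -> exists2 om, 0 < om & dG u (X u) = om * tl u.
Proof.
move=> u0; have Gu : 0 < G u by exact: level_gt0.
have [y0|y0] := eqVneq (wedge e u) 0; last first.
  exists (G u * (- (tq u / wedge e u) / (dot e u ^+ 2 + wedge e u ^+ 2))).
    by rewrite mulr_gt0// divr_gt0 ?oppr_gt0 ?tq_sign ?sum_sqr_gt0.
  by rewrite dlevel_off_axis// mulrA.
have x0 : dot e u != 0.
  by apply: contra u0 => /eqP d; apply/eqP; rewrite (frameE u e1) d y0 !mul0r subr0 addr0.
exists (G u * (alpha P Q e * dot e u ^+ n / (A * dot e u ^+ 2))).
  rewrite mulr_gt0// divr_gt0// mulr_gt0// ?exprn_even_gt0// ?x0 ?orbT//.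
rewrite /dG /dlevel y0 eqxx -/(G u) (radialE ce) (angularE ce) y0.
rewrite (radial_axis V ce) (angular_axis V ce) /tl /tilt y0.
by move: (m' _) => z; field; rewrite ?x0 ?gt_eqF.
Qed.

(** On the line [A x + c y = 0], eliminating [x] turns [tl (X u)] into [- A D / y], which is
    positive by [torque_sign]. *)
Lemma tilt_saddle u : u != (0, 0) -> tl u = 0 -> 0 < tl (X u).
Proof.
move=> u0 tu; have y0 : wedge e u != 0.
  apply: contra u0 => /eqP y0; apply/eqP; move: tu; rewrite /tl/tilt y0 mulr0 addr0 => /eqP.
  rewrite mulf_eq0 gt_eqF//= => /eqP d0.
  by rewrite (frameE u e1) d0 y0 !mul0r subr0 addr0.
have : 0 < - (tq u / wedge e u) * A by rewrite mulr_gt0// oppr_gt0 tq_sign.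
have dE : dot e u = - (c * wedge e u) / A.
  by rewrite -[LHS](mulKf (lt0r_neq0 A0)) mulrC; congr (_ / _); move: tu; rewrite /tl /tilt; lra.
congr (_ < _); rewrite /tl /tilt (radialE ce) (angularE ce) /tq /torque.
move: (radial _ _ _ _ _) (angular _ _ _ _ _) => r a; rewrite dE.
by field; rewrite y0 gt_eqF.
Qed.

Definition first_integral u : R :=
  if wedge e u == 0 then 0 else G u * expR (conserve A c (dot e u / wedge e u)).

Lemma first_integral_gt0 u : wedge e u != 0 -> 0 < first_integral u.
Proof.
move=> y0; rewrite /first_integral (negPf y0) mulr_gt0 ?expR_gt0//.
by apply: level_gt0 => //; apply: contraNneq y0 => ->; rewrite /wedge/= !mulr0 subr0.
Qed.

Lemma first_integral_ge0 u : 0 <= first_integral u.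
Proof.
have [y0|/first_integral_gt0/ltW//] := eqVneq (wedge e u) 0.
by rewrite /first_integral y0 eqxx.
Qed.

(** Near a point of the axis other than the origin, G is bounded and the slope tends to infinity, so
    [conserve_small] gives the limit 0. *)
Lemma first_integral_continuous p : p != (0, 0) -> {for p, continuous first_integral}.
Proof.
move=> pn; have cG := @level_continuous _ _ _ _ _ _ e1 sl sm dl dm lm p.
have cd : {for p, continuous (dot e)}.
  by apply: cvgD; apply: cvgM; try exact: cvg_cst; [exact: cvg_fst|exact: cvg_snd].
have cw : {for p, continuous (wedge e)}.
  by apply: cvgB; apply: cvgM; try exact: cvg_cst; [exact: cvg_snd|exact: cvg_fst].
have [y0|y0] := eqVneq (wedge e p) 0; last first.
  have cF : {for p, continuous (fun u => G u * expR (conserve A c (dot e u / wedge e u)))}.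
    apply: cvgM; first exact: cG.
    apply: continuous_comp; last exact: continuous_expR.
    apply: (@continuous_comp _ _ _ (fun u => dot e u / wedge e u)).
      by apply: cvgM; [exact: cd|exact: cvgV].
    exact: is_derive_continuous (is_derive_conserve A c _).
  have nb : \forall u \near p, wedge e u != 0 by exact: (cvgr_neq0 _ cw y0).
  rewrite /prop_for /continuous_at {2}/first_integral (negPf y0).
  move: cF; apply: cvg_trans; apply: near_eq_cvg; apply: filterS nb => u u0.
  by rewrite /first_integral (negPf u0).
have x0 : dot e p != 0.
  by apply: contra pn => /eqP d; apply/eqP; rewrite (frameE p e1) d y0 !mul0r subr0 addr0.
have xp : 0 < `|dot e p| by rewrite normr_gt0.
apply/continuous_atP => d d0; rewrite [first_integral p]/first_integral y0 eqxx.
have B0 : 0 < G p + 1 by rewrite addr_gt0// level_gt0.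
have [T T0 hT] := conserve_small c A0 (divr_gt0 d0 B0).
have [d1 d10 h1] := (continuous_atP _ _).1 cG 1 ltr01.
have x2 : 0 < `|dot e p| / 2 by rewrite divr_gt0.
have [d2 d20 h2] := (continuous_atP _ _).1 cd _ x2.
have xT : 0 < `|dot e p| / 2 / T by rewrite divr_gt0.
have [d3 d30 h3] := (continuous_atP _ _).1 cw _ xT.
have [r [r0 [r1 r2 r3]]] : exists r, 0 < r /\ [/\ r <= d1, r <= d2 & r <= d3].
  by exists (Num.min d1 (Num.min d2 d3)); rewrite !lt_min d10 d20 d30 !ge_min !lexx !orbT.
exists r => // q qr; rewrite subr0 (ger0_norm (first_integral_ge0 q)).
rewrite /first_integral; case: (eqVneq (wedge e q) 0) => // yq.
have g1 : G q <= G p + 1.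
  by have := h1 q (lt_le_trans qr r1); rewrite -/(G q) -/(G p) ltr_norml => /andP[]; lra.
have g2 : `|dot e p| / 2 < `|dot e q|.
  have := h2 q (lt_le_trans qr r2); have := ler_distD (dot e q) (dot e p) 0.
  by rewrite !subr0 distrC; lra.
have g3 : T <= `|dot e q / wedge e q|.
  rewrite normrM normfV ler_pdivlMr ?normr_gt0//.
  have := h3 q (lt_le_trans qr r3); rewrite y0 subr0 ltr_pdivlMr// mulrC; lra.
have q0 : q != (0, 0) by apply: contraNneq yq => ->; rewrite /wedge/= !mulr0 subr0.
have Gq : 0 < G q by exact: level_gt0.
apply: (@le_lt_trans _ _ ((G p + 1) * expR (conserve A c (dot e q / wedge e q)))).
  by rewrite ler_pM2r// expR_gt0.
by rewrite mulrC -ltr_pdivlMr//; exact: hT.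
Qed.

(** * Orbits of the field and of its opposite, treated together through the sign [sg] *)

Section Orbit.
Variables (Z Y : R * R -> R * R) (M L : R) (phi : R * R -> R -> R * R) (sg : R).
Hypotheses (fb : flow_box Z M Y L phi) (NM : forall q, N q -> `|q| < M).
Hypotheses (sg1 : sg * sg = 1) (ZE : forall u, Z u = (sg * (X u).1, sg * (X u).2)).

Let fl : is_flow Y L phi. Proof. by case: fb. Qed.

Let homZ a u : Z (a * u.1, a * u.2) = (a ^+ n * (Z u).1, a ^+ n * (Z u).2).
Proof. by rewrite !ZE /X (vfieldZ V)/=; congr (_, _); ring. Qed.

Let Ze : Z e = (sg * alpha P Q e * e.1, sg * alpha P Q e * e.2).
Proof. by rewrite ZE /X (vfield_char ce)/= !mulrA. Qed.

Let eN1 : (- e.1, - e.2).1 ^+ 2 + (- e.1, - e.2).2 ^+ 2 = 1 :> R.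
Proof. by rewrite /= !sqrrN. Qed.

(** As [n] is even, the field takes the same value at [e] and at [- e]: one half of the axis is
    outgoing and the other incoming. *)
Let ZeN : Z (- e.1, - e.2) = (- (sg * alpha P Q e) * - e.1, - (sg * alpha P Q e) * - e.2).
Proof.
have := homZ (-1) e; rewrite !mulN1r => ->; rewrite -signr_odd (negPf even) expr0 !mul1r.
by rewrite Ze/= !mulrNN.
Qed.

Let wedgeN u : wedge (- e.1, - e.2) u = - wedge e u.
Proof. by rewrite /wedge/=; ring. Qed.

Let dotN u : dot (- e.1, - e.2) u = - dot e u.
Proof. by rewrite /dot/=; ring. Qed.

Lemma orbit_side p T : 0 <= T -> (forall s, 0 <= s <= T -> N (phi p s)) ->
  [/\ wedge e p = 0 -> wedge e (phi p T) = 0, wedge e p != 0 -> wedge e (phi p T) != 0 &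
      0 <= wedge e p * wedge e (phi p T)].
Proof.
move=> T0 pN; have box s : 0 <= s <= T -> `|phi p s| <= M by move=> /pN/NM/ltW.
have [z pos] := wedge_keep fb homZ e1 Ze T0 box.
have [_] := wedge_keep fb homZ eN1 ZeN T0 box; rewrite !wedgeN !oppr_gt0 => neg.
split=> // [w0|].
  have [w|w] := ltP 0 (wedge e p); first by rewrite gt_eqF// pos.
  by rewrite lt_eqF// neg// lt_neqAle w0.
have [w|w] := ltP 0 (wedge e p); first by rewrite mulr_ge0 ?(ltW w)// ltW// pos.
have [w0|w0] := eqVneq (wedge e p) 0; first by rewrite w0 mul0r.
have wn : wedge e p < 0 by rewrite lt_neqAle w0.
by rewrite mulr_le0// ltW// neg.
Qed.

Let pnz u : wedge e u != 0 -> u != (0, 0).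
Proof. by apply: contraNneq => ->; rewrite /wedge/= !mulr0 subr0. Qed.

Lemma orbit_slope p t : `|phi p t| <= M -> wedge e (phi p t) != 0 ->
  is_derive t 1 (fun s => dot e (phi p s) / wedge e (phi p s))
    (sg * (- (tq (phi p t) / wedge e (phi p t)) / wedge e (phi p t))).
Proof.
move=> pM y0; have [_ _ YZ] := fb; have dp := flow_derive fl p t.
rewrite (YZ _ pM) ZE in dp.
have d1 := is_derive_dot e dp; have d2 := is_derive_wedge e dp.
rewrite dotZ (radialE ce) in d1; rewrite wedgeZr (angularE ce) in d2.
have d3 := @is_deriveV R (fun s => wedge e (phi p s)) t _ 1 y0 d2.
apply: (is_derive_eq (is_deriveM d1 d3)); rewrite /GRing.scale/= /tq /torque.
by move: (radial _ _ _ _ _) (angular _ _ _ _ _) => r a; field.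
Qed.

Lemma orbit_integral p T : 0 <= T -> (forall s, 0 <= s <= T -> N (phi p s)) ->
  first_integral (phi p T) = first_integral p.
Proof.
move=> T0 pN; have TT : 0 <= T <= T by rewrite T0 lexx.
have side s : 0 <= s <= T -> [/\ wedge e p = 0 -> wedge e (phi p s) = 0,
    wedge e p != 0 -> wedge e (phi p s) != 0 & 0 <= wedge e p * wedge e (phi p s)].
  move=> /andP[s0 sT]; apply: orbit_side => // u /andP[u0 us].
  by apply: pN; rewrite u0 (le_trans us).
have [y0|y0] := eqVneq (wedge e p) 0.
  have [h _ _] := side _ TT; by rewrite /first_integral (h y0) y0 eqxx.
pose J s := G (phi p s) * expR (conserve A c (dot e (phi p s) / wedge e (phi p s))).
have E s : 0 <= s <= T -> first_integral (phi p s) = J s.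
  by move=> /side[_ h _]; rewrite /first_integral (negPf (h y0)).
have E0 := E 0; rewrite (flow_start fl) lexx T0 in E0.
rewrite (E _ TT) (E0 isT); apply/esym/(is_derive0_eq T0) => s sT.
have [_ /(_ y0) ys _] := side s sT; have pM := ltW (NM (pN s sT)).
have [_ _ YZ] := fb; have dp := flow_derive fl p s; rewrite (YZ _ pM) ZE in dp.
have d1 := is_derive_level e1 dl dm lm (pnz ys) dp; rewrite dlevelZ in d1.
pose h r := dot e (phi p r) / wedge e (phi p r).
have dh : is_derive s 1 h _ := orbit_slope pM ys.
have d2 := is_derive1_comp (is_derive_conserve A c (h s)) dh.
have d3 := is_derive1_comp (is_derive_expR ((conserve A c \o h) s)) d2.
have -> : J = (level e l m \o phi p) * (expR \o (conserve A c \o h)) by [].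
apply: (is_derive_eq (is_deriveM d1 d3)); rewrite /GRing.scale/=.
rewrite -/(G _) -/(dG _ _) dlevel_off_axis// /tl /tilt /h.
move: (expR _) (tq _) (G _) => E' t' G'.
have r0 := sum_sqr_gt0 (dot e (phi p s)) ys.
have -> : 1 + (dot e (phi p s) / wedge e (phi p s)) ^+ 2 =
  (dot e (phi p s) ^+ 2 + wedge e (phi p s) ^+ 2) / wedge e (phi p s) ^+ 2 by field.
by field; rewrite ys gt_eqF.
Qed.

(** On an orbit that stays, [G <= 1] and the first integral is a positive constant, which bounds the
    slope. Then [wedge] is bounded away from 0 and the slope moves in one direction at a speed
    bounded below, a contradiction. *)
Lemma orbit_escape p : wedge e p != 0 -> ~ stays phi N p.
Proof.
move=> y0 st; have F0 := first_integral_gt0 y0.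
have [T T0 hT] := conserve_small c A0 F0.
have M0 : 0 < M by exact: le_lt_trans (NM (st 0 (lexx 0))).
pose h t := dot e (phi p t) / wedge e (phi p t).
have side t : 0 <= t -> wedge e (phi p t) != 0 /\ 0 <= wedge e p * wedge e (phi p t).
  move=> t0; have [|_ h1 h2] := @orbit_side p t t0; last by split; [exact: h1|].
  by move=> s /andP[s0 _]; exact: st.
have inte t : 0 <= t -> first_integral (phi p t) = first_integral p.
  by move=> t0; apply: orbit_integral => // s /andP[s0 _]; exact: st.
have FE t : 0 <= t -> first_integral p = G (phi p t) * expR (conserve A c (h t)).
  by move=> t0; rewrite -(inte t t0) /first_integral; have [/negPf -> _] := side t t0.
have hb t : 0 <= t -> `|h t| < T.
  move=> t0; rewrite ltNge; apply/negP => /hT; rewrite ltNge => /negP; apply.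
  by rewrite (FE t t0) ger_pMl ?expR_gt0//; exact: st.
have cont f f' : (forall x : R, is_derive x (1 : R) f (f' x : R)) -> continuous f.
  by move=> df x; exact: is_derive_continuous (df x).
have TT : - T <= T by lra.
have [B hB] : exists B, forall x, `|x| <= T -> l x + conserve A c x <= B.
  have cs : continuous (fun x => l x + conserve A c x).
    by move=> x; apply: cvgD; [exact: (cont _ _ dl)|exact: (cont _ _ (is_derive_conserve A c))].
  have [|b _ hb'] := @EVT_max R (fun x => l x + conserve A c x) _ _ TT.
    exact: continuous_subspaceT.
  by exists (l b + conserve A c b) => x xT; apply: hb'; rewrite in_itv/= -ler_norml.
have [d d0 hd] : exists2 d, 0 < d & forall x, `|x| <= T -> torque P Q e x 1 <= - d.
  have ct : continuous (fun x => torque P Q e x 1).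
    have ch F : continuous (fun x : R => F.[x, 1]).
      by move=> x; exact: continuous_horner2 (is_derive_id _ _) (is_derive_cst _ _ _).
    move=> x; apply: cvgB; apply: cvgM; [exact: cvg_id|exact: ch|exact: cvg_cst|exact: ch].
  have [|b _ hb'] := @EVT_max R (fun x => torque P Q e x 1) _ _ TT.
    exact: continuous_subspaceT.
  exists (- torque P Q e b 1).
    have := torque_sign V ce k0 single b (oner_neq0 R).
    by rewrite divr1 oppr_gt0.
  by move=> x xT; rewrite opprK; apply: hb'; rewrite in_itv/= -ler_norml.
(* The first integral equals [|wedge|] times [exp (l + conserve)] at the slope, and the exponent is
   at most [B]. *)
pose y1 := first_integral p * expR (- B).
have y10 : 0 < y1 by rewrite mulr_gt0// expR_gt0.
have yb t : 0 <= t -> y1 <= `|wedge e (phi p t)|.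
  move=> t0; have [yt _] := side t t0.
  have GE : G (phi p t) = `|wedge e (phi p t)| * expR (l (h t)) by rewrite /G /level potential2.
  rewrite /y1 (FE t t0) GE -!mulrA ler_piMr// -!expRD -expR0 ler_expR.
  by have := hB (h t) (ltW (hb t t0)); lra.
pose b := `|wedge e p| / (2 * M) * (y1 ^+ n * d).
have yp : 0 < `|wedge e p| by rewrite normr_gt0.
have b0 : 0 < b by rewrite mulr_gt0// ?divr_gt0// ?mulr_gt0// exprn_gt0.
(* The factor orients the slope so that it increases on either side of the axis and for either sign
   of time. It ranges over a length of at most [2 * |wedge e p| * T], which speed [b] exceeds at
   time [S]. *)
pose k t := sg * wedge e p * h t.
have kb t : 0 <= t -> `|k t| <= `|wedge e p| * T.
  move=> t0; rewrite /k normrM normrM.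
  have -> : `|sg| = 1 by apply/eqP; rewrite -(@eqrXn2 _ 2)// expr1n real_normK ?num_real// expr2 sg1.
  by rewrite mul1r ler_wpM2l// ltW// hb.
pose S := (2 * `|wedge e p| * T + 1) / b.
have S0 : 0 <= S by rewrite divr_ge0 ?(ltW b0)// addr_ge0// mulr_ge0 ?(ltW T0)// mulr_ge0// ltW.
have : b * (S - 0) <= k S - k 0.
  apply: (@is_derive_le_sub _ k (fun t => wedge e p * (- (tq (phi p t) / wedge e (phi p t)) / wedge e (phi p t))) 0 S b S0).
    move=> t /andP[t0 _]; have [yt _] := side t t0.
    have dh : is_derive t 1 h _ := orbit_slope (ltW (NM (st t t0))) yt.
    have dk := is_deriveM (is_derive_cst (sg * wedge e p) t (1 : R)) dh.
    have -> : k = (fun=> sg * wedge e p) * h by [].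
    apply: (is_derive_eq dk); rewrite scaler0 addr0 /GRing.scale/=.
    by rewrite mulrACA -[RHS]mul1r -sg1; ring.
  move=> t /andP[t0 _]; have [yt ys] := side t t0.
  have tE : - (tq (phi p t) / wedge e (phi p t)) = wedge e (phi p t) ^+ n * - torque P Q e (h t) 1.
    have -> : tq (phi p t) = wedge e (phi p t) ^+ n.+1 * torque P Q e (h t) 1.
      by rewrite -(torqueZ V ce) mulr1 mulrC divfK.
    by rewrite exprS; field.
  rewrite tE mulrA mulrAC.
  have yE : wedge e p / wedge e (phi p t) = `|wedge e p| / `|wedge e (phi p t)|.
    have q0 : 0 <= wedge e p / wedge e (phi p t).
      have -> : wedge e p / wedge e (phi p t) =
        wedge e p * wedge e (phi p t) / wedge e (phi p t) ^+ 2 by field.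
      by rewrite divr_ge0// sqr_ge0.
    by rewrite -(ger0_norm q0) normrM normfV.
  have nE : wedge e (phi p t) ^+ n = `|wedge e (phi p t)| ^+ n by rewrite -normrX ger0_norm// exprn_even_ge0.
  rewrite yE nE /b; apply: ler_pM.
  - by rewrite divr_ge0// mulr_ge0// ltW.
  - by rewrite mulr_ge0 ?(ltW d0)// exprn_ge0// ltW.
  - rewrite ler_wpM2l// lef_pV2 ?posrE ?mulr_gt0 ?normr_gt0//.
    have := wedge_le (phi p t) e1; have := NM (st t t0); lra.
  apply: ler_pM; [by rewrite exprn_ge0// ltW|exact: ltW| |].
    by rewrite lerXn2r ?nnegrE ?(ltW y10)// yb.
  by rewrite lerNr hd// ltW// hb.
rewrite subr0 /S mulrC divfK ?gt_eqF//.
have := kb S S0; have := kb 0 (lexx 0); rewrite !ler_norml => /andP[? ?] /andP[? ?]; lra.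
Qed.

Lemma orbit_axis_escape p : wedge e p = 0 -> 0 < sg * dot e p -> ~ stays phi N p.
Proof.
move=> wp dp st.
have Z0 : Z (0, 0) = (0, 0).
  by rewrite ZE; have -> : X (0, 0) = (0, 0); [case: V => _ _ []|rewrite /= mulr0].
have box t : 0 <= t -> `|phi p t| <= M by move=> /st/NM/ltW.
have [d|d] := ltP 0 (dot e p).
  have sp : 0 < sg by rewrite -(pmulr_lgt0 _ d).
  by apply: (ray_escape fb homZ Z0 e1 Ze _ wp d box); rewrite mulr_gt0.
have {}d : dot e p < 0.
  by rewrite lt_neqAle d andbT; apply: contraTneq dp => ->; rewrite mulr0 ltxx.
have sn : sg < 0 by rewrite -(nmulr_lgt0 _ d).
apply: (ray_escape fb homZ Z0 eN1 ZeN _ _ _ box).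
- by rewrite oppr_gt0 nmulr_rlt0.
- by rewrite wedgeN wp oppr0.
- by rewrite dotN oppr_gt0.
Qed.

Lemma orbit_axis p T : sg = 1 -> 0 <= T -> (forall s, 0 <= s <= T -> N (phi p s)) ->
  wedge e p = 0 -> dot e p < 0 -> wedge e (phi p T) = 0 /\ dot e (phi p T) < 0.
Proof.
move=> sgE T0 pN wp dp; have box s : 0 <= s <= T -> `|phi p s| <= M by move=> /pN/NM/ltW.
have Z0 : Z (0, 0) = (0, 0).
  by rewrite ZE; have -> : X (0, 0) = (0, 0); [case: V => _ _ []|rewrite /= mulr0].
have := ray_keep fb homZ Z0 eN1 ZeN T0 box; rewrite !wedgeN !dotN wp oppr0 !oppr_gt0.
by move=> /(_ erefl dp)[/eqP]; rewrite oppr_eq0 => /eqP.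
Qed.

End Orbit.

(** * The exit map and its extension to the axis *)

Section Exit.
Variables (Y : R * R -> R * R) (M L : R) (phi : R * R -> R -> R * R).
Hypotheses (B : block X Y M L phi N)
  (en : forall p, entry phi N p <-> G p = 1 /\ tl p <= 0)
  (ex : forall p, entry (rev phi) N p <-> G p = 1 /\ 0 <= tl p).

Let fb : flow_box X M Y L phi. Proof. by case: B. Qed.
Let NM : forall q, N q -> `|q| < M. Proof. by case: B. Qed.

Let XE u : X u = (1 * (X u).1, 1 * (X u).2).
Proof. by rewrite !mul1r -surjective_pairing. Qed.

Let XN u : - X u = (-1 * (X u).1, -1 * (X u).2). Proof. exact: plane_opp. Qed.

Let m11 : (-1) * (-1) = 1 :> R. Proof. by rewrite mulrNN mulr1. Qed.
Let p11 : 1 * 1 = 1 :> R. Proof. by rewrite mulr1. Qed.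

Let Np p : G p = 1 -> N p. Proof. by rewrite /N/sublevel/= -/(G p) => ->. Qed.

Let p0 p : G p = 1 -> p != (0, 0).
Proof. by apply: contra_eq_neq => ->; rewrite /G level0 eq_sym oner_eq0. Qed.

Let M0 : 0 < M.
Proof. by apply: le_lt_trans (NM (_ : N (0, 0))) => //; rewrite /N/sublevel/= level0. Qed.

(* A closed relation characterising the exit point [w] of the orbit entering at [p]
   and, on the axis, its limit. *)
Definition exit_rel p w := [/\ entry (rev phi) N w,
  first_integral w = first_integral p & 0 <= wedge e p * wedge e w].

(** Off the axis, [w] and [w'] are on the same side and have level 1, so [conserve] takes equal
    values at their slopes; [tl >= 0] puts both slopes on one side of the maximum, and
    [conserve_inj] applies. On the axis, the only exit point is the multiple of [e] of level 1 with
    positive [dot]. *)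
Lemma exit_rel_uniq p w w' : exit_rel p w -> exit_rel p w' -> w = w'.
Proof.
move=> [/ex[w1 wt] wF wp] [/ex[w1' wt'] wF' wp'].
have on_axis u : G u = 1 -> 0 <= tl u -> wedge e u = 0 ->
    u = (dot e u * e.1, dot e u * e.2) /\ dot e u * G e = 1.
  move=> u1 ut u0; have uE : u = (dot e u * e.1, dot e u * e.2).
    by rewrite {1}(frameE u e1) u0 !mul0r subr0 addr0.
  split=> //; have d0 : 0 <= dot e u by move: ut; rewrite /tl /tilt u0 mulr0 addr0 pmulr_rge0.
  by rewrite -u1 {2}uE /G levelZ ger0_norm.
have F0 u : (first_integral u == 0) = (wedge e u == 0).
  have [u0|u0] := eqVneq (wedge e u) 0; first by rewrite /first_integral u0 !eqxx.
  by rewrite gt_eqF// first_integral_gt0.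
have [z|z] := eqVneq (wedge e w) 0.
  have z' : wedge e w' = 0 by apply/eqP; rewrite -F0 wF' -wF F0 z eqxx.
  have [wE dw] := on_axis w w1 wt z; have [wE' dw'] := on_axis w' w1' wt' z'.
  have Ge : G e != 0 by apply: contra_eq_neq dw => ->; rewrite mulr0 eq_sym oner_eq0.
  have dd : dot e w = dot e w' by apply: (mulIf Ge); rewrite dw dw'.
  by rewrite wE wE' dd.
have z' : wedge e w' != 0 by rewrite -F0 wF' -wF F0.
have zp : wedge e p != 0 by rewrite -F0 -wF F0.
have yy : 0 < wedge e w / wedge e w'.
  have : 0 <= (wedge e p * wedge e w) * (wedge e p * wedge e w') by rewrite mulr_ge0.
  have -> : (wedge e p * wedge e w) * (wedge e p * wedge e w') =
    (wedge e p * wedge e w') ^+ 2 * (wedge e w / wedge e w') by field.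
  rewrite pmulr_rge0 ?exprn_even_gt0 ?mulf_neq0//= le_eqVlt => /orP[|//].
  by rewrite eq_sym mulf_eq0 invr_eq0 (negPf z) (negPf z').
have tt : dot e w / wedge e w = dot e w' / wedge e w'.
  apply: (@conserve_inj _ A c A0 _ _ _ z).
  - have -> : wedge e w * (A * (dot e w / wedge e w) + c) = tl w by rewrite /tl /tilt; field.
    exact: wt.
  - have -> : wedge e w * (A * (dot e w' / wedge e w') + c) = wedge e w / wedge e w' * tl w'.
      by rewrite /tl /tilt; field.
    by rewrite mulr_ge0// ltW.
  apply: expR_inj; move: (etrans wF (esym wF')).
  by rewrite /first_integral (negPf z) (negPf z') w1 w1' !mul1r.
pose b := wedge e w / wedge e w'.
have wE : w = (b * w'.1, b * w'.2).
  have yE : wedge e w = b * wedge e w' by rewrite divfK.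
  have xE : dot e w = b * dot e w'.
    by rewrite -[LHS](divfK z) tt yE; field.
  by rewrite (frameE w e1) yE xE [in RHS](frameE w' e1)/=; congr (_, _); ring.
have b1 : b = 1.
  by have := levelZ e l m b w'; rewrite -/(G _) -/(G w') -wE w1 w1' mulr1 gtr0_norm.
by rewrite wE b1 !mul1r -surjective_pairing.
Qed.

(** On the axis, where the first integral is 0, the extension sends an entry point to its antipode;
    this serves both the existence of values and surjectivity. *)
Let antipode p : wedge e p = 0 -> G p = 1 -> let w := (-1 * p.1, -1 * p.2) in
  [/\ G w = 1, tl w = - tl p, first_integral w = first_integral p &
      0 <= wedge e p * wedge e w].
Proof.
move=> wp p1 w; split.
- by rewrite /G levelZ normrN normr1 mul1r.
- by rewrite /tl /tilt dotZ wedgeZr; ring.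
- by rewrite /first_integral wedgeZr wp mulr0 eqxx.
- by rewrite wp mul0r.
Qed.

Lemma axis_stays p : entry phi N p -> wedge e p = 0 -> stays phi N p.
Proof.
move=> /en[p1 pt] wp; apply: contrapT => ns.
have dp : dot e p < 0.
  move: pt; rewrite /tl /tilt wp mulr0 addr0 pmulr_rle0// le_eqVlt => /orP[/eqP d0|//].
  by have := p0 p1; rewrite (frameE p e1) d0 wp !mul0r subr0 addr0 eqxx.
have [t [t0 ht /ex[_ wt]]] := exit_exists B (Np p1) ns.
have [z d] := orbit_axis fb NM XE erefl t0 ht wp dp.
by move: wt; rewrite /tl /tilt z mulr0 addr0 pmulr_rge0// leNgt d.
Qed.

Lemma off_axis_exits p : N p -> wedge e p != 0 -> exists2 w, exit_rel p w & exits_at phi N p w.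
Proof.
move=> Npp wp; have [t [t0 ht et]] := exit_exists B Npp (orbit_escape fb NM p11 XE wp).
exists (phi p t); last exact: exit_exits_at B _ _ t0 ht et.
by split=> //; [exact: (orbit_integral fb NM XE)|have [] := orbit_side fb NM XE t0 ht].
Qed.

Lemma exit_rel_exists p : entry phi N p -> exists2 w, exit_rel p w &
  ~ stays phi N p -> exits_at phi N p w.
Proof.
move=> ep; have [p1 pt] := (en p).1 ep; have [wp|wp] := eqVneq (wedge e p) 0.
  have [w1 wt wF ww] := antipode wp p1; eexists; last by move/(_ (axis_stays ep wp)).
  by split; [apply/ex; split; [exact: w1|rewrite wt oppr_ge0]|exact: wF|exact: ww].
by have [w rw xw] := off_axis_exits (Np p1) wp; exists w.
Qed.

Lemma exit_rel_onto w : entry (rev phi) N w -> exists2 p, entry phi N p & exit_rel p w.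
Proof.
move=> ew; have [w1 wt] := (ex w).1 ew; have [ww|ww] := eqVneq (wedge e w) 0.
  have [p1 pt pF pp] := antipode ww w1; exists (-1 * w.1, -1 * w.2).
    by apply/en; split; [exact: p1|rewrite pt oppr_le0].
  by split; [|exact: esym|rewrite mulrC].
have esc := orbit_escape (flow_box_rev fb) NM m11 XN ww.
have [t [t0 ht et]] := exit_exists (block_rev B) (Np w1) esc.
rewrite rev_rev in et; exists (rev phi w t) => //; split=> //.
  exact/esym/(orbit_integral (flow_box_rev fb) NM XN).
by rewrite mulrC; have [] := orbit_side (flow_box_rev fb) NM XN t0 ht.
Qed.

(** The point is pushed across the axis and brought back to the level curve by dividing by its
    level. At [p] the [tilt] is strictly negative, so it remains negative nearby. *)
Lemma off_axis_dense p d : entry phi N p -> wedge e p = 0 -> 0 < d ->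
  exists q, [/\ entry phi N q, `|q - p| < d & wedge e q != 0].
Proof.
move=> /en[p1 pt] wp d0; have pn := p0 p1.
have tp : tl p < 0.
  rewrite lt_neqAle pt andbT; apply: contra pn => /eqP t0; apply/eqP; move: t0.
  rewrite /tl /tilt wp mulr0 addr0 => /eqP; rewrite mulf_eq0 gt_eqF//= => /eqP dp.
  by rewrite (frameE p e1) dp wp !mul0r subr0 addr0.
pose v s := s *: (- e.2, e.1) + p.
have v0 : v 0 = p by rewrite /v scale0r add0r.
have dv : is_derive (0 : R) 1 v (- e.2, e.1) := is_derive_line (- e.2, e.1) p 0.
have vn : v 0 != (0, 0) by rewrite v0.
have dGv := is_derive_level e1 dl dm lm vn dv.
have G0 : (G \o v) 0 != 0 by rewrite /= v0 p1 oner_neq0.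
have ci := is_derive_continuous (is_deriveV G0 dGv).
have c1 := is_derive_continuous (is_derive_fst dv).
have c2 := is_derive_continuous (is_derive_snd dv).
pose g s := ((G (v s))^-1 * (v s).1, (G (v s))^-1 * (v s).2).
have g0 : g 0 = p by rewrite /g v0 p1 invr1 !mul1r -surjective_pairing.
have cg : {for (0 : R), continuous g}.
  by apply: continuous_pair_at; [exact: cvgM ci c1|exact: cvgM ci c2].
(* A Lipschitz constant for [tl], made positive by the added 1. *)
pose K := 2 * (`|A| + `|c|) + 1.
have K0 : 0 < K by rewrite /K ltr_wpDl// mulr_ge0// addr_ge0.
have r0 : 0 < Num.min d (- tl p / K) by rewrite lt_min d0 divr_gt0// oppr_gt0.
have [h h0 hg] := (continuous_atP _ _).1 cg _ r0.
have /hg : `|h / 2 - 0| < h by rewrite subr0 gtr0_norm ?divr_gt0//; lra.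
rewrite g0 lt_min => /andP[gd gt].
have wv : wedge e (v (h / 2)) = h / 2.
  rewrite /v /wedge /= /GRing.scale/=.
  transitivity (h / 2 * (e.1 ^+ 2 + e.2 ^+ 2) + wedge e p); first by rewrite /wedge; ring.
  by rewrite wp e1 mulr1 addr0.
have vh : v (h / 2) != (0, 0).
  apply/eqP => v00; move: wv; rewrite v00 /wedge/= !mulr0 subr0; lra.
have Gv : 0 < G (v (h / 2)) by exact: level_gt0.
exists (g (h / 2)); split=> //; last first.
  by rewrite wedgeZr wv mulf_neq0// ?invr_eq0 ?gt_eqF// divr_gt0.
apply/en; split.
  have := levelZ e l m (G (v (h / 2)))^-1 (v (h / 2)); rewrite -/(G _) -/(G (v _)) => ->.
  move: Gv; move: (G (v (h / 2))) => x x0.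
  by rewrite gtr0_norm ?invr_gt0// mulVf// gt_eqF.
have tE : tl (g (h / 2)) = tl p + tl (g (h / 2) - p) by rewrite /tl /tilt dotB wedgeB; ring.
have : `|tl (g (h / 2) - p)| <= K * `|g (h / 2) - p|.
  rewrite /tl /tilt (le_trans (ler_normD _ _))// !normrM /K.
  have b1 := dot_le (g (h / 2) - p) e1; have b2 := wedge_le (g (h / 2) - p) e1.
  have b3 : `|A| * `|dot e (g (h / 2) - p)| <= `|A| * (2 * `|g (h / 2) - p|) by rewrite ler_wpM2l.
  have b4 : `|c| * `|wedge e (g (h / 2) - p)| <= `|c| * (2 * `|g (h / 2) - p|) by rewrite ler_wpM2l.
  by have := normr_ge0 (g (h / 2) - p); move: b3 b4; lra.
have : K * `|g (h / 2) - p| < - tl p by rewrite mulrC -ltr_pdivlMr.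
by rewrite tE => b1 /ler_normlP[b2 b3]; lra.
Qed.

Section Map.
Variable f : R * R -> R * R.
Hypothesis fR : forall p, entry phi N p -> exit_rel p (f p).

(** A closed graph argument: on the compact set of exit points at distance at least [d] from [f p],
    the defect of the closed relation [exit_rel p] has a positive minimum by uniqueness. For [q]
    near [p] the defect at [f q] is smaller, so [f q] is within [d] of [f p]. *)
Lemma exit_map_continuous : continuous_in (entry phi N) f.
Proof.
move=> p ep d d0; have [p1 pt] := (en p).1 ep.
have cG q := @level_continuous _ _ _ _ _ _ e1 sl sm dl dm lm q.
have cd : continuous (dot e).
  by move=> q; apply: cvgD; apply: cvgM; try exact: cvg_cst; [exact: cvg_fst|exact: cvg_snd].
have cw : continuous (wedge e).
  by move=> q; apply: cvgB; apply: cvgM; try exact: cvg_cst; [exact: cvg_snd|exact: cvg_fst].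
have ct : continuous tl.
  by move=> q; apply: cvgD; apply: cvgM; try exact: cvg_cst; [exact: cd|exact: cw].
pose K := [set w | G w = 1] `&` [set w | 0 <= tl w] `&` [set w | d <= `|w - f p|].
have cK : compact K.
  apply: (compact_sublevel_closed e1 dl dm lm); last by move=> w [[/Np]].
  apply: closedI; first apply: closedI.
  - have -> : [set w | G w = 1] = G @^-1` [set x | x = 1] by [].
    by apply: closed_comp => [u _|]; [exact: cG|exact: closed_eq].
  - have -> : [set w | 0 <= tl w] = tl @^-1` [set x | 0 <= x] by [].
    by apply: closed_comp => [u _|]; [exact: ct|exact: closed_ge].
  have -> : [set w | d <= `|w - f p|] = (fun w => `|w - f p|) @^-1` [set x | d <= x] by [].
  apply: closed_comp => [u _|]; last exact: closed_ge.
  by apply: cvg_norm; apply: cvgB; [exact: cvg_id|exact: cvg_cst].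
(* The defect: by how much [w] violates the equality of first integrals and the condition on the
   side of the axis. *)
pose D w := `|first_integral w - first_integral p| + Num.max 0 (- (wedge e p * wedge e w)).
have [K0|Kn] := pselect (K !=set0); last first.
  exists 1 => // q eq _; rewrite ltNge; apply/negP => fd; apply: Kn; exists (f q).
  by have [/ex[? ?] _ _] := fR eq.
have cD : {within K, continuous (fun w => - D w)}.
  apply/subspace_continuousP => w [[w1 _] _]; have wn := p0 w1.
  have cDw : {for w, continuous (fun w => - D w)}.
    apply: cvgN; apply: cvgD.
      apply: cvg_norm; apply: cvgB; last exact: cvg_cst.
      exact: (first_integral_continuous wn).
    have c0 : {for w, continuous (fun w => - (wedge e p * wedge e w))}.
      by apply: cvgN; apply: cvgM; [exact: cvg_cst|exact: cw].
    apply/(continuous_atP (fun w => Num.max 0 (- (wedge e p * wedge e w)))) => x x0.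
    have [r r0 hr] := (continuous_atP _ _).1 c0 x x0; exists r => // q /hr.
    by apply: le_lt_trans; exact: max0_lip.
  by apply: cvg_trans cDw; apply: cvg_app; exact: cvg_within.
have [w Kw wmax] := compact_EVT_max K0 cK cD.
have [[w1 wt] wd] : K w by rewrite inE in Kw.
have Dw : 0 < D w.
  rewrite lt_neqAle eq_sym; apply/andP; split; last first.
    by rewrite addr_ge0// le_max lexx.
  apply/eqP => D0; have h1 := normr_ge0 (first_integral w - first_integral p).
  have h2 : 0 <= Num.max 0 (- (wedge e p * wedge e w)) by rewrite le_max lexx.
  have h3 : `|first_integral w - first_integral p| = 0 by move: D0; rewrite /D; lra.
  have h4 : - (wedge e p * wedge e w) <= 0.
    have : - (wedge e p * wedge e w) <= Num.max 0 (- (wedge e p * wedge e w)).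
      by rewrite le_max lexx orbT.
    by move: D0; rewrite /D h3; lra.
  have wE : w = f p.
    apply: (@exit_rel_uniq p) (fR ep); split.
    - by apply/ex.
    - by apply/eqP; rewrite -subr_eq0 -normr_eq0 h3.
    - by rewrite -oppr_le0.
  by move: wd; rewrite wE /= subrr normr0 leNgt d0.
have D2 : 0 < D w / 2 by rewrite divr_gt0.
have [d1 d10 h1] := (continuous_atP _ _).1 (first_integral_continuous (p0 p1)) _ D2.
have D8 : 0 < D w / 2 / (4 * M) by rewrite !divr_gt0// mulr_gt0.
exists (Num.min d1 (D w / 2 / (4 * M))); first by rewrite lt_min d10.
move=> q eq; rewrite lt_min => /andP[q1 q2]; rewrite ltNge; apply/negP => fd.
have [/ex[f1 ft] fF fw] := fR eq.
have /wmax : f q \in K by rewrite inE.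
rewrite lerN2 leNgt => /negP; apply.
have b1 := h1 q q1.
have fM : `|wedge e (f q)| <= 2 * M.
  by have := wedge_le (f q) e1; have := NM (Np f1); lra.
have b2 : `|wedge e (q - p) * wedge e (f q)| < D w / 2.
  rewrite normrM; apply: (@le_lt_trans _ _ (2 * `|q - p| * (2 * M))).
    by apply: ler_pM => //; exact: wedge_le.
  have -> : 2 * `|q - p| * (2 * M) = `|q - p| * (4 * M) by ring.
  by rewrite -ltr_pdivlMr// mulr_gt0.
have b3 : Num.max 0 (- (wedge e p * wedge e (f q))) < D w / 2.
  rewrite gt_max D2 /=.
  have -> : - (wedge e p * wedge e (f q)) =
    wedge e (q - p) * wedge e (f q) - wedge e q * wedge e (f q) by rewrite wedgeB; ring.
  by move: b2; rewrite ltr_norml => /andP[]; lra.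
have -> : D w = D w / 2 + D w / 2 by field.
by rewrite {1}/D fF ltrD.
Qed.

Lemma exit_map_extension : extension phi N f.
Proof.
split; first exact: exit_map_continuous.
  by move=> p /fR[].
move=> p ep ns; have [w rw xw] := exit_rel_exists ep.
by rewrite (exit_rel_uniq (fR ep) rw); exact: xw.
Qed.

(** Off the axis the orbit leaves [N], so its exit point is imposed; entry points of this kind are
    dense, and both maps are continuous. *)
Lemma exit_map_unique g : extension phi N g -> forall p, entry phi N p -> g p = f p.
Proof.
move=> [cg _ gx] p ep; have [cf _ fx] := exit_map_extension.
have off q : entry phi N q -> wedge e q != 0 -> g q = f q.
  move=> eq wq; have ns := orbit_escape fb NM p11 XE wq.
  exact: exits_at_uniq (gx q eq ns) (fx q eq ns).
have [wp|wp] := eqVneq (wedge e p) 0; last exact: off.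
apply/eqP/negPn/negP => gf.
have d0 : 0 < `|g p - f p| / 2 by rewrite divr_gt0// normr_gt0 subr_eq0.
have [d1 d10 h1] := cg p ep _ d0; have [d2 d20 h2] := cf p ep _ d0.
have r0 : 0 < Num.min d1 d2 by rewrite lt_min d10.
have [q [eq + wq]] := off_axis_dense ep wp r0.
rewrite lt_min => /andP[/(h1 q eq) q1 /(h2 q eq) q2].
have := ler_normB (f q - f p) (g q - g p); rewrite (off q eq wq).
have -> : f q - f p - (f q - g p) = g p - f p by rewrite opprB addrC addrA subrK.
by move: q1 q2; rewrite (off q eq wq); lra.
Qed.

Lemma exit_map_onto w : entry (rev phi) N w -> exists2 p, entry phi N p & f p = w.
Proof.
by move=> /exit_rel_onto[p ep rw]; exists p => //; exact: exit_rel_uniq (fR ep) rw.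
Qed.

End Map.

Lemma saddle_invariant : [set (0, 0)] = [set p | forall t, N (phi p t)].
Proof.
have X0 : X (0, 0) = (0, 0) by case: V => _ _ [].
apply/seteqP; split=> [_ -> t|p pN].
  by rewrite (flow_zero fb M0 X0) /N /sublevel/= level0.
have fwd : stays phi N p by move=> t _; exact: pN.
have bwd : stays (rev phi) N p by move=> t _; exact: pN.
have wp : wedge e p = 0.
  apply/eqP/negPn/negP => wp; exact: (orbit_escape fb NM p11 XE wp fwd).
have dp : dot e p = 0.
  apply/eqP/negPn/negP => d0; have [d|d] := ltP 0 (dot e p).
    by apply: (orbit_axis_escape fb NM XE wp _ fwd); rewrite mul1r.
  apply: (orbit_axis_escape (flow_box_rev fb) NM XN wp _ bwd).
  by rewrite mulN1r oppr_gt0 lt_neqAle d0.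
by rewrite /= (frameE p e1) wp dp !mul0r subr0 addr0.
Qed.

End Exit.

End SaddleOrbits.

(** * Conclusion of the sufficiency *)

Section Converse.
Variable R : realType.
Variables (n : nat) (P Q : {poly {poly R}}).
Hypothesis V : Vhom n P Q.
Implicit Types (u v e p q : R * R).

Lemma saddle_regularisable e : char_vector P Q e -> 0 < alpha P Q e -> kappa P Q e < 0 ->
  (forall u, u != (0, 0) -> dirD P Q u = 0 -> wedge e u = 0) ->
  C0_regularisable (vfield P Q) [set (0, 0)].
Proof.
move=> ce a0 k0 single; have [e1 _] := ce.
have [A [c [l [l' [m [m' [A0 [sl sm] [dl dm] lm along]]]]]]] := saddle_potential V ce a0 k0 single.
have [M M0 NM] := sublevel_bounded e1 dl dm lm.
have [Y [L [phi fb]]] := exists_flow_box (ltW M0) (vfield_lipschitz P Q).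
have [B en ex] := saddle_block e1 sl sm dl dm lm (lt0r_neq0 A0) fb NM
  (dlevel_saddle V ce a0 k0 single l m m' A0 along) (tilt_saddle V ce k0 single A0).
exists (sublevel e l m); split.
  apply/(isolating_blockE fb NM); split => //.
  exact: (saddle_invariant V ce a0 k0 single A0 dl dm lm along B).
have /boolp.choice[f fR] (p : R * R) : exists w : R * R,
    entry phi (sublevel e l m) p -> exit_rel e A c l m phi p w.
  have [ep|nep] := pselect (entry phi (sublevel e l m) p); last by exists p.
  by have [w rw _] := exit_rel_exists V ce k0 single A0 dl dm lm along B en ex ep; exists w.
exists f; apply/(regularisableE fb NM f); split.
- exact: (exit_map_extension V ce k0 single A0 sl sm dl dm lm along B en ex fR).
- exact: (exit_map_unique V ce k0 single A0 sl sm dl dm lm along B en ex fR).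
- exact: (exit_map_onto V ce k0 single A0 dl dm lm along B en ex fR).
Qed.

(** If [alpha] is negative at the vector found, the opposite vector is taken: as [n] is even,
    [alpha] and [kappa] both change sign there. *)
Lemma negative_critical_value_regularisable (l : option R) (r : R) :
  char_dirs P Q = [set l] -> critical_values P Q = [set r] -> r < 0 ->
  C0_regularisable (vfield P Q) [set (0, 0)].
Proof.
move=> cl cr r0; have [|e ce _] := @char_dirs_vector _ _ _ _ V l; first by rewrite cl.
have rE : kappa P Q e / alpha P Q e = r.
  have : [set kappa P Q e / alpha P Q e] r by rewrite -(critical_valuesE V cl ce) cr.
  by [].
have a0 := alpha_neq0 V ce.
have single u : u != (0, 0) -> dirD P Q u = 0 -> wedge e u = 0.
  move=> u0 Du; have [a _ ->] := char_dirs_parallel V cl ce u0 Du.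
  by rewrite wedgeZr /wedge; ring.
have ak : kappa P Q e = r * alpha P Q e by rewrite -rE divfK.
have [ap|an] := ltP 0 (alpha P Q e).
  by apply: (saddle_regularisable ce ap _ single); rewrite ak nmulr_rlt0.
have even := degree_even V ce single.
have {}an : alpha P Q e < 0 by rewrite lt_neqAle a0.
have s1 : (-1) ^+ n.+1 = -1 :> R by rewrite -signr_odd /= even expr1.
apply: (saddle_regularisable (char_vectorN V ce)).
- by rewrite (alphaN V ce) s1 mulN1r oppr_gt0.
- by rewrite (kappaN V ce) s1 mulN1r oppr_lt0 ak nmulr_rgt0.
by move=> u u0 Du; rewrite -(single u u0 Du) /wedge/=; have := single u u0 Du; rewrite /wedge; lra.
Qed.

End Converse.

Theorem theorem4p8 (R : realType) (n : nat) (P Q : {poly {poly R}}) :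
  Vhom n P Q ->
  (C0_regularisable (vfield P Q) [set (0, 0)] <->
   exists r : R,
     [/\ exists l : option R, char_dirs P Q = [set l],
         critical_values P Q = [set r] & r < 0]).
Proof.
move=> V; split; first exact: regularisable_saddle V.
by move=> [r [[l cl] cr r0]]; exact: (negative_critical_value_regularisable V cl cr r0).
Qed.
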